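(* Let $p\in[0,1]$ and let $G_N$ be distributed as $\mathrm{CM}_N(\mathbf 1,\mathbf 2)$ with $\lfloor pN\rfloor$ vertices of degree 2 and $N-\lfloor pN\rfloor$ vertices of degree 1. Then, for any $\beta\ge0$ and $B\in\mathbb R$, $$\frac{S_N-P_N(S_N)}{\sqrt N}\ \longrightarrow\ \mathcal N(0,\sigma_{\mathrm{aq}}^2)\qquad\text{in distribution with respect to } P_N,\ \text{as } N\to\infty,$$ where $\sigma_{\mathrm{aq}}^2=\chi+\sigma_G^2$. Here $\chi=\chi(\beta,B)$ is the thermodynamic limit $\lim_{N\to\infty}\chi_N(\beta,B)$ of the susceptibility of the Ising model on $\mathrm{CM}_N(\mathbf 1,\mathbf 2)$, explicitly $$\chi(\beta,B)=\frac{\partial^2}{\partial B^2}\log\lambda_+(\beta,B)+\sum_{l\ge2}p_l^*\,\frac{\partial^2}{\partial B^2}\log\left(A_+(\beta,B)+A_-(\beta,B)\,r_B^{\,l}\right),$$ and $\sigma_G^2=\sigma_G^2(\beta,B)$ is a positive number, given by $$\sigma_G^2=\frac{1-p}{2}\Bigg(\sum_{\ell=2}^\infty\gamma_\ell^2(B)\,H_{\ell,\ell}(\alpha)+\sum_{\substack{\ell,j=2\\ \ell\ne j}}^{\infty}\gamma_\ell(B)\gamma_j(B)\,H_{\ell,j}(\alpha)\Bigg),\qquad \alpha=\frac{2p}{1-p}.$$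
   Context: The configuration model with degree sequence $(d_i)_{i\in[N]}$ (with $\sum_i d_i$ even) is the random multigraph on $[N]=\{1,\dots,N\}$ obtained by attaching $d_i$ half-edges to vertex $i$ and pairing all half-edges uniformly at random, each pair forming an edge; self-loops and multiple edges are allowed. For a given $p\in[0,1]$, $\mathrm{CM}_N(\mathbf 1,\mathbf 2)$ is the case with $n_1=N-\lfloor pN\rfloor$ vertices of degree 1 and $n_2=\lfloor pN\rfloor$ vertices of degree 2, where $n_1$ is assumed to be even. $Q_N$ denotes its law. For a multigraph $G_N$ with edge multiset $E_N$, $\beta\ge0$, $B\in\mathbb R$ and $\sigma\in\{-1,1\}^N$, the random quenched measure is $$\mu_{G_N}(\sigma)=\frac{1}{Z_N(\beta,B)}\exp\Big[\beta\sum_{(i,j)\in E_N}\sigma_i\sigma_j+B\sum_{i\in[N]}\sigma_i\Big],$$ where each edge is counted once with multiplicity and $Z_N(\beta,B)$ is the normalizing partition function. The averaged quenched measure is $P_N(\sigma)=Q_N(\mu_{G_N}(\sigma))$, the expectation of $\mu_{G_N}(\sigma)$ over $G_N\sim Q_N$. The same symbols denote expectations. $S_N=\sum_{i\in[N]}\sigma_i$ and $\chi_N(\beta,B)=\operatorname{Var}_{\mu_{G_N}}(S_N/\sqrt N)$ is the random quenched susceptibility. Further notation (dependence on $\beta$ partly suppressed): $$\lambda_\pm(\beta,B)=e^\beta\left[\cosh(B)\pm\sqrt{\sinh^2(B)+e^{-4\beta}}\right],\qquad r_B=\frac{\lambda_-(\beta,B)}{\lambda_+(\beta,B)},$$ $$A_\pm(\beta,B)=\frac{e^{-2\beta}e^{\pm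 B}+(\lambda_+-e^{\beta+B})^2e^{\mp B}\pm2e^{-\beta}(\lambda_+-e^{\beta+B})}{\left[e^{-2\beta}+(\lambda_+-e^{\beta+B})^2\right]\lambda_\pm},$$ $$p_l^*=\left(\frac{2p}{p+1}\right)^{l-2}\left(\frac{1-p}{p+1}\right)\left(\frac{1-p}{2}\right),\qquad \gamma_l(B)=\frac{\partial}{\partial B}\log\left(1+\frac{A_-(\beta,B)}{A_+(\beta,B)}\,r_B^{\,l}\right),\qquad l\ge2,$$ $$H_{r,t}(\alpha)=-\frac{\alpha^{r+t-4}}{(1+\alpha)^{r+t-2}}\left(1+\frac{(r-2-\alpha)(t-2-\alpha)}{\alpha(1+\alpha)}\right)+\frac{\mathbf 1_{\{r=t\}}}{1+\alpha}\left(\frac{\alpha}{1+\alpha}\right)^{r-2}.$$ $\mathcal N(0,\sigma^2)$ is the centered Gaussian with variance $\sigma^2$.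
   Formalization: Positivity of σ_G² fails (σ_G²=0) when B=0, β=0, p=0 or p=1; it is stated as σ_G²≥0 always and σ_G²>0 when 0<p<1, β>0, B≠0. The limit of the random χ_N is taken in Q_N-probability. *)

(* Defs.v *)
From mathcomp Require Import all_boot all_order all_algebra.
From mathcomp Require Import all_classical all_reals all_analysis.
Set Implicit Arguments.
Unset Strict Implicit.
Unset Printing Implicit Defensive.
Import Order.TTheory GRing.Theory Num.Theory.
Import numFieldNormedType.Exports.

Local Open Scope classical_set_scope.
Local Open Scope ring_scope.

Section configuration_model.
Variables (R : realType) (N : nat) (d : 'I_N -> nat).

Definition half_edge : finType := {i : 'I_N & 'I_(d i)}.

(* A multigraph is represented by the pairing that generates it: a partition
   of the half-edges into blocks of size two. Each block is one edge, so
   multiple edges are distinct blocks and a self-loop is a block whose two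
   half-edges are attached to the same vertex. *)
Definition pairings : {set {set {set half_edge}}} :=
  [set M : {set {set half_edge}} |
    finset.partition M [set: half_edge]%SET & [forall (e | e \in M), #|e| == 2%N]]%SET.

Definition CM_expect (F : {set {set half_edge}} -> R) : R :=
  (\sum_(M in pairings) F M) / #|pairings|%:R.

Definition CM_prob (A : pred {set {set half_edge}}) : R :=
  CM_expect (fun M => (A M)%:R).

End configuration_model.

Section ising.
Variables (R : realType) (N : nat) (d : 'I_N -> nat) (beta B : R).

Definition config := {ffun 'I_N -> bool}.

Definition spin (sigma : config) (i : 'I_N) : R := if sigma i then 1 else -1.

Definition total_spin (sigma : config) : R := \sum_(i < N) spin sigma i.

Variable M : {set {set half_edge d}}.

(* For an edge e = {h, h'}, the product over h in e is sigma_i sigma_j, where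
   i and j are the vertices carrying h and h' (for a self-loop, sigma_i^2). *)
Definition boltzmann (sigma : config) : R :=
  expR (beta * (\sum_(e in M) \prod_(h in e) spin sigma (tag h))
        + B * total_spin sigma).

Definition partition_function : R := \sum_(sigma : config) boltzmann sigma.

Definition quenched (sigma : config) : R :=
  boltzmann sigma / partition_function.

Definition quenched_expect (f : config -> R) : R :=
  \sum_(sigma : config) quenched sigma * f sigma.

Definition quenched_var (f : config -> R) : R :=
  quenched_expect (fun sigma => (f sigma - quenched_expect f) ^+ 2).

Definition susceptibility : R :=
  quenched_var (fun sigma => total_spin sigma / Num.sqrt N%:R).

End ising.

Section averaged_quenched.
Variables (R : realType) (N : nat) (d : 'I_N -> nat) (beta B : R).

Definition avg_quenched (sigma : config N) : R :=
  CM_expect (fun M : {set {set half_edge d}} => quenched beta B M sigma).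

Definition avg_quenched_expect (f : config N -> R) : R :=
  \sum_(sigma : config N) avg_quenched sigma * f sigma.

Definition normalized_spin (sigma : config N) : R :=
  (total_spin R sigma - avg_quenched_expect (@total_spin R N))
    / Num.sqrt N%:R.

End averaged_quenched.

Section CM12.
Variables (R : realType) (p : R).

Definition n2 (N : nat) : nat := Num.truncn (p * N%:R).

Definition n1 (N : nat) : nat := (N - n2 N)%N.

(* Vertices 0, ..., n1 - 1 have degree 1 and the others degree 2; up to
   relabelling, the law of the multigraph does not depend on this choice. *)
Definition CM12_deg (N : nat) (i : 'I_N) : nat := if (i < n1 N)%N then 1%N else 2%N.

(* N tends to infinity along the integers for which the total degree
   n1 + 2 n2 is even; there are infinitely many of them for every p in [0, 1]. *)
Definition CM12_infty : set_system nat := within [set N | ~~ odd (n1 N)] \oo.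

End CM12.

Section limit_law.
Variable R : realType.

(* Weak convergence of the laws of the variables X N, where X N is defined on
   the finite space T N with weights P N. *)
Definition cvg_in_distribution (T : nat -> finType) (P X : forall N, T N -> R)
    (F : set_system nat) (mu : probability (measurableTypeR R) R) : Prop :=
  forall f : R -> R, continuous f -> (exists C, forall x, `|f x| <= C) ->
    (\sum_(w : T N) P N w * f (X N w)) @[N --> F]
      --> Rintegral mu [set: R] f.

(* The library's normal_prob takes the standard deviation as parameter, and it
   is the uniform law on [0, 1] when that parameter is 0. *)
Definition centered_gaussian (v : R) : probability (measurableTypeR R) R :=
  if v == 0 then (dirac (0 : measurableTypeR R) : probability _ R)
  else (normal_prob 0 (Num.sqrt v) : probability _ R).

End limit_law.

Section limit_variance.
Variables (R : realType).
Implicit Types p beta B alpha : R.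

Definition sum_from2 (u : nat -> R) : R :=
  limn (fun n => \sum_(2 <= l < n) u l).

Definition coshR B : R := (expR B + expR (- B)) / 2.

Definition sinhR B : R := (expR B - expR (- B)) / 2.

Definition lambda_plus beta B : R :=
  expR beta * (coshR B + Num.sqrt (sinhR B ^+ 2 + expR (- 4 * beta))).

Definition lambda_minus beta B : R :=
  expR beta * (coshR B - Num.sqrt (sinhR B ^+ 2 + expR (- 4 * beta))).

Definition ratio beta B : R := lambda_minus beta B / lambda_plus beta B.

Definition A_plus beta B : R :=
  let x := lambda_plus beta B - expR (beta + B) in
  (expR (- 2 * beta) * expR B + x ^+ 2 * expR (- B) + 2 * expR (- beta) * x)
    / ((expR (- 2 * beta) + x ^+ 2) * lambda_plus beta B).

(* At beta = 0 this is the form 0 / 0, read as 0; there ratio = 0 as well, so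
   that A_minus * ratio ^+ l = 0 for l >= 2. *)
Definition A_minus beta B : R :=
  let x := lambda_plus beta B - expR (beta + B) in
  (expR (- 2 * beta) * expR (- B) + x ^+ 2 * expR B - 2 * expR (- beta) * x)
    / ((expR (- 2 * beta) + x ^+ 2) * lambda_minus beta B).

Definition pstar p (l : nat) : R :=
  (2 * p / (p + 1)) ^+ (l - 2) * ((1 - p) / (p + 1)) * ((1 - p) / 2).

Definition gamma beta (l : nat) B : R :=
  derive1 (fun b =>
    ln (1 + A_minus beta b / A_plus beta b * ratio beta b ^+ l)) B.

(* Used for r, t >= 2 only, so the subtractions in the exponents are exact. *)
Definition Hker (r t : nat) alpha : R :=
  - (alpha ^+ (r + t - 4) / (1 + alpha) ^+ (r + t - 2))
    * (1 + (r%:R - 2 - alpha) * (t%:R - 2 - alpha) / (alpha * (1 + alpha)))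
  + (r == t)%:R / (1 + alpha) * (alpha / (1 + alpha)) ^+ (r - 2).

Definition chi_term p beta B (l : nat) : R :=
  pstar p l *
  derive1n 2 (fun b =>
    ln (A_plus beta b + A_minus beta b * ratio beta b ^+ l)) B.

Definition chi p beta B : R :=
  derive1n 2 (fun b => ln (lambda_plus beta b)) B
  + sum_from2 (chi_term p beta B).

(* For p = 1 this is a division by zero, with value 0, but then the prefactor
   (1 - p) / 2 of sigma2_G vanishes. *)
Definition alpha12 p : R := 2 * p / (1 - p).

Definition sigma2_G_term p beta B (l j : nat) : R :=
  gamma beta l B * gamma beta j B * Hker l j (alpha12 p).

Definition sigma2_G p beta B : R :=
  (1 - p) / 2 *
  (sum_from2 (fun l => gamma beta l B ^+ 2 * Hker l l (alpha12 p))
   + sum_from2 (fun l => sum_from2 (fun j =>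
       if j == l then 0 else sigma2_G_term p beta B l j))).

Definition sigma2_aq p beta B : R := chi p beta B + sigma2_G p beta B.

End limit_variance.

(* Main.v *)
Require Import Defs.
From mathcomp Require Import all_boot all_order all_algebra.
From mathcomp Require Import all_classical all_reals all_analysis.
From mathcomp Require Import ring lra zify.
From mathcomp Require Import measurable_realfun.
Set Implicit Arguments.
Unset Strict Implicit.
Unset Printing Implicit Defensive.
Import Order.TTheory GRing.Theory Num.Theory.
Import numFieldNormedType.Exports.

Local Open Scope classical_set_scope.
Local Open Scope ring_scope.

(** A multigraph with degrees 1 and 2 is a disjoint union of paths and cycles, and
    its Ising partition function is the product of those of its components. For a
    path with e edges and for a cycle with e edges, the transfer matrix gives
      ln Z = (e + 1) ln lambda_plus + ln A_plus + phi_e(B),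
      ln Z = e ln lambda_plus + psi_e(B),
    with phi_e = ln (1 + cc r^e) and psi_e = ln (1 + r^e) ([ln_zpath], [ln_zcyc]).
    Summing over the components, the free energy of the whole graph is a
    deterministic term plus the sum of phi_e over the paths plus the sum of psi_e
    over the cycles ([ln_zshape]): only the component lengths matter.

    Their law is that of a Markov chain. Insert the vertices of degree 2 one by one
    in the uniform pairing of the half-edges of the leaves: a new vertex becomes a
    loop with probability 1 / (2n + 2k + 1), where k is the number of paths and n the
    number of vertices already inserted, and otherwise subdivides a uniformly chosen
    edge ([CM12_law], with expectation operator [Ex]). The sum over paths of a
    function f of the length is then handled through the one-step conditional
    expectation, which replaces f by [back f]. This gives exact formulas for the
    first two moments of the path counts ([mean_ind], [cov_ind]), whose limits are
    the geometric law and the kernel H ([mean_ind_cvg], [cov_ind_cvg]), and, by a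
    martingale comparison, the Gaussian form of the moment generating function
    ([mgf_approx]). There are O(N^(1/4)) cycles in mean, even with an exponential
    moment, so they do not contribute at scale sqrt N ([Ex_exp_ncyc]).

    The quenched mean of exp (h S_N) is Z(B + h) / Z(B), so that with h = t / sqrt N
    the averaged Laplace transform of the normalized spin is the expectation of the
    exponential of an increment of the free energy ([Ex_laplace]). The second-order
    Taylor term of that increment in h concentrates and produces chi, the first-order
    term fluctuates and produces sigma2_G through the central limit theorem for
    the sum of gamma_l = phi_(l-1)' over the paths ([laplace_lim]). Convergence
    of the Laplace transform on the whole line implies weak convergence
    ([mgf_cvg_in_distribution]): exponentials generate polynomials, these generate
    powers of sin (w x), and Bernstein polynomials in sin (w x) approximate any
    bounded continuous function on a segment while staying bounded.

    The susceptibility is (ln Z)'' / N; its path part has variance O(1/N), hence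
    convergence in probability ([susceptibility_lim]). Finally sigma2_G is (1-p)/2
    times the squared distance, in the geometric law, from gamma to the affine
    functions of the length ([Qlim_residual]). It is nonnegative, and it vanishes only
    if gamma is affine, which its exponential decay excludes ([phi1_not_affine]). *)

(** * Taylor inequalities *)

Section calculus.
Variable R : realType.

(** A two-sided neighbourhood is used so that the increment [h] may have either sign. *)
Lemma mvt_ineq (g g' : R -> R) (x h C : R) :
  (forall y, `|y - x| <= `|h| -> is_derive y 1 g (g' y)) ->
  (forall y, `|y - x| <= `|h| -> `|g' y| <= C) ->
  `|g (x + h) - g x| <= C * `|h|.
Proof.
move=> dg bg.
have C0 : 0 <= C by apply: le_trans (bg x _); rewrite // subrr normr0.
have key a b : a <= b -> (forall y, a <= y <= b -> `|y - x| <= `|h|) ->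
    `|g b - g a| <= C * (b - a).
  move=> ab hab.
  have [] := @MVT_segment R g g' a b ab.
  - move=> y; rewrite in_itv/= => /andP[ay yb]; apply/dg/hab.
    by rewrite !ltW.
  - apply: derivable_within_continuous => y; rewrite in_itv/= => yab.
    by have := dg y (hab _ yab); case.
  - move=> c; rewrite in_itv/= => cab ->.
    by rewrite normrM (ger0_norm (_ : 0 <= b - a)) ?subr_ge0// ler_wpM2r ?subr_ge0//; exact/bg/hab.
have [h0|h0] := leP 0 h.
  have := key x (x + h); rewrite addrAC subrr add0r (ger0_norm h0); apply.
    by rewrite lerDl.
  by move=> y /andP[a b]; rewrite ger0_norm ?subr_ge0// lerBlDl.
have := key (x + h) x; rewrite distrC (ltr0_norm h0) opprD addrA subrr add0r; apply.
  by rewrite gerDl ltW.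
by move=> y /andP[a b]; rewrite ler0_norm ?subr_le0//; lra.
Qed.

Lemma taylor1_ineq (f f1 f2 : R -> R) (x h C : R) :
  (forall y, `|y - x| <= `|h| -> is_derive y 1 f (f1 y)) ->
  (forall y, `|y - x| <= `|h| -> is_derive y 1 f1 (f2 y)) ->
  (forall y, `|y - x| <= `|h| -> `|f2 y| <= C) ->
  `|f (x + h) - f x - h * f1 x| <= C * `|h| ^+ 2.
Proof.
move=> d1 d2 b2.
have C0 : 0 <= C by apply: le_trans (b2 x _); rewrite // subrr normr0.
have := @mvt_ineq (fun y => f y - y * f1 x) (fun y => f1 y - f1 x) x h (C * `|h|).
have -> : f (x + h) - (x + h) * f1 x - (f x - x * f1 x) = f (x + h) - f x - h * f1 x by ring.
rewrite expr2 mulrA; apply.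
  move=> y hy; have := d1 y hy => ?.
  apply: is_derive_eq; rewrite /GRing.scale /=; ring.
move=> y hy; rewrite -{1}(subrK x y) (addrC (y - x)).
apply: le_trans (@mvt_ineq f1 f2 x (y - x) C _ _) _.
- by move=> z hz; apply: d2; exact: le_trans hz hy.
- by move=> z hz; apply: b2; exact: le_trans hz hy.
by rewrite ler_wpM2l.
Qed.

Lemma taylor2_ineq (f f1 f2 f3 : R -> R) (x h C : R) :
  (forall y, `|y - x| <= `|h| -> is_derive y 1 f (f1 y)) ->
  (forall y, `|y - x| <= `|h| -> is_derive y 1 f1 (f2 y)) ->
  (forall y, `|y - x| <= `|h| -> is_derive y 1 f2 (f3 y)) ->
  (forall y, `|y - x| <= `|h| -> `|f3 y| <= C) ->
  `|f (x + h) - f x - h * f1 x - h ^+ 2 / 2 * f2 x| <= C * `|h| ^+ 3.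
Proof.
move=> d1 d2 d3 b3.
have C0 : 0 <= C by apply: le_trans (b3 x _); rewrite // subrr normr0.
have := @mvt_ineq (fun y => f y - y * f1 x - (y - x) ^+ 2 / 2 * f2 x)
  (fun y => f1 y - f1 x - (y - x) * f2 x) x h (C * `|h| ^+ 2).
have -> : f (x + h) - (x + h) * f1 x - (x + h - x) ^+ 2 / 2 * f2 x -
   (f x - x * f1 x - (x - x) ^+ 2 / 2 * f2 x)
  = f (x + h) - f x - h * f1 x - h ^+ 2 / 2 * f2 x by ring.
have -> : C * `|h| ^+ 3 = C * `|h| ^+ 2 * `|h| by ring.
apply.
  move=> y hy; have := d1 y hy => ?.
  apply: is_derive_eq; rewrite /GRing.scale /=; field => //.
move=> y hy; rewrite -{1}(subrK x y) (addrC (y - x)).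
apply: le_trans (@taylor1_ineq f1 f2 f3 x (y - x) C _ _ _) _.
- by move=> z hz; apply: d2; exact: le_trans hz hy.
- by move=> z hz; apply: d3; exact: le_trans hz hy.
- by move=> z hz; apply: b3; exact: le_trans hz hy.
by rewrite ler_wpM2l// lerXn2r ?nnegrE.
Qed.

Lemma expR_taylor1 (x : R) : `|x| <= 1 ->
  `|expR x - 1 - x| <= expR 1 * `|x| ^+ 2.
Proof.
move=> x1; have := @taylor1_ineq expR expR expR 0 x (expR 1).
rewrite add0r expR0 mulr1; apply=> y; rewrite subr0 => hy.
rewrite ger0_norm ?expR_ge0// ler_expR.
by apply: le_trans (ler_norm y) _; exact: le_trans hy x1.
Qed.

Lemma expR_taylor2 (x : R) : `|x| <= 1 ->
  `|expR x - 1 - x - x ^+ 2 / 2| <= expR 1 * `|x| ^+ 3.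
Proof.
move=> x1; have := @taylor2_ineq expR expR expR expR 0 x (expR 1).
rewrite add0r expR0 !mulr1; apply=> y; rewrite subr0 => hy.
rewrite ger0_norm ?expR_ge0// ler_expR.
by apply: le_trans (ler_norm y) _; exact: le_trans hy x1.
Qed.

End calculus.

(** * The Markov chain of component lengths *)

(** [(true, e)] is a path with [e] edges and [(false, e)] a cycle with [e] edges. A path has
    one more vertex than edges, a cycle as many. *)
Definition shape := seq (bool * nat).

Section chain.
Variable R : realType.
Implicit Types (s : shape) (F G : shape -> R) (f g : nat -> R).

(** Sum over the edges of the shape of the value of [F] after subdividing that edge: the
    [c.2] edges of a component all lead to the same new shape. *)
Fixpoint grow_sum F s : R :=
  if s is c :: s' then
    c.2%:R * F ((c.1, c.2.+1) :: s') + grow_sum (fun u => F (c :: u)) s'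
  else 0.

(** One insertion. The new vertex closes up into a loop in one way, and subdivides a given
    edge in two ways, according to which of its half-edges goes to which end. *)
Definition step (D : R) F s := (F ((false, 1%N) :: s) + 2 * grow_sum F s) / D.

Definition mass k n : R := 2 * n%:R + 2 * k%:R + 1.

(** Expectation for the chain started from [k] single edges and run for [n] insertions. *)
Fixpoint Ex k n F : R :=
  if n is n'.+1 then Ex k n' (step (mass k n') F) else F (nseq k (true, 1%N)).

Definition edges s : nat := \sum_(c <- s) c.2.

Definition reach k n s : bool :=
  [&& all (fun c => 0 < c.2)%N s, edges s == (n + k)%N & count fst s == k].

Lemma mass_gt0 k n : 0 < mass k n.
Proof. by rewrite /mass ltr_wpDl// -!natrM -natrD ler0n. Qed.

Lemma mass_ge k n : 2 * k%:R <= mass k n.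
Proof. by rewrite /mass; have := ler0n R n; lra. Qed.

Lemma grow_sum_le F G s :
  (forall s1 c s2, s = s1 ++ c :: s2 ->
     F (s1 ++ (c.1, c.2.+1) :: s2) <= G (s1 ++ (c.1, c.2.+1) :: s2)) ->
  grow_sum F s <= grow_sum G s.
Proof.
elim: s F G => [|c s IH] F G h //=.
apply: lerD.
  by apply: ler_wpM2l => //; exact: (h [::] c s erefl).
by apply: IH => s1 c' s2 e; apply: (h (c :: s1) c' s2); rewrite e.
Qed.

Lemma grow_sumD F G s :
  grow_sum (fun u => F u + G u) s = grow_sum F s + grow_sum G s.
Proof. by elim: s F G => [|c s IH] F G /=; rewrite ?addr0// IH; ring. Qed.

Lemma grow_sumZ a F s : grow_sum (fun u => a * F u) s = a * grow_sum F s.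
Proof. by elim: s F => [|c s IH] F /=; rewrite ?mulr0// IH; ring. Qed.

Lemma grow_sum_cst a s : grow_sum (fun=> a) s = (edges s)%:R * a.
Proof.
rewrite /edges; elim: s => [|c s IH] /=; first by rewrite big_nil mul0r.
by rewrite IH big_cons natrD mulrDl.
Qed.

Lemma reach_new k n s : reach k n s -> reach k n.+1 ((false, 1%N) :: s).
Proof.
case/and3P=> a b c; apply/and3P; split=> //=.
by rewrite /edges big_cons -/(edges s) (eqP b).
Qed.

Lemma reach_grow k n s1 (c : bool * nat) s2 : reach k n (s1 ++ c :: s2) ->
  reach k n.+1 (s1 ++ (c.1, c.2.+1) :: s2).
Proof.
rewrite /reach /edges !all_cat /= !count_cat /= !big_cat !big_cons /=.
case/and3P=> /and3P[-> _ ->] /eqP b /eqP d; apply/and3P; split=> //.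
- by rewrite addSn addnS b.
- by rewrite d.
Qed.

Lemma reach0 k : reach k 0 (nseq k (true, 1%N)).
Proof.
rewrite /reach /edges all_nseq orbT count_nseq mul1n eqxx andbT /=.
by rewrite sumr_const_nat || (elim: k => [|k IH]; rewrite ?big_nil//= big_cons (eqP IH)).
Qed.

Lemma step_le k n F G s : reach k n s ->
  (forall u, reach k n.+1 u -> F u <= G u) ->
  step (mass k n) F s <= step (mass k n) G s.
Proof.
move=> rs h; rewrite /step ler_pM2r ?invr_gt0 ?mass_gt0//.
apply: lerD; first exact/h/reach_new.
rewrite ler_pM2l//; apply: grow_sum_le => s1 c s2 e.
by apply/h/reach_grow; rewrite -e.
Qed.

Lemma Ex_le k n F G : (forall s, reach k n s -> F s <= G s) ->
  Ex k n F <= Ex k n G.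
Proof.
elim: n F G => [|n IH] F G h /=; first exact/h/reach0.
by apply: IH => s rs; apply: step_le rs h.
Qed.

Lemma Ex_eq k n F G : (forall s, reach k n s -> F s = G s) ->
  Ex k n F = Ex k n G.
Proof. by move=> h; apply/eqP; rewrite eq_le !Ex_le// => s /h ->. Qed.

Lemma stepD D F G s : step D (fun u => F u + G u) s = step D F s + step D G s.
Proof. by rewrite /step grow_sumD; ring. Qed.

Lemma stepZ D a F s : step D (fun u => a * F u) s = a * step D F s.
Proof. by rewrite /step grow_sumZ; ring. Qed.

Lemma ExD k n F G : Ex k n (fun s => F s + G s) = Ex k n F + Ex k n G.
Proof.
elim: n F G => [//|n IH] F G /=.
by rewrite -IH; apply: Ex_eq => s _; rewrite stepD.
Qed.

Lemma ExZ k n a F : Ex k n (fun s => a * F s) = a * Ex k n F.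
Proof.
elim: n F => [//|n IH] F /=.
by rewrite -IH; apply: Ex_eq => s _; rewrite stepZ.
Qed.

Lemma step_cst k n a s : reach k n s -> step (mass k n) (fun=> a) s = a.
Proof.
case/and3P=> _ /eqP e _; rewrite /step grow_sum_cst e.
have m0 := lt0r_neq0 (mass_gt0 k n).
apply: (mulIf m0); rewrite divfK// /mass natrD; ring.
Qed.

Lemma Ex_cst k n a : Ex k n (fun=> a) = a.
Proof.
elim: n => [//|n IH] /=.
by rewrite -[RHS]IH; apply: Ex_eq => s; exact: step_cst.
Qed.

Lemma ExN k n F : Ex k n (fun s => - F s) = - Ex k n F.
Proof. by rewrite -mulN1r -ExZ; apply: Ex_eq => s _; rewrite mulN1r. Qed.

Lemma ExB k n F G : Ex k n (fun s => F s - G s) = Ex k n F - Ex k n G.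
Proof. by rewrite -ExN -ExD. Qed.

Lemma Ex_ge0 k n F : (forall s, reach k n s -> 0 <= F s) -> 0 <= Ex k n F.
Proof. by move=> h; rewrite -(Ex_cst k n 0); exact: Ex_le. Qed.

Lemma Ex_norm k n F : `|Ex k n F| <= Ex k n (fun s => `|F s|).
Proof.
rewrite ler_norml -ExN; apply/andP; split; apply: Ex_le => s _.
  by rewrite lerNl -normrN ler_norm.
exact: ler_norm.
Qed.

Lemma Ex_sum (I : Type) (r : seq I) k n (F : I -> shape -> R) :
  Ex k n (fun s => \sum_(i <- r) F i s) = \sum_(i <- r) Ex k n (F i).
Proof.
elim: r => [|i r IH].
  by rewrite big_nil -[RHS](Ex_cst k n); apply: Ex_eq => s _; rewrite big_nil.
by rewrite big_cons -IH -ExD; apply: Ex_eq => s _; rewrite big_cons.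
Qed.

Definition psum f s : R := \sum_(c <- s | c.1) f c.2.

Definition dlt f (c : bool * nat) : R := if c.1 then f c.2.+1 - f c.2 else 0.

Lemma psum_cons f c s : psum f (c :: s) = (if c.1 then f c.2 else 0) + psum f s.
Proof. by rewrite /psum big_cons; case: c.1; rewrite ?add0r. Qed.

(** Subdividing an edge of a path of length [e] changes [psum f] by [f e.+1 - f e], and edges
    of cycles change nothing; this turns one insertion into the jump of a real number. *)
Lemma grow_sum_psum2 (G : R -> R -> R) f g s :
  grow_sum (fun u => G (psum f u) (psum g u)) s =
  \sum_(c <- s) c.2%:R * G (psum f s + dlt f c) (psum g s + dlt g c).
Proof.
elim: s G => [|c s IH] G /=; first by rewrite big_nil.
rewrite big_cons; congr (_ + _).
  rewrite !psum_cons /dlt /=; case: c.1; last by rewrite !addr0.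
  by congr (_ * G _ _); ring.
transitivity (grow_sum (fun u => G ((if c.1 then f c.2 else 0) + psum f u)
  ((if c.1 then g c.2 else 0) + psum g u)) s).
  by congr (grow_sum _ _); apply/funext => u; rewrite !psum_cons.
rewrite (IH (fun x y => G (_ + x) (_ + y))) !psum_cons.
by apply: eq_bigr => d _; rewrite !addrA.
Qed.

(** Mean of [psi] at the jump of [psum f] caused by one insertion from the shape [s]. *)
Definition jump D f s (psi : R -> R) : R :=
  (psi 0 + 2 * \sum_(c <- s) c.2%:R * psi (dlt f c)) / D.

Lemma step_psum D (G : R -> R) f s :
  step D (fun u => G (psum f u)) s = jump D f s (fun x => G (psum f s + x)).
Proof.
rewrite /step /jump psum_cons /= add0r addr0.
by rewrite (grow_sum_psum2 (fun x _ => G x) f f).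
Qed.

Lemma jumpD D f s p q :
  jump D f s (fun x => p x + q x) = jump D f s p + jump D f s q.
Proof.
rewrite /jump; under eq_bigr do rewrite mulrDr.
by rewrite big_split /=; ring.
Qed.

Lemma jumpZ D f s a p : jump D f s (fun x => a * p x) = a * jump D f s p.
Proof.
rewrite /jump; under eq_bigr do rewrite mulrCA.
by rewrite -mulr_sumr; ring.
Qed.

Lemma jump_cst k n f s a : reach k n s -> jump (mass k n) f s (fun=> a) = a.
Proof.
move=> rs; rewrite -{2}(step_cst a rs).
by rewrite (step_psum _ (fun=> a) f).
Qed.

Lemma jump_le k n f s p q : reach k n s ->
  p 0 <= q 0 ->
  (forall e, (0 < e)%N -> (e <= n + k)%N ->
      p (f e.+1 - f e) <= q (f e.+1 - f e)) ->
  jump (mass k n) f s p <= jump (mass k n) f s q.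
Proof.
case/and3P=> /allP pos /eqP tot _ h0 h.
rewrite /jump ler_pM2r ?invr_gt0 ?mass_gt0// lerD// ler_pM2l//.
rewrite big_seq [X in _ <= X]big_seq; apply: ler_sum => c cs.
rewrite ler_wpM2l//.
rewrite /dlt; case: c.1 => //; apply: h; first exact: pos.
by rewrite -tot /edges (big_rem c)//= leq_addr.
Qed.

(** The backward generator on path functionals: the mean of [psum f] after one insertion is
    [psum (back f)] before it, so that means are computed by iterating [back] on [f]. *)
Definition back D f e : R := f e + 2 * e%:R / D * (f e.+1 - f e).

Lemma jump_psum D f s p : p 0 = 0 ->
  jump D f s p = psum (fun e => 2 * e%:R / D * p (f e.+1 - f e)) s.
Proof.
move=> p0; rewrite /jump p0 add0r /psum [RHS]big_mkcond mulr_sumr mulr_suml.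
by apply: eq_bigr => c _; rewrite /dlt; case: c.1; rewrite ?p0; ring.
Qed.

Lemma psumD f g s : psum (fun e => f e + g e) s = psum f s + psum g s.
Proof. by rewrite /psum big_split. Qed.

Lemma psumZ a f s : psum (fun e => a * f e) s = a * psum f s.
Proof. by rewrite /psum mulr_sumr. Qed.

Lemma step_psum1 k n f s : reach k n s ->
  step (mass k n) (psum f) s = psum (back (mass k n) f) s.
Proof.
move=> rs; rewrite (step_psum _ id) jumpD jump_cst// (jump_psum _ _ _ (p := id))//.
by rewrite -psumD.
Qed.

Lemma Ex_psumS k n f : Ex k n.+1 (psum f) = Ex k n (psum (back (mass k n) f)).
Proof. by rewrite /=; apply: Ex_eq => s; exact: step_psum1. Qed.

Lemma psum_le k n f g s : reach k n s ->
  (forall e, (0 < e)%N -> (e <= n + k)%N -> f e <= g e) -> psum f s <= psum g s.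
Proof.
case/and3P=> /allP pos /eqP tot _ h; rewrite /psum big_seq_cond [X in _ <= X]big_seq_cond.
apply: ler_sum => c /andP[cs _]; apply: h; first exact: pos.
by rewrite -tot /edges (big_rem c)//= leq_addr.
Qed.

Lemma Ex_psum_le k n f g : (forall e, (0 < e)%N -> (e <= n + k)%N -> f e <= g e) ->
  Ex k n (psum f) <= Ex k n (psum g).
Proof. by move=> h; apply: Ex_le => s rs; exact: psum_le rs h. Qed.

End chain.

(** * Variance of additive path functionals *)

Section moments.
Variable R : realType.
Implicit Types (f g : nat -> R) (k n : nat).

Lemma succ_pow_le (a e : nat) : (0 < e)%N ->
  (e * e.+1 ^ a <= (e + 3 ^ a) * e ^ a)%N.
Proof.
move=> e0; elim: a => [|a IH]; first by rewrite !expn0 !muln1 leq_addr.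
rewrite [(e.+1 ^ a.+1)%N]expnS mulnCA.
apply: (@leq_trans (e.+1 * ((e + 3 ^ a) * e ^ a))%N); first by rewrite leq_mul2l IH orbT.
rewrite [(e ^ a.+1)%N]expnS [(3 ^ a.+1)%N]expnS !mulnA leq_mul2r; apply/orP; right.
have := expn_gt0 3 a; move: (3 ^ a)%N => b /= b0; nia.
Qed.

Lemma back_le k n f g : (forall e, (0 < e)%N -> (e <= n.+1 + k)%N -> f e <= g e) ->
  forall e, (0 < e)%N -> (e <= n + k)%N ->
  back (mass R k n) f e <= back (mass R k n) g e.
Proof.
move=> fg e e0 en; rewrite /back.
have m0 := mass_gt0 R k n.
have : 0 <= 2 * e%:R / mass R k n <= 1.
  rewrite divr_ge0 ?(ltW m0)//= ler_pdivrMr// mul1r /mass.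
  have : e%:R <= n%:R + k%:R :> R by rewrite -natrD ler_nat.
  lra.
move: (2 * e%:R / mass R k n) => th /andP[th0 th1].
have h1 := fg e e0 (leq_trans en (leq_addl 1 _)).
have h2 := fg e.+1 isT en.
have -> : forall u, u e + th * (u e.+1 - u e) = (1 - th) * u e + th * u e.+1 by move=> u; ring.
have -> : forall u, u e + th * (u e.+1 - u e) = (1 - th) * u e + th * u e.+1 by move=> u; ring.
by apply: lerD; rewrite ler_wpM2l// subr_ge0.
Qed.

(** An insertion multiplies the moments of order [a] by at most [1 + O(1 / k)], since a path of
    length [e] is hit at rate of order [e / k]; over [n <= r k] insertions they stay bounded. *)
Lemma back_pow k n (C : R) a : (0 < k)%N -> 0 <= C ->
  forall e, (0 < e)%N ->
  back (mass R k n) (fun e => C * e%:R ^+ a) e <=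
  C * expR (3 ^+ a / k%:R) * e%:R ^+ a.
Proof.
move=> k0 C0 e e0; rewrite /back -mulrBr.
have -> : forall th u v : R, C * u + th * (C * v) = C * (u + th * v) by move=> *; ring.
rewrite -[X in _ <= X]mulrA ler_wpM2l//.
have kR : 0 < k%:R :> R by rewrite ltr0n.
have m0 := mass_gt0 R k n; have mk := mass_ge R k n.
have e0' : 0 <= e%:R ^+ a :> R by rewrite exprn_ge0.
have H : e%:R * (e.+1%:R ^+ a - e%:R ^+ a) <= 3 ^+ a * e%:R ^+ a :> R.
  have := succ_pow_le a e0; rewrite -(ler_nat R) !natrM !natrX natrD natrX; lra.
apply: (@le_trans _ _ (e%:R ^+ a + 2 / mass R k n * (3 ^+ a * e%:R ^+ a))).
  rewrite lerD2l; have -> : 2 * e%:R / mass R k n * (e.+1%:R ^+ a - e%:R ^+ a) =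
    2 / mass R k n * (e%:R * (e.+1%:R ^+ a - e%:R ^+ a)) by ring.
  by rewrite ler_wpM2l// divr_ge0// ltW.
apply: (@le_trans _ _ ((1 + 3 ^+ a / k%:R) * e%:R ^+ a)); last first.
  by rewrite ler_wpM2r// expR_ge1Dx.
rewrite [X in _ <= X]mulrDl mul1r lerD2l mulrA ler_wpM2r// mulrC ler_wpM2l ?exprn_ge0//.
by rewrite ler_pdivrMr// mulrC ler_pdivlMr// mulrC.
Qed.

Lemma back_norm k n f (C : R) a : (0 < k)%N -> 0 <= C ->
  (forall e, (0 < e)%N -> (e <= n.+1 + k)%N -> `|f e| <= C * e%:R ^+ a) ->
  forall e, (0 < e)%N -> (e <= n + k)%N ->
  `|back (mass R k n) f e| <= C * expR (3 ^+ a / k%:R) * e%:R ^+ a.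
Proof.
move=> k0 C0 hf e e0 en.
apply: le_trans (back_pow n a k0 C0 e0).
rewrite ler_norml; apply/andP; split; last first.
  apply: back_le en => // e' p q; apply: le_trans (hf e' p q); exact: ler_norm.
rewrite lerNl.
have -> : - back (mass R k n) f e = back (mass R k n) (fun e0 => - f e0) e.
  by rewrite /back; ring.
apply: back_le en => // e' p q.
by apply: le_trans (hf e' p q); rewrite -normrN ler_norm.
Qed.

Lemma Ex_pow k n a : (0 < k)%N ->
  Ex k n (psum (fun e => e%:R ^+ a)) <= k%:R * expR (3 ^+ a * n%:R / k%:R) :> R.
Proof.
move=> k0.
suff H (C : R) : 0 <= C ->
    Ex k n (psum (fun e => C * e%:R ^+ a)) <= C * k%:R * expR (3 ^+ a * n%:R / k%:R) :> R.
  by have := H 1 ler01; rewrite mul1r; under eq_fun do rewrite mul1r.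
elim: n C => [|n IH] C C0.
  rewrite /= mulr0 mul0r expR0 mulr1 /psum big_nseq_cond /= iter_addr_0 expr1n.
  by rewrite mulr1 mulr_natr.
rewrite Ex_psumS; apply: (@le_trans _ _ (Ex k n (psum (fun e => C * expR (3 ^+ a / k%:R) * e%:R ^+ a)))).
  apply: Ex_psum_le.
  by move=> e e0 _; exact: back_pow.
apply: le_trans (IH _ _) _; first by rewrite mulr_ge0// expR_ge0.
have -> : expR (3 ^+ a * n.+1%:R / k%:R) = expR (3 ^+ a / k%:R) * expR (3 ^+ a * n%:R / k%:R) :> R.
  by rewrite -expRD; congr expR; rewrite -natr1; ring.
by rewrite le_eqVlt; apply/orP; left; apply/eqP; ring.
Qed.

Definition mean k n f : R := Ex k n (psum f).
Definition var k n f : R := Ex k n (fun s => (psum f s - mean k n f) ^+ 2).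

Definition jvar k n f s : R :=
  jump (mass R k n) f s (fun x => (x - jump (mass R k n) f s id) ^+ 2).

Lemma back_psum k n f s :
  psum (back (mass R k n) f) s = psum f s + jump (mass R k n) f s id.
Proof. by rewrite (jump_psum _ _ _ (p := id))// -psumD. Qed.

Lemma jump_center k n f s : reach k n s ->
  jump (mass R k n) f s (fun x => x - jump (mass R k n) f s id) = 0.
Proof. by move=> rs; rewrite jumpD jump_cst// subrr. Qed.

(** Martingale decomposition: the variance after one more insertion is that of the
    conditional mean plus the mean conditional variance of the jump. *)
Lemma varS k n f : var k n.+1 f = var k n (back (mass R k n) f) + Ex k n (jvar k n f).
Proof.
rewrite /var /mean Ex_psumS /= -ExD; apply: Ex_eq => s rs.
set m := Ex k n _; rewrite (step_psum _ (fun x => (x - m) ^+ 2)) back_psum /jvar.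
set mu := jump _ _ _ id.
transitivity (jump (mass R k n) f s (fun x => (psum f s + mu - m) ^+ 2 +
  (2 * (psum f s + mu - m) * (x - mu) + (x - mu) ^+ 2))).
  by congr jump; apply/funext => x; ring.
by rewrite jumpD jump_cst// jumpD jumpZ jump_center// mulr0 add0r.
Qed.

Lemma jvarE k n f s : reach k n s -> jvar k n f s =
  jump (mass R k n) f s (fun x => x ^+ 2) - (jump (mass R k n) f s id) ^+ 2.
Proof.
move=> rs; rewrite /jvar; set mu := jump _ _ _ id.
transitivity (jump (mass R k n) f s (fun x => x ^+ 2 + (- 2 * mu * x + mu ^+ 2))).
  by congr jump; apply/funext => x; ring.
by rewrite jumpD jumpD jump_cst// jumpZ -/mu; ring.
Qed.

Lemma jvar_ge0 k n f s : reach k n s -> 0 <= jvar k n f s.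
Proof.
by move=> rs; rewrite -(jump_cst f 0 rs); apply: jump_le => // *; exact: sqr_ge0.
Qed.

Lemma var_ge0 k n f : 0 <= var k n f.
Proof. by apply: Ex_ge0 => s _; exact: sqr_ge0. Qed.

Lemma jvar_le k n f s : reach k n s -> jvar k n f s <=
  psum (fun e => 2 * e%:R / mass R k n * (f e.+1 - f e) ^+ 2) s.
Proof.
move=> rs; rewrite jvarE// (jump_psum _ _ _ (p := fun x => x ^+ 2)) ?expr0n//.
by rewrite gerBl sqr_ge0.
Qed.

Lemma Ex_jvar_le k n f C a : (0 < k)%N -> 0 <= C ->
  (forall e, (0 < e)%N -> (e <= n.+1 + k)%N -> `|f e| <= C * e%:R ^+ a) ->
  Ex k n (jvar k n f) <=
  C ^+ 2 * (4 * 4 ^+ a * expR (3 ^+ (a + a).+1 * n%:R / k%:R)).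
Proof.
move=> k0 C0 hf.
have kR : 0 < k%:R :> R by rewrite ltr0n.
have m0 := mass_gt0 R k n; have mk := mass_ge R k n.
apply: (@le_trans _ _ (Ex k n (psum (fun e => (C ^+ 2 * (4 * 4 ^+ a) / k%:R) * e%:R ^+ (a + a).+1)))).
  apply: Ex_le => s rs; apply: le_trans (jvar_le _ rs) _.
  apply: psum_le rs _ => e e0 en.
  have e1 : 1 <= e%:R :> R by rewrite ler1n.
  have p0 : 0 <= e%:R ^+ a :> R by rewrite exprn_ge0.
  have h1 : `|f e| <= C * (2 ^+ a * e%:R ^+ a).
    apply: le_trans (hf e e0 (leq_trans en (leq_addl 1 _))) _.
    by rewrite ler_wpM2l// ler_peMl// exprn_ege1// ler1n.
  have h2 : `|f e.+1| <= C * (2 ^+ a * e%:R ^+ a).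
    apply: le_trans (hf e.+1 isT en) _.
    rewrite ler_wpM2l// -exprMn lerXn2r ?nnegrE ?mulr_ge0//.
    by rewrite -natr1; lra.
  have h3 : (f e.+1 - f e) ^+ 2 <= (2 * (C * (2 ^+ a * e%:R ^+ a))) ^+ 2.
    rewrite -(real_normK (num_real (f e.+1 - f e))) lerXn2r ?nnegrE ?mulr_ge0 ?exprn_ge0//.
    by apply: le_trans (ler_normB _ _) _; rewrite mulr2n mulrDl mul1r lerD.
  apply: (@le_trans _ _ (2 * e%:R / mass R k n * (2 * (C * (2 ^+ a * e%:R ^+ a))) ^+ 2)).
    by rewrite ler_wpM2l// divr_ge0 ?mulr_ge0// ltW.
  have -> : (2 * (C * (2 ^+ a * e%:R ^+ a))) ^+ 2 = 4 * C ^+ 2 * 4 ^+ a * (e%:R ^+ (a+a)) :> R.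
    have -> : 4 ^+ a = 2 ^+ a * 2 ^+ a :> R by rewrite -exprMn; congr (_ ^+ _); ring.
    by rewrite exprD; ring.
  rewrite [e%:R ^+ (a + a).+1]exprS.
  have -> : 2 * e%:R / mass R k n * (4 * C ^+ 2 * 4 ^+ a * e%:R ^+ (a + a)) =
     (C ^+ 2 * (4 * 4 ^+ a)) * (e%:R * e%:R ^+ (a + a)) * (2 / mass R k n) by ring.
  have -> : C ^+ 2 * (4 * 4 ^+ a) / k%:R * (e%:R * e%:R ^+ (a + a)) =
     (C ^+ 2 * (4 * 4 ^+ a)) * (e%:R * e%:R ^+ (a + a)) * k%:R^-1 :> R by ring.
  rewrite ler_wpM2l ?mulr_ge0 ?exprn_ge0//.
  by rewrite ler_pdivrMr// mulrC ler_pdivlMr// .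
have -> : psum (fun e : nat => C ^+ 2 * (4 * 4 ^+ a) / k%:R * e%:R ^+ (a + a).+1) =
   (fun s => C ^+ 2 * (4 * 4 ^+ a) / k%:R * psum (fun e : nat => e%:R ^+ (a + a).+1) s).
  by apply/funext => s; rewrite psumZ.
rewrite ExZ; apply: le_trans (ler_wpM2l _ (Ex_pow n (a + a).+1 k0)) _.
  by rewrite !mulr_ge0 ?exprn_ge0 ?invr_ge0.
by rewrite le_eqVlt; apply/orP; left; apply/eqP; field; rewrite gt_eqF.
Qed.

Definition varK (a : nat) (r : R) : R :=
  4 * 4 ^+ a * expR (3 ^+ (a + a).+1 * r) * expR (2 * 3 ^+ a * r).

(** Summing the jump variances over the [n] insertions; each is bounded by moments of the path
    lengths, which [Ex_pow] controls uniformly. *)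
Lemma var_le k n f C a (r : R) : (0 < k)%N -> 0 <= C -> n%:R <= r * k%:R ->
  (forall e, (0 < e)%N -> (e <= n + k)%N -> `|f e| <= C * e%:R ^+ a) ->
  var k n f <= n%:R * C ^+ 2 * varK a r.
Proof.
move=> k0 C0 nr hf.
have kR : 0 < k%:R :> R by rewrite ltr0n.
set B := 4 * 4 ^+ a * expR (3 ^+ (a + a).+1 * r).
have B0 : 0 <= B by rewrite !mulr_ge0 ?exprn_ge0 ?expR_ge0.
apply: (@le_trans _ _ (n%:R * C ^+ 2 * (B * expR (2 * 3 ^+ a * (n%:R / k%:R))))); last first.
  rewrite /varK -/B ler_wpM2l ?mulr_ge0 ?sqr_ge0//.
  rewrite ler_wpM2l// ler_expR ler_wpM2l ?mulr_ge0 ?exprn_ge0//.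
  by rewrite ler_pdivrMr.
elim: n f C C0 nr hf => [|n IH] f C C0 nr hf.
  rewrite /var /mean /= subrr expr0n /=; nra.
rewrite varS.
have nr' : n%:R <= r * k%:R by apply: le_trans nr; rewrite ler_nat.
apply: (@le_trans _ _ (n%:R * (C * expR (3 ^+ a / k%:R)) ^+ 2 * (B * expR (2 * 3 ^+ a * (n%:R / k%:R))) + C ^+ 2 * B)).
  apply: lerD.
    apply: IH => //; first by rewrite mulr_ge0 ?expR_ge0.
    by move=> e e0 en; apply: back_norm.
  apply: le_trans (Ex_jvar_le k0 C0 hf) _.
  rewrite ler_wpM2l ?sqr_ge0// /B ler_wpM2l ?mulr_ge0 ?exprn_ge0//.
  by rewrite ler_expR -mulrA ler_wpM2l ?exprn_ge0// ler_pdivrMr.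
have E : expR (3 ^+ a / k%:R) ^+ 2 * expR (2 * 3 ^+ a * (n%:R / k%:R)) =
   expR (2 * 3 ^+ a * (n.+1%:R / k%:R)) :> R.
  by rewrite -expRM_natl -expRD; congr expR; rewrite -natr1; ring.
have -> : n.+1%:R * C ^+ 2 * (B * expR (2 * 3 ^+ a * (n.+1%:R / k%:R))) =
  n%:R * C ^+ 2 * (B * expR (2 * 3 ^+ a * (n.+1%:R / k%:R))) +
  C ^+ 2 * (B * expR (2 * 3 ^+ a * (n.+1%:R / k%:R))) by move: (B * expR _) => X; rewrite -[n.+1%:R]natr1; ring.
apply: lerD.
  by rewrite le_eqVlt -E; apply/orP; left; apply/eqP; ring.
rewrite ler_wpM2l ?sqr_ge0// ler_peMr// -expR0 ler_expR.
by rewrite !mulr_ge0 ?exprn_ge0 ?invr_ge0.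
Qed.

End moments.

(** * Moment generating function of a path functional *)

Section mgf.
Variable R : realType.
Implicit Types (f g : nat -> R) (k n : nat) (h r t : R).

Let e1 : R := expR 1.
Let e1_ge1 : 1 <= e1. Proof. by rewrite /e1 -expR0 ler_expR. Qed.

Lemma sqr_norm_le (x c : R) : `|x| <= c -> x ^+ 2 <= c ^+ 2.
Proof.
move=> xc; rewrite -(real_normK (num_real x)) lerXn2r ?nnegrE//.
exact: le_trans (normr_ge0 x) xc.
Qed.

Definition bounded1 m f := forall e, (0 < e)%N -> (e <= m)%N -> `|f e| <= 1.

Lemma back_bounded1 k n f : bounded1 (n.+1 + k) f ->
  bounded1 (n + k) (back (mass R k n) f).
Proof.
move=> hf e e0 en; rewrite ler_norml.
have hf' : forall e', (0 < e')%N -> (e' <= n.+1 + k)%N -> (- 1 <= f e') /\ (f e' <= 1).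
  by move=> e' p q; apply/andP; rewrite -ler_norml; exact: hf.
apply/andP; split.
  have -> : -1 = back (mass R k n) (fun=> - 1) e by rewrite /back; ring.
  by apply: back_le en => // e' p q; case: (hf' e' p q).
have -> : 1 = back (mass R k n) (fun=> 1) e by rewrite /back; ring.
by apply: back_le en => // e' p q; case: (hf' e' p q).
Qed.

Lemma diff_bounded1 m f e : bounded1 m f -> (0 < e)%N -> (e.+1 <= m)%N ->
  `|f e.+1 - f e| <= 2.
Proof.
move=> hf e0 em; apply: le_trans (ler_normB _ _) _.
have := hf e e0 (ltnW em); have := hf e.+1 isT em; lra.
Qed.

Lemma jump_mean_bound k n f s : bounded1 (n.+1 + k) f -> reach k n s ->
  `|jump (mass R k n) f s id| <= 2.
Proof.
move=> hf rs; rewrite ler_norml -{1}(jump_cst f (-2) rs) -{2}(jump_cst f 2 rs).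
apply/andP; split; apply: jump_le => //; try lra.
- move=> e e0 en; have := diff_bounded1 hf e0 en.
  by rewrite ler_norml => /andP[].
- move=> e e0 en; have := diff_bounded1 hf e0 en.
  by rewrite ler_norml => /andP[].
Qed.

Lemma jvar_bound k n f s : bounded1 (n.+1 + k) f -> reach k n s ->
  jvar k n f s <= 4.
Proof.
move=> hf rs; rewrite jvarE// lerBlDr -[leLHS]addr0 lerD ?sqr_ge0//.
rewrite -[leRHS](jump_cst f 4 rs); apply: jump_le => //; first by rewrite expr0n.
move=> e e0 en; have := diff_bounded1 hf e0 en.
by move=> /sqr_norm_le; lra.
Qed.

(** The exponential moment of one jump, once its conditional mean has been removed. *)
Definition jexp k n f h s := jump (mass R k n) f s
  (fun x => expR (h * (x - jump (mass R k n) f s id))).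

Lemma jexp_taylor k n f h s : bounded1 (n.+1 + k) f -> reach k n s ->
  `|h| <= 1 / 4 ->
  `|jexp k n f h s - (1 + h ^+ 2 / 2 * jvar k n f s)| <= 64 * e1 * `|h| ^+ 3.
Proof.
move=> hf rs h4; set mu := jump (mass R k n) f s id.
have hmu : `|mu| <= 2 by exact: jump_mean_bound.
have -> : 1 + h ^+ 2 / 2 * jvar k n f s = jump (mass R k n) f s
   (fun x => 1 + h * (x - mu) + (h * (x - mu)) ^+ 2 / 2).
  transitivity (jump (mass R k n) f s (fun x => 1 + (h * (x - mu) + h ^+ 2 / 2 * (x - mu) ^+ 2))).
    by rewrite jumpD jump_cst// jumpD !jumpZ jump_center// mulr0 add0r.
  by congr jump; apply/funext => x; ring.
have key x : `|x| <= 2 -> `|expR (h * (x - mu)) - (1 + h * (x - mu) + (h * (x - mu)) ^+ 2 / 2)|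
    <= 64 * e1 * `|h| ^+ 3.
  move=> x2; have xm : `|x - mu| <= 4 by apply: le_trans (ler_normB _ _) _; lra.
  have y1 : `|h * (x - mu)| <= `|h| * 4 by rewrite normrM ler_wpM2l.
  have y2 : `|h * (x - mu)| <= 1 by apply: le_trans y1 _; lra.
  rewrite !opprD !addrA; apply: le_trans (expR_taylor2 y2) _.
  rewrite (_ : 64 * e1 * `|h| ^+ 3 = e1 * (`|h| * 4) ^+ 3); last by ring.
  by rewrite ler_wpM2l ?expR_ge0// lerXn2r// nnegrE mulr_ge0.
rewrite /jexp -/mu.
have key' x : `|x| <= 2 ->
    expR (h * (x - mu)) <= 64 * e1 * `|h| ^+ 3 + (1 + h * (x - mu) + (h * (x - mu)) ^+ 2 / 2) /\
   1 + h * (x - mu) + (h * (x - mu)) ^+ 2 / 2 <= 64 * e1 * `|h| ^+ 3 + expR (h * (x - mu)).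
  by move=> /key; rewrite ler_distl => /andP[]; split; lra.
rewrite ler_distl; apply/andP; split.
  rewrite lerBlDr addrC -[X in X + _](jump_cst f _ rs) -jumpD.
  apply: jump_le => //; first by case: (key' 0); rewrite ?normr0.
  by move=> e e0 en; case: (key' _ (diff_bounded1 hf e0 en)).
rewrite addrC -[X in X + _](jump_cst f _ rs) -jumpD.
apply: jump_le => //; first by case: (key' 0); rewrite ?normr0.
by move=> e e0 en; case: (key' _ (diff_bounded1 hf e0 en)).
Qed.

Definition mgf k n f h : R := Ex k n (fun s => expR (h * (psum f s - mean k n f))).

Lemma mgfS k n f h : mgf k n.+1 f h = Ex k n (fun s =>
  expR (h * (psum (back (mass R k n) f) s - mean k n (back (mass R k n) f))) * jexp k n f h s).
Proof.
rewrite /mgf /mean Ex_psumS /=; apply: Ex_eq => s rs.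
set m := Ex k n _; rewrite (step_psum _ (fun x => expR (h * (x - m)))) back_psum /jexp.
set mu := jump _ _ _ id; rewrite -jumpZ; congr jump; apply/funext => x.
by rewrite -expRD; congr expR; ring.
Qed.

Definition c0 : R := 2 + 16 * e1.

(** A first bound of Gaussian type, obtained by bounding each exponential jump moment by
    [expR (c0 * h ^+ 2)]. It controls the error terms of the sharp estimate. *)
Lemma mgf_crude k n f h : `|h| <= 1 / 4 -> bounded1 (n + k) f ->
  mgf k n f h <= expR (c0 * h ^+ 2 * n%:R).
Proof.
move=> h4; elim: n f => [|n IH] f hf.
  by rewrite /mgf /mean /= subrr !mulr0 expR0.
rewrite mgfS; apply: (@le_trans _ _ (Ex k n (fun s => expR (c0 * h ^+ 2) *
    expR (h * (psum (back (mass R k n) f) s - mean k n (back (mass R k n) f)))))).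
  apply: Ex_le => s rs; rewrite mulrC ler_wpM2r ?expR_ge0//.
  have := jexp_taylor hf rs h4; have := jvar_bound hf rs; have := jvar_ge0 f rs.
  rewrite ler_distl => v0 v4 /andP[_ J].
  apply: le_trans J _; apply: le_trans (expR_ge1Dx _).
  have h2 : 0 <= h ^+ 2 by exact: sqr_ge0.
  have h3 : `|h| ^+ 3 <= h ^+ 2 / 4.
    rewrite -[h ^+ 2](real_normK (num_real h)) exprSr ler_wpM2l ?exprn_ge0//; lra.
  have : e1 * `|h| ^+ 3 <= e1 * (h ^+ 2 / 4) by rewrite ler_wpM2l ?expR_ge0.
  have : h ^+ 2 / 2 * jvar k n f s <= h ^+ 2 / 2 * 4 by rewrite ler_wpM2l//; lra.
  rewrite /c0; lra.
rewrite ExZ -[_ * n.+1%:R](_ : c0 * h ^+ 2 + c0 * h ^+ 2 * n%:R = _); last by rewrite -natr1; ring.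
rewrite expRD ler_wpM2l ?expR_ge0//; exact/IH/back_bounded1.
Qed.

Lemma var_min k n (F : shape -> R) c :
  Ex k n (fun s => (F s - Ex k n F) ^+ 2) <= Ex k n (fun s => (F s - c) ^+ 2).
Proof.
rewrite -subr_ge0 -ExB; set m := Ex k n F.
rewrite (_ : Ex _ _ _ = Ex k n (fun s => 2 * (m - c) * F s + ((c ^+ 2 - m ^+ 2)))).
  rewrite ExD Ex_cst ExZ -/m (_ : _ + _ = (m - c) ^+ 2) ?sqr_ge0//; ring.
by apply: Ex_eq => s _; ring.
Qed.

Definition conc r : R := 160 * r * varK 1 r.

Lemma varK_ge0 a r : 0 <= varK a r.
Proof. by rewrite /varK !mulr_ge0 ?expR_ge0 ?exprn_ge0. Qed.

(** The conditional variance of a jump is itself a sum over paths divided by a quantity of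
    order [k]; its own variance is therefore of order [1 / k], and it is nearly constant. *)
Lemma jvar_conc k n f r : (0 < k)%N -> n%:R <= r * k%:R ->
  bounded1 (n.+1 + k) f ->
  Ex k n (fun s => (jvar k n f s - Ex k n (jvar k n f)) ^+ 2) <= conc r / k%:R.
Proof.
move=> k0 nr hf.
have kR : 0 < k%:R :> R by rewrite ltr0n.
set D := mass R k n; have D0 : 0 < D := mass_gt0 R k n.
have Dk : 2 * k%:R <= D := mass_ge R k n.
pose f1 e : R := 2 * e%:R * (f e.+1 - f e) ^+ 2.
pose f2 e : R := 2 * e%:R * (f e.+1 - f e).
have v1 : var k n f1 <= n%:R * 8 ^+ 2 * varK 1 r.
  apply: var_le => // e e0 en; rewrite expr1 /f1 normrM (ger0_norm (_ : 0 <= 2 * e%:R))//.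
  have := diff_bounded1 hf e0 en.
  rewrite normrX => u; rewrite (_ : 8 * e%:R = 2 * e%:R * 2 ^+ 2); last by ring.
  by rewrite ler_wpM2l// lerXn2r// nnegrE.
have v2 : var k n f2 <= n%:R * 4 ^+ 2 * varK 1 r.
  apply: var_le => // e e0 en; rewrite expr1 /f2 normrM (ger0_norm (_ : 0 <= 2 * e%:R))//.
  have := diff_bounded1 hf e0 en => u.
  by rewrite (_ : 4 * e%:R = 2 * e%:R * 2); [rewrite ler_wpM2l | ring].
have E1 s : jump D f s (fun x => x ^+ 2) = psum f1 s / D.
  rewrite (jump_psum _ _ _ (p := fun x => x ^+ 2)) ?expr0n// mulrC -psumZ.
  by congr psum; apply/funext => e; rewrite /f1; ring.
have E2 s : jump D f s id = psum f2 s / D.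
  rewrite (jump_psum _ _ _ (p := id))// mulrC -psumZ.
  by congr psum; apply/funext => e; rewrite /f2; ring.
set m1 := mean k n f1 in v1 *; set m2 := mean k n f2 in v2 *.
have m2b : `|m2 / D| <= 2.
  have -> : m2 / D = Ex k n (fun s => jump D f s id).
    by rewrite mulrC -ExZ; apply: Ex_eq => s _; rewrite E2 mulrC.
  apply: le_trans (Ex_norm _ _ _) _; rewrite -[leRHS](Ex_cst k n).
  by apply: Ex_le => s rs; exact: jump_mean_bound.
apply: le_trans (var_min _ _ _ (m1 / D - (m2 / D) ^+ 2)) _.
apply: (@le_trans _ _ (Ex k n (fun s => 2 / D ^+ 2 * (psum f1 s - m1) ^+ 2 +
    32 / D ^+ 2 * (psum f2 s - m2) ^+ 2))).
  apply: Ex_le => s rs; rewrite jvarE// E1 E2.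
  have X2 : `|psum f2 s / D| <= 2 by rewrite -E2; exact: jump_mean_bound.
  set x := psum f1 s / D; set y := psum f2 s / D in X2 *.
  have -> : 2 / D ^+ 2 * (psum f1 s - m1) ^+ 2 = 2 * (x - m1 / D) ^+ 2.
    by rewrite /x; field; rewrite gt_eqF.
  have -> : 32 / D ^+ 2 * (psum f2 s - m2) ^+ 2 = 32 * (y - m2 / D) ^+ 2.
    by rewrite /y; field; rewrite gt_eqF.
  move: (m1 / D) (m2 / D) m2b => a b b2.
  have -> : x - y ^+ 2 - (a - b ^+ 2) = (x - a) - (y - b) * (y + b) by ring.
  have : ((y - b) * (y + b)) ^+ 2 <= (y - b) ^+ 2 * 16.
    rewrite exprMn ler_wpM2l ?sqr_ge0//.
    have : `|y + b| <= 4 by apply: le_trans (ler_normD _ _) _; lra.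
    rewrite -(real_normK (num_real (y + b))) => ?.
    rewrite (_ : 16 = 4 ^+ 2); last by ring.
    by rewrite lerXn2r// nnegrE.
  move: ((y - b) * (y + b)) => u; move: (x - a) (y - b) => v w uw.
  rewrite -subr_ge0 (_ : _ - _ = (u + v) ^+ 2 + 2 * (w ^+ 2 * 16 - u ^+ 2)); last by ring.
  by rewrite addr_ge0 ?sqr_ge0// mulr_ge0// subr_ge0.
rewrite ExD !ExZ.
have V : 0 <= varK 1 r := varK_ge0 1 r.
have D2 : 0 <= 2 / D ^+ 2 by rewrite divr_ge0// exprn_ge0// ltW.
have D3 : 0 <= 32 / D ^+ 2 by rewrite divr_ge0// exprn_ge0// ltW.
apply: le_trans (lerD (ler_wpM2l D2 v1) (ler_wpM2l D3 v2)) _.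
have -> : 2 / D ^+ 2 * (n%:R * 8 ^+ 2 * varK 1 r) + 32 / D ^+ 2 * (n%:R * 4 ^+ 2 * varK 1 r) =
   640 * n%:R * varK 1 r / D ^+ 2 by field; rewrite gt_eqF.
rewrite ler_pdivrMr ?exprn_gt0//.
apply: (@le_trans _ _ (640 * (r * k%:R) * varK 1 r)).
  by apply: ler_wpM2r; [exact: varK_ge0 | exact: ler_wpM2l].
have r0 : 0 <= r by have := ler0n R n; nra.
have -> : 640 * (r * k%:R) * varK 1 r = conc r / k%:R * (2 * k%:R) ^+ 2.
  by rewrite /conc; field; rewrite gt_eqF.
rewrite ler_wpM2l ?divr_ge0 ?mulr_ge0// lerXn2r ?nnegrE ?mulr_ge0// ltW//.
Qed.

Definition mgfK r t : R :=
  r * t ^+ 2 * (expR (2 * t ^+ 2 * r) *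
    (68 * e1 * t * expR (c0 * t ^+ 2 * r) + (expR (4 * c0 * t ^+ 2 * r) + conc r) / 4)).

(** Each step multiplies the moment generating function by one plus half of [h^2] times
    the conditional variance of the jump, up to [O(h^3)]. That conditional variance can be replaced by its mean by
    [jvar_conc], and the means add up to the variance by [varS]: hence a Gaussian
    transform with the exact variance and an error of order [1 / sqrt k]. *)
Lemma mgf_approx k n f h r t : (0 < k)%N -> n%:R <= r * k%:R ->
  bounded1 (n + k) f -> 0 <= t -> `|h| <= t / Num.sqrt k%:R -> `|h| <= 1 / 8 ->
  `|mgf k n f h - expR (h ^+ 2 / 2 * var k n f)| <= mgfK r t / Num.sqrt k%:R.
Proof.
move=> k0 nr hf t0 ht h8.
have kR : 0 < k%:R :> R by rewrite ltr0n.
set q := Num.sqrt k%:R in ht *; have q0 : 0 < q by rewrite sqrtr_gt0.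
have qq : q ^+ 2 = k%:R by rewrite sqr_sqrtr// ltW.
have q1 : 1 <= q by rewrite -sqrtr1 ler_sqrt ?ltr0n// ler1n.
have r0 : 0 <= r by have := ler0n R n; nra.
have h20 : 0 <= h ^+ 2 by exact: sqr_ge0.
have h2t : h ^+ 2 <= t ^+ 2 / k%:R.
  rewrite -qq -expr_div_n -(real_normK (num_real h)) lerXn2r ?nnegrE//.
  by rewrite divr_ge0// ltW.
have h2n m : m%:R <= r * k%:R -> h ^+ 2 * m%:R <= t ^+ 2 * r.
  move=> mr; apply: (@le_trans _ _ (t ^+ 2 / k%:R * (r * k%:R))); first exact: ler_pM.
  by rewrite le_eqVlt; apply/orP; left; apply/eqP; field; rewrite gt_eqF.
have c00 : 0 <= c0 by rewrite /c0; have := e1_ge1; lra.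
set A := expR (c0 * t ^+ 2 * r); set A' := expR (4 * c0 * t ^+ 2 * r).
pose eps := h ^+ 2 * (68 * e1 * `|h| * A + (A' + conc r) / q / 4).
have V : 0 <= varK 1 r := varK_ge0 1 r.
have cr0 : 0 <= conc r by rewrite /conc !mulr_ge0.
have e10 : 0 <= e1 by exact: expR_ge0.
have A'0 : 0 <= A' + conc r by rewrite addr_ge0// expR_ge0.
have B0 : 0 <= (A' + conc r) / q / 4 by rewrite divr_ge0// divr_ge0// ltW.
have A0 : 0 <= A by exact: expR_ge0.
have B1 : 0 <= 68 * e1 * `|h| * A by rewrite mulr_ge0// mulr_ge0// mulr_ge0.
have eps0 : 0 <= eps by rewrite mulr_ge0// addr_ge0.
have main : `|mgf k n f h - expR (h ^+ 2 / 2 * var k n f)| <=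
   n%:R * (eps * expR (2 * h ^+ 2 * n%:R)).
  elim: n f nr hf => [|n IH] f nr hf.
    by rewrite /mgf /var /mean /= !subrr mulr0 expr0n mulr0 expR0 subrr normr0 mul0r.
  have nr' : n%:R <= r * k%:R by apply: le_trans nr; rewrite ler_nat.
  rewrite mgfS varS; set g := back _ f; set vb := Ex k n (jvar k n f).
  have hg : bounded1 (n + k) g by exact: back_bounded1.
  have vb0 : 0 <= vb by apply: Ex_ge0 => s; exact: jvar_ge0.
  have vb4 : vb <= 4 by rewrite -(Ex_cst k n 4); apply: Ex_le => s; exact: jvar_bound.
  pose P s := expR (h * (psum g s - mean k n g)).
  have step1 : `|Ex k n (fun s => P s * jexp k n f h s) - expR (h ^+ 2 / 2 * vb) * mgf k n g h| <= eps.
    rewrite /mgf -ExZ -ExB; apply: le_trans (Ex_norm _ _ _) _.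
    apply: (@le_trans _ _ (Ex k n (fun s => 68 * e1 * `|h| * h ^+ 2 * P s +
      (h ^+ 2 / 4 / q * (expR (2 * h * (psum g s - mean k n g))) +
       h ^+ 2 / 4 * q * (jvar k n f s - vb) ^+ 2)))).
      apply: Ex_le => s rs; rewrite [expR (h ^+ 2 / 2 * vb) * _]mulrC -/(P s) -mulrBr normrM.
      rewrite (ger0_norm (expR_ge0 _)).
      have h4 : `|h| <= 1 / 4 by lra.
      have J := jexp_taylor hf rs h4.
      have T : `|expR (h ^+ 2 / 2 * vb) - 1 - h ^+ 2 / 2 * vb| <= 4 * e1 * `|h| * h ^+ 2.
        have h64 : h ^+ 2 <= `|h| / 8.
          rewrite -(real_normK (num_real h)) expr2 ler_wpM2l//; lra.
        have y0 : 0 <= h ^+ 2 / 2 * vb by rewrite mulr_ge0// divr_ge0.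
        have y1 : h ^+ 2 / 2 * vb <= h ^+ 2 * 2.
          by rewrite (_ : h ^+ 2 * 2 = h ^+ 2 / 2 * 4); [rewrite ler_wpM2l// divr_ge0 | field].
        apply: le_trans (expR_taylor1 _) _; first by rewrite ger0_norm//; have := normr_ge0 h; lra.
        rewrite -/e1 ger0_norm//; move: e1_ge1 y0 y1 h64; move: (h ^+ 2 / 2 * vb) => y E y0 y1 h64.
        have : y ^+ 2 <= (h ^+ 2 * 2) ^+ 2 by rewrite lerXn2r// nnegrE mulr_ge0.
        have : (h ^+ 2 * 2) ^+ 2 <= 4 * `|h| * h ^+ 2.
          rewrite (_ : (h ^+ 2 * 2) ^+ 2 = 4 * h ^+ 2 * h ^+ 2); last by ring.
          rewrite ler_wpM2r// ler_wpM2l//; have := normr_ge0 h; lra.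
        move=> a b; rewrite (_ : 4 * e1 * `|h| * h ^+ 2 = e1 * (4 * `|h| * h ^+ 2)); last by ring.
        by rewrite ler_wpM2l ?(le_trans ler01)//; exact: le_trans b a.
      have K : `|jexp k n f h s - expR (h ^+ 2 / 2 * vb)| <=
          68 * e1 * `|h| * h ^+ 2 + h ^+ 2 / 2 * `|jvar k n f s - vb|.
        have -> : jexp k n f h s - expR (h ^+ 2 / 2 * vb) =
          (jexp k n f h s - (1 + h ^+ 2 / 2 * jvar k n f s)) -
          (expR (h ^+ 2 / 2 * vb) - 1 - h ^+ 2 / 2 * vb) +
          h ^+ 2 / 2 * (jvar k n f s - vb) by ring.
        apply: le_trans (ler_normD _ _) _; rewrite normrM (ger0_norm (_ : 0 <= h ^+ 2 / 2)) ?divr_ge0//.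
        rewrite lerD2r; apply: le_trans (ler_normB _ _) _.
        have -> : 68 * e1 * `|h| * h ^+ 2 = 64 * e1 * `|h| ^+ 3 + 4 * e1 * `|h| * h ^+ 2.
          by rewrite -[h ^+ 2](real_normK (num_real h)); ring.
        exact: lerD J T.
      have P0 : 0 < P s by exact: expR_gt0.
      have PP : expR (2 * h * (psum g s - mean k n g)) = P s ^+ 2.
        by rewrite -expRM_natl; congr expR; ring.
      rewrite PP; apply: le_trans (ler_wpM2l (ltW P0) K) _.
      rewrite mulrDr mulrC lerD2l.
      rewrite -[X in _ <= _ + _ * X](real_normK (num_real _)).
      move: (P s) P0 `|_ - vb| => p p0 w.
      rewrite -subr_ge0 (_ : _ - _ = h ^+ 2 / 4 / q * (p - q * w) ^+ 2); last by field; rewrite gt_eqF.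
      by rewrite mulr_ge0 ?sqr_ge0// !divr_ge0// ltW.
    rewrite !ExD !ExZ.
    have M1 : Ex k n P <= A.
      apply: le_trans (@mgf_crude k n g h _ hg) _; first by lra.
      by rewrite /A ler_expR -[c0 * h ^+ 2 * _]mulrA -[c0 * t ^+ 2 * r]mulrA ler_wpM2l// h2n.
    have M2 : Ex k n (fun s => expR (2 * h * (psum g s - mean k n g))) <= A'.
      apply: le_trans (@mgf_crude k n g (2 * h) _ hg) _.
        by rewrite normrM ger0_norm//; lra.
      rewrite /A' ler_expR (_ : c0 * _ * _ = 4 * c0 * (h ^+ 2 * n%:R)); last by ring.
      by rewrite -[4 * c0 * t ^+ 2 * r]mulrA ler_wpM2l ?mulr_ge0// h2n.
    have M3 := jvar_conc k0 nr' hf.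
    have -> : eps = 68 * e1 * `|h| * h ^+ 2 * A + (h ^+ 2 / 4 / q * A' + h ^+ 2 / 4 * q * (conc r / k%:R)).
      by rewrite /eps -qq; field; rewrite gt_eqF.
    apply: lerD; first by rewrite ler_wpM2l // mulr_ge0// mulr_ge0// mulr_ge0.
    have h40 : 0 <= h ^+ 2 / 4 by rewrite divr_ge0.
    have q0' := ltW q0.
    by apply: lerD; rewrite ler_wpM2l// ?divr_ge0// mulr_ge0.
  rewrite mulrDr expRD.
  have -> : Ex k n (fun s => P s * jexp k n f h s) - expR (h ^+ 2 / 2 * var k n g) * expR (h ^+ 2 / 2 * vb) =
    (Ex k n (fun s => P s * jexp k n f h s) - expR (h ^+ 2 / 2 * vb) * mgf k n g h) +
    expR (h ^+ 2 / 2 * vb) * (mgf k n g h - expR (h ^+ 2 / 2 * var k n g)) by ring.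
  apply: le_trans (ler_normD _ _) _.
  have -> : n.+1%:R * (eps * expR (2 * h ^+ 2 * n.+1%:R)) =
      eps * expR (2 * h ^+ 2 * n.+1%:R) + expR (2 * h ^+ 2) * (n%:R * (eps * expR (2 * h ^+ 2 * n%:R))).
    have -> : expR (2 * h ^+ 2 * n.+1%:R) = expR (2 * h ^+ 2) * expR (2 * h ^+ 2 * n%:R).
      by rewrite -expRD -[n.+1%:R]natr1; congr expR; ring.
    by rewrite -[n.+1%:R]natr1; ring.
  apply: lerD.
    have E1 : 1 <= expR (2 * h ^+ 2 * n.+1%:R) by rewrite -[leLHS]expR0 ler_expR mulr_ge0// mulr_ge0.
    by apply: le_trans step1 _; apply: ler_peMr; [exact: eps0|exact: E1].
  rewrite normrM (ger0_norm (expR_ge0 _)).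
  apply: ler_pM => //.
    by rewrite ler_expR; have := ler_wpM2l h20 vb4; lra.
  exact: IH.
apply: le_trans main _.
have nk : n%:R * h ^+ 2 <= t ^+ 2 * r by rewrite mulrC h2n.
have -> : n%:R * (eps * expR (2 * h ^+ 2 * n%:R)) =
   (n%:R * h ^+ 2) * (expR (2 * h ^+ 2 * n%:R) * (68 * e1 * `|h| * A + (A' + conc r) / q / 4)).
  by rewrite /eps; ring.
have -> : mgfK r t / q = (t ^+ 2 * r) * (expR (2 * t ^+ 2 * r) * (68 * e1 * (t / q) * A + (A' + conc r) / q / 4)).
  by rewrite /mgfK -/A -/A'; ring.
apply: ler_pM => //; first by rewrite mulr_ge0.
  by rewrite mulr_ge0 ?expR_ge0// addr_ge0.
apply: ler_pM => //.
- by rewrite addr_ge0.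
- by rewrite ler_expR -[2 * h ^+ 2 * _]mulrA -[2 * t ^+ 2 * r]mulrA ler_wpM2l// h2n.
by rewrite lerD2r ler_wpM2r// ler_wpM2l ?mulr_ge0.
Qed.

End mgf.

(** * Exact first and second moments of the path counts *)

Section exact.
Variable R : realType.
Implicit Types (f g : nat -> R) (k n L J : nat).

(** Falling factorial of a real number; the moments below involve it at the half-integer
    [n + k - 1/2]. *)
Definition ffR (x : R) m : R := \prod_(i < m) (x - i%:R).
Definition Mkn k n : R := n%:R + k%:R - 1 / 2.

Lemma ffRS x m : ffR x m.+1 = ffR x m * (x - m%:R).
Proof. by rewrite /ffR big_ord_recr. Qed.

Lemma ffRSS x m : ffR (x + 1) m.+1 = (x + 1) * ffR x m.
Proof.
rewrite /ffR big_ord_recl subr0; congr (_ * _); apply: eq_bigr => i _.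
by rewrite lift0 -natr1; ring.
Qed.

Lemma ffactR n m : (n ^_ m)%:R = ffR n%:R m.
Proof.
elim: m => [|m IH]; first by rewrite ffactn0 /ffR big_ord0.
rewrite ffactnSr natrM IH ffRS; have [mn|nm] := leqP m n; first by rewrite natrB.
by rewrite -IH ffact_small// !mul0r.
Qed.

Lemma Mkn_neq k n i : Mkn k n - i%:R != 0.
Proof.
apply/eqP => e.
have /eqP : (2 * (n + k))%N%:R = (2 * i + 1)%N%:R :> R.
  by rewrite !(natrM, natrD); move: e; rewrite /Mkn; lra.
rewrite eqr_nat => /eqP /(congr1 odd).
by rewrite oddD !oddM.
Qed.

Lemma ffR_neq0 k n m : ffR (Mkn k n) m != 0.
Proof. by apply/prodf_neq0 => i _; rewrite Mkn_neq. Qed.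

Lemma MknS k n : Mkn k n.+1 = Mkn k n + 1.
Proof. by rewrite /Mkn -natr1; ring. Qed.

Lemma mass_Mkn k n : mass R k n = 2 * (Mkn k n + 1).
Proof. by rewrite /mass /Mkn; field. Qed.

Definition U r k n s : R := (n ^_ s)%:R / ffR (Mkn k n) (s + r).

Lemma Mkn1_neq k n : Mkn k n + 1 != 0.
Proof. by have := Mkn_neq k n.+1 0; rewrite subr0 MknS. Qed.

Lemma US0 r k n : (0 < r)%N ->
  U r k n.+1 0 = (Mkn k n - r.-1%:R) / (Mkn k n + 1) * U r k n 0.
Proof.
case: r => // r _; rewrite /U !ffactn0 add0n MknS ffRSS ffRS /=.
have a := ffR_neq0 k n r; have b := Mkn1_neq k n; have c := Mkn_neq k n r.
by field; rewrite a b c.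
Qed.

Lemma USS r k n s : (0 < r)%N ->
  U r k n.+1 s.+1 = (Mkn k n - (s + r)%:R) / (Mkn k n + 1) * U r k n s.+1
     + s.+1%:R / (Mkn k n + 1) * U r k n s.
Proof.
case: r => // r _; rewrite /U MknS !addSn ffRSS !addnS [ffR _ (s + r).+2]ffRS ffactSS.
have a := ffR_neq0 k n (s + r).+1; have b := Mkn1_neq k n; have c := Mkn_neq k n (s + r).+1.
rewrite ffactnSr !natrM.
have -> : n.+1%:R * (n ^_ s)%:R = (n ^_ s)%:R * (n - s)%:R + s.+1%:R * (n ^_ s)%:R :> R.
  have [mn|nm] := leqP s n; first by rewrite natrB// -!natr1; ring.
  by rewrite ffact_small// !mulr0 mul0r addr0.
move: (s + r).+1%:R c => t c; by field; rewrite a b c.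
Qed.

Definition ind e0 : nat -> R := fun e => (e == e0)%:R.

Definition rate D f e : R := 2 * e%:R / D * (f e.+1 - f e).

Lemma rate_ind k n L e : rate (mass R k n) (ind L.+1) e =
  - (L.+1%:R / (Mkn k n + 1)) * ind L.+1 e + L%:R / (Mkn k n + 1) * ind L e.
Proof.
rewrite /rate /ind mass_Mkn eqSS; have b := Mkn1_neq k n.
have [->|eL] := eqVneq e L.
  by rewrite ltn_eqF// /=; field; rewrite b.
have [->|eL1] := eqVneq e L.+1; last by rewrite /=; ring.
by rewrite /= -natr1; field; rewrite b.
Qed.

Lemma psum_lin2 a b f g s :
  psum (fun e => a * f e + b * g e) s = a * psum f s + b * psum g s :> R.
Proof. by rewrite psumD !psumZ. Qed.

(** The counts of paths of given length satisfy a linear recursion in the number of insertions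
    whose solution is a ratio of falling factorials. *)
Lemma mean_ind k n L :
  mean k n (ind L.+1) = k%:R * (k%:R - 1 / 2) * U 1 k n L.
Proof.
elim: n L => [|n IH] L.
  rewrite /mean /= /psum big_nseq_cond /= iter_addr_0 /ind eqSS.
  rewrite /U /Mkn; case: L => [|L] /=; last by rewrite mul0rn ffact0n !mul0r mulr0.
  rewrite ffactn0 /ffR big_ord1 subr0 add0r mulr1n; field.
  by have := Mkn_neq k 0 0; rewrite /Mkn add0r subr0 => /eqP h; apply/eqP => h2; apply: h; lra.
rewrite /mean Ex_psumS.
have -> : Ex k n (psum (back (mass R k n) (ind L.+1))) =
   Ex k n (fun s => (1 - L.+1%:R / (Mkn k n + 1)) * psum (ind L.+1) s + L%:R / (Mkn k n + 1) * psum (ind L) s).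
  apply: Ex_eq => s _; rewrite -psum_lin2; congr psum; apply/funext => e.
  by rewrite /back -/(rate _ _ _) rate_ind; ring.
rewrite ExD !ExZ -!/(mean _ _ _) IH.
case: L => [|L].
  by rewrite mul0r mul0r addr0 US0//=; field; rewrite Mkn1_neq.
by rewrite IH USS// addn1; field; rewrite Mkn1_neq.
Qed.

(** The sum of [f c.2 * g c'.2] over ordered pairs of distinct paths: unlike the product of two
    counts, it satisfies a closed recursion. *)
Definition pairf f g s : R := psum f s * psum g s - psum (fun e => f e * g e) s.

Lemma pairf_lin a b f1 f2 g s : pairf (fun e => a * f1 e + b * f2 e) g s =
  a * pairf f1 g s + b * pairf f2 g s.
Proof.
rewrite /pairf psum_lin2.
have -> : psum (fun e => (a * f1 e + b * f2 e) * g e) s =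
  a * psum (fun e => f1 e * g e) s + b * psum (fun e => f2 e * g e) s.
  by rewrite -psum_lin2; congr psum; apply/funext => e; ring.
by ring.
Qed.

Lemma pairfC f g s : pairf f g s = pairf g f s.
Proof.
by rewrite /pairf mulrC; congr (_ - psum _ _); apply/funext => e; rewrite mulrC.
Qed.

Lemma pairf_linr a b f g1 g2 s : pairf f (fun e => a * g1 e + b * g2 e) s =
  a * pairf f g1 s + b * pairf f g2 s.
Proof. by rewrite pairfC pairf_lin !(pairfC f). Qed.

Lemma step_prod k n f g s : reach k n s ->
  step (mass R k n) (fun u => psum f u * psum g u) s =
  psum f s * psum g s + psum f s * psum (rate (mass R k n) g) s
  + psum (rate (mass R k n) f) s * psum g s
  + psum (fun e => 2 * e%:R / mass R k n * ((f e.+1 - f e) * (g e.+1 - g e))) s.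
Proof.
move=> rs; rewrite /step (grow_sum_psum2 (fun x y => x * y)) !psum_cons /= !add0r.
have m0 := lt0r_neq0 (mass_gt0 R k n).
have E : \sum_(c <- s) c.2%:R * ((psum f s + dlt f c) * (psum g s + dlt g c)) =
   (edges s)%:R * (psum f s * psum g s) + psum f s * (mass R k n / 2 * psum (rate (mass R k n) g) s)
   + (mass R k n / 2 * psum (rate (mass R k n) f) s) * psum g s
   + mass R k n / 2 * psum (fun e => 2 * e%:R / mass R k n * ((f e.+1 - f e) * (g e.+1 - g e))) s.
  have P h : mass R k n / 2 * psum (fun e => 2 * e%:R / mass R k n * h e) s = \sum_(c <- s | c.1) c.2%:R * h c.2.
    by rewrite -psumZ /psum; apply: eq_bigr => c _; field; rewrite m0.
  rewrite !P /edges natr_sum [X in _ = X + _ + _ + _]mulr_suml [X in _ = _ + X + _ + _]mulr_sumr [X in _ = _ + _ + X + _]mulr_suml.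
  rewrite [X in _ + X + _ + _]big_mkcond [X in _ + _ + X + _]big_mkcond [X in _ + _ + _ + X]big_mkcond.
  rewrite -!big_split /=; apply: eq_bigr => c _; rewrite /dlt.
  by case: c.1; ring.
rewrite E; case/and3P: rs => _ /eqP -> _; rewrite natrD /mass.
by field; have := m0; rewrite /mass; apply: contra_neq => <-; ring.
Qed.

Lemma step_pairf k n f g s : reach k n s ->
  step (mass R k n) (pairf f g) s =
  pairf f g s + pairf f (rate (mass R k n) g) s + pairf (rate (mass R k n) f) g s.
Proof.
move=> rs; have -> : pairf f g = (fun u => psum f u * psum g u + (-1) * psum (fun e => f e * g e) u).
  by apply/funext => u; rewrite mulN1r.
rewrite stepD stepZ step_prod// step_psum1// /pairf.
have -> : psum (back (mass R k n) (fun e => f e * g e)) s =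
   psum (fun e => f e * g e) s + (psum (fun e => f e * rate (mass R k n) g e) s
   + psum (fun e => rate (mass R k n) f e * g e) s
   + psum (fun e => 2 * e%:R / mass R k n * ((f e.+1 - f e) * (g e.+1 - g e))) s).
  by rewrite -!psumD; congr psum; apply/funext => e; rewrite /back /rate; ring.
by ring.
Qed.

(** One insertion lengthens at most one of the two paths, so that the pair count obeys the
    same kind of recursion as the count itself, with the total length as parameter. *)
Lemma Ex_pair_ind k n L J : (0 < k)%N ->
  Ex k n (pairf (ind L.+1) (ind J.+1)) =
  k%:R * (k%:R - 1) * (k%:R - 1 / 2) * (k%:R - 3 / 2) * U 2 k n (L + J).
Proof.
move=> k0; elim: n L J => [|n IH] L J.
  rewrite /= /pairf /psum !big_nseq_cond /= !iter_addr_0 /ind !eqSS.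
  rewrite /U /Mkn add0r.
  case: L => [|L]; last by rewrite addSn ffact0n /= !mul0r !mul0rn !mul0r subr0 mulr0.
  case: J => [|J]; last by rewrite add0n ffact0n /= !mulr0 !mul0rn !mul0r !mulr0 subr0.
  rewrite /= mulr1 ffactn0 /ffR !big_ord_recl big_ord0 /= subr0 mulr1.
  have := Mkn_neq k 0 0; have := Mkn_neq k 0 1; rewrite /Mkn add0r subr0.
  rewrite (_ : bump 0 0 = 1%N)//; move: (k%:R : R) => x h1 h2.
  by field; apply/andP; split; [move: h1|move: h2]; apply: contra_neq => h; lra.
have -> : Ex k n.+1 (pairf (ind L.+1) (ind J.+1)) =
   Ex k n (fun s => (1 - L.+1%:R / (Mkn k n + 1) - J.+1%:R / (Mkn k n + 1)) * pairf (ind L.+1) (ind J.+1) s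
     + (J%:R / (Mkn k n + 1) * pairf (ind L.+1) (ind J) s
     + L%:R / (Mkn k n + 1) * pairf (ind L) (ind J.+1) s)).
  rewrite /=; apply: Ex_eq => s rs; rewrite step_pairf//.
  have -> : rate (mass R k n) (ind L.+1) = fun e => - (L.+1%:R / (Mkn k n + 1)) * ind L.+1 e + L%:R / (Mkn k n + 1) * ind L e.
    by apply/funext => e; exact: rate_ind.
  have -> : rate (mass R k n) (ind J.+1) = fun e => - (J.+1%:R / (Mkn k n + 1)) * ind J.+1 e + J%:R / (Mkn k n + 1) * ind J e.
    by apply/funext => e; exact: rate_ind.
  by rewrite pairf_linr pairf_lin; ring.
rewrite !ExD !ExZ IH; have b := Mkn1_neq k n.
case: L => [|L]; case: J => [|J].
- by rewrite !mul0r !addr0 US0//=; field; rewrite b.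
- by rewrite IH !mul0r !addr0 add0n USS// natrD; rewrite -[J.+2%:R]natr1; field; rewrite b.
- by rewrite IH !mul0r add0r !addn0 USS// natrD; rewrite -[L.+2%:R]natr1; field; rewrite b.
rewrite !IH !addnS !addSn USS//= .
have -> : (L + J).+1.+1%:R = L%:R + J%:R + 2 :> R by rewrite -!natr1 natrD; ring.
have -> : ((L + J).+1 + 2)%:R = L%:R + J%:R + 3 :> R by rewrite natrD -!natr1 natrD; ring.
by rewrite -!natr1; field; rewrite b.
Qed.

Definition cov k n f g : R :=
  Ex k n (fun s => (psum f s - mean k n f) * (psum g s - mean k n g)).

Lemma covE k n f g : cov k n f g = Ex k n (fun s => psum f s * psum g s) - mean k n f * mean k n g.
Proof.
rewrite /cov (@Ex_eq _ _ _ _ (fun s => psum f s * psum g s + ((- mean k n g) * psum f s +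
   ((- mean k n f) * psum g s + mean k n f * mean k n g)))); last by move=> s _; ring.
by rewrite !ExD !ExZ Ex_cst -!/(mean _ _ _); ring.
Qed.

Lemma cov_ind k n L J : (0 < k)%N -> cov k n (ind L.+1) (ind J.+1) =
  k%:R * (k%:R - 1) * (k%:R - 1 / 2) * (k%:R - 3 / 2) * U 2 k n (L + J)
  - (k%:R * (k%:R - 1 / 2)) ^+ 2 * (U 1 k n L * U 1 k n J)
  + (L == J)%:R * mean k n (ind L.+1).
Proof.
move=> k0; rewrite covE.
have -> : Ex k n (fun s => psum (ind L.+1) s * psum (ind J.+1) s) =
   Ex k n (pairf (ind L.+1) (ind J.+1)) + (L == J)%:R * mean k n (ind L.+1).
  rewrite -ExZ -ExD; apply: Ex_eq => s _; rewrite /pairf -addrA -[LHS]addr0; congr (_ + _).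
  apply/esym/eqP; rewrite addrC subr_eq0 -psumZ; apply/eqP; congr psum; apply/funext => e.
  rewrite /ind; have [->|LJ] := eqVneq L J; first by rewrite mul1r; case: eqP; rewrite ?mulr1 ?mulr0.
  by rewrite mul0r; case: eqP => [->|]; rewrite ?mul0r// eqSS (negPf LJ) mulr0.
by rewrite Ex_pair_ind// !mean_ind; ring.
Qed.

End exact.

(** * First-order asymptotics of the path counts *)

Section filters.
Variables (R : realType) (T : Type) (F : set_system T).
Context {FF : Filter F}.

Lemma cvg_near_eq (a b : T -> R) (l : R) : (\forall x \near F, a x = b x) ->
  a x @[x --> F] --> l -> b x @[x --> F] --> l.
Proof. by move=> ab; apply: cvg_trans; exact: near_eq_cvg. Qed.

Lemma cvg_approx (a : T -> R) (S : R) : (forall e : R, 0 < e -> exists (b : T -> R) (B : R),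
   [/\ \forall x \near F, `|a x - b x| <= e, b x @[x --> F] --> B & `|B - S| <= e]) ->
  a x @[x --> F] --> S.
Proof.
move=> h; apply/cvgrPdist_le => e e0.
have e3 : 0 < e / 3 by rewrite divr_gt0.
have [b [B [ab bB BS]]] := h _ e3.
move/cvgrPdist_le : bB => /(_ _ e3) bB.
near=> x.
have h1 : `|a x - b x| <= e / 3 by near: x.
have h2 : `|B - b x| <= e / 3 by near: x.
have -> : S - a x = - (B - S) + ((B - b x) - (a x - b x)) by ring.
apply: le_trans (ler_normD _ _) _; rewrite normrN.
by have := ler_normB (B - b x) (a x - b x); lra.
Unshelve. all: by end_near. Qed.

(** A first-order expansion with a leading part that may depend on [x]: a covariance is a
    difference of two quantities of order [k^2] that agree to leading order, and the next
    order is what remains. *)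
Definition fo (eps a a0 : T -> R) (A a1 : R) :=
  (a0 x @[x --> F] --> A) /\ ((a x - a0 x) / eps x @[x --> F] --> a1).

Variable eps : T -> R.
Hypothesis eps_cvg : eps x @[x --> F] --> (0 : R).
Hypothesis eps_neq : \forall x \near F, eps x != 0.

Lemma fo_cvg a a0 A a1 : fo eps a a0 A a1 -> a x @[x --> F] --> A.
Proof.
case=> h0 h1.
have H : a0 x + eps x * ((a x - a0 x) / eps x) @[x --> F] --> A + 0 * a1.
  by apply: cvgD => //; exact: cvgM.
rewrite mul0r addr0 in H; apply: (cvg_near_eq _ H); near=> x => /=.
have e0 : eps x != 0 by near: x.
by field; rewrite e0.
Unshelve. all: by end_near. Qed.

Lemma fo_eq (a a' a0 : T -> R) (A a1 : R) : (\forall x \near F, a x = a' x) ->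
  fo eps a a0 A a1 -> fo eps a' a0 A a1.
Proof.
move=> e [h0 h1]; split=> //; apply: cvg_near_eq h1; near=> x.
by rewrite (_ : a x = a' x)//; near: x.
Unshelve. all: by end_near. Qed.

Lemma fo_cst (c : R) : fo eps (fun=> c) (fun=> c) c 0.
Proof.
split; first exact: cvg_cst.
by under eq_fun do rewrite subrr mul0r; exact: cvg_cst.
Qed.

Lemma fo_lin (a0 : T -> R) (A c : R) : a0 x @[x --> F] --> A ->
  fo eps (fun x => a0 x + c * eps x) a0 A c.
Proof.
move=> h; split=> //; apply: (@cvg_near_eq (fun=> c)); last exact: cvg_cst.
near=> x; have e0 : eps x != 0 by near: x.
by field; rewrite e0.
Unshelve. all: by end_near. Qed.

Lemma foM a a0 A a1 b b0 B b1 : fo eps a a0 A a1 -> fo eps b b0 B b1 ->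
  fo eps (fun x => a x * b x) (fun x => a0 x * b0 x) (A * B) (a1 * B + A * b1).
Proof.
move=> ha hb; split; first exact: cvgM ha.1 hb.1.
have H : ((a x - a0 x) / eps x) * b x + a0 x * ((b x - b0 x) / eps x) @[x --> F]
    --> a1 * B + A * b1.
  by apply: cvgD; apply: cvgM; [exact: ha.2 | exact: fo_cvg hb | exact: ha.1 | exact: hb.2].
apply: (cvg_near_eq _ H); near=> x; ring.
Unshelve. all: by end_near.
Qed.

Lemma foV a a0 A a1 : A != 0 -> fo eps a a0 A a1 ->
  fo eps (fun x => (a x)^-1) (fun x => (a0 x)^-1) A^-1 (- a1 / A ^+ 2).
Proof.
move=> An ha; split; first by apply: cvgV => //; exact: ha.1.
have c1 := fo_cvg ha; have c0 := ha.1.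
have H : - ((a x - a0 x) / eps x) * (a x * a0 x)^-1 @[x --> F] --> - a1 / A ^+ 2.
  apply: cvgM; first by apply: cvgN; exact: ha.2.
  by apply: cvgV; [rewrite expf_neq0 | rewrite expr2; exact: cvgM].
apply: cvg_near_eq H.
have n1 : \forall x \near F, a x != 0 by exact: (cvgr_neq0 _ c1).
have n0 : \forall x \near F, a0 x != 0 by exact: (cvgr_neq0 _ c0).
near=> x.
have e1 : a x != 0 by near: x.
have e0 : a0 x != 0 by near: x.
have e : eps x != 0 by near: x.
by field; rewrite e e0 e1.
Unshelve. all: by end_near. Qed.

End filters.

Section limits.
Variables (R : realType) (T : Type) (F : set_system T).
Context {FF : Filter F}.
Variables (k_ n_ : T -> nat) (alpha : R).
Hypothesis a0 : 0 < alpha.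
Hypothesis k_cvg : (k_ x)%:R^-1 @[x --> F] --> (0 : R).
Hypothesis k_gt0 : \forall x \near F, (0 < k_ x)%N.
Hypothesis n_cvg : (n_ x)%:R / (k_ x)%:R @[x --> F] --> alpha.

Let eps x : R := (k_ x)%:R^-1.
Let nu x : R := (n_ x)%:R / (k_ x)%:R.
Let eps_neq : \forall x \near F, eps x != 0.
Proof.
near=> x; rewrite invr_neq0// pnatr_eq0 -lt0n; near: x; exact: k_gt0.
Unshelve. all: by end_near. Qed.
Let an0 : alpha != 0. Proof. by rewrite gt_eqF. Qed.
Let an1 : 1 + alpha != 0. Proof. by rewrite gt_eqF// ltr_wpDr// ltW. Qed.

Local Notation foM' := (@foM R T F FF eps k_cvg eps_neq _ _ _ _ _ _ _ _).
Local Notation foV' := (@foV R T F FF eps k_cvg eps_neq _ _ _ _).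
Local Notation fo_cvg' := (@fo_cvg R T F FF eps k_cvg eps_neq _ _ _ _).
Local Notation fo_lin' := (@fo_lin R T F FF eps eps_neq _ _).

Lemma fo_ffact s : fo F eps (fun x => (n_ x ^_ s)%:R / (k_ x)%:R ^+ s)
  (fun x => nu x ^+ s) (alpha ^+ s) (- (s%:R * (s%:R - 1) / 2) * alpha ^+ s / alpha).
Proof.
elim: s => [|s IH].
  have := @fo_cst R T F FF eps 1.
  rewrite mul0r mul0r oppr0 !mul0r expr0; apply: fo_eq; near=> x.
  by rewrite ffactn0 expr0 divr1.
have h := foM' IH (fo_lin' (- s%:R) n_cvg).
have -> : - (s.+1%:R * (s.+1%:R - 1) / 2) * alpha ^+ s.+1 / alpha =
  (- (s%:R * (s%:R - 1) / 2) * alpha ^+ s / alpha) * alpha + alpha ^+ s * - s%:R.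
  by rewrite exprS -natr1; field; rewrite an0.
have -> : (fun x => nu x ^+ s.+1) = (fun x => nu x ^+ s * ((n_ x)%:R / (k_ x)%:R)).
  by apply/funext => x; rewrite exprSr.
rewrite [alpha ^+ _.+1]exprSr; apply: fo_eq h; near=> x.
have k0 : (k_ x)%:R != 0 :> R by rewrite pnatr_eq0 -lt0n; near: x; exact: k_gt0.
rewrite !ffactR ffRS /eps [_%:R ^+ s.+1]exprS; field.
by rewrite k0 expf_neq0.
Unshelve. all: by end_near. Qed.

Lemma fo_ffM m : fo F eps (fun x => ffR (Mkn R (k_ x) (n_ x)) m / (k_ x)%:R ^+ m)
  (fun x => (1 + nu x) ^+ m) ((1 + alpha) ^+ m) (- (m%:R ^+ 2 / 2) * (1 + alpha) ^+ m / (1 + alpha)).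
Proof.
elim: m => [|m IH].
  have := @fo_cst R T F FF eps 1.
  rewrite expr0n mul0r oppr0 !mul0r expr0; apply: fo_eq; near=> x.
  by rewrite /ffR big_ord0 expr0 divr1.
have n1 : 1 + nu x @[x --> F] --> 1 + alpha by apply: cvgD => //; exact: cvg_cst.
have h := foM' IH (fo_lin' (- (m%:R + 1 / 2)) n1).
have -> : - (m.+1%:R ^+ 2 / 2) * (1 + alpha) ^+ m.+1 / (1 + alpha) =
  (- (m%:R ^+ 2 / 2) * (1 + alpha) ^+ m / (1 + alpha)) * (1 + alpha) + (1 + alpha) ^+ m * - (m%:R + 1 / 2).
  by rewrite [(1 + alpha) ^+ m.+1]exprS -[m.+1%:R]natr1; field; rewrite an1.
have -> : (fun x => (1 + nu x) ^+ m.+1) = (fun x => (1 + nu x) ^+ m * (1 + nu x)).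
  by apply/funext => x; rewrite exprSr.
rewrite [(1 + alpha) ^+ _.+1]exprSr; apply: fo_eq h; near=> x.
have k0 : (k_ x)%:R != 0 :> R by rewrite pnatr_eq0 -lt0n; near: x; exact: k_gt0.
rewrite ffRS /eps /nu /Mkn [_%:R ^+ m.+1]exprS; field.
by rewrite k0 expf_neq0.
Unshelve. all: by end_near. Qed.

(** Probability of [L] under the geometric law of mean [alpha], the limit law of the number of
    vertices of degree 2 on a path. *)
Definition pil (alpha : R) L : R := alpha ^+ L / (1 + alpha) ^+ L.+1.

Lemma fo_U r s : fo F eps
  (fun x => (k_ x)%:R ^+ r * U R r (k_ x) (n_ x) s)
  (fun x => nu x ^+ s / (1 + nu x) ^+ (s + r))
  (alpha ^+ s / (1 + alpha) ^+ (s + r))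
  (alpha ^+ s / (1 + alpha) ^+ (s + r) * (- (s%:R * (s%:R - 1) / 2) / alpha
     + (s + r)%:R ^+ 2 / 2 / (1 + alpha))).
Proof.
have p1 : (1 + alpha) ^+ (s + r) != 0 by rewrite expf_neq0.
have h := foM' (fo_ffact s) (foV' p1 (fo_ffM (s + r))).
have -> : alpha ^+ s / (1 + alpha) ^+ (s + r) * (- (s%:R * (s%:R - 1) / 2) / alpha
     + (s + r)%:R ^+ 2 / 2 / (1 + alpha)) =
  (- (s%:R * (s%:R - 1) / 2) * alpha ^+ s / alpha) * ((1 + alpha) ^+ (s + r))^-1 +
  alpha ^+ s * (- (- ((s + r)%:R ^+ 2 / 2) * (1 + alpha) ^+ (s + r) / (1 + alpha)) / ((1 + alpha) ^+ (s + r)) ^+ 2).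
  by move: p1; move: ((1 + alpha) ^+ (s + r)) => y p1; field; rewrite p1 an0 an1.
apply: fo_eq h; near=> x.
have k0 : (k_ x)%:R != 0 :> R by rewrite pnatr_eq0 -lt0n; near: x; exact: k_gt0.
rewrite /U exprD; field.
by rewrite !expf_neq0//= ffR_neq0.
Unshelve. all: by end_near. Qed.

Lemma mean_ind_cvg L :
  mean (k_ x) (n_ x) (ind R L.+1) / (k_ x)%:R @[x --> F] --> pil alpha L.
Proof.
have h := fo_cvg' (foM' (fo_lin' (- (1 / 2)) (@cvg_cst _ (1 : R) _ F FF)) (fo_U 1 L)).
rewrite [X in _ --> X](_ : _ = pil alpha L) in h; last by rewrite [LHS]mul1r addn1.
 apply: cvg_near_eq h; near=> x.
have k0 : (k_ x)%:R != 0 :> R by rewrite pnatr_eq0 -lt0n; near: x; exact: k_gt0.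
by rewrite mean_ind /eps; field; rewrite k0.
Unshelve. all: by end_near. Qed.

(** In terms of the geometric law, the kernel is the covariance of a multinomial sample with
    the fluctuation of the total length removed. *)
Lemma HkerE L J : Hker L.+2 J.+2 alpha =
  - (pil alpha L * pil alpha J) * (1 + (L%:R - alpha) * (J%:R - alpha) / (alpha * (1 + alpha)))
  + (L == J)%:R * pil alpha L.
Proof.
rewrite /Hker /pil !eqSS.
have -> : (L.+2 - 2 = L)%N by lia.
have -> : (L.+2 + J.+2 - 4 = L + J)%N by lia.
have -> : (L.+2 + J.+2 - 2 = L.+1 + J.+1)%N by lia.
rewrite !exprD expr_div_n [in RHS]exprS.
have -> : L.+2%:R - 2 = L%:R :> R by rewrite -!natr1; ring.
have -> : J.+2%:R - 2 = J%:R :> R by rewrite -!natr1; ring.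
have := expf_neq0 L an1; have := expf_neq0 J an1; rewrite !exprS.
move: ((1 + alpha) ^+ L) ((1 + alpha) ^+ J) => y z h1 h2.
by field; rewrite h1 h2 an0 an1.
Qed.

(** The leading orders of the pair count and of the product of the means coincide, and the
    kernel collects the corrections of order [k]. *)
Lemma cov_ind_cvg L J :
  cov (k_ x) (n_ x) (ind R L.+1) (ind R J.+1) / (k_ x)%:R @[x --> F] --> Hker L.+2 J.+2 alpha.
Proof.
pose lin c := fo_lin' c (@cvg_cst _ (1 : R) _ F FF).
have h2 := foM' (foM' (lin (- 1)) (foM' (lin (- (1 / 2))) (lin (- (3 / 2))))) (fo_U 2 (L + J)).
have h1 := foM' (foM' (lin (- (1 / 2))) (lin (- (1 / 2)))) (foM' (fo_U 1 L) (fo_U 1 J)).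
have H := @cvgD _ _ _ F FF _ _ _ _ (@cvgB _ _ _ F FF _ _ _ _ h2.2 h1.2)
  (@cvgM _ _ F FF _ _ _ _ (@cvg_cst _ ((L == J)%:R : R) _ F FF) (@mean_ind_cvg L)).
move: H; set lim := (X in _ --> X); have -> : lim = Hker L.+2 J.+2 alpha.
  rewrite /lim HkerE /pil; congr (_ + _).
  rewrite !natrD !exprD !exprS ?expr1 ?expr0.
  have := expf_neq0 L an1; have := expf_neq0 J an1.
  move: ((1 + alpha) ^+ L) ((1 + alpha) ^+ J) => y z p1 p2.
  by field; rewrite p1 p2 an0 an1.
apply: cvg_near_eq; near=> x.
have k0 : (k_ x)%:R != 0 :> R by rewrite pnatr_eq0 -lt0n; near: x; exact: k_gt0.
have nu1 : 1 + nu x != 0 by rewrite gt_eqF// ltr_pwDl// divr_ge0.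
rewrite /= cov_ind; last by near: x; exact: k_gt0.
rewrite !fctE /=.
have -> : nu x ^+ (L + J) / (1 + nu x) ^+ (L + J + 2) =
   nu x ^+ L / (1 + nu x) ^+ (L + 1) * (nu x ^+ J / (1 + nu x) ^+ (J + 1)).
  have -> : (L + J + 2 = (L + 1) + (J + 1))%N by lia.
  rewrite !exprD; have := expf_neq0 L nu1; have := expf_neq0 J nu1.
  move: ((1 + nu x) ^+ L) ((1 + nu x) ^+ J) => y z p1 p2.
  by field; rewrite p1 p2 nu1.
by move: (_ / _ * (_ / _)) => w; rewrite /eps; field; rewrite k0.
Unshelve. all: by end_near. Qed.

End limits.

(** * Limits of means and variances of path functionals *)

Section bilinear.
Variable R : realType.
Implicit Types (f g : nat -> R) (k n L J : nat).

Lemma Hker0 L J : Hker L.+2 J.+2 (0 : R) = 0.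
Proof.
rewrite /Hker !mul0r invr0 !mulr0 !addr0 !eqSS !expr1n mulr1.
have -> : (L.+2 + J.+2 - 4 = L + J)%N by lia.
have -> : (L.+2 - 2 = L)%N by lia.
rewrite !divr1; case: L => [|L]; case: J => [|J] /=; rewrite ?addn0 ?addSn ?add0n ?expr0n ?mul0r ?mulr0 /=; ring.
Qed.

Lemma meanD k n f g : mean k n (fun e => f e + g e) = mean k n f + mean k n g.
Proof. by rewrite /mean -ExD; apply: Ex_eq => s _; rewrite psumD. Qed.

Lemma meanZ k n a f : mean k n (fun e => a * f e) = a * mean k n f.
Proof. by rewrite /mean -ExZ; apply: Ex_eq => s _; rewrite psumZ. Qed.

Definition trunc M f e : R := \sum_(L < M) f L.+1 * ind R L.+1 e.

Lemma truncE M f e : (0 < e)%N -> trunc M f e = if (e <= M)%N then f e else 0.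
Proof.
case: e => // e _; rewrite /trunc /ind; case: ltnP => eM.
  rewrite (bigD1 (Ordinal eM))//= eqxx mulr1 big1 ?addr0// => i.
  by rewrite -val_eqE /= eq_sym eqSS => /negPf ->; rewrite mulr0.
rewrite big1// => i _; rewrite eqSS; case: eqP => ei; rewrite ?mulr0//.
by move: eM; rewrite ei leqNgt ltn_ord.
Qed.

Lemma psum_trunc M f s : psum (trunc M f) s = \sum_(L < M) f L.+1 * psum (ind R L.+1) s.
Proof.
rewrite /psum exchange_big /=; first by apply: eq_bigr => c _; rewrite mulr_sumr.
Qed.

Lemma mean_trunc k n M f : mean k n (trunc M f) = \sum_(L < M) f L.+1 * mean k n (ind R L.+1).
Proof.
rewrite /mean; under eq_bigr do rewrite -ExZ; rewrite -Ex_sum.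
by apply: Ex_eq => s _; rewrite psum_trunc.
Qed.

Lemma var_trunc k n M f : var k n (trunc M f) =
  \sum_(L < M) \sum_(J < M) f L.+1 * f J.+1 * cov k n (ind R L.+1) (ind R J.+1).
Proof.
rewrite /var mean_trunc /cov.
under [RHS]eq_bigr => L _ do (under eq_bigr => J _ do rewrite -ExZ; rewrite -Ex_sum).
rewrite -Ex_sum; apply: Ex_eq => s _; rewrite psum_trunc -sumrB expr2 big_distrlr /=.
by apply: eq_bigr => L _; apply: eq_bigr => J _; ring.
Qed.

(** The variance is a quadratic form, so it moves little when [f] is replaced by a function
    close to it in variance; used to truncate and to linearize. *)
Lemma var_diff k n f g eta : 0 < eta ->
  `|var k n f - var k n g| <= eta * var k n g + (1 + eta^-1) * var k n (fun e => f e - g e).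
Proof.
move=> eta0; set h := fun e => f e - g e.
have mh : mean k n h = mean k n f - mean k n g.
  rewrite (_ : h = fun e => f e + (-1) * g e) ?meanD ?meanZ; first by ring.
  by apply/funext => e; rewrite /h; ring.
rewrite /var -ExB -!ExZ -ExD; apply: le_trans (Ex_norm _ _ _) _; apply: Ex_le => s _.
have -> : psum f s - mean k n f = (psum g s - mean k n g) + (psum h s - mean k n h).
  rewrite mh (_ : psum h s = psum f s - psum g s); first by ring.
  rewrite (_ : h = fun e => f e + (-1) * g e) ?psumD ?psumZ; first by ring.
  by apply/funext => e; rewrite /h; ring.
move: (psum g s - _) (psum h s - _) => u v.
have -> : (u + v) ^+ 2 - u ^+ 2 = v ^+ 2 + 2 * u * v by ring.
have p1 : eta * u ^+ 2 + (1 + eta^-1) * v ^+ 2 - (v ^+ 2 + 2 * u * v) = eta^-1 * (eta * u - v) ^+ 2.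
  by field; rewrite gt_eqF.
have p2 : eta * u ^+ 2 + (1 + eta^-1) * v ^+ 2 + (v ^+ 2 + 2 * u * v) = 2 * v ^+ 2 + eta^-1 * (eta * u + v) ^+ 2.
  by field; rewrite gt_eqF.
have e0 : 0 <= eta^-1 by rewrite invr_ge0 ltW.
have := mulr_ge0 e0 (sqr_ge0 (eta * u - v)); have := mulr_ge0 e0 (sqr_ge0 (eta * u + v)).
rewrite ler_norml; have := sqr_ge0 v; lra.
Qed.

End bilinear.

Lemma cvg_sumr (R : realType) (T I : Type) (F : set_system T) {FF : Filter F}
    (s : seq I) (G : I -> T -> R) (l : I -> R) :
  (forall i, G i x @[x --> F] --> l i) ->
  \sum_(i <- s) G i x @[x --> F] --> \sum_(i <- s) l i.
Proof.
move=> h; elim: s => [|i s IH].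
  by under eq_fun do rewrite big_nil; rewrite big_nil; exact: cvg_cst.
by under eq_fun do rewrite big_cons; rewrite big_cons; exact: cvgD.
Qed.

Section limits.
Variables (R : realType) (T : Type) (F : set_system T).
Context {FF : Filter F}.
Variables (k_ n_ : T -> nat) (alpha : R).
Hypothesis alpha_ok : 0 < alpha \/ (alpha = 0 /\ forall x, n_ x = 0%N).
Hypothesis k_cvg : (k_ x)%:R^-1 @[x --> F] --> (0 : R).
Hypothesis k_gt0 : \forall x \near F, (0 < k_ x)%N.
Hypothesis n_cvg : (n_ x)%:R / (k_ x)%:R @[x --> F] --> alpha.

Let r : R := alpha + 1.
Let r0 : 0 < r. Proof. by rewrite /r; case: alpha_ok => [|[-> _]]; lra. Qed.

Lemma n_bound : \forall x \near F, (n_ x)%:R <= r * (k_ x)%:R.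
Proof.
move/cvgrPdist_le : n_cvg => /(_ _ ltr01) h; near=> x.
have k0 : 0 < (k_ x)%:R :> R by rewrite ltr0n; near: x.
rewrite -ler_pdivrMr//; have : `|alpha - (n_ x)%:R / (k_ x)%:R| <= 1 by near: x.
by rewrite ler_distl /r => /andP[]; lra.
Unshelve. all: by end_near. Qed.

Lemma mean0 k (f : nat -> R) : mean k 0 f = k%:R * f 1%N.
Proof. by rewrite /mean /= /psum big_nseq_cond /= iter_addr_0 mulr_natl. Qed.

Lemma cov0 k (f g : nat -> R) : cov k 0 f g = 0.
Proof. by rewrite /cov /mean /= subrr mul0r. Qed.

Lemma mean_ind_cvg' L :
  mean (k_ x) (n_ x) (ind R L.+1) / (k_ x)%:R @[x --> F] --> pil alpha L.
Proof.
case: alpha_ok => [a0|[a0 n0]]; first exact: mean_ind_cvg.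
apply: (@cvg_near_eq _ _ _ _ (fun=> pil alpha L)); last exact: cvg_cst.
near=> x; rewrite n0 mean0 a0 /pil addr0 expr1n divr1 /ind.
have k0 : (k_ x)%:R != 0 :> R by rewrite pnatr_eq0 -lt0n; near: x; exact: k_gt0.
by rewrite mulrAC divff// mul1r; case: L => [|L]; rewrite ?expr0// expr0n.
Unshelve. all: by end_near. Qed.

Lemma cov_ind_cvg' L J :
  cov (k_ x) (n_ x) (ind R L.+1) (ind R J.+1) / (k_ x)%:R @[x --> F] --> Hker L.+2 J.+2 alpha.
Proof.
case: alpha_ok => [a0|[a0 n0]]; first exact: cov_ind_cvg.
rewrite a0 Hker0; apply: (@cvg_near_eq _ _ _ _ (fun=> 0)); last exact: cvg_cst.
by near=> x; rewrite n0 cov0 mul0r.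
Unshelve. all: by end_near. Qed.

Variables (f : nat -> R) (C : R) (a : nat).
Hypothesis C0 : 0 <= C.
Hypothesis fC : forall e, (0 < e)%N -> `|f e| <= C * e%:R ^+ a.

Lemma trunc_tail M e : (0 < M)%N -> (0 < e)%N ->
  `|f e - trunc M f e| <= C / M%:R * e%:R ^+ a.+1.
Proof.
move=> M0 e0; rewrite truncE//; have MR : 0 < M%:R :> R by rewrite ltr0n.
case: leqP => eM.
  by rewrite subrr normr0 mulr_ge0 ?exprn_ge0// divr_ge0.
rewrite subr0; apply: le_trans (fC e0) _.
rewrite (_ : C / M%:R * e%:R ^+ a.+1 = C * e%:R ^+ a * (e%:R / M%:R)); last by rewrite exprS; ring.
rewrite ler_peMr ?mulr_ge0 ?exprn_ge0// ler_pdivlMr// mul1r ler_nat; exact: ltnW.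
Qed.

Lemma trunc_bound M e : (0 < e)%N -> `|trunc M f e| <= C * e%:R ^+ a.
Proof.
move=> e0; rewrite truncE//; case: leqP => _; first exact: fC.
by rewrite normr0 mulr_ge0 ?exprn_ge0.
Qed.

Lemma exists_inv (K e : R) : 0 < e -> 0 <= K -> exists M0, forall M, (M0 <= M)%N ->
  (0 < M)%N /\ K / M%:R <= e.
Proof.
move=> e0 K0; have p : 0 < e / (K + 1) by rewrite divr_gt0// ltr_wpDl.
have [m hm] := ltr_add_invr p.
exists m.+1 => M mM; have M0 : (0 < M)%N by apply: leq_trans mM.
have MR : 0 < M%:R :> R by rewrite ltr0n.
split=> //; rewrite ler_pdivrMr//; move: hm; rewrite add0r => hm.
have K1 : 0 < K + 1 by rewrite ltr_wpDl.
have : M%:R^-1 <= e / (K + 1).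
  apply: le_trans (ltW hm); rewrite lef_pV2 ?posrE ?ltr0n// ler_nat//.
rewrite ler_pdivlMr// mulrC ler_pdivrMr//; lra.
Qed.

(** The limit is known for finitely many lengths; the remaining ones contribute little,
    because a bound on one higher moment gives a tail of order [1 / M]. *)
Lemma mean_cvg (S : R) :
  (fun M => \sum_(L < M) f L.+1 * pil alpha L) @ \oo --> S ->
  mean (k_ x) (n_ x) f / (k_ x)%:R @[x --> F] --> S.
Proof.
move=> hS; apply: cvg_approx => e e0.
have K0 : 0 <= C * expR (3 ^+ a.+1 * r) by rewrite mulr_ge0 ?expR_ge0.
have [M0 hM0] := exists_inv e0 K0.
move/cvgrPdist_le : hS => /(_ _ e0) [M1 _ hM1].
pose M := maxn M0 M1; have [MP MK] := hM0 M (leq_maxl _ _).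
exists (fun x => \sum_(L < M) f L.+1 * (mean (k_ x) (n_ x) (ind R L.+1) / (k_ x)%:R)).
exists (\sum_(L < M) f L.+1 * pil alpha L); split.
- near=> x.
  have k0 : (0 < k_ x)%N by near: x.
  have kR : 0 < (k_ x)%:R :> R by rewrite ltr0n.
  have nr : (n_ x)%:R <= r * (k_ x)%:R by near: x; exact: n_bound.
  under eq_bigr do rewrite mulrA; rewrite -mulr_suml -mean_trunc -mulrBl.
  rewrite normrM (ger0_norm (_ : 0 <= (k_ x)%:R^-1)) ?invr_ge0//.
  rewrite ler_pdivrMr//.
  have -> : mean (k_ x) (n_ x) f - mean (k_ x) (n_ x) (trunc M f) =
    Ex (k_ x) (n_ x) (fun s => psum f s - psum (trunc M f) s) by rewrite ExB.
  apply: le_trans (Ex_norm _ _ _) _.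
  apply: (@le_trans _ _ (Ex (k_ x) (n_ x) (psum (fun e => C / M%:R * e%:R ^+ a.+1)))).
    apply: Ex_le => s rs.
    have -> : psum f s - psum (trunc M f) s = psum (fun e => f e - trunc M f e) s.
      by rewrite /psum sumrB.
    apply: le_trans (ler_norm_sum _ _ _) _.
    rewrite -/(psum (fun e => `|f e - trunc M f e|) s).
    by apply: (psum_le rs) => i i0 _; exact: trunc_tail.
  rewrite (_ : psum _ = fun s => C / M%:R * psum (fun e => e%:R ^+ a.+1) s); last first.
    by apply/funext => s; rewrite psumZ.
  rewrite ExZ; apply: le_trans (ler_wpM2l _ (Ex_pow R _ _ k0)) _; first by rewrite divr_ge0.
  apply: (@le_trans _ _ (C * expR (3 ^+ a.+1 * r) / M%:R * (k_ x)%:R)).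
    rewrite mulrCA -[X in _ <= X]mulrC ler_wpM2l// mulrAC ler_wpM2r ?invr_ge0//.
    rewrite ler_wpM2l// ler_expR -mulrA ler_wpM2l ?exprn_ge0//.
    by rewrite ler_pdivrMr.
  by rewrite ler_wpM2r.
- by apply: cvg_sumr => L; apply: cvgM; [exact: cvg_cst | exact: mean_ind_cvg'].
- by rewrite distrC; apply: hM1; rewrite /= leq_maxr.
Unshelve. all: by end_near. Qed.

(** Same truncation as for the mean, the tail being absorbed by [var_diff]. *)
Lemma var_cvg (S : R) :
  (fun M => \sum_(L < M) \sum_(J < M) f L.+1 * f J.+1 * Hker L.+2 J.+2 alpha) @ \oo --> S ->
  var (k_ x) (n_ x) f / (k_ x)%:R @[x --> F] --> S.
Proof.
move=> hS; apply: cvg_approx => e e0.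
pose K := r * C ^+ 2 * varK a r + 2 * (r * C ^+ 2 * varK a.+1 r).
have V1 := varK_ge0 a r; have V2 := varK_ge0 a.+1 r; have r0' := ltW r0.
have C2 : 0 <= C ^+ 2 by exact: sqr_ge0.
have K0 : 0 <= K by rewrite addr_ge0 ?mulr_ge0.
have [M0 hM0] := exists_inv e0 K0.
move/cvgrPdist_le : hS => /(_ _ e0) [M1 _ hM1].
pose M := maxn M0 M1; have [MP MK] := hM0 M (leq_maxl _ _).
have MR : 0 < M%:R :> R by rewrite ltr0n.
exists (fun x => \sum_(L < M) \sum_(J < M) f L.+1 * f J.+1 *
   (cov (k_ x) (n_ x) (ind R L.+1) (ind R J.+1) / (k_ x)%:R)).
exists (\sum_(L < M) \sum_(J < M) f L.+1 * f J.+1 * Hker L.+2 J.+2 alpha); split.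
- near=> x.
  have k0 : (0 < k_ x)%N by near: x.
  have kR : 0 < (k_ x)%:R :> R by rewrite ltr0n.
  have nr : (n_ x)%:R <= r * (k_ x)%:R by near: x; exact: n_bound.
  under eq_bigr do (under eq_bigr do rewrite mulrA; rewrite -mulr_suml).
  rewrite -mulr_suml -var_trunc -mulrBl.
  rewrite normrM (ger0_norm (_ : 0 <= (k_ x)%:R^-1)) ?invr_ge0//.
  rewrite ler_pdivrMr//.
  have M0' : 0 < M%:R^-1 :> R by rewrite invr_gt0.
  apply: le_trans (var_diff _ _ _ _ M0') _; rewrite invrK.
  have v1 : var (k_ x) (n_ x) (trunc M f) <= (n_ x)%:R * C ^+ 2 * varK a r.
    by apply: var_le => // i i0 _; exact: trunc_bound.
  have v2 : var (k_ x) (n_ x) (fun i => f i - trunc M f i) <= (n_ x)%:R * (C / M%:R) ^+ 2 * varK a.+1 r.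
    apply: var_le => //; first by rewrite divr_ge0.
    by move=> i i0 _; exact: trunc_tail.
  apply: (@le_trans _ _ (K / M%:R * (k_ x)%:R)); last by rewrite ler_wpM2r.
  apply: (@le_trans _ _ (M%:R^-1 * (r * (k_ x)%:R * C ^+ 2 * varK a r) +
     (2 * M%:R) * (r * (k_ x)%:R * (C / M%:R) ^+ 2 * varK a.+1 r))).
    apply: lerD.
      rewrite ler_wpM2l ?(ltW M0')//; apply: le_trans v1 _.
      by rewrite ler_wpM2r// ler_wpM2r.
    apply: ler_pM; rewrite ?var_ge0//.
      have : 1 <= M%:R :> R by rewrite ler1n.
      by lra.
    apply: le_trans v2 _.
    by rewrite ler_wpM2r// ler_wpM2r ?sqr_ge0.
  rewrite le_eqVlt; apply/orP; left; apply/eqP; rewrite /K; field.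
  by rewrite gt_eqF.
- apply: cvg_sumr => L; apply: cvg_sumr => J.
  by apply: cvgM; [exact: cvg_cst | exact: cov_ind_cvg'].
- by rewrite distrC; apply: hM1; rewrite /= leq_maxr.
Unshelve. all: by end_near. Qed.

End limits.

(** * Cycles are negligible *)

Section cycles.
Variable R : realType.
Implicit Types (k n : nat) (s : shape).

Definition ncyc s : R := \sum_(c <- s | ~~ c.1) 1.

Lemma ncyc_cons c s : ncyc (c :: s) = (~~ c.1)%:R + ncyc s.
Proof. by rewrite /ncyc big_cons; case: c.1; rewrite ?add0r. Qed.

Lemma ncyc_ge0 s : 0 <= ncyc s. Proof. exact: sumr_ge0. Qed.

Lemma grow_sum_ncyc (G : R -> R) s :
  grow_sum (fun u => G (ncyc u)) s = (edges s)%:R * G (ncyc s).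
Proof.
rewrite /edges; elim: s G => [|c s IH] G /=; first by rewrite big_nil mul0r.
rewrite big_cons natrD mulrDl !ncyc_cons /=; congr (_ + _).
transitivity (grow_sum (fun u => G ((~~ c.1)%:R + ncyc u)) s).
  by congr (grow_sum _ _); apply/funext => u; rewrite ncyc_cons.
by rewrite (IH (fun x => G (_ + x))).
Qed.

Lemma step_ncyc k n (G : R -> R) s : reach k n s ->
  step (mass R k n) (fun u => G (ncyc u)) s =
  G (ncyc s) + (G (1 + ncyc s) - G (ncyc s)) / mass R k n.
Proof.
move=> rs; rewrite /step grow_sum_ncyc ncyc_cons /=.
have m0 := lt0r_neq0 (mass_gt0 R k n).
case/and3P: rs => _ /eqP -> _; rewrite natrD.
apply: (mulIf m0); rewrite divfK// [RHS]mulrDl divfK// /mass; ring.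
Qed.

(** The sum of the probabilities that an insertion creates a new cycle. *)
Definition harm k n : R := \sum_(i < n) (mass R k i)^-1.

Lemma Ex_ncyc k n : Ex k n ncyc = harm k n.
Proof.
rewrite /harm; elim: n => [|n IH].
  by rewrite big_ord0 /= /ncyc big_nseq_cond.
rewrite big_ord_recr /= -IH.
rewrite -[X in _ = _ + X](Ex_cst k n) -ExD; apply: Ex_eq => s rs.
by rewrite (step_ncyc id rs) addrK mul1r.
Qed.

(** The number of cycles is a sum of independent indicators. *)
Lemma Ex_exp_ncyc k n (a : R) : 0 <= a ->
  Ex k n (fun s => expR (a * ncyc s)) <= expR ((expR a - 1) * harm k n).
Proof.
move=> a0; rewrite /harm; elim: n => [|n IH].
  by rewrite big_ord0 mulr0 expR0 /= /ncyc big_nseq_cond /= mulr0 expR0.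
have m0 := mass_gt0 R k n.
rewrite big_ord_recr /= mulrDr expRD.
apply: (@le_trans _ _ (Ex k n (fun s => expR ((expR a - 1) / mass R k n) * expR (a * ncyc s)))).
  apply: Ex_le => s rs; rewrite (step_ncyc (fun x => expR (a * x)) rs).
  rewrite mulrDr mulr1 expRD.
  have -> : expR (a * ncyc s) + (expR a * expR (a * ncyc s) - expR (a * ncyc s)) / mass R k n =
    (1 + (expR a - 1) / mass R k n) * expR (a * ncyc s) by ring.
  by rewrite ler_wpM2r ?expR_ge0// expR_ge1Dx.
by rewrite ExZ mulrC ler_wpM2r ?expR_ge0.
Qed.

Lemma harm_ge0 k n : 0 <= harm k n.
Proof. by apply: sumr_ge0 => i _; rewrite invr_ge0 ltW// mass_gt0. Qed.

(** The sum is logarithmic; the fourth root is a convenient upper bound, obtained by comparing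
    [1 / (i + 1)] with the increment of [4 i^(1/4)]. *)
Lemma harm_le k n : harm k n <= 4 * Num.sqrt (Num.sqrt n%:R).
Proof.
rewrite /harm; elim: n => [|n IH]; first by rewrite big_ord0 !sqrtr0 mulr0.
rewrite big_ord_recr /=; apply: le_trans (lerD IH (lexx _)) _.
set x := Num.sqrt (Num.sqrt n%:R); set y := Num.sqrt (Num.sqrt n.+1%:R).
have x0 : 0 <= x by exact: sqrtr_ge0.
have y1 : 1 <= y.
  rewrite -sqrtr1 ler_sqrt ?sqrtr_gt0 ?ltr0n//.
  by rewrite -[leLHS]sqrtr1 ler_sqrt ?ltr0n// ler1n.
have xy : x <= y.
  by rewrite ler_sqrt ?sqrtr_gt0 ?ltr0n// ler_sqrt ?ltr0n// ler_nat.
have x4 : x ^+ 4 = n%:R by rewrite (exprM x 2 2) !sqr_sqrtr ?sqrtr_ge0.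
have y4 : y ^+ 4 = n.+1%:R by rewrite (exprM y 2 2) !sqr_sqrtr ?sqrtr_ge0.
have mn : n.+1%:R <= mass R k n.
  by rewrite /mass -natr1; have := ler0n R n; have := ler0n R k; lra.
have inv : (mass R k n)^-1 <= (y ^+ 4)^-1.
  by rewrite y4 lef_pV2 ?posrE ?mass_gt0 ?ltr0n.
apply: le_trans (lerD (lexx _) inv) _.
have y40 : 0 < y ^+ 4 by rewrite y4 ltr0n.
rewrite -lerBrDl -mulrBr -[leLHS]mul1r ler_pdivrMr//.
have E1 : y ^+ 4 - x ^+ 4 = 1 by rewrite x4 y4 -natr1 addrAC subrr add0r.
rewrite -[leLHS]E1.
rewrite (_ : y ^+ 4 - x ^+ 4 = (y - x) * ((y + x) * (y ^+ 2 + x ^+ 2))); last by ring.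
rewrite (_ : 4 * (y - x) * y ^+ 4 = (y - x) * (4 * y ^+ 4)); last by ring.
rewrite ler_wpM2l ?subr_ge0//.
have y3 : y ^+ 3 <= y ^+ 4 by rewrite [leRHS]exprS ler_peMl// exprn_ge0// (le_trans ler01).
apply: (@le_trans _ _ (4 * y ^+ 3)); last by rewrite ler_wpM2l.
rewrite (_ : 4 * y ^+ 3 = (2 * y) * (2 * y ^+ 2)); last by ring.
have y0 : 0 <= y by exact: le_trans ler01 y1.
apply: ler_pM; rewrite ?addr_ge0 ?sqr_ge0//; first by lra.
by have : x ^+ 2 <= y ^+ 2 by [rewrite lerXn2r]; lra.
Qed.

Definition csum (w : nat -> R) s : R := \sum_(c <- s | ~~ c.1) w c.2.

Lemma csum_le (w : nat -> R) B k n s : reach k n s -> (forall e, (0 < e)%N -> `|w e| <= B) ->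
  `|csum w s| <= B * ncyc s.
Proof.
case/and3P=> /allP pos _ _ h; apply: le_trans (ler_norm_sum _ _ _) _.
rewrite /ncyc mulr_sumr big_seq_cond [X in _ <= X]big_seq_cond.
by apply: ler_sum => c /andP[cs _]; rewrite mulr1 h// pos.
Qed.

(** Combines [|e^E - 1| <= e^|E| - 1] with the weighted inequality between a product and
    squares, in order to separate the two exponents. *)
Lemma Ex_exp_perturb k n (A E K : shape -> R) (d : R) : 0 < d ->
  (forall s, reach k n s -> `|E s| <= K s) ->
  `|Ex k n (fun s => expR (A s + E s)) - Ex k n (fun s => expR (A s))| <=
   (d * Ex k n (fun s => expR (2 * A s)) + d^-1 * (Ex k n (fun s => expR (2 * K s)) - 1)) / 2.
Proof.
move=> d0 EK; rewrite -ExB; apply: le_trans (Ex_norm _ _ _) _.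
rewrite -[X in _ - X](Ex_cst k n) -ExB -!ExZ -ExD [X in _ <= X]mulrC -ExZ.
apply: Ex_le => s rs; rewrite expRD.
have e1 : `|expR (E s) - 1| <= expR (K s) - 1.
  apply: (@le_trans _ _ (expR `|E s| - 1)); last by rewrite lerD2r ler_expR EK.
  have [E0|E0] := leP 0 (E s).
    by rewrite (ger0_norm E0) ger0_norm// subr_ge0 -[leLHS]expR0 ler_expR.
  rewrite (ltr0_norm E0) ler0_norm; last by rewrite subr_le0 -[leRHS]expR0 ler_expR ltW.
  have := expR_gt0 (E s); have := expR_gt0 (- E s); have := expRxMexpNx_1 (E s).
  move: (expR (E s)) (expR (- E s)) => u v uv v0 u0.
  have w2 : 2 <= u + v.
    rewrite leNgt -subr_gt0; apply/negP => w2.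
    have := mulr_gt0 w2 (addr_gt0 u0 v0); have := sqr_ge0 (u - v).
    have -> : (2 - (u + v)) * (u + v) = 2 * (u + v) - (u - v) ^+ 2 - 4 * (u * v) by ring.
    by rewrite uv; lra.
  by lra.
have K0 : 0 <= K s by apply: le_trans (EK s rs).
have e2 : (expR (K s) - 1) ^+ 2 <= expR (2 * K s) - 1.
  have -> : expR (2 * K s) = expR (K s) ^+ 2 by rewrite expRM_natl.
  have : 1 <= expR (K s) by rewrite -expR0 ler_expR.
  by move: (expR _) => u u1; nra.
have -> : expR (2 * A s) = expR (A s) ^+ 2 by rewrite expRM_natl.
have -> : expR (A s) * expR (E s) - expR (A s) = expR (A s) * (expR (E s) - 1) by ring.
rewrite normrM (ger0_norm (expR_ge0 _)).
have := expR_gt0 (A s); move: (expR (A s)) `|expR (E s) - 1| (normr_ge0 (expR (E s) - 1)) e1 => u v v0 e1 u0.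
have v2 : v ^+ 2 <= expR (2 * K s) - 1.
  by apply: le_trans e2; rewrite lerXn2r// nnegrE (le_trans v0).
rewrite mulrC -[leRHS]mulrC ler_pdivlMr//.
have di : 0 < d^-1 by rewrite invr_gt0.
apply: (@le_trans _ _ (d * u ^+ 2 + d^-1 * v ^+ 2)); last by rewrite lerD2l ler_wpM2l// ltW.
rewrite -subr_ge0 (_ : _ - _ = d^-1 * (d * u - v) ^+ 2); last by field; rewrite gt_eqF.
by rewrite mulr_ge0 ?sqr_ge0// ltW.
Qed.

End cycles.

(** * Polynomial approximation on a segment *)

Section weierstrass.
Variable R : realType.
Implicit Types (g : nat -> R) (u : R).

(** Bernstein polynomials defined by their martingale recursion, one binomial trial at a time:
    positivity, mass and variance follow by induction without binomial coefficients. *)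
Fixpoint bern n g u : R :=
  if n is n'.+1 then (1 - u) * bern n' g u + u * bern n' (g \o S) u else g 0%N.

Lemma bernD n g g' u : bern n (fun j => g j + g' j) u = bern n g u + bern n g' u.
Proof. elim: n g g' => //= n IH g g'; rewrite IH (IH (g \o S)); ring. Qed.

Lemma bernZ n g c u : bern n (fun j => c * g j) u = c * bern n g u.
Proof. elim: n g => //= n IH g; rewrite IH (IH (g \o S)); ring. Qed.

Lemma bern1 n c u : bern n (fun=> c) u = c.
Proof. by elim: n => //= n IH; rewrite (_ : _ \o _ = fun=> c)// IH -mulrDl subrK mul1r. Qed.

Lemma bern_le n g g' u : 0 <= u <= 1 -> (forall j, (j <= n)%N -> g j <= g' j) ->
  bern n g u <= bern n g' u.
Proof.
move=> /andP[u0 u1]; elim: n g g' => /= [|n IH] g g' H; first exact: H.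
apply: lerD; apply: ler_wpM2l; rewrite ?subr_ge0//; apply: IH => j jn; apply: H => //.
exact: leqW.
Qed.

Lemma bern_poly n g : exists q : {poly R}, forall u, bern n g u = q.[u].
Proof.
elim: n g => /= [|n IH] g; first by exists (g 0%N)%:P => u; rewrite hornerC.
have [q1 H1] := IH g; have [q2 H2] := IH (g \o S).
by exists ((1 - 'X) * q1 + 'X * q2) => u; rewrite H1 H2 !hornerE.
Qed.

Lemma bern_var n c u : bern n (fun j => (j%:R - n%:R * u - c) ^+ 2) u
  = n%:R * (u * (1 - u)) + c ^+ 2.
Proof.
elim: n c => /= [|n IH] c; first by ring.
have -> : (fun j => (j%:R - n.+1%:R * u - c) ^+ 2) = fun j => (j%:R - n%:R * u - (c + u)) ^+ 2.
  by apply/funext => j; rewrite -natr1; ring.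
have -> : (fun j => (j%:R - n%:R * u - (c + u)) ^+ 2) \o S =
  fun j => (j%:R - n%:R * u - (c + u - 1)) ^+ 2.
  by apply/funext => j /=; rewrite -natr1; ring.
by rewrite !IH -natr1; ring.
Qed.

(** With a modulus of continuity of the form [e + K (u - v)^2], the error is [e] plus [K] times
    the binomial variance. *)
Lemma bern_approx (G : R -> R) e K n u : 0 <= e -> 0 <= K -> 0 <= u <= 1 ->
  (forall v, 0 <= v <= 1 -> `|G u - G v| <= e + K * (u - v) ^+ 2) ->
  `|G u - bern n.+1 (fun j => G (j%:R / n.+1%:R)) u| <= e + K / n.+1%:R.
Proof.
move=> e0 K0 u01 H.
have n0 : 0 < n.+1%:R :> R by rewrite ltr0n.
pose w j := e + K / n.+1%:R ^+ 2 * (j%:R - n.+1%:R * u - 0) ^+ 2.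
have Hw j : (j <= n.+1)%N -> `|G u - G (j%:R / n.+1%:R)| <= w j.
  move=> jn; apply: le_trans (H _ _) _.
    by rewrite divr_ge0//= ler_pdivrMr// mul1r ler_nat.
  rewrite /w lerD2l le_eqVlt; apply/orP; left; apply/eqP; field.
  by rewrite gt_eqF.
have W : bern n.+1 w u <= e + K / n.+1%:R.
  rewrite bernD bern1 bernZ bern_var lerD2l expr0n/= addr0.
  have /andP[u0 u1] := u01.
  have -> : K / n.+1%:R ^+ 2 * (n.+1%:R * (u * (1 - u))) = K / n.+1%:R * (u * (1 - u)).
    by field; rewrite gt_eqF.
  rewrite ler_piMr ?divr_ge0//; nra.
apply: le_trans W; rewrite ler_norml; apply/andP; split.
  rewrite lerNl opprB lerBlDr -[G u in leRHS](bern1 n.+1 (G u) u) -bernD.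
  apply: bern_le => // j jn; have := Hw j jn; rewrite ler_norml => /andP[h _]; lra.
rewrite lerBlDr -[leLHS](bern1 n.+1 (G u) u) -bernD.
apply: bern_le => // j jn; have := Hw j jn; rewrite ler_norml => /andP[_ h]; lra.
Qed.

Lemma bern_bound n g M u : 0 <= u <= 1 -> (forall j, (j <= n)%N -> `|g j| <= M) -> `|bern n g u| <= M.
Proof.
move=> u01 H; rewrite ler_norml; apply/andP; split.
  rewrite -[leLHS](bern1 n _ u); apply: bern_le => // j jn.
  by have := H j jn; rewrite ler_norml => /andP[].
rewrite -[leRHS](bern1 n _ u); apply: bern_le => // j jn.
by have := H j jn; rewrite ler_norml => /andP[].
Qed.

End weierstrass.

Section modulus.
Variable R : realType.

(** Compactness of the segment, applied to the filter of small radii. *)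
Lemma segment_unif (f : R -> R) (L e : R) : continuous f -> 0 < e ->
  exists2 d, 0 < d & forall x y, - L <= x <= L -> `|x - y| < d -> `|f x - f y| < e.
Proof.
move=> cf e0.
have := (compact_near_coveringP _).1 (@segment_compact R (-L) L).
move=> /(_ R (0^'+) (fun d x => forall y, `|x - y| < d -> `|f x - f y| < e)).
have near_ x : [set` `[- L, L]] x -> \forall x' \near x & d \near 0^'+,
    forall y, `|x' - y| < d -> `|f x' - f y| < e.
  move=> _.
  have /cvgrPdist_lt /(_ (e / 2)) : f @ x --> f x by exact: cf.
  rewrite divr_gt0// => /(_ isT) /nbhs_ballP[d /= d0 H].
  exists (ball x (d / 2), [set t | t < d / 2]).
    split; first by exists (d / 2) => //=; rewrite divr_gt0.
    by apply: nbhs_right_lt; rewrite divr_gt0.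
  move=> [x' t] /= [bx td] y hy.
  have h1 : `|f x - f x'| < e / 2.
    by apply: H; apply: le_ball bx; lra.
  have h2 : `|f x - f y| < e / 2.
    apply: H; rewrite /ball /=; move: bx; rewrite /ball/= => bx.
    by have := ler_distD x' x y; lra.
  by have := ler_distD (f x) (f x') (f y); rewrite (distrC (f x') (f x)); lra.
move=> /(_ _ near_) H.
have [d [/= d0 Hd]] : exists d, 0 < d /\ [set` `[- L, L]] `<=` (fun x => forall y, `|x - y| < d -> `|f x - f y| < e).
  near (0 : R)^'+ => d; exists d; split; first by [].
  by near: d.
by exists d => // x y hx; apply: Hd; rewrite /= in_itv.
Unshelve. all: by end_near. Qed.

Lemma quad_modulus (f : R -> R) (L M e : R) : continuous f -> (forall x, `|f x| <= M) -> 0 < e ->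
  exists2 K, 0 <= K & forall x y, - L <= x <= L -> `|f x - f y| <= e + K * (x - y) ^+ 2.
Proof.
move=> cf fM e0; have M0 : 0 <= M := le_trans (normr_ge0 _) (fM 0).
have [d d0 H] := segment_unif L cf e0.
have K0 : 0 <= 2 * M / d ^+ 2 by apply: divr_ge0; [exact: mulr_ge0 | exact: sqr_ge0].
exists (2 * M / d ^+ 2) => //.
move=> x y xL; have [xy|xy] := ltP `|x - y| d.
  apply: le_trans (ltW (H _ _ xL xy)) _; rewrite lerDl.
  by apply: mulr_ge0 => //; exact: sqr_ge0.
apply: le_trans (ler_normB _ _) _; apply: le_trans (lerD (fM x) (fM y)) _.
have : 1 <= (x - y) ^+ 2 / d ^+ 2.
  rewrite ler_pdivlMr ?exprn_gt0// mul1r -(real_normK (num_real (x - y))).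
  by rewrite lerXn2r// ?nnegrE// ltW.
move=> h; have M2 : 0 <= 2 * M by exact: mulr_ge0.
have -> : 2 * M / d ^+ 2 * (x - y) ^+ 2 = 2 * M * ((x - y) ^+ 2 / d ^+ 2) by move: ((d ^+ 2)^-1) => z; ring.
have := ler_peMr M2 h; lra.
Qed.

(** [sin a - sin b] is twice [cos ((a + b) / 2) * sin ((a - b) / 2)], and under these bounds both angles
    stay in a segment on which the cosine is bounded below. *)
Lemma sin_dist : exists2 c : R, 0 < c & forall a b : R, `|a| <= pi / 4 -> `|b| <= pi / 2 ->
  c * `|a - b| <= `|sin a - sin b|.
Proof.
have p0 := pi_gt0 R.
pose c := cos (3 * pi / 8 : R).
have c0 : 0 < c by apply: cos_gt0_pihalf; lra.
have cosge (x : R) : `|x| <= 3 * pi / 8 -> c <= cos x.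
  move=> hx; have -> : cos x = cos `|x| by case: (leP 0 x) => x0; [rewrite ger0_norm | rewrite ltr0_norm// cosN].
  have [->//|ne] := eqVneq `|x| (3 * pi / 8).
  have i1 : `|x| \in `[0, (pi : R)] by rewrite in_itv/= normr_ge0/=; lra.
  have i2 : 3 * pi / 8 \in `[0, (pi : R)] by rewrite in_itv/=; apply/andP; split; lra.
  by apply: ltW; rewrite /c ltr_cos// lt_neqAle ne.
have sinle (x : R) : 0 < x -> x <= 3 * pi / 8 -> c * x <= sin x.
  move=> x0 hx; have [|y] := @MVT R sin cos 0 x x0.
  - by apply: continuous_subspaceT; exact: continuous_sin.
  rewrite in_itv/= sin0 !subr0 => /andP[y0 yx] ->; rewrite ler_wpM2r ?(ltW x0)//.
  by apply: cosge; rewrite gtr0_norm//; lra.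
have sinabs (x : R) : `|x| <= 3 * pi / 8 -> c * `|x| <= `|sin x|.
  move=> hx; case: (ltgtP x 0) => [x0|x0|->]; last by rewrite normr0 mulr0.
    rewrite ltr0_norm//; rewrite ltr0_norm// in hx.
    apply: le_trans (sinle _ _ hx) _; first by rewrite oppr_gt0.
    by rewrite sinN -normrN ler_norm.
  rewrite gtr0_norm//; rewrite gtr0_norm// in hx.
  by apply: le_trans (sinle _ x0 hx) _; rewrite ler_norm.
exists (c ^+ 2); first by rewrite exprn_gt0.
move=> a b ha hb.
have -> : sin a - sin b = 2 * (cos ((a + b) / 2) * sin ((a - b) / 2)).
  have -> : sin a = sin ((a + b) / 2 + (a - b) / 2) by congr sin; field.
  have -> : sin b = sin ((a + b) / 2 - (a - b) / 2) by congr sin; field.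
  by rewrite sinD sinB; ring.
move: ha hb; rewrite !ler_norml => /andP[a1 a2] /andP[b1 b2].
have h1 : `|(a + b) / 2| <= 3 * pi / 8 by rewrite ler_norml; apply/andP; split; lra.
have h2 : `|(a - b) / 2| <= 3 * pi / 8 by rewrite ler_norml; apply/andP; split; lra.
have k1 := cosge _ h1; have k2 := sinabs _ h2.
rewrite !normrM (ger0_norm (ltW (lt_le_trans c0 k1))) (ger0_norm (ler0n R 2)).
have -> : c ^+ 2 * `|a - b| = 2 * (c * (c * `|(a - b) / 2|)).
  by rewrite normrM (ger0_norm (_ : 0 <= 2^-1))//; field.
rewrite ler_wpM2l//; apply: ler_pM => //; try exact: ltW.
by apply: mulr_ge0 => //; exact: ltW.
Qed.

End modulus.

(** * Exponential weights *)

Section weights.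
Variable R : realType.
Implicit Types (a b t x : R).

(** The weight in which functions are compared: its expectations are exactly those controlled
    by exponential moments. *)
Definition wt a x : R := expR (a * x) + expR (- a * x).

Lemma expR_norm_le_wt b x : expR (b * `|x|) <= wt b x.
Proof.
rewrite /wt; case: (leP 0 x) => [h0|h0]; first by rewrite ger0_norm// lerDl.
by rewrite ltr0_norm// mulrN mulNr lerDr.
Qed.

Lemma wt_ge0 a x : 0 <= wt a x.
Proof. by rewrite addr_ge0. Qed.

Lemma expX_le_expR k x : `|x| ^+ k <= k`!%:R * expR `|x|.
Proof.
have k0 : 0 < k`!%:R :> R by rewrite ltr0n fact_gt0.
rewrite mulrC -ler_pdivrMr//; case: k k0 => [|k] k0.
  by rewrite expr0 fact0 divr1 -expR0 ler_expR.
have := @expR_ge1Dxn R `|x| k (normr_ge0 _); lra.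
Qed.

(** Differentiating [e^(s x)] in [s] multiplies by [x]; the uniform bound on the remainder allows
    this differentiation under the expectation. *)
Lemma diffquot_wt k s : exists C a, 0 <= C /\ forall t x, 0 < t <= 1 ->
  `|x ^+ k * ((expR ((s + t) * x) - expR (s * x)) / t) - x ^+ k.+1 * expR (s * x)| <= t * (C * wt a x).
Proof.
exists (k.+2)`!%:R, (2 + `|s|); split=> // t x /andP[t0 t1].
have T := @taylor1_ineq R expR expR expR 0 (t * x) (expR (`|x|)).
have {T} T : `|expR (t * x) - 1 - t * x| <= expR `|x| * `|t * x| ^+ 2.
  move: T; rewrite add0r expR0 mulr1; apply=> y; rewrite subr0 => hy.
  rewrite ger0_norm// ler_expR; apply: le_trans (ler_norm _) _; apply: le_trans hy _.
  by rewrite normrM (gtr0_norm t0) ler_piMl.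
have -> : x ^+ k * ((expR ((s + t) * x) - expR (s * x)) / t) - x ^+ k.+1 * expR (s * x)
   = x ^+ k * expR (s * x) / t * (expR (t * x) - 1 - t * x).
  by rewrite [(s + t) * x]mulrDl expRD exprS; field; rewrite gt_eqF.
rewrite normrM.
have -> : `|x ^+ k * expR (s * x) / t| = `|x| ^+ k * expR (s * x) / t.
  by rewrite !normrM normfV normrX (gtr0_norm t0) (ger0_norm (expR_ge0 _)).
have p0 : 0 <= `|x| ^+ k * expR (s * x) / t.
  by apply: divr_ge0 (ltW t0); apply: mulr_ge0 => //; exact: exprn_ge0.
apply: le_trans (ler_wpM2l p0 T) _.
have -> : `|x| ^+ k * expR (s * x) / t * (expR `|x| * `|t * x| ^+ 2) =
    t * (`|x| ^+ k.+2 * (expR (s * x) * expR `|x|)).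
  by rewrite normrM (gtr0_norm t0) !exprS; field; rewrite gt_eqF.
rewrite ler_wpM2l ?(ltW t0)//.
apply: le_trans (ler_wpM2r _ (expX_le_expR k.+2 x)) _; first by rewrite mulr_ge0.
rewrite -mulrA ler_wpM2l//; apply: le_trans (expR_norm_le_wt _ _).
rewrite -!expRD ler_expR mulrDl.
have : s * x <= `|s| * `|x| by rewrite -normrM ler_norm.
lra.
Qed.

Definition sinJ J x : R := series (sin_coeff x) J.

Lemma sinJ_poly J : exists q : {poly R}, forall x, sinJ J x = q.[x].
Proof.
exists (\poly_(n < J) ((odd n)%:R * (-1) ^+ n.-1./2 / n`!%:R)) => x.
rewrite horner_poly /sinJ /series/= big_mkord; apply: eq_bigr => i _.
by rewrite sin_coeffE.
Qed.

Lemma series_exp_le x n : 0 <= x -> \sum_(0 <= i < n) (x ^+ i / i`!%:R) <= expR x.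
Proof.
move=> x0; have := @nondecreasing_cvgn_le R (series (exp_coeff x)) _ (is_cvg_series_exp_coeff x) n.
apply; apply: nondecreasing_series => i _ _; rewrite /exp_coeff /=.
by rewrite divr_ge0 ?exprn_ge0.
Qed.

Lemma sin_coeff_norm x i : `|sin_coeff x i| <= `|x| ^+ i / i`!%:R.
Proof.
rewrite sin_coeffE /= !normrM normfV normrX (ger0_norm (ler0n R i`!)) normrX normrN1 expr1n mulr1.
by rewrite mulrAC ler_wpM2r ?invr_ge0// ler_piMl ?exprn_ge0// ger0_norm// lern1; case: odd.
Qed.

Lemma sinJ_bound J x : `|sinJ J x| <= expR `|x|.
Proof.
apply: le_trans (series_exp_le J (normr_ge0 x)).
apply: le_trans (ler_norm_sum _ _ _) _; apply: ler_sum => i _; exact: sin_coeff_norm.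
Qed.

(** The tail of the exponential series of [|x|] from rank [J] is at most [2^-J] times the
    exponential of [2 |x|]. *)
Lemma sinJ_approx J x : `|sin x - sinJ J x| <= 2^-1 ^+ J * expR (2 * `|x|).
Proof.
rewrite distrC; have cv : `|sinJ J x - series (sin_coeff x) n| @[n --> \oo] --> `|sinJ J x - sin x|.
  apply: cvg_norm; apply: cvgB; first exact: cvg_cst.
  by rewrite sin.unlock; exact: is_cvg_series_sin_coeff.
rewrite -(cvg_lim _ cv)//; apply: limr_le; first by apply/cvg_ex; exists `|sinJ J x - sin x|.
near=> n; have Jn : (J <= n)%N by near: n; exact: nbhs_infty_ge.
rewrite distrC /sinJ sub_series_geq//; apply: le_trans (ler_norm_sum _ _ _) _.
apply: (@le_trans _ _ (2^-1 ^+ J * \sum_(0 <= k < n) ((2 * `|x|) ^+ k / k`!%:R))); last first.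
  by rewrite ler_wpM2l ?exprn_ge0// series_exp_le ?mulr_ge0.
rewrite (big_cat_nat (leq0n J) Jn) mulrDr/= -[leLHS]add0r; apply: lerD.
  by apply: mulr_ge0; [rewrite exprn_ge0 | apply: sumr_ge0 => i _; rewrite divr_ge0 ?exprn_ge0 ?mulr_ge0].
rewrite mulr_sumr; apply: ler_sum_nat => k /andP[Jk _].
apply: le_trans (sin_coeff_norm x k) _; rewrite mulrA ler_wpM2r ?invr_ge0//.
rewrite exprMn mulrA ler_peMl ?exprn_ge0// exprVn mulrC ler_pdivlMr ?exprn_gt0// mul1r.
by rewrite ler_weXn2l// ler1n.
Unshelve. all: by end_near. Qed.

End weights.

(** * From exponential moments to bounded continuous functions *)

Section transfer.
Variables (R : realType) (T : nat -> finType) (P X : forall N, T N -> R).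
Variables (F : set_system nat) (FF : Filter F) (mu : probability (measurableTypeR R) R).
Hypothesis P_ge0 : forall (N : nat) (w : T N), 0 <= P w.

Let E (N : nat) (g : R -> R) := \sum_(w : T N) P w * g (X w).
Let integ (g : R -> R) := mu.-integrable [set: R] (EFin \o g).
Let L (g : R -> R) := Rintegral mu [set: R] g.

(** The functions [g] for which the expectations converge. This class is closed under linear
    combinations and under approximation in a weight that belongs to it. *)
Definition conv (g : R -> R) := integ g /\ E N g @[N --> F] --> L g.

Hypothesis mgf_conv : forall t : R, conv (fun x => expR (t * x)).

Lemma conv_lin a g h : conv g -> conv h -> conv (fun x => a * g x + h x).
Proof.
move=> [ig cg] [ih ch].
pose ag x : R := a * g x; have iag : integ ag.
  rewrite /integ (_ : _ \o _ = fun x => (a%:E * (g x)%:E)%E); first exact: integrableZl.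
  by apply/funext => x /=; rewrite /ag EFinM.
split.
  rewrite /integ (_ : _ \o _ = ((EFin \o ag) \+ (EFin \o h))%E).
    exact: integrableD.
  by apply/funext => x /=; rewrite EFinD.
have -> : L (fun x => a * g x + h x) = a * L g + L h.
  by rewrite /L RintegralD// RintegralZl.
have -> : (fun N => E N (fun x => a * g x + h x)) = fun N => a * E N g + E N h.
  apply/funext => N; rewrite /E mulr_sumr -big_split/=; apply: eq_bigr => w _; ring.
by apply: cvgD => //; apply: cvgM => //; exact: cvg_cst.
Qed.

Lemma eq_conv g h : (forall x, g x = h x) -> conv g -> conv h.
Proof. by move=> gh; rewrite (_ : g = h)//; exact/funext. Qed.

Lemma conv0 : conv (fun=> 0).
Proof.
apply: eq_conv (conv_lin (-1) (mgf_conv 0) (mgf_conv 0)) => x; rewrite mulN1r addNr//.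
Qed.

Lemma convZ a g : conv g -> conv (fun x => a * g x).
Proof. by move=> cg; apply: eq_conv (conv_lin a cg conv0) => x; rewrite addr0. Qed.

Lemma convD g h : conv g -> conv h -> conv (fun x => g x + h x).
Proof. by move=> cg ch; apply: eq_conv (conv_lin 1 cg ch) => x; rewrite mul1r. Qed.

Lemma conv_wt a : conv (wt a).
Proof. exact: convD (mgf_conv a) (mgf_conv (- a)). Qed.

Lemma E_approx N g h W e : (forall x, `|g x - h x| <= e * W x) -> `|E N g - E N h| <= e * E N W.
Proof.
move=> H; rewrite /E -sumrB mulr_sumr; apply: le_trans (ler_norm_sum _ _ _) _.
apply: ler_sum => w _; rewrite -mulrBr normrM (ger0_norm (P_ge0 _)) mulrCA ler_wpM2l//.
Qed.

Lemma L_le g h : integ g -> integ h -> (forall x, g x <= h x) -> L g <= L h.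
Proof. by move=> ig ih gh; apply: le_Rintegral => // x _. Qed.

Lemma conv_approx (g W : R -> R) : measurable_fun [set: R] g -> conv W ->
  (forall e : R, 0 < e -> exists2 h, conv h & forall x, `|g x - h x| <= e * W x) ->
  conv g.
Proof.
move=> mg [iW cW] H.
have W0 x : 0 <= W x.
  have [h _ /(_ x) hW] := H 1 ltr01; rewrite mul1r in hW.
  exact: le_trans hW.
have ig : integ g.
  have [h [ih _] hW] := H 1 ltr01.
  have iS : mu.-integrable [set: R] (fun x => ((`|h x| + W x)%:E)).
    rewrite (_ : (fun x => _) = (abse \o (EFin \o h) \+ (EFin \o W))%E); last by apply/funext => x /=; rewrite EFinD.
    by apply: integrableD => //; exact: integrable_abse.
  apply: le_integrable iS => //; first exact/measurable_EFinP.
  move=> x _ /=; rewrite lee_fin (ger0_norm (_ : 0 <= `|h x| + W x)) ?addr_ge0//.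
  have := hW x; rewrite mul1r -{2}(subrK (h x) (g x)) => k.
  by apply: le_trans (ler_normD _ _) _; rewrite addrC lerD2l.
split=> //; apply: cvg_approx => e e0.
have LW0 : 0 <= L W by apply: Rintegral_ge0.
have d0 : 0 < e / (L W + 1) by rewrite divr_gt0// ltr_wpDl.
have [h [ih ch] hW] := H _ d0.
exists (fun N => E N h), (L h); split=> //.
- have EW : \forall N \near F, E N W <= L W + 1.
    move/cvgrPdist_le : cW => /(_ 1 ltr01); apply: filterS => N; rewrite ler_norml => /andP[]; lra.
  near=> N; apply: le_trans (E_approx N hW) _.
  rewrite -[leRHS](@divfK _ (L W + 1)) ?gt_eqF ?ltr_wpDl// ler_wpM2l ?(ltW d0)//.
  by near: N.
- have [i1 _] := convZ (e / (L W + 1)) (conj iW cW).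
  have LWe : e / (L W + 1) * L W <= e.
    rewrite -[leRHS](@divfK _ (L W + 1)) ?gt_eqF ?ltr_wpDl// ler_wpM2l ?(ltW d0)//; lra.
  have LZ : L (fun x => e / (L W + 1) * W x) = e / (L W + 1) * L W by rewrite /L RintegralZl.
  apply: le_trans LWe; rewrite -LZ.
  have -> : L h - L g = L (fun x => h x - g x) by rewrite /L RintegralB.
  have ihg : integ (fun x => h x - g x).
    rewrite /integ (_ : _ \o _ = ((EFin \o h) \- (EFin \o g))%E); last by apply/funext => x /=; rewrite EFinB.
    exact: integrableB.
  apply: le_trans (le_normr_Rintegral _ ihg) _ => //.
  apply: L_le => //; first exact: (integrable_abse ihg).
  by move=> x; rewrite distrC.
Unshelve. all: by end_near. Qed.

Lemma measurable_pow k s : measurable_fun [set: R] (fun x : R => x ^+ k * expR (s * x)).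
Proof.
apply: measurable_funM; first exact: measurable_funX.
apply: measurableT_comp => //; exact: measurable_funM.
Qed.

(** Moments are obtained from exponentials as limits of difference quotients in the parameter. *)
Lemma conv_mono k s : conv (fun x => x ^+ k * expR (s * x)).
Proof.
elim: k s => [|k IH] s; first by apply: eq_conv (mgf_conv s) => x; rewrite expr0 mul1r.
have [C [a [C0 H]]] := diffquot_wt k s.
apply: (conv_approx (measurable_pow _ _) (convZ C (conv_wt a))) => e e0.
pose t := Num.min e 1; have t0 : 0 < t by rewrite lt_min e0 ltr01.
have t1 : t <= 1 by rewrite ge_min lexx orbT.
have te : t <= e by rewrite ge_min lexx.
exists (fun x => x ^+ k * ((expR ((s + t) * x) - expR (s * x)) / t)).
  apply: eq_conv (convD (convZ t^-1 (IH (s + t))) (convZ (- t^-1) (IH s))) => x; ring.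
move=> x; rewrite distrC; apply: le_trans (H t x _) _; first by rewrite t0.
by rewrite ler_wpM2r// mulr_ge0// wt_ge0.
Qed.

Lemma conv_sum (I : Type) (r : seq I) (g : I -> R -> R) : (forall i, conv (g i)) ->
  conv (fun x => \sum_(i <- r) g i x).
Proof.
move=> H; elim: r => [|i r IH]; first by apply: eq_conv conv0 => x; rewrite big_nil.
by apply: eq_conv (convD (H i) IH) => x; rewrite big_cons.
Qed.

Lemma conv_poly (q : {poly R}) : conv (fun x => q.[x]).
Proof.
apply: (@eq_conv (fun x => \sum_(i < size q) q`_i * x ^+ i)) => [x|]; first by rewrite horner_coef.
apply: conv_sum => i; apply: convZ.
by apply: eq_conv (conv_mono i 0) => x; rewrite mul0r expR0 mulr1.
Qed.

Lemma sin_normle1 (x : R) : `|sin x| <= 1.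
Proof. by rewrite ler_norml sin_geN1 sin_le1. Qed.

Lemma measurable_sinw w : measurable_fun [set: R] (fun x : R => sin (w * x)).
Proof.
apply: continuous_measurable_fun => x; apply: continuous_comp; last exact: continuous_sin.
by apply: cvgM; [exact: cvg_cst | exact: cvg_id].
Qed.

(** The sine is a limit of its Taylor polynomials in exponential weight, and so are its powers
    because the Taylor polynomials are bounded by [e^|x|]. *)
Lemma conv_sinX w m : conv (fun x => sin (w * x) ^+ m).
Proof.
have mX : measurable_fun [set: R] (fun x => sin (w * x) ^+ m).
  by apply: measurable_funX; exact: measurable_sinw.
pose a := (m.+2)%:R * `|w|.
apply: (conv_approx mX (convZ m%:R (conv_wt a))) => e e0.
have [J Je] : exists J, 2^-1 ^+ J <= e :> R.
  have /cvgrPdist_le /(_ e e0) [J _ HJ] : (2^-1 : R) ^+ n @[n --> \oo] --> (0 : R).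
    by apply: cvg_expr; rewrite ger0_norm// invf_lt1// ltr1n.
  exists J; have := HJ J (leqnn J); rewrite sub0r normrN ger0_norm// exprn_ge0//.
exists (fun x => sinJ J (w * x) ^+ m).
  have [q Hq] := sinJ_poly R J.
  apply: eq_conv (conv_poly ((q \Po (w *: 'X)) ^+ m)) => x.
  by rewrite Hq horner_exp horner_comp hornerZ hornerX.
move=> x.
have base k : `|sin (w * x) ^+ k - sinJ J (w * x) ^+ k| <= k%:R * (2^-1 ^+ J * expR ((k.+2)%:R * `|w * x|)).
  elim: k => [|k IH]; first by rewrite !expr0 subrr normr0 mul0r.
  have -> : sin (w * x) ^+ k.+1 - sinJ J (w * x) ^+ k.+1 =
    sin (w * x) * (sin (w * x) ^+ k - sinJ J (w * x) ^+ k) + (sin (w * x) - sinJ J (w * x)) * sinJ J (w * x) ^+ k.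
    by rewrite !exprS; ring.
  apply: le_trans (ler_normD _ _) _; rewrite [X in X + _]normrM [X in _ + X]normrM normrX.
  have J0 : 0 <= 2^-1 ^+ J :> R by rewrite exprn_ge0.
  have h1 : `|sin (w * x)| * `|sin (w * x) ^+ k - sinJ J (w * x) ^+ k| <=
      k%:R * (2^-1 ^+ J * expR ((k.+3)%:R * `|w * x|)).
    apply: le_trans (ler_piMl _ (sin_normle1 _)) _ => //; apply: le_trans IH _.
    by rewrite ler_wpM2l// ler_wpM2l// ler_expR ler_wpM2r// ler_nat.
  have h2 : `|sin (w * x) - sinJ J (w * x)| * `|sinJ J (w * x)| ^+ k <=
      2^-1 ^+ J * expR ((k.+3)%:R * `|w * x|).
    apply: (@le_trans _ _ ((2^-1 ^+ J * expR (2 * `|w * x|)) * expR `|w * x| ^+ k)).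
      apply: ler_pM => //; [exact: sinJ_approx |].
      by apply: lerXn2r; rewrite ?nnegrE//; exact: sinJ_bound.
    rewrite -mulrA ler_wpM2l// -expRM_natl -expRD ler_expR -mulrDl ler_wpM2r//.
    by rewrite -natrD ler_nat.
  by rewrite -[k.+1%:R]natr1 mulrDl mul1r lerD.
apply: le_trans (base m) _; rewrite mulrCA; apply: ler_pM; [exact: exprn_ge0 | exact: mulr_ge0 | exact: Je |].
rewrite ler_wpM2l//; apply: le_trans (expR_norm_le_wt _ _).
by rewrite normrM mulrA.
Qed.

Lemma conv_sin_poly w (q : {poly R}) : conv (fun x => q.[(1 + sin (w * x)) / 2]).
Proof.
pose q' := q \Po (2^-1 *: (1 + 'X)).
apply: (@eq_conv (fun x => \sum_(i < size q') q'`_i * sin (w * x) ^+ i)) => [x|].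
  by rewrite -horner_coef /q' horner_comp !hornerE mulrC.
by apply: conv_sum => i; apply: convZ; exact: conv_sinX.
Qed.

(** Write [f x] as [f (asin (sin (w x)) / w)] for [|x| <= l] and approximate by a Bernstein
    polynomial in [sin (w x)]. It is bounded by [M] everywhere, so that beyond [l] the error
    is at most [2 M <= e x^2]. *)
Lemma conv_bounded (f : R -> R) (M : R) : continuous f -> (forall x, `|f x| <= M) -> conv f.
Proof.
move=> cf fM; have M0 : 0 <= M := le_trans (normr_ge0 _) (fM 0).
have cW : conv (fun x => 1 + x ^+ 2).
  apply: eq_conv (conv_poly (1 + 'X^2)) => x; by rewrite !hornerE.
apply: (conv_approx (continuous_measurable_fun cf) cW) => e e0.
pose l := 1 + 2 * M / e; have l1 : 1 <= l by rewrite lerDl divr_ge0 ?mulr_ge0// ltW.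
have l0 : 0 < l by exact: lt_le_trans l1.
have p0 := pi_gt0 R.
have Ml : 2 * M <= e * l ^+ 2.
  have : 2 * M = e * (2 * M / e) by rewrite mulrCA divff ?gt_eqF// mulr1.
  move=> ->; rewrite ler_wpM2l ?(ltW e0)//.
  have : l <= l ^+ 2 by rewrite expr2 ler_peMr// ltW.
  rewrite {1}/l; lra.
(* with this frequency the sine is invertible on [-l, l], with a margin *)
have [w w0 wl] : exists2 w, 0 < w & w * l = pi / 4.
  exists (pi / (4 * l)); first by rewrite divr_gt0// mulr_gt0.
  by field; rewrite gt_eqF.
have [c c0 Hs] := sin_dist R.
have e2 : 0 < e / 2 by rewrite divr_gt0.
have [K K0 HK] := quad_modulus l cf fM e2.
pose K' := 4 * K / (w ^+ 2 * c ^+ 2).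
have K'0 : 0 <= K' by apply: divr_ge0; apply: mulr_ge0 => //; apply: exprn_ge0; exact: ltW.
pose n := Num.truncn (K' / (e / 2)).
have Hn : K' / n.+1%:R <= e / 2.
  rewrite ler_pdivrMr ?ltr0n// mulrC -ler_pdivrMr//; apply: ltW; exact: truncnS_gt.
pose G v := f (asin (2 * v - 1) / w).
have [q Hq] := bern_poly n.+1 (fun j => G (j%:R / n.+1%:R)).
exists (fun x => q.[(1 + sin (w * x)) / 2]); first exact: conv_sin_poly.
move=> x; rewrite -Hq; set u := (1 + sin (w * x)) / 2.
have u01 : 0 <= u <= 1.
  have := sin_normle1 (w * x); rewrite ler_norml => /andP[s1 s2].
  by apply/andP; rewrite /u; split; lra.
have x20 : 0 <= x ^+ 2 by exact: sqr_ge0.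
have [xl|xl] := leP `|x| l; last first.
  apply: le_trans (ler_normB _ _) _.
  apply: (@le_trans _ _ (M + M)); first by apply: lerD => //; apply: bern_bound => // j _; exact: fM.
  have : l ^+ 2 <= x ^+ 2.
    by rewrite -(real_normK (num_real x)) lerXn2r ?nnegrE// ltW.
  move=> h; have : e * l ^+ 2 <= e * (1 + x ^+ 2) by rewrite ler_wpM2l ?(ltW e0)//; lra.
  lra.
have wx : `|w * x| <= pi / 4.
  by rewrite normrM (gtr0_norm w0) -wl ler_wpM2l// ltW.
have GE : G u = f x.
  rewrite /G /u; have -> : 2 * ((1 + sin (w * x)) / 2) - 1 = sin (w * x) by field.
  rewrite sinK; first by rewrite mulrAC divff ?gt_eqF// mul1r.
  move: wx; rewrite ler_norml in_itv/= => /andP[w1 w2]; apply/andP; split; lra.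
have B := @bern_approx R G (e / 2) K' n u (ltW e2) K'0 u01.
rewrite -GE; apply: (@le_trans _ _ (e / 2 + e / 2)); last first.
  by rewrite -splitr ler_peMr ?(ltW e0)// lerDl.
apply: le_trans (B _) _; last by rewrite lerD2l.
move=> v /andP[v0 v1]; rewrite GE /G; set y := asin _ / w.
have xl' : - l <= x <= l by rewrite -ler_norml.
apply: le_trans (HK x y xl') _; rewrite lerD2l /K'.
have v11 : -1 <= 2 * v - 1 <= 1 by apply/andP; split; lra.
have wy : w * y = asin (2 * v - 1) by rewrite /y mulrC divfK// gt_eqF.
have hy : `|w * y| <= pi / 2.
  by rewrite wy ler_norml asin_geNpi2//= asin_lepi2.
have := Hs _ _ wx hy; rewrite wy asinK ?in_itv//= -wy.
have -> : sin (w * x) - (2 * v - 1) = 2 * (u - v) by rewrite /u; field.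
have -> : w * x - w * y = w * (x - y) by ring.
rewrite [`|w * _|]normrM [`|2 * _|]normrM (gtr0_norm w0) (ger0_norm (ler0n R 2)) => hh.
have h2 : (c * (w * `|x - y|)) ^+ 2 <= (2 * `|u - v|) ^+ 2.
  apply: lerXn2r => //; rewrite nnegrE; last exact: mulr_ge0.
  by apply: mulr_ge0; [exact: ltW | apply: mulr_ge0 => //; exact: ltW].
rewrite !exprMn !real_normK ?num_real// in h2.
have cw : 0 < w ^+ 2 * c ^+ 2 by rewrite mulr_gt0 ?exprn_gt0.
rewrite mulrAC ler_pdivlMr//.
have : K * (c ^+ 2 * (w ^+ 2 * (x - y) ^+ 2)) <= K * (2 ^+ 2 * (u - v) ^+ 2) by rewrite ler_wpM2l.
lra.
Qed.

End transfer.

(** * Gaussian limit laws *)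

Section gaussian.
Variable R : realType.
Local Notation leb := (@lebesgue_measure R).

(** The density is a version of the Radon-Nikodym derivative. *)
Lemma integral_normal_prob (m s : R) (f : R -> \bar R) : measurable_fun [set: R] f ->
  (forall x, (0 <= f x)%E) ->
  (\int[normal_prob m s]_x f x = \int[leb]_x (f x * (normal_pdf m s x)%:E))%E.
Proof.
move=> mf f0; have dom := normal_prob_dominates m s.
rewrite -(Radon_Nikodym_SigmaFinite.change_of_variables dom f0 measurableT mf).
have ig := Radon_Nikodym_SigmaFinite.f_integrable dom.
apply: ae_eq_integral => //.
- by apply: emeasurable_funM => //; exact: measurable_int ig.
- by apply: emeasurable_funM => //; apply/measurable_EFinP; exact: measurable_normal_pdf.
- apply: ae_eqe_mul2l; apply: integral_ae_eq => //.
  + by apply/measurable_EFinP; exact: measurable_normal_pdf.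
  + by move=> E _ mE; rewrite -Radon_Nikodym_SigmaFinite.f_integral.
Qed.

(** Completing the square turns [e^(t x)] times the centered density into a constant times the
    density of mean [s^2 t]. *)
Lemma integral_gauss_exp (s t : R) : s != 0 ->
  (\int[normal_prob 0%R s]_x (expR (t * x))%:E = (expR (s ^+ 2 * t ^+ 2 / 2))%:E)%E.
Proof.
move=> s0; have mexp : measurable_fun [set: R] (fun x : R => expR (t * x)).
  by apply: measurableT_comp => //; exact: measurable_funM.
rewrite integral_normal_prob; last 2 first.
- exact/measurable_EFinP.
- by move=> x; rewrite lee_fin expR_ge0.
transitivity (\int[leb]_x ((expR (s ^+ 2 * t ^+ 2 / 2))%:E * (normal_pdf (s ^+ 2 * t) s x)%:E))%E.
  apply: eq_integral => x _; rewrite -!EFinM !normal_pdfE//; congr EFin.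
  rewrite mulrCA [RHS]mulrCA; congr (_ * _).
  rewrite /normal_fun -!expRD; congr expR; rewrite subr0 -mulr_natr; field.
  exact: s0.
rewrite integralZl//=; last exact: integrable_normal_pdf.
by rewrite integral_normal_pdf mule1.
Qed.

Lemma centered_gaussian_mgf (v t : R) : 0 <= v ->
  (centered_gaussian v).-integrable [set: R] (EFin \o (fun x => expR (t * x))) /\
  Rintegral (centered_gaussian v) [set: R] (fun x => expR (t * x)) = expR (v * t ^+ 2 / 2).
Proof.
move=> v0; have mexp : measurable_fun [set: R] (fun x : R => expR (t * x)).
  by apply: measurableT_comp => //; exact: measurable_funM.
have I : (\int[centered_gaussian v]_x (expR (t * x))%:E = (expR (v * t ^+ 2 / 2))%:E)%E.
  rewrite /centered_gaussian; have [->|vn] := eqVneq v 0.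
    rewrite integral_dirac//=; last exact/measurable_EFinP.
    by rewrite diracT mul1e mulr0 !mul0r.
  rewrite integral_gauss_exp; last by rewrite sqrtr_eq0 -ltNge lt_neqAle eq_sym vn.
  by rewrite sqr_sqrtr.
split; last by rewrite /Rintegral I.
apply/integrableP; split; first exact/measurable_EFinP.
rewrite [X in (X < _)%E](_ : _ = (expR (v * t ^+ 2 / 2))%:E) ?ltry// -I.
by apply: eq_integral => x _ /=; rewrite ger0_norm.
Qed.

End gaussian.

Lemma mgf_cvg_in_distribution (R : realType) (T : nat -> finType)
    (P X : forall N, T N -> R) (F : set_system nat) (v : R) :
  Filter F -> 0 <= v -> (forall (N : nat) (w : T N), 0 <= P N w) ->
  (forall t : R, \sum_(w : T N) P N w * expR (t * X N w) @[N --> F] --> expR (v * t ^+ 2 / 2)) ->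
  cvg_in_distribution P X F (centered_gaussian v).
Proof.
move=> FF v0 P0 H f cf [M fM].
have [|_ h] := @conv_bounded R T P X F FF (centered_gaussian v) P0 _ f M cf fM; last exact: h.
move=> t; have [i e] := centered_gaussian_mgf t v0; split=> //.
by rewrite e; exact: H.
Qed.

(** * Recursion over perfect matchings *)

Module Pairings.
Import mathcomp.boot.fintype mathcomp.boot.finset.
Local Open Scope set_scope.
Section pairs.
Variable T : finType.
Implicit Types (A : {set T}) (M : {set {set T}}) (x y a b : T).

Definition pairs A : {set {set {set T}}} :=
  [set M : {set {set T}} |
    partition M A & [forall (e | e \in M), #|e| == 2%N]]%SET.

Lemma pairsP M A : reflect (partition M A /\ forall e, e \in M -> #|e| = 2%N)
  (M \in pairs A).
Proof.
rewrite inE; apply: (iffP andP) => -[p h]; split=> //.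
  by move=> e eM; apply/eqP; move/forall_inP: h; apply.
by apply/forall_inP => e /h ->.
Qed.

Lemma pairs_partner M A x : M \in pairs A -> x \in A ->
  exists2 y, y \in A :\ x & [set x; y] \in M.
Proof.
move=> /pairsP[pM card2] xA.
have xc : x \in cover M by rewrite (cover_partition pM).
have BM := pblock_mem xc; have xB : x \in pblock M x by rewrite mem_pblock.
have /eqP/cards2P[u [v [uv Euv]]] := card2 _ BM.
have sub := partitionS pM BM.
move: xB; rewrite Euv !inE => /orP[] /eqP ex; subst x.
  exists v; last by rewrite -Euv.
  by rewrite !inE eq_sym uv (subsetP sub)// Euv !inE eqxx orbT.
exists u; last by rewrite setUC -Euv.
by rewrite !inE uv (subsetP sub)// Euv !inE eqxx.
Qed.

Lemma pairs_partner_uniq M A x y z : M \in pairs A -> y != x -> z != x ->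
  [set x; y] \in M -> [set x; z] \in M -> y = z.
Proof.
move=> /pairsP[pM _] yx zx yM zM.
have tM := partition_trivIset pM.
have e1 : pblock M x = [set x; y] by apply: def_pblock => //; rewrite !inE eqxx.
have e2 : pblock M x = [set x; z] by apply: def_pblock => //; rewrite !inE eqxx.
have : y \in [set x; z] by rewrite -e2 e1 !inE eqxx orbT.
by rewrite !inE (negPf yx) /= => /eqP.
Qed.

Lemma setD_pair A x y : A :\: [set x; y] = A :\ x :\ y.
Proof. by apply/setP => z; rewrite !inE negb_or; case: (z == x); case: (z == y). Qed.

Lemma pairs_rem M A x y : M \in pairs A -> [set x; y] \in M ->
  M :\ [set x; y] \in pairs (A :\ x :\ y).
Proof.
move=> /pairsP[pM card2] xyM; apply/pairsP; split.
  by rewrite -setD_pair; apply: partitionD1.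
by move=> e; rewrite !inE => /andP[_ /card2].
Qed.

Lemma pairs_add M A x y : x \in A -> y \in A :\ x -> M \in pairs (A :\ x :\ y) ->
  [set x; y] |: M \in pairs A.
Proof.
move=> xA yA /pairsP[pM card2].
have /andP[yx yA'] : (y != x) && (y \in A) by move: yA; rewrite !inE.
apply/pairsP; split; last first.
  by move=> e; rewrite !inE => /orP[/eqP ->|/card2//]; rewrite cards2 eq_sym yx.
have -> : A = [set x; y] :|: (A :\ x :\ y).
  apply/setP => z; rewrite !inE; have [->|] := eqVneq z x => //=.
  by have [->|] := eqVneq z y.
apply: partitionU1 => //.
  by apply/set0Pn; exists x; rewrite !inE eqxx.
by rewrite -setI_eq0; apply/eqP/setP => z; rewrite !inE; case: (z == x); case: (z == y); rewrite ?andbF.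
Qed.

Lemma pairs_notin M A x y : M \in pairs (A :\ x :\ y) -> [set x; y] \notin M.
Proof.
move=> /pairsP[pM _]; apply/negP => /(partitionS pM)/subsetP/(_ x).
by rewrite !inE eqxx /= andbF => /(_ isT).
Qed.

Section sums.
Variable R : realType.
Implicit Type F : {set {set T}} -> R.

(** The element [x] is matched with exactly one [y], and what remains is a pairing of the
    other elements. *)
Lemma sum_pairs_rec A x F : x \in A ->
  \sum_(M in pairs A) F M =
  \sum_(y in A :\ x) \sum_(M in pairs (A :\ x :\ y)) F ([set x; y] |: M).
Proof.
move=> xA.
transitivity (\sum_(M in pairs A) \sum_(y in A :\ x | [set x; y] \in M) F M).
  apply: eq_bigr => M MA; have [y yA yM] := pairs_partner MA xA.
  rewrite (big_pred1 y)// => z; apply/andP/eqP => [[zA zM]|->]; last by [].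
  by apply: (pairs_partner_uniq MA _ _ zM yM); [move: zA|move: yA]; rewrite !inE => /andP[].
rewrite (exchange_big_dep (mem (A :\ x)))/=; last by move=> M y _ /andP[].
apply: eq_bigr => y yA.
rewrite (reindex_onto (fun M => [set x; y] |: M) (fun M => M :\ [set x; y])) /=; last first.
  by move=> M /andP[_ /andP[_ yM]]; rewrite setD1K.
apply: eq_bigl => M; rewrite yA setU11 /= andbT.
apply/andP/idP => [[MA /eqP eM]|MA].
  by rewrite -eM; apply: pairs_rem => //; exact: setU11.
by split; [exact: pairs_add | rewrite setU1K// (pairs_notin MA)].
Qed.

(** The two half-edges of a new vertex are either matched together, giving a loop, or with [x]
    and [y] that were matched to each other, in which case the edge is subdivided. *)
Lemma sum_pairs_insert A a b F : a != b -> a \notin A -> b \notin A ->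
  \sum_(M in pairs (a |: (b |: A))) F M =
  \sum_(M in pairs A) (F ([set a; b] |: M) +
    \sum_(x in A) \sum_(y in A :\ x | [set x; y] \in M)
       F ([set a; x] |: ([set b; y] |: (M :\ [set x; y])))).
Proof.
move=> ab aA bA; rewrite (sum_pairs_rec _ (x := a)) ?setU11//.
have aD : (a |: (b |: A)) :\ a = b |: A by rewrite setU1K// !inE negb_or ab.
rewrite aD (big_setU1 _ bA) big_split /= setU1K//; congr (_ + _).
rewrite exchange_big /=; apply: eq_bigr => x xA.
have xb : x != b by apply: contraNneq bA => <-.
have -> : (b |: A) :\ x = b |: (A :\ x).
  by apply/setP => z; rewrite !inE; have [->|] := eqVneq z b => //=; rewrite ?andbT ?orbF// eq_sym.
rewrite (sum_pairs_rec _ (x := b)) ?setU11//.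
have -> : (b |: (A :\ x)) :\ b = A :\ x by rewrite setU1K// !inE negb_and bA orbT.
rewrite [RHS](eq_bigr (fun M => \sum_(y in A :\ x | [set x; y] \in M) F ([set a; x] |: ([set b; y] |: (M :\ [set x; y])))))//.
rewrite [RHS](exchange_big_dep (mem (A :\ x)))/=; last by move=> M y _ /andP[].
apply: eq_bigr => y yA.
rewrite [RHS](reindex_onto (fun M => [set x; y] |: M) (fun M => M :\ [set x; y])) /=; last first.
  by move=> M /andP[_ /andP[_ yM]]; rewrite setD1K.
apply: eq_big => [M|M MA]; last by rewrite setU1K// (pairs_notin MA).
rewrite yA setU11 /= andbT; apply/idP/andP => [MA|[MA /eqP eM]].
  by split; [exact: pairs_add | rewrite setU1K// (pairs_notin MA)].
by rewrite -eM; apply: pairs_rem => //; exact: setU11.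
Qed.

End sums.

(** Ordered edges keep track of the direction in which a component is traversed. *)
Definition esetE (E : seq (T * T)) : {set {set T}} := [set [set e.1; e.2] | e in E].
Definition flat (E : seq (T * T)) : seq T := flatten [seq [:: e.1; e.2] | e <- E].

Lemma esetE_cons e E : esetE (e :: E) = [set e.1; e.2] |: esetE E.
Proof.
apply/setP => B; rewrite !inE; apply/imsetP/orP => [[u]|].
  by rewrite inE => /predU1P[-> ->|uE ->]; [left|right; apply/imsetP; exists u].
case=> [/eqP ->|/imsetP[u uE ->]]; first by exists e; rewrite ?inE ?eqxx.
by exists u; rewrite ?inE ?uE ?orbT.
Qed.

Lemma esetE_perm E E' : E =i E' -> esetE E = esetE E'.
Proof.
by move=> h; apply/setP => B; apply/imsetP/imsetP => -[u uE ->]; exists u; rewrite ?h// -h.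
Qed.

Lemma flat_cons e E : flat (e :: E) = [:: e.1, e.2 & flat E]. Proof. by []. Qed.

Lemma flat_cat E E' : flat (E ++ E') = flat E ++ flat E'.
Proof. by rewrite /flat map_cat flatten_cat. Qed.

Lemma mem_flat E e : e \in E -> (e.1 \in flat E) && (e.2 \in flat E).
Proof.
by move=> eE; apply/andP; split; apply/flattenP; exists [:: e.1; e.2];
   rewrite ?inE ?eqxx ?orbT//; apply/mapP; exists e.
Qed.

Lemma esetE_notin x y E : x \notin flat E -> [set x; y] \notin esetE E.
Proof.
apply: contraNN => /imsetP[e eE exy]; have /andP[e1 e2] := mem_flat eE.
have : x \in [set e.1; e.2] by rewrite -exy !inE eqxx.
by rewrite !inE => /orP[] /eqP ->.
Qed.

Lemma esetE_pairs E : uniq (flat E) -> esetE E \in pairs [set x in flat E].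
Proof.
elim: E => [|e E IH]; first move=> _.
  apply/pairsP; split; last by move=> e /imsetP[].
  have -> : [set x in flat [::]] = set0 :> {set T} by apply/setP => x; rewrite !inE.
  by rewrite partition_set0; apply/eqP/setP => x; rewrite !inE; apply/imsetP => -[].
rewrite flat_cons cons_uniq inE negb_or -andbA => /and4P[e12 e1 e2 u].
rewrite esetE_cons; apply: pairs_add.
- by rewrite !inE eqxx.
- by rewrite !inE eqxx orbT andbT eq_sym.
have -> : [set x in [:: e.1, e.2 & flat E]] :\ e.1 :\ e.2 = [set x in flat E].
  apply/setP => x; rewrite !inE; have [->|_] := eqVneq x e.1 => //=.
    by rewrite (negPf e1) andbF.
  by have [->|_] := eqVneq x e.2 => //=; rewrite (negPf e2).
exact: IH.
Qed.

Fixpoint allpair (n : nat) (s : seq T) : seq (seq (T * T)) :=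
  if n is n'.+1 then
    if s is x :: s' then
      flatten [seq [seq (x, y) :: E | E <- allpair n' (rem y s')] | y <- s']
    else [::]
  else [:: [::]].

Lemma sum_allpair (R : realType) (F : {set {set T}} -> R) n s : size s = n.*2 -> uniq s ->
  \sum_(M in pairs [set x in s]) F M = \sum_(E <- allpair n s) F (esetE E).
Proof.
elim: n s F => [|n IH] s F.
  case: s => // _ _; rewrite /= big_seq1 (big_pred1 set0).
    congr F; apply/setP => x; rewrite inE; apply/esym/imsetP; by case.
  move=> M; rewrite (_ : [set x in [::]] = set0 :> {set T}); last by apply/setP => x; rewrite !inE.
  apply/pairsP/eqP => [[]|->]; first by rewrite partition_set0 => /eqP.
  by rewrite partition_set0 eqxx; split=> // e; rewrite inE.
case: s => // x s; rewrite [LHS]/=; case=> ss /andP[xs us].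
rewrite (sum_pairs_rec _ (x := x)) ?inE ?eqxx// big_flatten big_map /=.
have -> : [set y in x :: s] :\ x = [set y in s].
  by apply/setP => y; rewrite !inE; have [->|] := eqVneq y x => //=; rewrite (negPf xs).
rewrite [RHS](big_uniq _ us) /=.
apply: eq_big => [y|y]; first by rewrite inE.
rewrite inE => ys; rewrite big_map.
have -> : [set z in s] :\ y = [set z in rem y s].
  by apply/setP => z; rewrite !inE mem_rem_uniq// !inE.
rewrite IH ?rem_uniq//; last by rewrite size_rem// ss.
by apply: eq_bigr => E _; rewrite esetE_cons.
Qed.

Lemma allpair_perm n s E : size s = n.*2 -> E \in allpair n s -> perm_eq (flat E) s.
Proof.
elim: n s E => [|n IH] [|x s] E //=; first by move=> _; rewrite inE => /eqP ->.
case=> ss /flattenP[L /mapP[y ys ->] /mapP[E' E'in ->]].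
rewrite flat_cons perm_cons perm_sym (permPl (perm_to_rem ys)) perm_cons perm_sym.
by apply: IH => //; rewrite size_rem// ss.
Qed.

Lemma allpair_size n s E : size s = n.*2 -> E \in allpair n s -> size E = n.
Proof.
elim: n s E => [|n IH] [|x s] E //=; first by move=> _; rewrite inE => /eqP ->.
case=> ss /flattenP[L /mapP[y ys ->] /mapP[E' E'in ->]] /=.
by congr S; apply: IH E'in; rewrite size_rem// ss.
Qed.

Lemma allpair_neq0 n s : size s = n.*2 -> allpair n s != [::].
Proof.
elim: n s => [|n IH] [|x s] //= [ss].
case: s ss => // y s /= [ss].
rewrite eqxx; have := IH s ss; by case: (allpair n s).
Qed.

End pairs.
End Pairings.

(** * Inserting the vertices of degree 2 one at a time *)

Module Structures.
Import mathcomp.boot.fintype mathcomp.boot.finset.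
Local Open Scope set_scope.
Export Pairings.
Section structures.
Variables (T V : finType) (tg : T -> V).
Implicit Types (x y a b : T) (E es : seq (T * T)).

Definition comp : Type := (bool * seq (T * T))%type.
Implicit Types (D : seq comp) (c : comp).

Definition edgesD D : seq (T * T) := flatten [seq c.2 | c <- D].
Definition shapeD D : shape := [seq (c.1, size c.2) | c <- D].

(** All subdivisions of an edge of the list by a vertex with half-edges [a] and [b], each edge in
    its two ways. *)
Fixpoint insE a b es : seq (seq (T * T)) :=
  if es is e :: es' then
    ((e.1, a) :: (b, e.2) :: es') :: ((e.1, b) :: (a, e.2) :: es')
      :: [seq e :: u | u <- insE a b es']
  else [::].

Fixpoint insD a b D : seq (seq comp) :=
  if D is c :: D' then
    [seq (c.1, u) :: D' | u <- insE a b c.2] ++ [seq c :: v | v <- insD a b D']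
  else [::].

Definition next a b D : seq (seq comp) := ((false, [:: (a, b)]) :: D) :: insD a b D.

Lemma insEP a b es u : u \in insE a b es ->
  exists es1 x y es2 a' b', [/\ es = es1 ++ (x, y) :: es2,
    u = es1 ++ (x, a') :: (b', y) :: es2 & (a', b') = (a, b) \/ (a', b') = (b, a)].
Proof.
elim: es u => // -[x y] es IH u; rewrite !inE => /or3P[/eqP ->|/eqP ->|].
- by exists [::], x, y, es, a, b; split=> //; left.
- by exists [::], x, y, es, b, a; split=> //; right.
case/mapP => w /IH[es1 [x' [y' [es2 [a' [b' [-> -> h]]]]]]] ->.
by exists ((x, y) :: es1), x', y', es2, a', b'.
Qed.

Lemma insDP a b D D' : D' \in insD a b D ->
  exists D1 c u D2, [/\ D = D1 ++ c :: D2, D' = D1 ++ (c.1, u) :: D2 & u \in insE a b c.2].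
Proof.
elim: D D' => // c D IH D'; rewrite mem_cat => /orP[/mapP[u uin ->]|/mapP[v /IH]].
  by exists [::], c, u, D.
by case=> [D1 [c' [u [D2 [-> -> h]]]]] ->; exists (c :: D1), c', u, D2.
Qed.

Section sums.
Variables (R : realType) (F : {set {set T}} -> R) (a b : T).

Definition subd (M : {set {set T}}) x y : R :=
  F ([set a; x] |: ([set b; y] |: (M :\ [set x; y]))).

Lemma flat_perm E E' : perm_eq E E' -> perm_eq (flat E) (flat E').
Proof. by move=> h; apply: perm_flatten; apply: perm_map. Qed.

Lemma esetE_split E1 x y E2 : uniq (flat (E1 ++ (x, y) :: E2)) ->
  esetE (E1 ++ (x, y) :: E2) :\ [set x; y] = esetE (E1 ++ E2).
Proof.
have p : perm_eq (E1 ++ (x, y) :: E2) ((x, y) :: (E1 ++ E2)).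
  by rewrite perm_catC /= perm_cons perm_catC.
rewrite (perm_uniq (flat_perm p)) (esetE_perm (perm_mem p)) => /=.
rewrite inE negb_or => /andP[/andP[_ xE] _].
by rewrite esetE_cons setU1K// esetE_notin.
Qed.

Lemma esetE_ins E1 E2 x y x' y' :
  esetE (E1 ++ (x, y) :: (x', y') :: E2) =
  [set x; y] |: ([set x'; y'] |: esetE (E1 ++ E2)).
Proof.
rewrite (esetE_perm (E' := (x, y) :: (x', y') :: (E1 ++ E2))) ?esetE_cons//.
by apply: perm_mem; rewrite perm_catC /= !perm_cons perm_catC.
Qed.

Lemma pairC x y : [set x; y] = [set y; x]. Proof. by rewrite setUC. Qed.

Lemma sum_insE E1 es E2 : uniq (flat (E1 ++ es ++ E2)) ->
  \sum_(u <- insE a b es) F (esetE (E1 ++ u ++ E2)) =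
  \sum_(e <- es) (subd (esetE (E1 ++ es ++ E2)) e.1 e.2 + subd (esetE (E1 ++ es ++ E2)) e.2 e.1).
Proof.
elim: es E1 => [|[x y] es IH] E1 un; first by rewrite !big_nil.
rewrite /= !big_cons big_map /= addrA; congr (_ + _ + _).
- by rewrite /subd esetE_split// esetE_ins (pairC a).
- by rewrite /subd (pairC y) esetE_split// esetE_ins (pairC b) setUCA.
have := IH (rcons E1 (x, y)); rewrite !cat_rcons => /(_ un) <-.
by apply: eq_bigr => u _; rewrite cat_rcons.
Qed.

Lemma sum_insD E1 D : uniq (flat (E1 ++ edgesD D)) ->
  \sum_(D' <- insD a b D) F (esetE (E1 ++ edgesD D')) =
  \sum_(e <- edgesD D) (subd (esetE (E1 ++ edgesD D)) e.1 e.2 + subd (esetE (E1 ++ edgesD D)) e.2 e.1).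
Proof.
elim: D E1 => [|c D IH] E1 un; first by rewrite !big_nil.
rewrite /= big_cat !big_map /= {3}/edgesD /= -/(edgesD D) big_cat /=.
congr (_ + _); first exact: sum_insE.
have := IH (E1 ++ c.2); rewrite -!catA => /(_ un) <-.
by apply: eq_bigr => u _; rewrite -catA.
Qed.

Lemma uniq_edge E e : uniq (flat E) -> e \in E -> e.1 != e.2.
Proof.
elim: E => //= f E IH; rewrite inE negb_or -andbA => /and4P[f12 _ _ un].
by rewrite inE => /predU1P[->|/IH]; [|exact].
Qed.

Lemma sum_edges E (G : T -> T -> R) : uniq (flat E) ->
  \sum_(x in [set x in flat E]) \sum_(y in [set x in flat E] :\ x | [set x; y] \in esetE E) G x y =
  \sum_(e <- E) (G e.1 e.2 + G e.2 e.1).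
Proof.
move=> un; have EP := esetE_pairs un.
transitivity (\sum_(x <- flat E) \sum_(y in [set x in flat E] :\ x | [set x; y] \in esetE E) G x y).
  by rewrite [RHS](big_uniq _ un) /=; apply: eq_bigl => x; rewrite inE.
rewrite /flat big_flatten big_map /= -/(flat E) big_seq [RHS]big_seq.
apply: eq_bigr => e eE; have /andP[f1 f2] := mem_flat eE.
have ne := uniq_edge un eE.
have eM : [set e.1; e.2] \in esetE E by apply/imsetP; exists e.
rewrite big_cons big_seq1; congr (_ + _).
  rewrite (big_pred1 e.2)// => y; apply/andP/eqP => [[yA yM]|->].
    by apply: (pairs_partner_uniq EP _ _ yM eM); [move: yA; rewrite !inE => /andP[] | rewrite eq_sym].
  by rewrite !inE eq_sym ne f2.
rewrite (big_pred1 e.1)// => y; rewrite (pairC e.2); apply/andP/eqP => [[yA yM]|->].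
  rewrite pairC in yM; rewrite pairC in eM.
  by apply: (pairs_partner_uniq EP _ ne yM eM); move: yA; rewrite !inE => /andP[].
by split; [rewrite !inE ne f1 | exact: eM].
Qed.

Hypothesis ab : a != b.

Lemma sum_pairs_next (A : {set T}) (full : seq (seq comp)) :
  a \notin A -> b \notin A ->
  (forall D, D \in full -> uniq (flat (edgesD D)) /\ A = [set x in flat (edgesD D)]) ->
  (forall F' : {set {set T}} -> R, \sum_(M in pairs A) F' M = \sum_(D <- full) F' (esetE (edgesD D))) ->
  \sum_(M in pairs (a |: (b |: A))) F M =
  \sum_(D <- flatten [seq next a b D | D <- full]) F (esetE (edgesD D)).
Proof.
move=> aA bA hD hF; rewrite sum_pairs_insert// hF big_flatten big_map /=.
rewrite big_seq [RHS]big_seq; apply: eq_bigr => D DF.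
have [un EA] := hD D DF; rewrite big_cons /=; congr (_ + _).
  by rewrite [edgesD _]/= esetE_cons.
by rewrite EA (sum_edges (subd (esetE (edgesD D))))// -(sum_insD (E1 := [::])).
Qed.

End sums.

Lemma size_insE a b es u : u \in insE a b es -> size u = (size es).+1.
Proof. by case/insEP=> es1 [x [y [es2 [a' [b' [-> -> _]]]]]]; rewrite !size_cat /= !addnS. Qed.

(** Both subdivisions of each of the [c.2] edges of a component lengthen it by one: this is the
    transition of the chain on shapes. *)
Lemma sum_insD_shape (R : realType) a b D (Phi : shape -> R) :
  \sum_(D' <- insD a b D) Phi (shapeD D') = 2 * grow_sum Phi (shapeD D).
Proof.
elim: D Phi => [|c D IH] Phi /=; first by rewrite big_nil mulr0.
rewrite big_cat !big_map /= (IH (fun u => Phi ((c.1, size c.2) :: u))) mulrDr; congr (_ + _).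
transitivity (\sum_(u <- insE a b c.2) Phi ((c.1, (size c.2).+1) :: shapeD D)).
  by rewrite big_seq [RHS]big_seq; apply: eq_bigr => u /size_insE /= ->.
have sz : size (insE a b c.2) = (2 * size c.2)%N.
  by elim: c.2 => //= e es IHe; rewrite size_map IHe mulnS.
by rewrite big_const_seq count_predT iter_addr_0 -(mulr_natl (Phi _)) sz natrM mulrA.
Qed.

Lemma sum_next_shape (R : realType) a b D (Phi : shape -> R) (k n : nat) :
  \sum_(D' <- next a b D) Phi (shapeD D') = mass R k n * step (mass R k n) Phi (shapeD D).
Proof.
rewrite /next big_cons sum_insD_shape /step /= mulrCA divff ?mulr1//.
by rewrite gt_eqF// mass_gt0.
Qed.

Definition adj (e e' : T * T) := tg e.2 == tg e'.1.
Definition wfc c := (c.2 != [::]) && (if c.1 then sorted adj c.2 else cycle adj c.2).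
Definition verts c : seq V :=
  [seq tg e.1 | e <- take c.1 c.2] ++ [seq tg e.2 | e <- c.2].
(** The component list describes a pairing of the half-edges [H] in which the vertices [W]
    appear once each along the components. *)
Definition good (H : seq T) (W : seq V) D :=
  [&& perm_eq (flat (edgesD D)) H, perm_eq (flatten [seq verts c | c <- D]) W
    & all wfc D].

Lemma path_snd e e' es : e.2 = e'.2 -> path adj e es = path adj e' es.
Proof. by case: es => //= f es ee; rewrite /adj ee. Qed.

Lemma last_snd e e' es : e.2 = e'.2 -> (last e es).2 = (last e' es).2.
Proof. by case: es. Qed.

Lemma wfc_ins a b c u : tg a = tg b -> u \in insE a b c.2 -> wfc c -> wfc (c.1, u).
Proof.
move=> tab /insEP[es1 [x [y [es2 [a' [b' [e -> h]]]]]]] /andP[_].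
have tab' : tg a' = tg b' by case: h => -[-> ->].
have aj : adj (x, a') (b', y) by rewrite /adj /= tab'.
have P : path adj (b', y) es2 = path adj (x, y) es2 by exact: path_snd.
have Lt : adj (last (b', y) es2) =1 adj (last (x, y) es2).
  by move=> f; rewrite /adj (@last_snd _ (x, y)).
rewrite /wfc e /=; case: c.1 => h0; apply/andP; split; try by case: (es1).
  case: es1 {e} h0 => [|e es1] /= h0; first by rewrite aj P.
  move: h0; rewrite !cat_path /= => /and3P[-> h1 h2].
  by rewrite aj P h2 /= !andbT; exact: h1.
case: es1 {e} h0 => [|e es1] /= h0.
  move: h0; rewrite !rcons_path aj P Lt => /andP[-> h2] /=; exact: h2.
move: h0; rewrite !rcons_path !cat_path !last_cat /= => /andP[/and3P[-> h1 h2] h3].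
rewrite aj P Lt h2 h3 /= !andbT; exact: h1.
Qed.

Lemma verts_ins a b c u : tg a = tg b -> u \in insE a b c.2 ->
  perm_eq (verts (c.1, u)) (tg a :: verts c).
Proof.
move=> tab /insEP[es1 [x [y [es2 [a' [b' [e -> h]]]]]]].
have ta' : tg a' = tg a by case: h => -[-> _].
rewrite /verts e /=.
have -> : [seq tg e0.1 | e0 <- take c.1 (es1 ++ (x, a') :: (b', y) :: es2)] =
   [seq tg e0.1 | e0 <- take c.1 (es1 ++ (x, y) :: es2)].
  by case: c.1; case: es1 {e} => [|f es1] /=; rewrite ?take0.
rewrite -[tg a :: _ ++ _]cat1s perm_sym perm_catCA perm_cat2l cat1s !map_cat /=.
by rewrite ta' perm_sym -cat1s perm_catCA.
Qed.

Lemma flat_ins a b c u : u \in insE a b c.2 ->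
  perm_eq (flat u) [:: a, b & flat c.2].
Proof.
move=> /insEP[es1 [x [y [es2 [a' [b' [-> -> h]]]]]]].
rewrite !flat_cat !flat_cons /=.
have p : perm_eq [:: a, b & flat es1 ++ [:: x, y & flat es2]] [:: a', b' & flat es1 ++ [:: x, y & flat es2]].
  case: h => -[-> ->] //; by rewrite -(cat1s b) -(cat1s a) perm_catCA.
rewrite perm_sym (permPl p) -[[:: a', b' & _]]/([:: a'; b'] ++ _) perm_catCA perm_cat2l /=.
rewrite -(cat1s a') -(cat1s b') -(cat1s x) -(cat1s y).
apply/permP => P; rewrite !count_cat /=; lia.
Qed.

Lemma edgesD_cat D D' : edgesD (D ++ D') = edgesD D ++ edgesD D'.
Proof. by rewrite /edgesD map_cat flatten_cat. Qed.

Lemma edgesD_cons c D : edgesD (c :: D) = c.2 ++ edgesD D. Proof. by []. Qed.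

Lemma good_next a b H W D D' : tg a = tg b -> good H W D -> D' \in next a b D ->
  good [:: a, b & H] (tg a :: W) D'.
Proof.
move=> tab /and3P[pH pW wf]; rewrite inE => /orP[/eqP ->|].
  apply/and3P; split=> /=.
  - by rewrite [edgesD _]/= flat_cons !perm_cons.
  - by rewrite /verts /= tab perm_cons.
  - by rewrite /wfc /= /adj /= tab eqxx.
case/insDP=> D1 [c [u [D2 [eD -> uin]]]]; subst D.
apply/and3P; split.
- move: pH; rewrite !edgesD_cat !edgesD_cons !flat_cat => pH.
  have := flat_ins uin => p.
  apply: (@perm_trans _ ([:: a; b] ++ flat (edgesD D1) ++ flat c.2 ++ flat (edgesD D2))); last by rewrite !perm_cons.
  by rewrite perm_sym perm_catCA perm_cat2l perm_sym catA perm_cat2r.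
- move: pW; rewrite !map_cat !flatten_cat /= => pW.
  have := verts_ins tab uin => p.
  apply: (@perm_trans _ ([:: tg a] ++ flatten [seq verts c | c <- D1] ++ verts c ++ flatten [seq verts c | c <- D2])); last by rewrite perm_cons.
  by rewrite perm_sym perm_catCA perm_cat2l perm_sym catA perm_cat2r.
- move: wf; rewrite !all_cat /= => /and3P[-> w ->]; rewrite andbT /=; exact: wfc_ins uin w.
Qed.

Fixpoint fullD (base : seq (seq comp)) (tw : seq (T * T)) : seq (seq comp) :=
  if tw is ab :: tw' then
    flatten [seq next ab.1 ab.2 D | D <- fullD base tw']
  else base.

Definition baseD k (leaves : seq T) : seq (seq comp) :=
  [seq [seq (true, [:: e]) | e <- E] | E <- allpair k leaves].

Section law.
Variables (R : realType) (k : nat) (leaves : seq T) (twos : seq (T * T)).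
Hypothesis size_leaves : size leaves = k.*2.
Hypothesis twos_tg : forall e, e \in twos -> tg e.1 = tg e.2.

Lemma edgesD_base E : edgesD [seq (true, [:: e]) | e <- E] = E.
Proof. by elim: E => //= e E IH; rewrite /edgesD /= -/(edgesD _) IH. Qed.

Lemma good_base D : D \in baseD k leaves -> good leaves [seq tg x | x <- leaves] D.
Proof.
case/mapP=> E Ein ->; have p := allpair_perm size_leaves Ein.
apply/and3P; split; first by rewrite edgesD_base.
  have -> : flatten [seq verts c | c <- [seq (true, [:: e]) | e <- E]] = [seq tg x | x <- flat E].
    by elim: {Ein p} E => //= e E ->.
  exact: perm_map.
by apply/allP => c /mapP[e _ ->].
Qed.

Lemma good_full D : D \in fullD (baseD k leaves) twos ->
  good (flat twos ++ leaves) ([seq tg e.1 | e <- twos] ++ [seq tg x | x <- leaves]) D.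
Proof.
elim: twos twos_tg D => [|ab tw IH] htw D /=; first exact: good_base.
case/flattenP=> L /mapP[D0 D0in ->]; apply: good_next.
  by apply: htw; rewrite inE eqxx.
by apply: IH => // e etw; apply: htw; rewrite inE etw orbT.
Qed.

(** Iterating the insertion of a vertex of degree 2, starting from pairings of the leaves. *)
Lemma sum_full (F : {set {set T}} -> R) : uniq (flat twos ++ leaves) ->
  \sum_(M in pairs [set x in flat twos ++ leaves]) F M =
  \sum_(D <- fullD (baseD k leaves) twos) F (esetE (edgesD D)).
Proof.
elim: twos twos_tg F => [|ab tw IH] htw F /= un.
  rewrite /baseD big_map (sum_allpair _ size_leaves un).
  by apply: eq_bigr => E _; rewrite edgesD_base.
case/andP: un; rewrite inE negb_or => /andP[ab12 a1] /andP[b1 un].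
have htw' : forall e, e \in tw -> tg e.1 = tg e.2.
  by move=> e etw; apply: htw; rewrite inE etw orbT.
have -> : [set x in [:: ab.1, ab.2 & flat tw] ++ leaves] =
    ab.1 |: (ab.2 |: [set x in flat tw ++ leaves]).
  by apply/setP => x; rewrite !inE.
apply: sum_pairs_next => //.
- by rewrite inE.
- by rewrite inE.
- move=> D Din.
  have g : good (flat tw ++ leaves) ([seq tg e.1 | e <- tw] ++ [seq tg x | x <- leaves]) D.
    elim: tw htw' D Din {IH htw a1 b1 un} => [|ab' tw IH] htw D /=; first exact: good_base.
    case/flattenP=> L /mapP[D0 D0in ->]; apply: good_next.
      by apply: htw; rewrite inE eqxx.
    by apply: IH => // e etw; apply: htw; rewrite inE etw orbT.
  case/and3P: g => p _ _; split; first by rewrite (perm_uniq p).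
  by apply/setP => x; rewrite !inE (perm_mem p).
- by move=> F'; exact: IH.
Qed.

Lemma sum_full_shape (Phi : shape -> R) :
  \sum_(D <- fullD (baseD k leaves) twos) Phi (shapeD D) =
  (size (fullD (baseD k leaves) twos))%:R * Ex k (size twos) Phi.
Proof.
elim: twos Phi => [|ab tw IH] Phi /=.
  rewrite /baseD big_map size_map big_seq.
  transitivity (\sum_(E <- allpair k leaves) Phi (nseq k (true, 1%N))).
    rewrite [RHS]big_seq; apply: eq_bigr => E Ein; congr Phi.
    rewrite -(allpair_size size_leaves Ein) /shapeD -map_comp.
    by elim: {Ein} E => //= e E ->.
  by rewrite big_const_seq count_predT iter_addr_0 mulr_natl.
have key Psi : \sum_(D <- flatten [seq next ab.1 ab.2 D | D <- fullD (baseD k leaves) tw]) Psi (shapeD D)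
   = mass R k (size tw) * ((size (fullD (baseD k leaves) tw))%:R * Ex k (size tw) (step (mass R k (size tw)) Psi)).
  rewrite big_flatten big_map -IH mulr_sumr; apply: eq_bigr => D _; exact: sum_next_shape.
rewrite key; have := key (fun=> 1).
rewrite big_const_seq count_predT iter_addr_0 => ->.
by rewrite -[Ex k (size tw) (step _ (fun=> 1))]/(Ex k (size tw).+1 (fun=> 1)) Ex_cst mulr1 -mulrA.
Qed.

Lemma size_full_gt0 : (0 < size (fullD (baseD k leaves) twos))%N.
Proof.
elim: twos => [|ab tw IH] /=.
  by rewrite /baseD size_map lt0n size_eq0 allpair_neq0.
by case: (fullD _ tw) IH => // D l _ /=.
Qed.

Theorem pairing_law (F : {set {set T}} -> R) (Phi : shape -> R) :
  uniq (flat twos ++ leaves) -> (forall x, x \in flat twos ++ leaves) ->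
  (forall D, good (flat twos ++ leaves) ([seq tg e.1 | e <- twos] ++ [seq tg x | x <- leaves]) D ->
     F (esetE (edgesD D)) = Phi (shapeD D)) ->
  (\sum_(M in pairs [set: T]) F M) / #|pairs [set: T]|%:R = Ex k (size twos) Phi.
Proof.
move=> un cov hF.
have <- : [set x in flat twos ++ leaves] = [set: T] by apply/setP => x; rewrite !inE cov.
have -> : #|pairs [set x in flat twos ++ leaves]|%:R = (size (fullD (baseD k leaves) twos))%:R :> R.
  rewrite -sum1_card natr_sum (sum_full (fun=> 1))//.
  by rewrite big_const_seq count_predT iter_addr_0.
rewrite sum_full//.
have -> : \sum_(D <- fullD (baseD k leaves) twos) F (esetE (edgesD D)) =
  \sum_(D <- fullD (baseD k leaves) twos) Phi (shapeD D).
  by rewrite big_seq [RHS]big_seq; apply: eq_bigr => D /good_full /hF.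
rewrite sum_full_shape mulrAC divff ?mul1r// pnatr_eq0 -lt0n; exact: size_full_gt0.
Qed.

End law.
End structures.
End Structures.

(** * Transfer matrices and the law of the component lengths *)

Module Transfer.
Import mathcomp.boot.fintype mathcomp.boot.finset.
Local Open Scope set_scope.
Export Structures.

Section isum.
Variables (R : realType) (V : finType).
Implicit Types (s : {ffun V -> bool}) (l : seq V) (G : {ffun V -> bool} -> R).

Definition upd v (t : bool) s : {ffun V -> bool} := [ffun x => if x == v then t else s x].

(** Sum over the spins of the vertices of [l] only, so that spins can be summed out along a
    component one after the other. *)
Fixpoint isum l G s : R :=
  if l is v :: l' then isum l' G (upd v true s) + isum l' G (upd v false s) else G s.

Definition agree l s : pred {ffun V -> bool} := fun t => [forall x, (x \notin l) ==> (t x == s x)].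

Lemma isumE l G s : uniq l -> isum l G s = \sum_(t | agree l s t) G t.
Proof.
elim: l s => [|v l IH] s /=.
  rewrite (big_pred1 s)// => t; apply/forallP/eqP => [h|-> x]; last by rewrite eqxx implybT.
  by apply/ffunP => x; apply/eqP; have := h x.
case/andP=> vl ul; rewrite !IH// [RHS](bigID (fun t : {ffun V -> bool} => t v)) /=.
have H b t : agree l (upd v b s) t = agree (v :: l) s t && (t v == b).
  apply/forallP/andP => [h|[/forallP h tv] x].
    have tv : t v == b by have := h v; rewrite vl ffunE eqxx.
    split=> //; apply/forallP => x; rewrite inE negb_or; apply/implyP => /andP[xv xl].
    by have := h x; rewrite xl ffunE (negPf xv).
  rewrite ffunE; have [->|xv] := eqVneq x v; first by rewrite tv implybT.
  by have := h x; rewrite inE negb_or xv.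
by congr (_ + _); apply: eq_bigl => t; rewrite H; case: (t v).
Qed.

Lemma isum_all l G s : uniq l -> (forall v, v \in l) -> \sum_t G t = isum l G s.
Proof.
move=> ul al; rewrite isumE//; apply: eq_bigl => t; apply/esym/forallP => x.
by rewrite al.
Qed.

Lemma eq_isum l G G' s : uniq l -> (forall t, agree l s t -> G t = G' t) ->
  isum l G s = isum l G' s.
Proof. by move=> ul h; rewrite !isumE//; apply: eq_bigr. Qed.

Lemma isum_cat l1 l2 G s : isum (l1 ++ l2) G s = isum l1 (isum l2 G) s.
Proof. by elim: l1 s => //= v l IH s; rewrite !IH. Qed.

Lemma isumZ l a G s : isum l (fun t => a * G t) s = a * isum l G s.
Proof. by elim: l s => //= v l IH s; rewrite !IH mulrDr. Qed.

Lemma isumZr l a G s : isum l (fun t => G t * a) s = isum l G s * a.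
Proof. by elim: l s => //= v l IH s; rewrite !IH mulrDl. Qed.

Lemma agree_mem l s t v : agree l s t -> v \notin l -> t v = s v.
Proof. by move=> /forallP/(_ v)/implyP h /h /eqP. Qed.

Variables (beta b : R).

Definition sg (t : bool) : R := if t then 1 else -1.
Definition wgt (t : bool) : R := expR (b * sg t).
Definition ker (t t' : bool) : R := expR (beta * (sg t * sg t')).

Fixpoint chainw v l s : R :=
  if l is u :: l' then ker (s v) (s u) * wgt (s u) * chainw u l' s else 1.

(** Powers of the transfer matrix applied to a function of the spin at the end. *)
Fixpoint tm n (phi : bool -> R) t : R :=
  if n is n'.+1 then ker t true * wgt true * tm n' phi true
                   + ker t false * wgt false * tm n' phi false
  else phi t.

Lemma isum_chain v l (phi : bool -> R) s : uniq (v :: l) ->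
  isum l (fun t => chainw v l t * phi (t (last v l))) s = tm (size l) phi (s v).
Proof.
elim: l v s => [|u l IH] v s /=; first by rewrite mul1r.
case/andP; rewrite inE negb_or => /andP[vu vl] /andP[ul un].
have key t : isum l (fun t => ker (t v) (t u) * wgt (t u) * chainw u l t * phi (t (last u l))) (upd u t s)
   = ker (s v) t * wgt t * tm (size l) phi t.
  transitivity (ker (s v) t * wgt t * tm (size l) phi (upd u t s u)); last by rewrite ffunE eqxx.
  have uu : uniq (u :: l) by rewrite /= ul.
  rewrite -(IH u (upd u t s) uu) -isumZ; apply: eq_isum => // t' ag.
  by rewrite (agree_mem ag vl) (agree_mem ag ul) !ffunE eqxx (negPf vu) !mulrA.
by rewrite !key.
Qed.

Definition zpath e : R := wgt true * tm e (fun=> 1) true + wgt false * tm e (fun=> 1) false.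
Definition zcyc e : R := wgt true * tm e.-1 (fun t => ker t true) true
  + wgt false * tm e.-1 (fun t => ker t false) false.

Lemma isum_path v l s : uniq (v :: l) ->
  isum (v :: l) (fun t => wgt (t v) * chainw v l t) s = zpath (size l).
Proof.
move=> un; have /andP[vl ul] := un; rewrite /= /zpath.
have key t : isum l (fun t => wgt (t v) * chainw v l t) (upd v t s) = wgt t * tm (size l) (fun=> 1) t.
  transitivity (wgt t * tm (size l) (fun=> 1) (upd v t s v)); last by rewrite ffunE eqxx.
  rewrite -(isum_chain _ _ un) -isumZ; apply: eq_isum => // t' ag.
  by rewrite (agree_mem ag vl) !ffunE eqxx mulr1.
by rewrite !key.
Qed.

Lemma isum_cycle v l s : uniq (v :: l) ->
  isum (v :: l) (fun t => wgt (t v) * chainw v l t * ker (t (last v l)) (t v)) s = zcyc (size l).+1.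
Proof.
move=> un; have /andP[vl ul] := un; rewrite /= /zcyc.
have key t : isum l (fun t => wgt (t v) * chainw v l t * ker (t (last v l)) (t v)) (upd v t s)
    = wgt t * tm (size l) (fun t' => ker t' t) t.
  transitivity (wgt t * tm (size l) (fun t' => ker t' t) (upd v t s v)); last by rewrite ffunE eqxx.
  rewrite -(isum_chain (fun t' => ker t' t) _ un) -isumZ; apply: eq_isum => // t' ag.
  by rewrite (agree_mem ag vl) !ffunE eqxx mulrA.
by rewrite !key.
Qed.

Lemma chainw_agree v l l2 s t : agree l2 s t -> (forall x, x \in v :: l -> x \notin l2) ->
  chainw v l t = chainw v l s.
Proof.
elim: l v => //= u l IH v ag h.
rewrite (IH u)//; last by move=> x xl; apply: h; rewrite inE xl orbT.
by rewrite !(agree_mem ag) ?h ?inE ?eqxx ?orbT.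
Qed.

End isum.

Section partition.
Variables (R : realType) (T V : finType) (tg : T -> V) (beta b : R).
Implicit Types (s : {ffun V -> bool}) (c : comp T) (D : seq (comp T)).

Definition zc (c : bool * nat) : R := if c.1 then zpath beta b c.2 else zcyc beta b c.2.
Definition zshape (sh : shape) : R := \prod_(c <- sh) zc c.

Definition wcomp c s : R :=
  expR (beta * (\sum_(e <- c.2) sg R (s (tg e.1)) * sg R (s (tg e.2)))
        + b * \sum_(v <- verts tg c) sg R (s v)).

Lemma wcomp_chain (e : T * T) es s : path (adj tg) e es ->
  expR (beta * (\sum_(f <- es) sg R (s (tg f.1)) * sg R (s (tg f.2)))
        + b * \sum_(f <- es) sg R (s (tg f.2)))
  = chainw beta b (tg e.2) [seq tg f.2 | f <- es] s.
Proof.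
elim: es e => [|f es IH] e /=; first by rewrite !big_nil !mulr0 addr0 expR0.
case/andP=> /eqP ef pes; rewrite !big_cons -(IH f pes) /ker /wgt -!expRD ef; congr expR; ring.
Qed.

Definition cweight (p : bool) (l : seq V) s : R :=
  if l is v :: l' then wgt b (s v) * chainw beta b v l' s *
     (if p then 1 else ker beta (s (last v l')) (s v)) else 1.

Lemma wcompE c s : wfc tg c -> wcomp c s = cweight c.1 (verts tg c) s.
Proof.
case: c => p [|e es] /andP[//= _]; rewrite /wcomp /verts.
case: p => /= h; rewrite ?take0 /=.
  rewrite !big_cons -(wcomp_chain _ h) big_map /ker /wgt mulr1 mulrA -!expRD; congr expR; ring.
move: h; rewrite rcons_path => /andP[h /eqP hl].
rewrite !big_cons -(wcomp_chain _ h) big_map /ker /wgt.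
rewrite last_map -hl -!expRD; congr expR; ring.
Qed.

Lemma cweight_agree p l l2 s t : agree l2 s t -> (forall x, x \in l -> x \notin l2) ->
  cweight p l t = cweight p l s.
Proof.
case: l => //= v l ag h; rewrite (chainw_agree _ _ ag h).
have hv : t v = s v by apply: (agree_mem ag); apply: h; rewrite inE eqxx.
have hl : t (last v l) = s (last v l) by apply: (agree_mem ag); apply: h; exact: mem_last.
by rewrite hv hl.
Qed.

Lemma isum_cweight c s : wfc tg c -> uniq (verts tg c) ->
  isum (verts tg c) (cweight c.1 (verts tg c)) s = zc (c.1, size c.2).
Proof.
case: c => p [|e es] /andP[//= _]; case: p => _.
  have -> : verts tg (true, e :: es) = tg e.1 :: [seq tg f.2 | f <- e :: es].
    by rewrite /verts /= take0.
  move=> un; transitivity (zpath beta b (size (e :: es))); last by [].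
  have := isum_path beta b s un; rewrite size_map => <-.
  by apply: eq_isum => // t _; rewrite /cweight mulr1.
have -> : verts tg (false, e :: es) = tg e.2 :: [seq tg f.2 | f <- es] by [].
move=> un; transitivity (zcyc beta b (size es).+1); last by [].
by have := isum_cycle beta b s un; rewrite size_map => <-.
Qed.

Lemma isum_prod D s : all (wfc tg) D -> uniq (flatten [seq verts tg c | c <- D]) ->
  isum (flatten [seq verts tg c | c <- D]) (fun t => \prod_(c <- D) wcomp c t) s =
  zshape (shapeD D).
Proof.
rewrite /zshape; elim: D s => [|c D IH] s /=; first by rewrite !big_nil.
case/andP=> wc wD; rewrite cat_uniq => /and3P[uc nh uD].
rewrite isum_cat big_cons -(isum_cweight s wc uc) -isumZr.
apply: eq_isum => // t _.
rewrite -(IH t wD uD) -isumZ; apply: eq_isum => // t' ag.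
rewrite big_cons wcompE//; congr (_ * _); apply: cweight_agree ag _ => x xc.
by apply: contraNN nh => xD; apply/hasP; exists x.
Qed.

Lemma sum_esetE (E : seq (T * T)) (f : {set T} -> R) : uniq (flat E) ->
  \sum_(e in esetE E) f e = \sum_(e <- E) f [set e.1; e.2].
Proof.
elim: E => [|e E IH] /=.
  by rewrite big_nil big_pred0// => B; apply/imsetP => -[].
rewrite inE negb_or -andbA => /and4P[_ e1 _ un].
by rewrite esetE_cons big_setU1 ?esetE_notin//= IH// big_cons.
Qed.

Lemma prod_pair (x y : T) (f : T -> R) : x != y -> \prod_(h in [set x; y]) f h = f x * f y.
Proof. by move=> xy; rewrite big_setU1 ?inE// big_set1. Qed.

(** The Boltzmann weight is a product over the components, which involve disjoint sets of
    vertices. *)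
Lemma zshape_partition (H : seq T) (W : seq V) D : uniq H -> uniq W -> (forall v, v \in W) ->
  good tg H W D ->
  \sum_(s : {ffun V -> bool})
    expR (beta * (\sum_(e in esetE (edgesD D)) \prod_(h in e) sg R (s (tg h)))
          + b * \sum_(v : V) sg R (s v)) = zshape (shapeD D).
Proof.
move=> uH uW cW /and3P[pH pW wf].
have un : uniq (flat (edgesD D)) by rewrite (perm_uniq pH).
have uv : uniq (flatten [seq verts tg c | c <- D]) by rewrite (perm_uniq pW).
have cv v : v \in flatten [seq verts tg c | c <- D] by rewrite (perm_mem pW).
rewrite (isum_all _ [ffun=> true] uv cv) -(isum_prod [ffun=> true] wf uv).
apply: eq_isum => // s _; rewrite (sum_esetE _ un) /wcomp -expR_sum; congr expR.
rewrite big_split /= -!mulr_sumr; congr (beta * _ + b * _).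
  rewrite /edgesD big_flatten big_map [LHS]big_seq [RHS]big_seq.
  apply: eq_bigr => c cD.
  rewrite big_seq [RHS]big_seq; apply: eq_bigr => e ec; rewrite prod_pair//.
  apply: (uniq_edge un); apply/flattenP; exists c.2 => //.
  by apply/mapP; exists c.
transitivity (\sum_(v <- flatten [seq verts tg c | c <- D]) sg R (s v)).
  by rewrite [RHS](big_uniq _ uv) /=; apply: eq_bigl => v; rewrite cv.
by rewrite big_flatten big_map.
Qed.

End partition.

Section half_edges.
Variables (N : nat) (d : 'I_N -> nat).
Local Notation H := (half_edge d).
Implicit Types (l : seq 'I_N).

Definition mkH (i : 'I_N) (x : 'I_(d i)) : H := Tagged (fun j => 'I_(d j)) x.

Lemma leaves_exist l : uniq l -> (forall i, i \in l -> d i = 1%N) ->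
  exists L : seq H, map tag L = l /\ forall h, (h \in L) = (tag h \in l).
Proof.
elim: l => [|i l IH] /=; first by exists [::].
case/andP=> il ul hd; have [L [tL mL]] : exists L : seq H, map tag L = l /\ forall h, (h \in L) = (tag h \in l).
  by apply: IH => // j jl; apply: hd; rewrite inE jl orbT.
have di : d i = 1%N by apply: hd; rewrite inE eqxx.
exists (mkH (cast_ord (esym di) ord0) :: L); split; first by rewrite /= tL.
case=> j x; rewrite !inE mL /=; congr (_ || _); apply/eqP/eqP => [/(congr1 (@tag _ _))//|ji].
subst j; congr existT; apply: val_inj => /=.
by have := ltn_ord x; move: (val x) => m; rewrite di; case: m.
Qed.

Lemma twos_exist l : uniq l -> (forall i, i \in l -> d i = 2%N) ->
  exists L : seq (H * H), [/\ [seq tag e.1 | e <- L] = l,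
    forall e, e \in L -> tag e.1 = tag e.2, uniq (flat L)
    & forall h, (h \in flat L) = (tag h \in l)].
Proof.
elim: l => [|i l IH] /=; first by exists [::].
case/andP=> il ul hd; have [L [tL eL uL mL]] : exists L : seq (H * H), [/\ [seq tag e.1 | e <- L] = l,
    forall e, e \in L -> tag e.1 = tag e.2, uniq (flat L)
    & forall h, (h \in flat L) = (tag h \in l)].
  by apply: IH => // j jl; apply: hd; rewrite inE jl orbT.
have di : d i = 2%N by apply: hd; rewrite inE eqxx.
pose a := mkH (cast_ord (esym di) ord0); pose b := mkH (cast_ord (esym di) (@ord_max 1)).
exists ((a, b) :: L); split.
- by rewrite /= tL.
- by move=> e; rewrite inE => /predU1P[->|/eL].
- rewrite flat_cons /= uL inE !mL /= (negPf il) orbF !andbT.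
  by apply/negP => /eqP/(congr1 (fun h : H => nat_of_ord (tagged h))).
case=> j x; rewrite flat_cons !inE mL /= orbA; congr (_ || _).
apply/orP/eqP => [[] /eqP/(congr1 (@tag _ _))//|ji].
subst j; have := ltn_ord x; rewrite {2}di => x2.
case E : (val x) x2 => [|[|m]]// _; [left|right]; apply/eqP; congr existT; apply: val_inj => /=;
  by rewrite -E.
Qed.

End half_edges.

Section CM12.
Variables (R : realType) (p : R) (N : nat).
Hypothesis ev : ~~ odd (n1 p N).
Local Notation d := (@CM12_deg R p N).
Local Notation k := (n1 p N)./2.

(** The components of every pairing can be listed, and the resulting shape determines the
    partition function; averaging over pairings is then averaging over the chain. *)
Lemma CM12_law (n2N : (n2 p N <= N)%N) (F : {set {set half_edge d}} -> R) (Phi : shape -> R) :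
  (forall M sh, (forall beta b : R, partition_function beta b M = zshape beta b sh) -> F M = Phi sh) ->
  CM_expect F = Ex k (n2 p N) Phi.
Proof.
move=> hF.
have ul P : uniq [seq i <- enum 'I_N | P i] by rewrite filter_uniq// enum_uniq.
have h1 : forall i, i \in [seq i : 'I_N <- enum 'I_N | (i < n1 p N)%N] -> d i = 1%N.
  by move=> i; rewrite mem_filter /CM12_deg => /andP[->].
have h2 : forall i, i \in [seq i : 'I_N <- enum 'I_N | ~~ (i < n1 p N)%N] -> d i = 2%N.
  by move=> i; rewrite mem_filter /CM12_deg => /andP[/negPf ->].
have [L [tL mL]] := leaves_exist (ul _) h1.
have [W [tW eW uW mW]] := twos_exist (ul _) h2.
have cL : size L = k.*2.
  have k2 : k.*2 = n1 p N by have := odd_double_half (n1 p N); rewrite (negPf ev).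
  rewrite -[LHS](size_map (@tag _ _)) tL k2 size_filter.
  have -> : count (fun i : 'I_N => (i < n1 p N)%N) (enum 'I_N) =
      count (fun i => (i < n1 p N)%N) (iota 0 N) by rewrite -val_enum_ord count_map.
  have nN : (n1 p N <= N)%N by rewrite /n1 leq_subr.
  rewrite -[X in iota 0 X](subnKC nN) iotaD count_cat.
  rewrite (eq_in_count (a2 := predT)); last by move=> i; rewrite mem_iota add0n.
  rewrite count_predT size_iota (eq_in_count (a2 := pred0)); last first.
    by move=> i; rewrite mem_iota add0n => /andP[h _] /=; rewrite ltnNge h.
  by rewrite count_pred0 addn0.
have cW : size W = n2 p N.
  have : size (L) + size W = N.
    rewrite -[size L](size_map (@tag _ _)) -[size W](size_map (fun e => tag e.1)) tL tW.
    by rewrite !size_filter -[RHS](size_enum_ord N) -(count_predC (fun i : 'I_N => (i < n1 p N)%N)).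
  rewrite cL; have -> : k.*2 = n1 p N by have := odd_double_half (n1 p N); rewrite (negPf ev).
  by rewrite /n1; move: n2N; lia.
have uL : uniq L by rewrite (@map_uniq _ _ (@tag _ _))// tL ul.
have uWL : uniq (flat W ++ L).
  rewrite cat_uniq uW uL andbT /=; apply/hasPn => h; rewrite mL mW !mem_filter.
  by case/andP=> -> _.
have cov h : h \in flat W ++ L.
  by rewrite mem_cat mL mW mem_filter [X in _ || X]mem_filter !mem_enum !andbT orNb.
rewrite /CM_expect -cW -(pairing_law cL eW uWL cov (F := F)) //.
move=> D gD; apply: hF => beta b.
have eV : perm_eq ([seq tag e.1 | e <- W] ++ [seq tag h | h <- L]) (enum 'I_N).
  by rewrite tW tL perm_catC; apply/permPl; exact: perm_filterC.
rewrite -(zshape_partition beta b uWL _ _ gD); last 2 first.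
- by rewrite (perm_uniq eV) enum_uniq.
- by move=> v; rewrite (perm_mem eV) mem_enum.
by [].
Qed.

End CM12.
End Transfer.

(** * Derivatives, Peano expansions and exponential sums *)

Section smooth.
Variable R : realType.
Implicit Types (f g : R -> R) (x b h : R).

Definition D1 f f' := forall b, is_derive b 1 f (f' b).

Lemma D1_eq f f' g' : D1 f f' -> f' =1 g' -> D1 f g'.
Proof. by move=> d e b; apply: is_derive_eq (d b) (e b). Qed.

Lemma D1_cst x : D1 (fun=> x) (fun=> 0). Proof. by move=> b; exact: is_derive_cst. Qed.
Lemma D1_id : D1 (fun b => b) (fun=> 1). Proof. by move=> b; exact: is_derive_id. Qed.

Lemma D1D f f' g g' : D1 f f' -> D1 g g' -> D1 (fun b => f b + g b) (fun b => f' b + g' b).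
Proof. by move=> df dg b; have := df b; have := dg b => ? ?; exact: is_deriveD. Qed.

Lemma D1N f f' : D1 f f' -> D1 (fun b => - f b) (fun b => - f' b).
Proof. by move=> df b; have := df b => ?; exact: is_deriveN. Qed.

Lemma D1M f f' g g' : D1 f f' -> D1 g g' -> D1 (fun b => f b * g b) (fun b => f' b * g b + f b * g' b).
Proof.
move=> df dg b; have := df b; have := dg b => ? ?.
apply: is_derive_eq; rewrite /GRing.scale /=; ring.
Qed.

Lemma D1V f f' : (forall b, f b != 0) -> D1 f f' -> D1 (fun b => (f b)^-1) (fun b => - f' b / f b ^+ 2).
Proof.
move=> f0 df b; have [dv Dv] := df b.
apply: DeriveDef; first exact: derivableV.
by rewrite deriveV// Dv /GRing.scale /= mulNr mulrC mulNr.
Qed.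

Lemma D1_exp f f' : D1 f f' -> D1 (fun b => expR (f b)) (fun b => f' b * expR (f b)).
Proof.
move=> df b; have := df b => ?.
have := is_derive1_comp (is_derive_expR (f b)) (df b).
by move=> h; apply: is_derive_eq h _; rewrite mulrC.
Qed.

Lemma D1_ln f f' : (forall b, 0 < f b) -> D1 f f' -> D1 (fun b => ln (f b)) (fun b => f' b / f b).
Proof.
move=> f0 df b; have := is_derive1_comp (is_derive1_ln (f0 b)) (df b).
by move=> h; apply: is_derive_eq h _; rewrite mulrC.
Qed.

Lemma D1_derive1 f f' : D1 f f' -> derive1 f = f'.
Proof. by move=> d; apply/funext => b; rewrite derive1E; have [_ ->] := d b. Qed.

Definition smooth2 f := exists f' f'', D1 f f' /\ D1 f' f''.

Lemma smooth2_cst x : smooth2 (fun=> x).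
Proof. by exists (fun=> 0), (fun=> 0); split; exact: D1_cst. Qed.

Lemma smooth2_id : smooth2 (fun b => b).
Proof. by exists (fun=> 1), (fun=> 0); split; [exact: D1_id | exact: D1_cst]. Qed.

Lemma smooth2D f g : smooth2 f -> smooth2 g -> smooth2 (fun b => f b + g b).
Proof.
move=> [f1 [f2 [a1 a2]]] [g1 [g2 [b1 b2]]].
by exists (fun b => f1 b + g1 b), (fun b => f2 b + g2 b); split; exact: D1D.
Qed.

Lemma smooth2N f : smooth2 f -> smooth2 (fun b => - f b).
Proof.
move=> [f1 [f2 [a1 a2]]].
by exists (fun b => - f1 b), (fun b => - f2 b); split; exact: D1N.
Qed.

Lemma smooth2M f g : smooth2 f -> smooth2 g -> smooth2 (fun b => f b * g b).
Proof.
move=> [f1 [f2 [a1 a2]]] [g1 [g2 [b1 b2]]].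
exists (fun b => f1 b * g b + f b * g1 b); eexists; split; first exact: D1M.
by apply: D1D; apply: D1M; eassumption.
Qed.

Lemma smooth2V f : (forall b, f b != 0) -> smooth2 f -> smooth2 (fun b => (f b)^-1).
Proof.
move=> f0 [f1 [f2 [a1 a2]]].
exists (fun b => - f1 b / f b ^+ 2); eexists; split; first exact: D1V.
apply: D1M; first exact: D1N a2.
apply: D1V; first by move=> b; rewrite expf_neq0.
under eq_fun do rewrite expr2; exact: (D1M a1 a1).
Qed.

Lemma smooth2_exp f : smooth2 f -> smooth2 (fun b => expR (f b)).
Proof.
move=> [f1 [f2 [a1 a2]]].
exists (fun b => f1 b * expR (f b)); eexists; split; first exact: D1_exp.
apply: D1M; first exact: a2. exact: D1_exp a1.
Qed.

Lemma smooth2_ln f : (forall b, 0 < f b) -> smooth2 f -> smooth2 (fun b => ln (f b)).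
Proof.
move=> f0 [f1 [f2 [a1 a2]]].
exists (fun b => f1 b / f b); eexists; split; first exact: D1_ln.
apply: D1M; first exact: a2. apply: D1V; last exact: a1.
by move=> b; rewrite gt_eqF.
Qed.

Lemma smooth2X f n : smooth2 f -> smooth2 (fun b => f b ^+ n).
Proof.
move=> sf; elim: n => [|n IH]; first by under eq_fun do rewrite expr0; exact: smooth2_cst.
by under eq_fun do rewrite exprS; exact: smooth2M.
Qed.

Lemma peano1 f x l e : is_derive x 1 f l -> 0 < e ->
  exists2 d, 0 < d & forall h, `|h| < d -> `|f (x + h) - f x - h * l| <= e * `|h|.
Proof.
move=> df e0; have [dv Dv] := df.
have : (fun h => h^-1 *: (f (h *: 1 + x) - f x)) @ 0^' --> l.
  by rewrite -Dv; exact: dv.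
move=> /cvgrPdist_le/(_ _ e0); rewrite near_withinE => -[d /= d0 H].
exists d => // h hd; have [->|h0] := eqVneq h 0.
  by rewrite addr0 subrr mul0r subr0 normr0 mulr0.
have := H h; rewrite /ball /= sub0r normrN => /(_ hd h0).
rewrite /GRing.scale /= mulr1 => He.
have -> : f (x + h) - f x - h * l = - (h * (l - h^-1 * (f (h + x) - f x))).
  by rewrite [h + x]addrC; field.
by rewrite normrN normrM mulrC ler_wpM2r.
Qed.

Lemma lip_at f x l : is_derive x 1 f l ->
  exists C d, [/\ 0 <= C, 0 < d & forall h, `|h| < d -> `|f (x + h) - f x| <= C * `|h|].
Proof.
move=> df; have [d d0 H] := peano1 df ltr01.
exists (`|l| + 1), d; split=> //.
move=> h /H hh; have -> : f (x + h) - f x = (f (x + h) - f x - h * l) + h * l by ring.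
apply: le_trans (ler_normD _ _) _; rewrite normrM; lra.
Qed.

(** Only two derivatives are available at hand and no bound on a third one is required,
    whence the Peano form of the remainder. *)
Lemma peano2 f f' f'' x e : D1 f f' -> D1 f' f'' -> 0 < e ->
  exists2 d, 0 < d & forall h, `|h| < d ->
   `|f (x + h) - f x - h * f' x - h ^+ 2 / 2 * f'' x| <= e * h ^+ 2.
Proof.
move=> d1 d2 e0; have [d d0 H] := peano1 (d2 x) e0.
exists d => // h hd.
have := @mvt_ineq R (fun y => f y - y * f' x - (y - x) ^+ 2 / 2 * f'' x)
  (fun y => f' y - f' x - (y - x) * f'' x) x h (e * `|h|).
have -> : f (x + h) - (x + h) * f' x - (x + h - x) ^+ 2 / 2 * f'' x -
   (f x - x * f' x - (x - x) ^+ 2 / 2 * f'' x)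
  = f (x + h) - f x - h * f' x - h ^+ 2 / 2 * f'' x by ring.
have -> : e * h ^+ 2 = e * `|h| * `|h|.
  by rewrite -(real_normK (num_real h)); ring.
apply.
  move=> y _; have := d1 y => ?.
  by apply: is_derive_eq; rewrite /GRing.scale /=; field.
move=> y hy; have := H (y - x); rewrite subrKC => /(_ (le_lt_trans hy hd)) hh.
by apply: le_trans hh _; rewrite ler_wpM2l// ltW.
Qed.

(** Positive combinations of exponentials with frequencies in [[-l, l]]. The derivatives of the
    logarithm are cumulants of a law on that interval, hence bounded by powers of [l]. *)
Definition expsum (l : R) (z : R -> R) := exists L : seq (R * R),
  [/\ L != [::], forall i, i \in L -> 0 < i.1 /\ `|i.2| <= l
    & z = fun b => \sum_(i <- L) i.1 * expR (i.2 * b)].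

Lemma expsumD l z z' : expsum l z -> expsum l z' -> expsum l (fun b => z b + z' b).
Proof.
move=> [L [L0 hL ->]] [L' [L0' hL' ->]]; exists (L ++ L'); split.
- by case: (L) L0.
- by move=> i; rewrite mem_cat => /orP[/hL|/hL'].
- by apply/funext => b; rewrite big_cat.
Qed.

Lemma expsumZ l (w s : R) z : 0 < w -> expsum l z ->
  expsum (l + `|s|) (fun b => w * expR (s * b) * z b).
Proof.
move=> w0 [L [L0 hL ->]]; exists [seq (w * i.1, s + i.2) | i <- L]; split.
- by case: (L) L0.
- move=> i /mapP[j /hL [j1 j2] ->] /=; split; first by rewrite mulr_gt0.
  by apply: le_trans (ler_normD _ _) _; rewrite addrC lerD2r.
- apply/funext => b; rewrite big_map mulr_sumr; apply: eq_bigr => i _ /=.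
  by rewrite mulrDl expRD; ring.
Qed.

Lemma expsum1 (w : R) : 0 < w -> expsum 0 (fun=> w).
Proof.
move=> w0; exists [:: (w, 0)]; split=> //.
  by move=> i; rewrite inE => /eqP -> /=; rewrite normr0.
by apply/funext => b; rewrite big_seq1 mul0r expR0 mulr1.
Qed.

(** The three derivatives are the mean, the variance and the third cumulant of a frequency
    drawn proportionally to its weight at [b]. *)
Lemma expsum_cumulant l z : expsum l z ->
  (forall b, 0 < z b) /\ exists K1 K2 K3,
  [/\ D1 (fun b => ln (z b)) K1, D1 K1 K2 & D1 K2 K3] /\
  forall b, [/\ `|K1 b| <= l, `|K2 b| <= 2 * l ^+ 2 & `|K3 b| <= 6 * l ^+ 3].
Proof.
move=> [L [L0 hL zE]].
pose m j b : R := \sum_(i <- L) i.1 * i.2 ^+ j * expR (i.2 * b).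
have m00 b : 0 < m 0%N b.
  rewrite /m; case: L L0 hL {m zE} => // i L _ hL.
  have P j : j \in i :: L -> 0 < j.1 * j.2 ^+ 0 * expR (j.2 * b).
    by move=> /hL[j1 _]; rewrite expr0 mulr1 mulr_gt0 ?expR_gt0.
  rewrite big_cons ltr_pwDl ?P ?inE ?eqxx// big_seq; apply: sumr_ge0 => j jL.
  by rewrite ltW// P// inE jL orbT.
have l0 : 0 <= l.
  case: L L0 hL {m m00 zE} => // i L _ hL.
  by have [|_ h] := hL i; rewrite ?inE ?eqxx//; apply: le_trans h.
have dm j : D1 (m j) (m j.+1).
  rewrite /m; elim: (L) => [|i L' IH].
    under eq_fun do rewrite big_nil; apply: D1_eq (D1_cst 0) _ => b; by rewrite big_nil.
  have H : D1 (fun b => i.1 * i.2 ^+ j * expR (i.2 * b)) (fun b => i.1 * i.2 ^+ j.+1 * expR (i.2 * b)).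
    have E : D1 (fun b => i.2 * b) (fun=> i.2).
      by apply: D1_eq (D1M (D1_cst i.2) D1_id) _ => b; ring.
    by apply: D1_eq (D1M (D1_cst _) (D1_exp E)) _ => b; rewrite exprSr; ring.
  under eq_fun do rewrite big_cons.
  by apply: D1_eq (D1D H IH) _ => b; rewrite big_cons.
have mb j b : `|m j b / m 0%N b| <= l ^+ j.
  rewrite normrM normfV (gtr0_norm (m00 b)) ler_pdivrMr//.
  rewrite /m mulr_sumr; apply: le_trans (ler_norm_sum _ _ _) _.
  rewrite big_seq [X in _ <= X]big_seq; apply: ler_sum => i /hL[i1 i2].
  rewrite !normrM (ger0_norm (ltW i1)) (ger0_norm (expR_ge0 _)) expr0 mulr1 mulrA.
  rewrite ler_wpM2r ?expR_ge0// mulrC ler_wpM2r ?(ltW i1)// normrX.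
  by rewrite lerXn2r// nnegrE.
have E0 : z = m 0%N.
  by rewrite zE; apply/funext => b; apply: eq_bigr => i _; rewrite expr0 mulr1.
rewrite E0; split=> //.
have n0 b : m 0%N b != 0 by rewrite gt_eqF.
exists (fun b => m 1%N b / m 0%N b), (fun b => m 2 b / m 0%N b - (m 1%N b / m 0%N b) ^+ 2),
  (fun b => m 3 b / m 0%N b - (m 2 b / m 0%N b) * (m 1%N b / m 0%N b)
    - 2 * (m 1%N b / m 0%N b) * (m 2 b / m 0%N b - (m 1%N b / m 0%N b) ^+ 2)).
have q j : D1 (fun b => m j b / m 0%N b) (fun b => m j.+1 b / m 0%N b - (m j b / m 0%N b) * (m 1%N b / m 0%N b)).
  apply: D1_eq; first by apply: D1M; [exact: dm | apply: D1V; [exact: n0 | exact: dm]].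
  by move=> b; field; rewrite n0.
split.
  split; first exact: D1_ln.
    by apply: D1_eq (q 1%N) _ => b; rewrite expr2.
  apply: D1_eq.
    apply: D1D; first exact: q.
    by apply: D1N; under eq_fun do rewrite expr2; apply: D1M; exact: q.
  by move=> b /=; ring.
move=> b; have a1 := mb 1%N b; have a2 := mb 2 b; have a3 := mb 3 b.
rewrite expr1 in a1; move: (m 1%N b / _) (m 2 b / _) (m 3 b / _) a1 a2 a3 => x y w a1 a2 a3.
have x2 : `|x ^+ 2| <= l ^+ 2 by rewrite normrX lerXn2r// nnegrE.
have v : `|y - x ^+ 2| <= 2 * l ^+ 2 by apply: le_trans (ler_normB _ _) _; lra.
split=> //.
have yx : `|y * x| <= l ^+ 3 by rewrite normrM exprSr ler_pM.
have xv : `|2 * x * (y - x ^+ 2)| <= 4 * l ^+ 3.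
  rewrite normrM (_ : 4 * l ^+ 3 = (2 * l) * (2 * l ^+ 2)); last by ring.
  by rewrite ler_pM// normrM ger0_norm// ler_wpM2l.
apply: le_trans (ler_normB _ _) _; have := ler_normB w (y * x); lra.
Qed.

End smooth.

(** * Eigenvalues of the transfer matrix *)

Import Transfer.
Section geometric.
Variable R : realType.

Lemma bernoulli_low (x : R) n : 0 <= x <= 1 -> 1 - n%:R * x <= (1 - x) ^+ n.
Proof.
move=> /andP[x0 x1]; elim: n => [|n IH]; first by rewrite mul0r subr0 expr0.
rewrite exprS; apply: (@le_trans _ _ ((1 - x) * (1 - n%:R * x))).
  rewrite -natr1; have := mulr_ge0 (ler0n R n) (sqr_ge0 x); nra.
by rewrite ler_wpM2l// subr_ge0.
Qed.

Lemma natmul_geom (y : R) n : 0 <= y < 1 -> n%:R * y ^+ n <= (1 - y)^-1.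
Proof.
move=> /andP[y0 y1]; have y1' : 0 < 1 - y by rewrite subr_gt0.
rewrite -[leRHS]mul1r ler_pdivlMr//.
apply: (@le_trans _ _ ((\sum_(i < n) y ^+ i) * (1 - y))).
  rewrite ler_wpM2r ?(ltW y1')//.
  have -> : n%:R * y ^+ n = \sum_(i < n) y ^+ n by rewrite sumr_const card_ord mulr_natl.
  by apply: ler_sum => i _; rewrite ler_wiXn2l ?(ltW y1)// ltnW.
have -> : (\sum_(i < n) y ^+ i) * (1 - y) = 1 - y ^+ n.
  by have := subrX1 y n; move=> h; rewrite -[1 - y ^+ n]opprB h; ring.
by rewrite gerBl exprn_ge0.
Qed.

(** By Bernoulli's inequality [q <= y ^+ a.+1] for [y = 1 - (1 - q) / a.+1]; each of the [a] factors
    [n] is then absorbed by one of the factors [y ^+ n]. *)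
Lemma poly_geom (q : R) a : 0 <= q < 1 -> exists C y,
  [/\ 0 <= C, 0 <= y < 1 & forall n, n%:R ^+ a * q ^+ n <= C * y ^+ n].
Proof.
move=> /andP[q0 q1].
pose x := (1 - q) / a.+1%:R; pose y := 1 - x.
have a0 : 0 < a.+1%:R :> R by rewrite ltr0n.
have x0 : 0 < x by rewrite divr_gt0// subr_gt0.
have x1 : x <= 1.
  rewrite ler_pdivrMr// mul1r; have : 1 <= a.+1%:R :> R by rewrite ler1n.
  lra.
have y01 : 0 <= y < 1 by rewrite /y; lra.
have qy : q <= y ^+ a.+1.
  have := @bernoulli_low x a.+1; rewrite x1 ltW//= => /(_ isT); apply: le_trans.
  by rewrite /x mulrC divfK ?gt_eqF//; lra.
exists ((1 - y)^-1 ^+ a), y; split=> //.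
  by rewrite exprn_ge0// invr_ge0; case/andP: y01; lra.
move=> n; apply: (@le_trans _ _ (n%:R ^+ a * (y ^+ a.+1) ^+ n)).
  rewrite ler_wpM2l ?exprn_ge0// lerXn2r ?nnegrE//.
  by rewrite exprn_ge0//; case/andP: y01.
have y0 : 0 <= y by case/andP: y01.
rewrite -exprM mulnC exprM exprSr mulrA -exprMn ler_wpM2r ?exprn_ge0//.
by rewrite lerXn2r ?nnegrE ?mulr_ge0 ?exprn_ge0// ?invr_ge0 ?natmul_geom//; case/andP: y01; lra.
Qed.

End geometric.

Section ising.
Variables (R : realType) (beta : R).
Hypothesis beta_ge0 : 0 <= beta.
Implicit Types (b h : R).

Definition sB b : R := Num.sqrt (sinhR b ^+ 2 + expR (- 4 * beta)).
Local Notation C := (@coshR R).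
Local Notation S := (@sinhR R).
Local Notation lp := (lambda_plus beta).
Local Notation lm := (lambda_minus beta).
Local Notation rr := (Defs.ratio beta).

Lemma cosh2 b : C b ^+ 2 = S b ^+ 2 + 1.
Proof. by rewrite /coshR /sinhR expRN; field; rewrite gt_eqF ?expR_gt0. Qed.

Lemma cosh_gt0 b : 0 < C b.
Proof. by rewrite divr_gt0// addr_gt0 ?expR_gt0. Qed.

Lemma disc_gt0 b : 0 < S b ^+ 2 + expR (- 4 * beta).
Proof. by rewrite ltr_wpDl ?sqr_ge0 ?expR_gt0. Qed.

Lemma sB_gt0 b : 0 < sB b. Proof. by rewrite sqrtr_gt0 disc_gt0. Qed.

Lemma sB2 b : sB b ^+ 2 = S b ^+ 2 + expR (- 4 * beta).
Proof. by rewrite sqr_sqrtr// ltW// disc_gt0. Qed.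

Lemma sinh_lt_sB b : `|S b| < sB b.
Proof.
rewrite -(@ltr_pXn2r _ 2)// ?nnegrE ?ltW ?sB_gt0//.
by rewrite real_normK ?num_real// sB2 ltrDl expR_gt0.
Qed.

Lemma sB_le_cosh b : sB b <= C b.
Proof.
rewrite -(@ler_pXn2r _ 2)// ?nnegrE ?(ltW (sB_gt0 b)) ?(ltW (cosh_gt0 b))//.
by rewrite sB2 cosh2 lerD2l -[leRHS]expR0 ler_expR mulNr oppr_le0 mulr_ge0.
Qed.

Lemma sB_lt_cosh b : 0 < beta -> sB b < C b.
Proof.
move=> b0; rewrite -(@ltr_pXn2r _ 2)// ?nnegrE ?(ltW (sB_gt0 b)) ?(ltW (cosh_gt0 b))//.
by rewrite sB2 cosh2 ltrD2l -[ltRHS]expR0 ltr_expR mulNr oppr_lt0 mulr_gt0.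
Qed.

Lemma lpE b : lp b = expR beta * (C b + sB b). Proof. by []. Qed.
Lemma lmE b : lm b = expR beta * (C b - sB b). Proof. by []. Qed.

Lemma lp_gt0 b : 0 < lp b.
Proof. by rewrite lpE mulr_gt0 ?expR_gt0// addr_gt0 ?cosh_gt0 ?sB_gt0. Qed.

Lemma lm_ge0 b : 0 <= lm b.
Proof. by rewrite lmE mulr_ge0 ?expR_ge0// subr_ge0 sB_le_cosh. Qed.

Lemma lm_lt_lp b : lm b < lp b.
Proof. by rewrite lmE lpE ltr_pM2l ?expR_gt0//; have := sB_gt0 b; lra. Qed.

Lemma ratio_ge0 b : 0 <= rr b.
Proof. by rewrite /Defs.ratio divr_ge0 ?lm_ge0// ltW// lp_gt0. Qed.

Lemma ratio_lt1 b : rr b < 1.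
Proof. by rewrite /Defs.ratio ltr_pdivrMr ?lp_gt0// mul1r lm_lt_lp. Qed.

Lemma ratio_gt0 b : 0 < beta -> 0 < rr b.
Proof.
move=> b0; rewrite /Defs.ratio divr_gt0 ?lp_gt0// lmE mulr_gt0 ?expR_gt0//.
by rewrite subr_gt0 sB_lt_cosh.
Qed.

Definition xx b : R := lp b - expR (beta + b).
Definition nrm b : R := expR (- 2 * beta) + xx b ^+ 2.
Definition nump b : R := expR (- 2 * beta) * expR b + xx b ^+ 2 * expR (- b) + 2 * expR (- beta) * xx b.
Definition numm b : R := expR (- 2 * beta) * expR (- b) + xx b ^+ 2 * expR b - 2 * expR (- beta) * xx b.

Lemma xxE b : xx b = expR beta * (sB b - S b).
Proof. by rewrite /xx lpE expRD /coshR /sinhR; field. Qed.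

Lemma xx_gt0 b : 0 < xx b.
Proof.
by rewrite xxE mulr_gt0 ?expR_gt0// subr_gt0; apply: le_lt_trans (sinh_lt_sB b); exact: ler_norm.
Qed.

Lemma expm2 : expR (- 2 * beta) = expR (- beta) ^+ 2.
Proof. by rewrite -expRM_natl; congr expR; ring. Qed.

Lemma expm4 : expR (- 4 * beta) = expR (- beta) ^+ 4.
Proof. by rewrite -expRM_natl; congr expR; ring. Qed.

(** [(e^(-beta), xx)] is an eigenvector of the transfer matrix for the largest eigenvalue. *)
Lemma xx_eq b : xx b ^+ 2 + xx b * (expR beta * (expR b - expR (- b))) = expR (- beta) ^+ 2.
Proof.
have -> : expR b - expR (- b) = 2 * S b by rewrite /sinhR; field.
rewrite xxE; have := sB2 b; rewrite expm4 => s2.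
have -> : (expR beta * (sB b - S b)) ^+ 2 + expR beta * (sB b - S b) * (expR beta * (2 * S b)) =
  expR beta ^+ 2 * (sB b ^+ 2 - S b ^+ 2) by ring.
rewrite s2 addrAC subrr add0r expRN; field; by rewrite gt_eqF ?expR_gt0.
Qed.

Lemma nrm_gt0 b : 0 < nrm b.
Proof. by rewrite /nrm ltr_pwDl ?expR_gt0// sqr_ge0. Qed.

Lemma nump_gt0 b : 0 < nump b.
Proof.
have x0 := xx_gt0 b; rewrite /nump addr_gt0// ?mulr_gt0 ?expR_gt0//.
by rewrite addr_gt0// mulr_gt0 ?expR_gt0// exprn_gt0.
Qed.

Lemma numm_sq b : numm b = expR (- b) * (xx b * expR b - expR (- beta)) ^+ 2.
Proof. by rewrite /numm expm2 [expR (- b)]expRN; field; rewrite gt_eqF ?expR_gt0. Qed.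

Lemma numm_ge0 b : 0 <= numm b.
Proof. by rewrite numm_sq mulr_ge0 ?expR_ge0// sqr_ge0. Qed.

(** Equality in the square would force [sinh b * sinh beta = 0]. *)
Lemma numm_gt0 b : 0 < beta -> b != 0 -> 0 < numm b.
Proof.
move=> b0 bn; rewrite numm_sq mulr_gt0 ?expR_gt0// lt_neqAle sqr_ge0 andbT eq_sym.
rewrite sqrf_eq0; apply/eqP => /eqP; rewrite subr_eq0 => /eqP e.
have := xx_eq b; rewrite ![expR (- _)]expRN.
have u0 : expR b != 0 by rewrite gt_eqF ?expR_gt0.
have w0 : expR beta != 0 by rewrite gt_eqF ?expR_gt0.
have -> : xx b = (expR beta)^-1 / expR b by rewrite -[xx b](mulfK u0) e expRN.
have u1 : expR b ^+ 2 != 1.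
  by rewrite -expRM_natl -[X in _ != X]expR0; apply: contraNneq bn => /expR_inj/eqP; rewrite mulf_eq0 pnatr_eq0.
have w1 : expR beta ^+ 2 != 1.
  by rewrite -expRM_natl -[X in _ != X]expR0; apply: contraTneq b0 => /expR_inj/eqP; rewrite mulf_eq0 pnatr_eq0/= => /eqP ->; rewrite ltxx.
move: (expR b) (expR beta) u0 w0 u1 w1 => u w u0 w0 u1 w1 H.
have : (u ^+ 2 - 1) * (w ^+ 2 - 1) = 0.
  have : u ^+ 2 * w ^+ 2 * (((w^-1 / u) ^+ 2 + w^-1 / u * (w * (u - u^-1))) - w^-1 ^+ 2) = 0.
    by rewrite H subrr mulr0.
  by move=> <-; field; rewrite u0 w0.
by move/eqP; rewrite mulf_eq0 !subr_eq0 (negPf u1) (negPf w1).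
Qed.

(** Trace and determinant of the transfer matrix. *)
Definition tr b : R := expR beta * (expR b + expR (- b)).
Definition det : R := expR beta ^+ 2 - expR (- beta) ^+ 2.

Lemma lp_lm_add b : lp b + lm b = tr b.
Proof. by rewrite lpE lmE /tr /coshR; field. Qed.

Lemma lp_lm_mul b : lp b * lm b = det.
Proof.
rewrite lpE lmE.
have -> : expR beta * (C b + sB b) * (expR beta * (C b - sB b)) = expR beta ^+ 2 * (C b ^+ 2 - sB b ^+ 2) by ring.
rewrite cosh2 sB2 expm4 /det expRN; field; by rewrite gt_eqF ?expR_gt0.
Qed.

Let wt b : wgt b true = expR b. Proof. by rewrite /wgt /sg mulr1. Qed.
Let wf b : wgt b false = expR (- b). Proof. by rewrite /wgt /sg mulrN1. Qed.
Let ktt : Transfer.ker beta true true = expR beta. Proof. by rewrite /Transfer.ker /sg mulr1 mulr1. Qed.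
Let kff : Transfer.ker beta false false = expR beta. Proof. by rewrite /Transfer.ker /sg mulrNN mulr1 mulr1. Qed.
Let ktf : Transfer.ker beta true false = expR (- beta). Proof. by rewrite /Transfer.ker /sg mul1r mulrN1. Qed.
Let kft : Transfer.ker beta false true = expR (- beta). Proof. by rewrite /Transfer.ker /sg mulr1 mulrN1. Qed.
End ising.

(** * Free energies of a path and of a cycle *)

Section partition_functions.
Variables (R : realType) (beta : R).
Hypothesis beta_ge0 : 0 <= beta.
Implicit Types (b h : R).
Local Notation C := (@coshR R).
Local Notation S := (@sinhR R).
Local Notation lp := (lambda_plus beta).
Local Notation lm := (lambda_minus beta).
Local Notation rr := (Defs.ratio beta).
Local Notation w := (expR beta).

Let wt b : wgt b true = expR b. Proof. by rewrite /wgt /sg mulr1. Qed.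
Let wf b : wgt b false = expR (- b). Proof. by rewrite /wgt /sg mulrN1. Qed.
Let ktt : Transfer.ker beta true true = w. Proof. by rewrite /Transfer.ker /sg mulr1 mulr1. Qed.
Let kff : Transfer.ker beta false false = w. Proof. by rewrite /Transfer.ker /sg mulrNN mulr1 mulr1. Qed.
Let ktf : Transfer.ker beta true false = expR (- beta). Proof. by rewrite /Transfer.ker /sg mul1r mulrN1. Qed.
Let kft : Transfer.ker beta false true = expR (- beta). Proof. by rewrite /Transfer.ker /sg mulr1 mulrN1. Qed.
Let w0 : w != 0. Proof. by rewrite gt_eqF ?expR_gt0. Qed.
Let u0 b : expR b != 0. Proof. by rewrite gt_eqF ?expR_gt0. Qed.

(** Cayley-Hamilton for the two-by-two transfer matrix, so that path and cycle partition
    functions solve the same second-order recurrence as the powers of the eigenvalues. *)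
Lemma tm_rec b n (phi : bool -> R) t :
  tm beta b n.+2 phi t = tr beta b * tm beta b n.+1 phi t - det beta * tm beta b n phi t.
Proof.
elim: n t => [|n IH] t.
  rewrite /= wt wf ktt kff ktf kft /tr /det.
  by case: t; rewrite ?ktt ?kff ?ktf ?kft !expRN; field; rewrite ?w0 ?u0.
have E m : tm beta b m.+1 phi t = Transfer.ker beta t true * wgt b true * tm beta b m phi true
  + Transfer.ker beta t false * wgt b false * tm beta b m phi false by [].
rewrite (E n.+2) (E n.+1) (E n) (IH true) (IH false); ring.
Qed.

Lemma zpath_rec b n : zpath beta b n.+2 = tr beta b * zpath beta b n.+1 - det beta * zpath beta b n.
Proof. by rewrite /zpath !tm_rec; ring. Qed.

Lemma zcyc_rec b n : zcyc beta b n.+3 = tr beta b * zcyc beta b n.+2 - det beta * zcyc beta b n.+1.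
Proof. by rewrite /zcyc -[n.+3.-1]/(n.+2) -[n.+2.-1]/(n.+1) -[n.+1.-1]/n !tm_rec; ring. Qed.

Lemma lp_sq b : lp b ^+ 2 = tr beta b * lp b - det beta.
Proof. by rewrite -(lp_lm_add beta b) -(lp_lm_mul beta b); ring. Qed.

Lemma lm_sq b : lm b ^+ 2 = tr beta b * lm b - det beta.
Proof. by rewrite -(lp_lm_add beta b) -(lp_lm_mul beta b); ring. Qed.

Lemma rec2_eq (t d : R) (f g : nat -> R) : f 0%N = g 0%N -> f 1%N = g 1%N ->
  (forall n, f n.+2 = t * f n.+1 - d * f n) ->
  (forall n, g n.+2 = t * g n.+1 - d * g n) -> f =1 g.
Proof.
move=> f0 f1 hf hg n; suff : f n = g n /\ f n.+1 = g n.+1 by case.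
by elim: n => // n [a c]; rewrite hf hg a c.
Qed.

Lemma zpathE b e : zpath beta b e =
  (nump beta b * lp b ^+ e + numm beta b * lm b ^+ e) / nrm beta b.
Proof.
have n0 : nrm beta b != 0 by rewrite gt_eqF ?nrm_gt0.
move: e; apply: (@rec2_eq (tr beta b) (det beta)).
- rewrite /zpath /= wt wf !expr0 !mulr1; apply: (mulIf n0); rewrite divfK//.
  by rewrite /nump /numm /nrm; ring.
- rewrite /zpath /= wt wf ktt kff ktf kft !expr1 !mulr1; apply: (mulIf n0); rewrite divfK//.
  have L : lp b = xx beta b + w * expR b by rewrite /xx expRD; ring.
  have M : lm b = w * expR (- b) - xx beta b.
    by have := lp_lm_add beta b; rewrite L /tr; lra.
  have := xx_eq beta b; rewrite L M /nump /numm /nrm expm2.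
  move: (xx beta b) => x; rewrite !expRN => rel; apply/eqP; rewrite -subr_eq0; apply/eqP.
  transitivity ((x * (expR b - (expR b)^-1) - 2 * w^-1) *
     (x ^+ 2 + x * (w * (expR b - (expR b)^-1)) - w^-1 ^+ 2)); last by rewrite rel subrr mulr0.
  by field; rewrite w0 u0.
- by move=> n; exact: zpath_rec.
- by move=> n; rewrite !(exprS _ n.+1) !(exprS _ n) ![lp b * (lp b * _)]mulrA ![lm b * (lm b * _)]mulrA -!expr2 lp_sq lm_sq; ring.
Qed.

Lemma zcycE b e : (0 < e)%N -> zcyc beta b e = lp b ^+ e + lm b ^+ e.
Proof.
case: e => // e _; move: e; apply: (@rec2_eq (tr beta b) (det beta)).
- rewrite /zcyc /= wt wf ktt kff !expr1 lp_lm_add /tr; ring.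
- rewrite /zcyc /= wt wf ktt kff ktf kft lp_sq lm_sq.
  transitivity (tr beta b * (lp b + lm b) - 2 * det beta); last by ring.
  rewrite lp_lm_add /tr /det !expRN; by field; rewrite w0 u0.
- by move=> n; exact: zcyc_rec.
- by move=> n; rewrite !(exprS _ n.+2) !(exprS _ n.+1) ![lp b * (lp b * _)]mulrA ![lm b * (lm b * _)]mulrA -!expr2 lp_sq lm_sq; ring.
Qed.

Definition cc b : R := numm beta b / nump beta b.
Definition phi e b : R := ln (1 + cc b * rr b ^+ e).
Definition psi e b : R := ln (1 + rr b ^+ e).
Definition La b : R := ln (lp b).
Definition Pf b : R := ln (A_plus beta b).

Lemma cc_ge0 b : 0 <= cc b.
Proof. exact: divr_ge0 (numm_ge0 beta b) (ltW (nump_gt0 beta b)). Qed.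

Lemma rX_ge0 e b : 0 <= rr b ^+ e.
Proof. exact: exprn_ge0 (ratio_ge0 beta_ge0 b). Qed.

Lemma ccr_ge0 e b : 0 <= cc b * rr b ^+ e.
Proof. exact: mulr_ge0 (cc_ge0 b) (rX_ge0 e b). Qed.

Lemma phi_arg_gt0 e b : 0 < 1 + cc b * rr b ^+ e.
Proof. exact: ltr_pwDl ltr01 (ccr_ge0 e b). Qed.

Lemma psi_arg_gt0 e b : 0 < 1 + rr b ^+ e.
Proof. exact: ltr_pwDl ltr01 (rX_ge0 e b). Qed.

Lemma A_plusE b : A_plus beta b = nump beta b / (nrm beta b * lp b).
Proof. by []. Qed.

Lemma A_plus_gt0 b : 0 < A_plus beta b.
Proof. exact: divr_gt0 (nump_gt0 beta b) (mulr_gt0 (nrm_gt0 beta b) (lp_gt0 beta b)). Qed.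

(** At [beta = 0] both sides vanish, as the small eigenvalue is then 0. *)
Lemma A_minusE b e : (0 < e)%N ->
  A_minus beta b * rr b ^+ e.+1 = A_plus beta b * (cc b * rr b ^+ e).
Proof.
case: e => // e _.
have -> : A_minus beta b = numm beta b / (nrm beta b * lm b) by [].
rewrite A_plusE /cc.
have n0 : nrm beta b != 0 by rewrite gt_eqF ?nrm_gt0.
have p0 : nump beta b != 0 by rewrite gt_eqF ?nump_gt0.
have l0 : lp b != 0 by rewrite gt_eqF ?lp_gt0.
have rE : rr b = lm b / lp b by [].
have [m0|m0] := eqVneq (lm b) 0.
  by rewrite !exprS rE m0 !mul0r !mulr0.
by rewrite [rr b ^+ e.+2]exprS {1}rE; field; rewrite n0 p0 l0 m0.
Qed.

Lemma gamma_arg b e : (0 < e)%N ->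
  1 + A_minus beta b / A_plus beta b * rr b ^+ e.+1 = 1 + cc b * rr b ^+ e.
Proof.
move=> e0; congr (_ + _).
have a0 : A_plus beta b != 0 by rewrite gt_eqF ?A_plus_gt0.
by rewrite mulrAC A_minusE// mulrC mulKf.
Qed.

Lemma chi_arg b e : (0 < e)%N ->
  ln (A_plus beta b + A_minus beta b * rr b ^+ e.+1) = Pf b + phi e b.
Proof.
move=> e0; rewrite A_minusE// -{1}[A_plus beta b]mulr1 -mulrDr.
by rewrite (lnM (A_plus_gt0 b) (phi_arg_gt0 e b)).
Qed.

Lemma zpath_prod b e : zpath beta b e = lp b ^+ e.+1 * (A_plus beta b * (1 + cc b * rr b ^+ e)).
Proof.
have n0 : nrm beta b != 0 by rewrite gt_eqF ?nrm_gt0.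
have p0 : nump beta b != 0 by rewrite gt_eqF ?nump_gt0.
have l0 : lp b != 0 by rewrite gt_eqF ?lp_gt0.
rewrite zpathE A_plusE /cc /Defs.ratio expr_div_n exprS; field.
by rewrite n0 p0 l0 expf_neq0.
Qed.

Lemma zcyc_prod b e : (0 < e)%N -> zcyc beta b e = lp b ^+ e * (1 + rr b ^+ e).
Proof.
move=> e0; have l0 : lp b != 0 by rewrite gt_eqF ?lp_gt0.
by rewrite zcycE// /Defs.ratio expr_div_n; field; rewrite expf_neq0.
Qed.

Lemma ln_zpath b e : ln (zpath beta b e) = e.+1%:R * La b + (Pf b + phi e b).
Proof.
have a0 := A_plus_gt0 b; have f0 := phi_arg_gt0 e b; have l0 := lp_gt0 beta b.
have e1 := exprn_gt0 e.+1 l0; have q0 := mulr_gt0 a0 f0.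
by rewrite zpath_prod (lnM e1 q0) (lnM a0 f0) (lnXn _ l0) mulr_natl.
Qed.

Lemma ln_zcyc b e : (0 < e)%N -> ln (zcyc beta b e) = e%:R * La b + psi e b.
Proof.
move=> e0; have f0 := psi_arg_gt0 e b; have l0 := lp_gt0 beta b.
have e1 := exprn_gt0 e l0.
by rewrite zcyc_prod// (lnM e1 f0) (lnXn _ l0) mulr_natl.
Qed.

Lemma D1_cosh : D1 C S.
Proof.
move=> b; have d : D1 (fun b : R => expR (- b)) (fun b => - 1 * expR (- b)).
  by apply: D1_exp; exact: D1N (@D1_id R).
have e : D1 (fun b : R => expR b) (fun b => 1 * expR b) by exact: D1_exp (@D1_id R).
have := D1M (D1D e d) (D1_cst (2^-1 : R)) b.
by move=> h; apply: is_derive_eq h _; rewrite /sinhR; ring.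
Qed.

Lemma D1_sinh : D1 S C.
Proof.
move=> b; have d : D1 (fun b : R => expR (- b)) (fun b => - 1 * expR (- b)).
  by apply: D1_exp; exact: D1N (@D1_id R).
have e : D1 (fun b : R => expR b) (fun b => 1 * expR b) by exact: D1_exp (@D1_id R).
have := D1M (D1D e (D1N d)) (D1_cst (2^-1 : R)) b.
by move=> h; apply: is_derive_eq h _; rewrite /coshR; ring.
Qed.

Lemma smooth2_cosh : smooth2 C.
Proof. by exists S, C; split; [exact: D1_cosh | exact: D1_sinh]. Qed.
Lemma smooth2_sinh : smooth2 S.
Proof. by exists C, S; split; [exact: D1_sinh | exact: D1_cosh]. Qed.

Local Notation s := (sB beta).

Lemma sB_exp : s = fun b => expR (2^-1 * ln (S b ^+ 2 + expR (- 4 * beta))).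
Proof.
apply/funext => b; apply/eqP.
rewrite -(@eqrXn2 _ 2)// ?(ltW (sB_gt0 beta b)) ?expR_ge0//.
by rewrite sB2 -expRM_natl mulrA divff// mul1r lnK// posrE disc_gt0.
Qed.

Lemma D1_sB : D1 s (fun b => S b * C b / s b).
Proof.
have d : D1 (fun b => S b ^+ 2 + expR (- 4 * beta)) (fun b => 2 * S b * C b).
  apply: D1_eq; first by apply: D1D; [under eq_fun do rewrite expr2; exact: (D1M D1_sinh D1_sinh) | exact: D1_cst].
  by move=> b /=; ring.
rewrite {1}sB_exp; apply: D1_eq.
  by apply: D1_exp; apply: D1M; [exact: D1_cst | apply: D1_ln; [exact: disc_gt0 | exact: d]].
move=> b /=; have -> : expR (2^-1 * ln (S b ^+ 2 + expR (- 4 * beta))) = s b by rewrite sB_exp.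
rewrite -sB2; field; by rewrite gt_eqF ?sB_gt0.
Qed.

Lemma smooth2_sB : smooth2 s.
Proof.
rewrite sB_exp; apply: smooth2_exp; apply: smooth2M; first exact: smooth2_cst.
apply: smooth2_ln; first exact: disc_gt0.
by apply: smooth2D; [exact: (smooth2X 2 smooth2_sinh) | exact: smooth2_cst].
Qed.

Lemma smooth2_lp : smooth2 lp.
Proof. by apply: smooth2M; [exact: smooth2_cst | exact: (smooth2D smooth2_cosh smooth2_sB)]. Qed.

Lemma smooth2_lm : smooth2 lm.
Proof. by apply: smooth2M; [exact: smooth2_cst | exact: (smooth2D smooth2_cosh (smooth2N smooth2_sB))]. Qed.

Lemma smooth2_expb : smooth2 (fun b : R => expR b).
Proof. exact: (smooth2_exp (@smooth2_id R)). Qed.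
Lemma smooth2_expNb : smooth2 (fun b : R => expR (- b)).
Proof. exact: (smooth2_exp (smooth2N (@smooth2_id R))). Qed.

Lemma smooth2_xx : smooth2 (xx beta).
Proof.
apply: smooth2D; first exact: smooth2_lp.
apply: smooth2N; apply: smooth2_exp; exact: (smooth2D (smooth2_cst beta) (@smooth2_id R)).
Qed.

Lemma smooth2_nrm : smooth2 (nrm beta).
Proof. exact: (smooth2D (smooth2_cst _) (smooth2X 2 smooth2_xx)). Qed.

Lemma smooth2_nump : smooth2 (nump beta).
Proof.
exact: (smooth2D (smooth2D (smooth2M (smooth2_cst _) smooth2_expb)
  (smooth2M (smooth2X 2 smooth2_xx) smooth2_expNb)) (smooth2M (smooth2_cst _) smooth2_xx)).
Qed.

Lemma smooth2_numm : smooth2 (numm beta).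
Proof.
exact: (smooth2D (smooth2D (smooth2M (smooth2_cst _) smooth2_expNb)
  (smooth2M (smooth2X 2 smooth2_xx) smooth2_expb)) (smooth2N (smooth2M (smooth2_cst _) smooth2_xx))).
Qed.

Lemma smooth2_cc : smooth2 cc.
Proof.
apply: smooth2M; first exact: smooth2_numm.
by apply: smooth2V; [move=> b; rewrite gt_eqF ?nump_gt0 | exact: smooth2_nump].
Qed.

Lemma smooth2_rr : smooth2 rr.
Proof.
apply: smooth2M; first exact: smooth2_lm.
by apply: smooth2V; [move=> b; rewrite gt_eqF ?lp_gt0 | exact: smooth2_lp].
Qed.

Lemma smooth2_La : smooth2 La.
Proof. by apply: smooth2_ln; [exact: lp_gt0 | exact: smooth2_lp]. Qed.

Lemma smooth2_Pf : smooth2 Pf.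
Proof.
apply: smooth2_ln; first exact: A_plus_gt0.
apply: smooth2M; first exact: smooth2_nump.
apply: smooth2V; first by move=> b; exact: (lt0r_neq0 (mulr_gt0 (nrm_gt0 beta b) (lp_gt0 beta b))).
exact: (smooth2M smooth2_nrm smooth2_lp).
Qed.

Lemma smooth2_phi e : smooth2 (phi e).
Proof.
apply: smooth2_ln; first exact: phi_arg_gt0.
exact: (smooth2D (smooth2_cst 1) (smooth2M smooth2_cc (smooth2X e smooth2_rr))).
Qed.

(** Logarithmic derivative of the ratio of the eigenvalues. *)
Definition rho b : R := - 2 * S b / s b.

Lemma D1_rr : D1 rr (fun b => rho b * rr b).
Proof.
have dp : D1 lp (fun b => lp b * (S b / s b)).
  apply: D1_eq (D1M (D1_cst w) (D1D D1_cosh D1_sB)) _ => b.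
  by rewrite lpE; field; rewrite gt_eqF ?sB_gt0.
have dm : D1 lm (fun b => - lm b * (S b / s b)).
  apply: D1_eq (D1M (D1_cst w) (D1D D1_cosh (D1N D1_sB))) _ => b.
  by rewrite lmE; field; rewrite gt_eqF ?sB_gt0.
have l0 b : lp b != 0 by rewrite gt_eqF ?lp_gt0.
apply: D1_eq (D1M dm (D1V l0 dp)) _ => b.
by rewrite /rho /Defs.ratio; field; rewrite l0 gt_eqF ?sB_gt0.
Qed.

Lemma D1_rX e : D1 (fun b => rr b ^+ e) (fun b => e%:R * rho b * rr b ^+ e).
Proof.
elim: e => [|e IH].
  by under eq_fun do rewrite expr0; apply: D1_eq (D1_cst 1) _ => b; ring.
under eq_fun do rewrite exprS.
by apply: D1_eq (D1M D1_rr IH) _ => b; rewrite exprS -natr1; ring.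
Qed.

End partition_functions.

(** * Dependence of the free energies on the field *)

Section estimates.
Variables (R : realType) (beta : R).
Hypothesis beta_ge0 : 0 <= beta.
Implicit Types (b h : R).
Local Notation rr := (Defs.ratio beta).

Lemma expsum_tm n t : expsum n%:R (fun b : R => tm beta b n (fun=> 1) t).
Proof.
elim: n t => [|n IH] t; first exact: expsum1.
have H t' : expsum n.+1%:R (fun b : R => Transfer.ker beta t t' * wgt b t' * tm beta b n (fun=> 1) t').
  have := expsumZ (sg R t') (expR_gt0 (beta * (sg R t * sg R t'))) (IH t').
  have -> : `|sg R t'| = 1 by case: t'; rewrite /sg ?normrN normr1.
  rewrite natr1; congr expsum; apply/funext => b.
  by rewrite /wgt [b * _]mulrC.
exact: expsumD.
Qed.

Lemma expsum_zpath e : expsum e.+1%:R (fun b : R => zpath beta b e).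
Proof.
have H t' : expsum e.+1%:R (fun b : R => wgt b t' * tm beta b e (fun=> 1) t').
  have := expsumZ (sg R t') (@ltr01 R) (expsum_tm e t').
  have -> : `|sg R t'| = 1 by case: t'; rewrite /sg ?normrN normr1.
  rewrite natr1; congr expsum; apply/funext => b.
  by rewrite /wgt mul1r [b * _]mulrC.
exact: expsumD.
Qed.

Definition phi1 e := derive1 (phi beta e).
Definition phi2 e := derive1 (phi1 e).
Definition La1 := derive1 (La beta).
Definition La2 := derive1 La1.
Definition Pf1 := derive1 (Pf beta).
Definition Pf2 := derive1 Pf1.

Lemma smooth2_derive1 (f : R -> R) : smooth2 f ->
  D1 f (derive1 f) /\ D1 (derive1 f) (derive1 (derive1 f)).
Proof.
move=> [f1 [f2 [a1 a2]]]; rewrite (D1_derive1 a1); split=> //.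
by rewrite (D1_derive1 a2).
Qed.

Lemma D1_phi e : D1 (phi beta e) (phi1 e) /\ D1 (phi1 e) (phi2 e).
Proof. exact/smooth2_derive1/smooth2_phi. Qed.
Lemma D1_La : D1 (La beta) La1 /\ D1 La1 La2.
Proof. exact/smooth2_derive1/smooth2_La. Qed.
Lemma D1_Pf : D1 (Pf beta) Pf1 /\ D1 Pf1 Pf2.
Proof. exact/smooth2_derive1/smooth2_Pf. Qed.

Lemma ln_lip (u v : R) : 0 <= u -> 0 <= v -> `|ln (1 + u) - ln (1 + v)| <= `|u - v|.
Proof.
have key x y : 0 <= x -> 0 <= y -> ln (1 + x) - ln (1 + y) <= `|x - y|.
  move=> x0 y0; have x1 : 0 < 1 + x by rewrite ltr_pwDl.
  have y1 : 0 < 1 + y by rewrite ltr_pwDl.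
  have [xy|xy] := leP x y.
    apply: (@le_trans _ _ 0) => //; rewrite subr_le0 ler_ln ?posrE//; lra.
  rewrite -ln_div ?posrE//.
  have -> : (1 + x) / (1 + y) = 1 + (x - y) / (1 + y) by field; rewrite gt_eqF.
  have d0 : 0 < x - y by rewrite subr_gt0.
  have q0 : 0 <= (x - y) / (1 + y) := divr_ge0 (ltW d0) (ltW y1).
  apply: le_trans (le_ln1Dx _) _; first by lra.
  by rewrite gtr0_norm// ler_pdivrMr// ler_peMr ?(ltW d0)// lerDl.
move=> u0 v0; rewrite ler_norml key// andbT lerNl opprB distrC; exact: key.
Qed.

Lemma pow_lip (q x y : R) n : 0 <= q < 1 -> 0 <= x <= q -> 0 <= y <= q ->
  `|x ^+ n - y ^+ n| <= `|x - y| / (1 - q).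
Proof.
move=> /andP[q0 q1] /andP[x0 xq] /andP[y0 yq].
have q1' : 0 < 1 - q by rewrite subr_gt0.
elim: n => [|n IH]; first by rewrite !expr0 subrr normr0 divr_ge0// ltW.
have -> : x ^+ n.+1 - y ^+ n.+1 = x * (x ^+ n - y ^+ n) + y ^+ n * (x - y).
  by rewrite !exprS; ring.
apply: le_trans (ler_normD _ _) _; rewrite !normrM (ger0_norm x0) (ger0_norm (exprn_ge0 n y0)).
have h1 : x * `|x ^+ n - y ^+ n| <= q * (`|x - y| / (1 - q)) by rewrite ler_pM.
have h2 : y ^+ n * `|x - y| <= `|x - y|.
  by rewrite ler_piMl// exprn_ile1//; lra.
apply: le_trans (lerD h1 h2) _.
have -> : q * (`|x - y| / (1 - q)) + `|x - y| = `|x - y| / (1 - q) by field; rewrite gt_eqF.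
by [].
Qed.

Variable B : R.

Lemma rr_lip : exists q C d, [/\ 0 <= q < 1, 0 <= C, 0 < d &
  forall h, `|h| < d -> rr (B + h) <= q /\ `|rr (B + h) - rr B| <= C * `|h|].
Proof.
have [C [d [C0 d0 H]]] := lip_at (D1_rr beta B).
have r0 := ratio_ge0 beta_ge0 B; have r1 := ratio_lt1 beta B.
pose q := (1 + rr B) / 2; have q0 : 0 < q - rr B by rewrite /q; lra.
exists q, C, (Num.min d ((q - rr B) / (C + 1))); split=> //.
- by rewrite /q; lra.
- by rewrite lt_min d0 divr_gt0// ltr_wpDl.
move=> h; rewrite lt_min => /andP[hd hq]; split; last exact: H.
have := H h hd; rewrite ler_norml => /andP[_ h1].
have C1 : 0 < C + 1 by rewrite ltr_wpDl.
move: hq; rewrite ltr_pdivlMr// => hq; have := normr_ge0 h; nra.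
Qed.

Lemma psi_lip : exists C d, [/\ 0 <= C, 0 < d & forall e h, `|h| < d ->
  `|psi beta e (B + h) - psi beta e B| <= C * `|h|].
Proof.
have [q [C [d [q01 C0 d0 H]]]] := rr_lip.
have q1 : 0 < 1 - q by case/andP: q01; lra.
exists (C / (1 - q)), d; split=> //; first by rewrite divr_ge0// ltW.
move=> e h hd; apply: le_trans (ln_lip (rX_ge0 beta_ge0 _ _) (rX_ge0 beta_ge0 _ _)) _.
have n0 : `|0 : R| < d by rewrite normr0.
have [a1 a2] := H h hd; have [a3 _] := H 0 n0; rewrite addr0 in a3.
have hx : 0 <= rr (B + h) <= q by rewrite a1 (ratio_ge0 beta_ge0).
have hy : 0 <= rr B <= q by rewrite a3 (ratio_ge0 beta_ge0).
apply: le_trans (pow_lip _ q01 hx hy) _.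
by rewrite mulrAC ler_wpM2r// invr_ge0 ltW.
Qed.

Lemma phi_lip : exists C d, [/\ 0 <= C, 0 < d & forall e h, `|h| < d ->
  `|phi beta e (B + h) - phi beta e B| <= C * `|h|].
Proof.
have [q [C [d [q01 C0 d0 H]]]] := rr_lip.
have q1 : 0 < 1 - q by case/andP: q01; lra.
have [f1 [f2 [c1 _]]] := smooth2_cc beta.
have [C' [d' [C0' d0' H']]] := lip_at (c1 B).
have cB := cc_ge0 beta B.
exists (C' + cc beta B * (C / (1 - q))), (Num.min d d'); split.
- by rewrite addr_ge0// mulr_ge0// divr_ge0// ltW.
- by rewrite lt_min d0.
move=> e h; rewrite lt_min => /andP[hd hd'].
apply: le_trans (ln_lip (ccr_ge0 beta_ge0 _ _) (ccr_ge0 beta_ge0 _ _)) _.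
have n0 : `|0 : R| < d by rewrite normr0.
have [a1 a2] := H h hd; have [a3 _] := H 0 n0; rewrite addr0 in a3.
have hx : 0 <= rr (B + h) <= q by rewrite a1 (ratio_ge0 beta_ge0).
have hy : 0 <= rr B <= q by rewrite a3 (ratio_ge0 beta_ge0).
have -> : cc beta (B + h) * rr (B + h) ^+ e - cc beta B * rr B ^+ e =
  (cc beta (B + h) - cc beta B) * rr (B + h) ^+ e + cc beta B * (rr (B + h) ^+ e - rr B ^+ e) by ring.
apply: le_trans (ler_normD _ _) _; rewrite [leRHS]mulrDl; apply: lerD.
  rewrite normrM -[leRHS]mulr1; apply: ler_pM => //; first exact: H'.
  rewrite (ger0_norm (rX_ge0 beta_ge0 e (B + h))).
  exact: exprn_ile1 (ratio_ge0 beta_ge0 _) (ltW (ratio_lt1 _ _)).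
rewrite normrM (ger0_norm cB) -[leRHS]mulrA; apply: ler_wpM2l => //.
apply: le_trans (pow_lip _ q01 hx hy) _.
by rewrite mulrAC ler_wpM2r// invr_ge0 ltW.
Qed.

Lemma leS2 e : (0 < e)%N -> e.+1%:R <= 2 * e%:R :> R.
Proof. by move=> e0; rewrite -natrM ler_nat mul2n -addnn -addn1 leq_add2l. Qed.

Lemma affine_bound (K x F c l p : R) : `|K| <= c * F -> 0 <= x -> x <= 2 * F -> 1 <= F ->
  `|K - x * l - p| <= (c + 2 * `|l| + `|p|) * F.
Proof.
move=> hK x0 hx F1; apply: le_trans (ler_normB _ _) _.
apply: le_trans (lerD (ler_normB _ _) (lexx _)) _; rewrite normrM (ger0_norm x0) 2!mulrDl.
apply: lerD; last by rewrite ler_peMr.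
by apply: lerD => //; rewrite mulrAC ler_wpM2r.
Qed.

(** The partition function of a path of [e] edges is a sum of exponentials with frequencies in
    [[-(e + 1), e + 1]], the total spins. The cumulant bounds make the third derivative of its
    logarithm at most of order [e^3], uniformly in the field; the terms linear in [e] have
    ordinary expansions. *)
Lemma phi_taylor :
  (exists2 C, 0 <= C & forall e, (0 < e)%N ->
     `|phi1 e B| <= C * e%:R /\ `|phi2 e B| <= C * e%:R ^+ 2) /\
  forall eps, 0 < eps -> exists2 d, 0 < d & forall e h, (0 < e)%N -> `|h| < d ->
   `|phi beta e (B + h) - phi beta e B - h * phi1 e B - h ^+ 2 / 2 * phi2 e B|
     <= eps * e%:R ^+ 3 * h ^+ 2.
Proof.
have [La_1 La_2] := D1_La; have [P_1 P_2] := D1_Pf.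
have base e : exists K1 K2 K3,
   [/\ phi1 e B = K1 B - e.+1%:R * La1 B - Pf1 B, phi2 e B = K2 B - e.+1%:R * La2 B - Pf2 B,
       `|K1 B| <= e.+1%:R, `|K2 B| <= 2 * e.+1%:R ^+ 2 &
    [/\ forall b, `|K3 b| <= 6 * e.+1%:R ^+ 3, D1 (fun b => ln (zpath beta b e)) K1, D1 K1 K2 & D1 K2 K3]].
  have [_ [K1 [K2 [K3 [[k1 k2 k3] kb]]]]] := expsum_cumulant (expsum_zpath e).
  have E : phi beta e = fun b => ln (zpath beta b e) - e.+1%:R * La beta b - Pf beta b.
    by apply/funext => b; rewrite ln_zpath//; ring.
  have d1 : D1 (phi beta e) (fun b => K1 b - e.+1%:R * La1 b - Pf1 b).
    rewrite E; apply: D1_eq (D1D (D1D k1 (D1N (D1M (D1_cst _) La_1))) (D1N P_1)) _ => b /=; ring.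
  have d2 : D1 (fun b => K1 b - e.+1%:R * La1 b - Pf1 b) (fun b => K2 b - e.+1%:R * La2 b - Pf2 b).
    apply: D1_eq (D1D (D1D k2 (D1N (D1M (D1_cst _) La_2))) (D1N P_2)) _ => b /=; ring.
  have [b1 b2 b3] := kb B.
  exists K1, K2, K3; split=> //.
  - by rewrite /phi1 (D1_derive1 d1).
  - by rewrite /phi2 /phi1 (D1_derive1 d1) (D1_derive1 d2).
  - by split=> // b; case: (kb b).
split.
  exists (8 + 2 * (`|La1 B| + `|La2 B|) + `|Pf1 B| + `|Pf2 B|); first by rewrite !addr_ge0// mulr_ge0// addr_ge0.
  move=> e e0; have [K1 [K2 [K3 [-> -> b1 b2 _]]]] := base e.
  have e1 : 1 <= e%:R :> R by rewrite ler1n.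
  have e2 : e.+1%:R <= 2 * e%:R :> R by exact: leS2.
  have ee : e%:R <= e%:R ^+ 2 :> R by rewrite expr2 ler_peMl.
  have e22 : 2 * e.+1%:R ^+ 2 <= 8 * e%:R ^+ 2 :> R.
    rewrite (_ : 8 * e%:R ^+ 2 = 2 * (2 * e%:R) ^+ 2); last by ring.
    by rewrite ler_wpM2l// lerXn2r// nnegrE ?mulr_ge0.
  have n1 := normr_ge0 (La1 B); have n2 := normr_ge0 (La2 B).
  have n3 := normr_ge0 (Pf1 B); have n4 := normr_ge0 (Pf2 B).
  have x0 : 0 <= e.+1%:R :> R by [].
  move: b1 b2 n1 n2 n3 n4 e1 e2 ee e22 x0.
  move: (La1 B) (La2 B) (Pf1 B) (Pf2 B) (K1 B) (K2 B) (e%:R : R) (e.+1%:R : R).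
  move=> l1 l2 p1 p2 k1 k2 E x b1 b2 n1 n2 n3 n4 e1 e2 ee e22 x0.
  split.
    have := affine_bound l1 p1 (le_trans b1 e2) x0 e2 e1 => h; apply: le_trans h _.
    by rewrite ler_wpM2r; lra.
  have h2 : x <= 2 * E ^+ 2 by lra.
  have := affine_bound l2 p2 (le_trans b2 e22) x0 h2 (le_trans e1 ee) => h; apply: le_trans h _.
  by rewrite ler_wpM2r; lra.
move=> eps eps0; have e6 : 0 < eps / 6 by rewrite divr_gt0.
have [d1 d10 H1] := peano2 B La_1 La_2 e6.
have [d2 d20 H2] := peano2 B P_1 P_2 e6.
exists (Num.min (Num.min d1 d2) (eps / 96)); first by rewrite !lt_min d10 d20 divr_gt0.
move=> e h e0; rewrite !lt_min => /andP[/andP[hd1 hd2] hd3].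
have [K1 [K2 [K3 [-> -> b1 b2 [b3 k1 k2 k3]]]]] := base e.
have T := @taylor2_ineq R (fun b => ln (zpath beta b e)) K1 K2 K3 B h (6 * e.+1%:R ^+ 3)
  (fun y _ => k1 y) (fun y _ => k2 y) (fun y _ => k3 y) (fun y _ => b3 y).
move: T; rewrite !ln_zpath// => T.
have TL := H1 h hd1; have TP := H2 h hd2.
set x1 := La beta (B + h) - _ in TL; set x2 := Pf beta (B + h) - _ in TP.
set x3 := (X in `|X| <= _) in T.
have -> : phi beta e (B + h) - phi beta e B - h * (K1 B - e.+1%:R * La1 B - Pf1 B) -
   h ^+ 2 / 2 * (K2 B - e.+1%:R * La2 B - Pf2 B) = x3 - e.+1%:R * (x1 - h * La1 B - h ^+ 2 / 2 * La2 B)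
     - (x2 - h * Pf1 B - h ^+ 2 / 2 * Pf2 B).
  by rewrite /x1 /x2 /x3; ring.
apply: le_trans (ler_normB _ _) _.
apply: le_trans (lerD (ler_normB _ _) (lexx _)) _; rewrite normrM (ger0_norm (ler0n _ _)).
have e1 : 1 <= e%:R :> R by rewrite ler1n.
have e2 : e.+1%:R <= 2 * e%:R :> R by exact: leS2.
have ee : e%:R <= e%:R ^+ 3 :> R by rewrite [leRHS]exprS ler_peMr// expr_ge1// (le_trans ler01).
have e33 : e.+1%:R ^+ 3 <= 8 * e%:R ^+ 3 :> R.
  rewrite (_ : 8 * e%:R ^+ 3 = (2 * e%:R) ^+ 3); last by ring.
  by rewrite lerXn2r// nnegrE ?mulr_ge0.
have h20 : 0 <= h ^+ 2 by exact: sqr_ge0.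
move: TL TP T; rewrite -/x3.
move: x3 (x1 - _ - _) (x2 - _ - _) => {x1 x2} x3 y1 y2 TL TP T.
have x0 : 0 <= e.+1%:R :> R by [].
move: hd3 T e1 e2 ee e33 x0; move: (e%:R : R) (e.+1%:R : R) => E x hd3 T e1 e2 ee e33 x0.
have t1 : `|x3| <= eps / 2 * E ^+ 3 * h ^+ 2.
  apply: le_trans T _.
  have -> : `|h| ^+ 3 = `|h| * h ^+ 2 by rewrite -[h ^+ 2](real_normK (num_real h)) exprS.
  rewrite mulrA ler_wpM2r//.
  apply: (@le_trans _ _ (6 * (8 * E ^+ 3) * (eps / 96))); last by lra.
  by apply: ler_pM; rewrite ?mulr_ge0 ?exprn_ge0// ?ler_wpM2l// ltW.
have t2 : x * `|y1| <= eps / 3 * E ^+ 3 * h ^+ 2.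
  apply: (@le_trans _ _ (2 * E ^+ 3 * (eps / 6 * h ^+ 2))); last by lra.
  by apply: ler_pM => //; lra.
have t3 : `|y2| <= eps / 6 * E ^+ 3 * h ^+ 2.
  apply: le_trans TP _; rewrite ler_wpM2r// ler_peMr ?(ltW e6)//; lra.
lra.
Qed.

Definition psi1 e b : R := e%:R * rho beta b * (rr b ^+ e / (1 + rr b ^+ e)).

Lemma D1_psi e : D1 (psi beta e) (psi1 e).
Proof.
apply: D1_eq (D1_ln (psi_arg_gt0 beta_ge0 e) (D1D (D1_cst 1) (D1_rX beta e))) _ => b.
by rewrite /psi1 add0r; ring.
Qed.

Lemma smooth2_rho : smooth2 (rho beta).
Proof.
apply: smooth2M; first exact: (smooth2M (smooth2_cst _) (@smooth2_sinh R)).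
by apply: smooth2V; [move=> b; rewrite gt_eqF ?sB_gt0 | exact: smooth2_sB].
Qed.

(** The factor [r^e] beats the powers of [e] coming from the derivatives, so that these
    bounds hold uniformly in the length of the cycle. *)
Lemma psi_bounds : exists2 C, 0 <= C & exists psi2, forall e,
  [/\ D1 (psi1 e) (psi2 e), `|psi1 e B| <= C & `|psi2 e B| <= C].
Proof.
have [ro1 [_ [dro _]]] := smooth2_rho.
pose sig e b := rr b ^+ e / (1 + rr b ^+ e).
have a0 e b : 1 + rr b ^+ e != 0 by rewrite gt_eqF ?psi_arg_gt0.
have dsig e : D1 (sig e) (fun b => e%:R * rho beta b * rr b ^+ e / (1 + rr b ^+ e) ^+ 2).
  apply: D1_eq (D1M (D1_rX beta e) (D1V (a0 e) (D1D (D1_cst 1) (D1_rX beta e)))) _ => b.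
  by field; rewrite a0.
have r01 : 0 <= rr B < 1 by rewrite ratio_ge0// ratio_lt1.
have [C1 [y1 [C10 y10 H1]]] := poly_geom 1 r01.
have [C2 [y2 [C20 y20 H2]]] := poly_geom 2 r01.
have yle (y : R) n : 0 <= y < 1 -> y ^+ n <= 1.
  by move=> /andP[p q]; rewrite exprn_ile1// ltW.
have B1 e : e%:R * rr B ^+ e <= C1.
  have := H1 e; rewrite expr1 => h; apply: le_trans h _.
  by rewrite ler_piMr// yle.
have B2 e : e%:R ^+ 2 * rr B ^+ e <= C2.
  by apply: le_trans (H2 e) _; rewrite ler_piMr// yle.
have s1 e : `|e%:R * sig e B| <= C1.
  have S0 : 0 <= e%:R * sig e B.
    by apply: mulr_ge0 => //; apply: divr_ge0; [exact: rX_ge0 | exact: ltW (psi_arg_gt0 _ _ _)].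
  rewrite ger0_norm//.
  rewrite /sig mulrA ler_pdivrMr ?psi_arg_gt0//; apply: le_trans (B1 e) _.
  by rewrite ler_peMr// lerDl rX_ge0.
pose psi2 e b := e%:R * (ro1 b * sig e b) + e%:R * rho beta b * (e%:R * rho beta b * rr b ^+ e / (1 + rr b ^+ e) ^+ 2).
pose CC : R := C1 * (`|rho beta B| + `|ro1 B|) + C2 * rho beta B ^+ 2.
have CC0 : 0 <= CC.
  by apply: addr_ge0; apply: mulr_ge0 => //; first [exact: addr_ge0 | exact: sqr_ge0].
apply: (ex_intro2 _ _ CC CC0); exists psi2 => e; rewrite /CC.
have R2 : 0 <= rho beta B ^+ 2 by exact: sqr_ge0.
have p1 : 0 <= C1 * `|ro1 B| by rewrite mulr_ge0.
have p2 : 0 <= C1 * `|rho beta B| by rewrite mulr_ge0.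
have p3 : 0 <= C2 * rho beta B ^+ 2 by rewrite mulr_ge0.
split.
- apply: D1_eq (D1M (D1M (D1_cst e%:R) dro) (dsig e)) _ => b; rewrite /psi2 /sig; ring.
- have -> : psi1 e B = (e%:R * sig e B) * rho beta B by rewrite /psi1 /sig; ring.
  rewrite normrM; have : `|e%:R * sig e B| * `|rho beta B| <= C1 * `|rho beta B| by rewrite ler_wpM2r.
  lra.
have -> : psi2 e B = (e%:R * sig e B) * ro1 B + (e%:R ^+ 2 * rr B ^+ e / (1 + rr B ^+ e) ^+ 2) * rho beta B ^+ 2.
  by rewrite /psi2; ring.
have q1 : 0 <= e%:R ^+ 2 * rr B ^+ e / (1 + rr B ^+ e) ^+ 2.
  apply: divr_ge0; first by apply: mulr_ge0; [exact: sqr_ge0 | exact: rX_ge0].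
  exact: sqr_ge0.
apply: le_trans (ler_normD _ _) _.
rewrite [`|_ * ro1 B|]normrM [`|_ * rho beta B ^+ 2|]normrM (ger0_norm q1) (ger0_norm R2).
have : `|e%:R * sig e B| * `|ro1 B| <= C1 * `|ro1 B| by rewrite ler_wpM2r// s1.
have : e%:R ^+ 2 * rr B ^+ e / (1 + rr B ^+ e) ^+ 2 * rho beta B ^+ 2 <= C2 * rho beta B ^+ 2.
  rewrite ler_wpM2r// ler_pdivrMr ?exprn_gt0 ?psi_arg_gt0//; apply: le_trans (B2 e) _.
  by rewrite ler_peMr// exprn_ege1// lerDl rX_ge0.
lra.
Qed.

(** [e |phi1 e B|] is bounded, because [r^e] decays exponentially. An affine function with this
    property is 0, and vanishing of [phi1] for [e = 1, 2] would give [rho = 0], hence [sinh B = 0]. *)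
Lemma phi1_not_affine (a0 b0 : R) : 0 < beta -> B != 0 ->
  ~ (forall e, (0 < e)%N -> phi1 e B = a0 + b0 * e%:R).
Proof.
move=> bp Bn H.
have [c1 [_ [dc _]]] := smooth2_cc beta.
have c0 : 0 < cc beta B by exact: divr_gt0 (numm_gt0 bp Bn) (nump_gt0 beta B).
have r0 := ratio_gt0 B bp.
have E e : phi1 e B = (c1 B + cc beta B * rho beta B * e%:R) * rr B ^+ e / (1 + cc beta B * rr B ^+ e).
  rewrite /phi1 (D1_derive1 (D1_ln (phi_arg_gt0 beta_ge0 e) (D1D (D1_cst 1) (D1M dc (D1_rX beta e))))).
  by rewrite add0r; congr (_ / _); ring.
have r01 : 0 <= rr B < 1 by rewrite ratio_ge0// ratio_lt1.
have [C0 [y0 [C00 y00 H0]]] := poly_geom 2 r01.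
have [y0a y0b] : 0 <= y0 /\ y0 < 1 by case/andP: y00.
pose K := (`|c1 B| + `|cc beta B * rho beta B|) * C0.
have K0 : 0 <= K by rewrite mulr_ge0// addr_ge0.
have bd e : (0 < e)%N -> e%:R * `|phi1 e B| <= K.
  move=> e0; rewrite E !normrM normfV.
  have e1 : 1 <= e%:R :> R by rewrite ler1n.
  rewrite (ger0_norm (rX_ge0 beta_ge0 e B)) (gtr0_norm (phi_arg_gt0 beta_ge0 e B)).
  rewrite mulrA ler_pdivrMr ?phi_arg_gt0//.
  apply: (@le_trans _ _ K); last by rewrite ler_peMr// lerDl ccr_ge0.
  apply: (@le_trans _ _ ((`|c1 B| + `|cc beta B * rho beta B|) * (e%:R ^+ 2 * rr B ^+ e))).
    have : `|c1 B + cc beta B * rho beta B * e%:R| <= (`|c1 B| + `|cc beta B * rho beta B|) * e%:R.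
      apply: le_trans (ler_normD _ _) _; rewrite normrM (ger0_norm (ler0n _ _)) mulrDl lerD2r.
      by rewrite ler_peMr.
    move=> h; rewrite (_ : _ * (e%:R ^+ 2 * _) = e%:R * ((`|c1 B| + `|cc beta B * rho beta B|) * e%:R * rr B ^+ e)); last by ring.
    by rewrite ler_wpM2l// ler_wpM2r ?rX_ge0.
  rewrite /K ler_wpM2l ?addr_ge0//; apply: le_trans (H0 e) _.
  by rewrite ler_piMr// exprn_ile1// ltW.
have aff e : (0 < e)%N -> e%:R * `|a0 + b0 * e%:R| <= K by move=> e0; rewrite -H// bd.
have small (x : R) : (forall n, (0 < n)%N -> n%:R * `|x| <= K) -> x = 0.
  move=> hx; apply/eqP; rewrite -normr_le0 leNgt; apply/negP => x0.
  have := hx (Num.truncn (K / `|x|)).+1 isT; rewrite leNgt => /negP; apply.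
  by rewrite -ltr_pdivrMr// truncnS_gt.
have b00 : b0 = 0.
  have K2 : 0 <= 4 * K + K by lra.
  have hb n : (0 < n)%N -> n%:R * `|b0| <= 2 * K.
    move=> n0; have := aff n n0; have := aff n.+1 isT.
    have n1 : 1 <= n%:R :> R by rewrite ler1n.
    have := normr_ge0 (a0 + b0 * n.+1%:R) => p1.
    have : n%:R * `|a0 + b0 * n.+1%:R| <= n.+1%:R * `|a0 + b0 * n.+1%:R|.
      by rewrite ler_wpM2r// ler_nat.
    have -> : n%:R * `|b0| = n%:R * `|(a0 + b0 * n.+1%:R) - (a0 + b0 * n%:R)|.
      by congr (_ * `|_|); rewrite -natr1; ring.
    have : n%:R * `|(a0 + b0 * n.+1%:R) - (a0 + b0 * n%:R)| <=
      n%:R * (`|a0 + b0 * n.+1%:R| + `|a0 + b0 * n%:R|) by rewrite ler_wpM2l// ler_normB.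
    rewrite mulrDr; lra.
  have : 2^-1 * b0 = 0.
    by apply: small => n n0; rewrite normrM (ger0_norm (_ : 0 <= 2^-1))//; have := hb n n0; lra.
  by move=> h; lra.
have a00 : a0 = 0.
  by apply: small => n n0; have := aff n n0; rewrite b00 mul0r addr0.
have Z e : (0 < e)%N -> c1 B + cc beta B * rho beta B * e%:R = 0.
  move=> e0; have := H e e0; rewrite E a00 b00 mul0r addr0 => /eqP.
  rewrite mulf_eq0 invr_eq0 (gt_eqF (phi_arg_gt0 beta_ge0 e B)) orbF mulf_eq0.
  by rewrite (gt_eqF (exprn_gt0 e r0)) orbF => /eqP.
have := Z 1%N isT; have := Z 2 isT; rewrite mulr1 => z2 z1.
have : cc beta B * rho beta B = 0 by lra.
move/eqP; rewrite mulf_eq0 gt_eqF//= /rho mulf_eq0 invr_eq0 (gt_eqF (sB_gt0 beta B)) orbF.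
rewrite mulf_eq0 oppr_eq0 pnatr_eq0/= /sinhR mulf_eq0 invr_eq0 pnatr_eq0 orbF subr_eq0.
move/eqP/expR_inj => e; move: Bn; have -> : B = 0 by lra.
by rewrite eqxx.
Qed.

End estimates.

(** * Geometric series *)

Section series_tools.
Variable R : realType.
Implicit Types (u : nat -> R) (y K : R).

Lemma geo_cvg u K y : 0 <= y < 1 -> (forall L, `|u L| <= K * y ^+ L) -> cvgn (series u).
Proof.
move=> /andP[y0 y1] H; apply: normed_cvg.
apply: (@series_le_cvg R (fun L => `|u L|) (geometric K y)) => //.
- by move=> n; apply: le_trans (H n).
- by apply: is_cvg_geometric_series; rewrite ger0_norm.
Qed.

Lemma sum_from2_cvg u (l : R) : series (fun L => u L.+2) @ \oo --> l -> sum_from2 u = l.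
Proof.
move=> h; apply/cvg_lim => //; rewrite -(cvg_shiftn 2) /=.
rewrite (_ : (fun n => _) = series (fun L => u L.+2))//.
apply/funext => n; by rewrite /series /= addn2 big_add1 big_add1.
Qed.

Lemma esum_geo (A : set nat) (a : nat -> \bar R) K y : 0 <= y < 1 -> 0 <= K ->
  (forall l, A l -> (0 <= a l <= (K * y ^+ l)%:E)%E) ->
  (\esum_(l in A) a l <= (K / (1 - y))%:E)%E.
Proof.
move=> y01 K0 H; have /andP[y0 y1] := y01.
have g0 l : 0 <= K * y ^+ l by rewrite mulr_ge0 ?exprn_ge0.
apply: (@le_trans _ _ (\esum_(l in [set: nat]) (K * y ^+ l)%:E)%E).
  rewrite esum_mkcond; apply: le_esum => l _.
  by case: ifPn => [/set_mem /H /andP[]//|_]; rewrite lee_fin.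
rewrite -nneseries_esumT; last by move=> l; rewrite lee_fin; exact: g0.
apply: lime_le; first by apply: is_cvg_nneseries => l _ _; rewrite lee_fin; exact: g0.
near=> n; rewrite sumEFin lee_fin.
have := @nondecreasing_cvgn_le R (series (geometric K y)).
have cg : cvgn (series (geometric K y)) by apply: is_cvg_geometric_series; rewrite ger0_norm.
move=> /(_ _ cg n); rewrite (cvg_lim _ (@cvg_geometric_series _ K y _)) ?ger0_norm//.
by apply; apply: nondecreasing_series => i _ _ /=.
Unshelve. all: by end_near. Qed.

Lemma summable_geo (A : set nat) u K y : 0 <= y < 1 -> 0 <= K ->
  (forall l, A l -> `|u l| <= K * y ^+ l) -> summable A (fun l => (u l)%:E).
Proof.
move=> y01 K0 H; apply: le_lt_trans (ltry (K / (1 - y))).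
by apply: esum_geo => // l Al; rewrite abse_ge0 /= lee_fin H.
Qed.

(** A sum over pairs of indices is an iterated sum of geometric bounds. *)
Lemma summable_geo2 (t : nat -> nat -> R) K y : 0 <= y < 1 -> 0 <= K ->
  (forall l j, (2 <= l)%N -> (2 <= j)%N -> `|t l j| <= K * y ^+ l * y ^+ j) ->
  summable [set lj : nat * nat | (2 <= lj.1)%N /\ (2 <= lj.2)%N] (fun lj => (t lj.1 lj.2)%:E).
Proof.
move=> y01 K0 H; have /andP[y0 y1] := y01; apply: le_lt_trans (ltry (K / (1 - y) / (1 - y))).
rewrite (_ : [set lj | _] = [set l | (2 <= l)%N] `*`` (fun=> [set j | (2 <= j)%N])); last first.
  by apply/seteqP; split=> -[l j].
have y1' : 0 <= (1 - y)^-1 by rewrite invr_ge0 subr_ge0 ltW.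
rewrite -(@esum_esum _ _ _ _ _ (fun l j => `|(t l j)%:E|%E)) => [|l j _ _]; last exact: abse_ge0.
apply: esum_geo => //; first by rewrite mulr_ge0.
move=> l l2; apply/andP; split; first by apply: esum_ge0 => j _; exact: abse_ge0.
rewrite mulrAC; apply: esum_geo => //; first by rewrite mulr_ge0 ?exprn_ge0.
by move=> j j2; rewrite abse_ge0/= lee_fin H.
Qed.

End series_tools.

Section geometric_law.
Variables (R : realType) (alpha : R).
Hypothesis alpha_ge0 : 0 <= alpha.
Let q := alpha / (1 + alpha).
Let a1p : 0 < 1 + alpha.
Proof. exact: ltr_pwDl ltr01 alpha_ge0. Qed.
Notation pl := (pil alpha).

Lemma pil_ge0 L : 0 <= pl L.
Proof. by rewrite divr_ge0 ?exprn_ge0// addr_ge0. Qed.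

Lemma pilE L : pl L = q ^+ L / (1 + alpha).
Proof. by rewrite /pil /q expr_div_n exprSr invfM mulrA. Qed.

Lemma q01 : 0 <= q < 1.
Proof.
by rewrite /q divr_ge0 ?(ltW a1p)//= ltr_pdivrMr// mul1r ltrDr.
Qed.

Lemma pil_poly a : exists K y, [/\ 0 <= K, 0 < y < 1 & forall L, L.+1%:R ^+ a * pl L <= K * y ^+ L].
Proof.
(* the base q' is positive even when alpha = 0, so that one power of it can be divided out *)
have /andP[q0 q1] := q01; pose q' := (1 + q) / 2.
have q'0 : 0 < q' by rewrite /q'; lra.
have q'1 : q' < 1 by rewrite /q'; lra.
have q'01 : 0 <= q' < 1 by rewrite ltW.
have [C [y [C0 /andP[y0 y1] H]]] := poly_geom a q'01.
pose z := (1 + y) / 2; have z0 : 0 < z by rewrite /z; lra.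
exists (C / q'), z; split; first by rewrite divr_ge0 ?(ltW q'0).
  by rewrite z0 /z; lra.
move=> L; rewrite pilE.
have h1 : q ^+ L / (1 + alpha) <= q' ^+ L.
  rewrite ler_pdivrMr//.
  apply: (@le_trans _ _ (q' ^+ L)); last by rewrite ler_peMr ?exprn_ge0 ?(ltW q'0)// lerDl.
  by rewrite lerXn2r ?nnegrE ?(ltW q'0)// /q'; lra.
apply: le_trans (ler_wpM2l _ h1) _; first exact: exprn_ge0.
rewrite mulrAC ler_pdivlMr// -mulrA -exprSr; apply: le_trans (H L.+1) _.
rewrite ler_wpM2l//; apply: (@le_trans _ _ (y ^+ L)).
  by rewrite exprS ler_piMl ?exprn_ge0// ltW.
by rewrite lerXn2r ?nnegrE ?(ltW z0)// /z; lra.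
Qed.

Lemma pil_cvg (u : nat -> R) a K : 0 <= K -> (forall L, `|u L| <= K * (L.+1%:R ^+ a * pl L)) -> cvgn (series u).
Proof.
move=> K0 H; have [K' [y [K'0 /andP[y0 y1] H']]] := pil_poly a.
apply: (@geo_cvg _ _ (K * K') y); first by rewrite ltW.
by move=> L; apply: le_trans (H L) _; rewrite -mulrA ler_wpM2l.
Qed.

Let qX0 a : (n%:R ^+ a * q ^+ n) @[n --> \oo] --> (0 : R).
Proof.
have [C [y [C0 /andP[y0 y1] H]]] := poly_geom a q01.
have /andP[q0 _] := q01.
have cy : (C * y ^+ n) @[n --> \oo] --> (0 : R).
  rewrite -[X in _ --> X](mulr0 C); apply: cvgM; first exact: cvg_cst.
  by apply: cvg_expr; rewrite ger0_norm.
apply: (@squeeze_cvgr _ _ _ _ (fun=> 0) (fun n => C * y ^+ n)) => //; last exact: cvg_cst.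
by near=> n; rewrite H mulr_ge0 ?exprn_ge0.
Unshelve. all: by end_near. Qed.

Let oneq : 1 - q = (1 + alpha)^-1.
Proof. by rewrite /q; field; rewrite gt_eqF. Qed.

(** Partial sums of the mass, the centered first moment and the variance of the geometric law
    have closed forms, from which the limits 1, 0 and [alpha (1 + alpha)] are read off. *)
Lemma pil_sum0 : series pl @ \oo --> (1 : R).
Proof.
have -> : series pl = fun n => 1 - n%:R ^+ 0 * q ^+ n.
  apply/funext; elim=> [|n IH]; first by rewrite /series/= big_geq// !expr0 mulr1 subrr.
  rewrite seriesSr IH pilE -oneq !expr0 exprS; ring.
by rewrite -[X in _ --> X]subr0; apply: cvgB; [exact: cvg_cst | exact: qX0].
Qed.

Lemma pil_sum1 : series (fun L => pl L * (L%:R - alpha)) @ \oo --> (0 : R).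
Proof.
have a1 : 1 + alpha != 0 by rewrite gt_eqF.
have -> : series (fun L => pl L * (L%:R - alpha)) = fun n => - (n%:R ^+ 1 * q ^+ n).
  apply/funext; elim=> [|n IH]; first by rewrite /series/= big_geq// expr0 expr1 mul0r oppr0.
  rewrite seriesSr IH pilE !expr1 exprS -natr1 /q; field; exact: a1.
by rewrite -[X in _ --> X]oppr0; apply: cvgN; exact: qX0.
Qed.

Lemma pil_sum2 : series (fun L => pl L * (L%:R - alpha) ^+ 2) @ \oo --> alpha * (1 + alpha).
Proof.
have a1 : 1 + alpha != 0 by rewrite gt_eqF.
have -> : series (fun L => pl L * (L%:R - alpha) ^+ 2) = fun n =>
   alpha * (1 + alpha) - (n%:R ^+ 2 * q ^+ n + alpha * (1 + alpha) * (n%:R ^+ 0 * q ^+ n)).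
  apply/funext; elim=> [|n IH]; first by rewrite /series/= big_geq// !expr0 expr0n/= mul0r add0r !mulr1 subrr.
  rewrite seriesSr IH pilE !expr0 [q ^+ n.+1]exprS -natr1 /q; field; exact: a1.
rewrite -[X in _ --> X]subr0; apply: cvgB; first exact: cvg_cst.
rewrite -[X in _ --> X](addr0 0); apply: cvgD; first exact: qX0.
by rewrite -[X in _ --> X](mulr0 (alpha * (1 + alpha))); apply: cvgM; [exact: cvg_cst | exact: qX0].
Qed.

End geometric_law.

(** * The limiting quadratic form *)

Section quadratic_form.
Variables (R : realType) (alpha : R) (g : nat -> R) (C : R).
Hypotheses (alpha_ge0 : 0 <= alpha) (C_ge0 : 0 <= C).
Hypothesis g_le : forall L, `|g L| <= C * L.+1%:R.
Notation pl := (pil alpha).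
Let V := alpha * (1 + alpha).
Let W L : R := 1 + (L%:R - alpha) ^+ 2 / V.

Let a1p : 0 < 1 + alpha.
Proof. exact: ltr_pwDl ltr01 alpha_ge0. Qed.

Let pil_le1 L : pl L <= 1.
Proof.
rewrite /pil ler_pdivrMr ?exprn_gt0// mul1r exprSr.
apply: (@le_trans _ _ ((1 + alpha) ^+ L)).
  by apply: lerXn2r; rewrite ?nnegrE// ?(ltW a1p)// lerDr.
by rewrite ler_peMr ?exprn_ge0 ?(ltW a1p)// lerDl.
Qed.

Let pil_gt0 L : 0 < alpha -> 0 < pl L.
Proof. by move=> a0; rewrite /pil divr_gt0 ?exprn_gt0. Qed.

#[local] Opaque pil.

Let dev_le L : `|L%:R - alpha| <= (1 + alpha) * L.+1%:R.
Proof.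
apply: le_trans (ler_normB _ _) _; rewrite (ger0_norm (ler0n _ _)) (ger0_norm alpha_ge0).
rewrite -natr1 mulrDl mul1r mulrDr mulr1.
have := mulr_ge0 alpha_ge0 (ler0n R L); lra.
Qed.

Let S1 a : 1 <= a.+1%:R :> R.
Proof. by rewrite ler1n. Qed.

Definition ser (u : nat -> R) : R := limn (series u).

Let ser_cvg (u : nat -> R) a K : 0 <= K ->
  (forall L, `|u L| <= K * (L.+1%:R ^+ a * pl L)) -> series u @ \oo --> ser u.
Proof. by move=> K0 H; have := @pil_cvg R alpha alpha_ge0 u a K K0 H; apply. Qed.

Let c0 : series (fun L => g L * pl L) @ \oo --> ser (fun L => g L * pl L).
Proof.
apply: (@ser_cvg _ 1 C) => // L; rewrite normrM (ger0_norm (pil_ge0 alpha_ge0 L)) expr1 [C * _]mulrA.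
by rewrite ler_wpM2r ?pil_ge0.
Qed.

Let c1 : series (fun L => g L * pl L * (L%:R - alpha)) @ \oo --> ser (fun L => g L * pl L * (L%:R - alpha)).
Proof.
apply: (@ser_cvg _ 2 (C * (1 + alpha))); first by rewrite mulr_ge0// ltW.
move=> L; rewrite 2!normrM (ger0_norm (pil_ge0 alpha_ge0 L)).
have p0 := pil_ge0 alpha_ge0 L.
have -> : C * (1 + alpha) * (L.+1%:R ^+ 2 * pl L) = (C * L.+1%:R * pl L) * ((1 + alpha) * L.+1%:R) by ring.
by apply: ler_pM => //; [exact: mulr_ge0 | rewrite ler_wpM2r].
Qed.

Let g2_le L : g L ^+ 2 <= C ^+ 2 * L.+1%:R ^+ 2.
Proof.
rewrite -(real_normK (num_real (g L))) -exprMn; apply: lerXn2r => //; rewrite nnegrE//.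
exact: mulr_ge0.
Qed.

Let c2 : series (fun L => g L ^+ 2 * pl L) @ \oo --> ser (fun L => g L ^+ 2 * pl L).
Proof.
have C2 : 0 <= C ^+ 2 by exact: sqr_ge0.
apply: (@ser_cvg _ 2 (C ^+ 2)) => // L.
rewrite ger0_norm; last by apply: mulr_ge0; [exact: sqr_ge0 | exact: pil_ge0].
by rewrite [C ^+ 2 * _]mulrA; apply: ler_wpM2r; [exact: pil_ge0 | exact: g2_le].
Qed.

Let V_ge0 : 0 <= V. Proof. by apply: mulr_ge0 => //; exact: ltW. Qed.

Let W_le L : 0 <= W L <= (1 + (1 + alpha) ^+ 2 / V) * L.+1%:R ^+ 2.
Proof.
have d2 : (L%:R - alpha) ^+ 2 <= (1 + alpha) ^+ 2 * L.+1%:R ^+ 2.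
  rewrite -(real_normK (num_real (L%:R - alpha))) -exprMn; apply: lerXn2r => //; rewrite nnegrE//.
  by apply: mulr_ge0 => //; exact: ltW.
have d0 : 0 <= (L%:R - alpha) ^+ 2 / V by apply: divr_ge0 => //; exact: sqr_ge0.
rewrite /W addr_ge0//= mulrDl; apply: lerD.
  by rewrite mul1r exprn_ege1.
by rewrite [leRHS]mulrAC; apply: ler_wpM2r; rewrite ?invr_ge0.
Qed.

Let c3 : series (fun L => (g L * pl L) ^+ 2 * W L) @ \oo --> ser (fun L => (g L * pl L) ^+ 2 * W L).
Proof.
have C2 : 0 <= C ^+ 2 by exact: sqr_ge0.
have K0 : 0 <= 1 + (1 + alpha) ^+ 2 / V by apply: addr_ge0 => //; apply: divr_ge0 => //; exact: sqr_ge0.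
apply: (@ser_cvg _ 4 (C ^+ 2 * (1 + (1 + alpha) ^+ 2 / V))); first exact: mulr_ge0.
move=> L; have p0 := pil_ge0 alpha_ge0 L; have /andP[W0 W1] := W_le L.
have gp : 0 <= (g L * pl L) ^+ 2 by exact: sqr_ge0.
rewrite ger0_norm; last exact: mulr_ge0.
have -> : C ^+ 2 * (1 + (1 + alpha) ^+ 2 / V) * (L.+1%:R ^+ 4 * pl L) =
  (C ^+ 2 * L.+1%:R ^+ 2 * pl L) * ((1 + (1 + alpha) ^+ 2 / V) * L.+1%:R ^+ 2) by ring.
apply: ler_pM => //; rewrite exprMn.
apply: ler_pM; [exact: sqr_ge0 | exact: sqr_ge0 | exact: g2_le |].
by rewrite expr2 ler_piMr.
Qed.

(** Weighted second moment of [g] minus its projections on the constants and on the centered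
    length, that is the residual of the linear regression of [g] on the length. *)
Definition Qlim := ser (fun L => g L ^+ 2 * pl L) - ser (fun L => g L * pl L) ^+ 2
   - ser (fun L => g L * pl L * (L%:R - alpha)) ^+ 2 / V.

Section positive.
Hypothesis alpha_gt0 : 0 < alpha.
Let V0 : V != 0. Proof. by rewrite gt_eqF// mulr_gt0. Qed.

(** Each of the two rank-one parts of the kernel factors into a square of a single sum. *)
Lemma truncated_form M : \sum_(L < M) \sum_(J < M) g L * g J * Hker L.+2 J.+2 alpha =
  series (fun L => g L ^+ 2 * pl L) M - series (fun L => g L * pl L) M ^+ 2
   - series (fun L => g L * pl L * (L%:R - alpha)) M ^+ 2 / V.
Proof.
rewrite /series /= !big_mkord.
transitivity (\sum_(L < M) (g L ^+ 2 * pl L - g L * pl L * (\sum_(J < M) g J * pl J)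
   - g L * pl L * (L%:R - alpha) * (\sum_(J < M) g J * pl J * (J%:R - alpha)) / V)).
  apply: eq_bigr => L _.
  transitivity (\sum_(J < M) ((L == J)%:R * (g L ^+ 2 * pl L) - g L * pl L * (g J * pl J)
     - g L * pl L * (L%:R - alpha) / V * (g J * pl J * (J%:R - alpha)))).
    apply: eq_bigr => J _; rewrite (HkerE alpha_gt0) -/V val_eqE.
    case: eqVneq => [->|_]; rewrite /=; field; exact: V0.
  rewrite !sumrB -!mulr_sumr; congr (_ - _ - _).
    rewrite (bigD1 L)//= eqxx mul1r big1 ?addr0// => J JL.
    by rewrite eq_sym (negPf JL) mul0r.
  by rewrite mulrAC.
by rewrite !sumrB -!mulr_suml -!expr2.
Qed.

Lemma truncated_form_cvg :
  (fun M => \sum_(L < M) \sum_(J < M) g L * g J * Hker L.+2 J.+2 alpha) @ \oo --> Qlim.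
Proof.
under eq_cvg do rewrite truncated_form.
apply: cvgB; first apply: cvgB; first exact: c2.
  by rewrite expr2; under eq_cvg do rewrite expr2; apply: cvgM; exact: c0.
apply: cvgM; last exact: cvg_cst.
by rewrite expr2; under eq_cvg do rewrite expr2; apply: cvgM; exact: c1.
Qed.

Let s0 := ser (fun L => g L * pl L).
Let s1 := ser (fun L => g L * pl L * (L%:R - alpha)).

Lemma Qlim_residual :
  series (fun L => pl L * (g L - s0 - s1 / V * (L%:R - alpha)) ^+ 2) @ \oo --> Qlim.
Proof.
have -> : series (fun L => pl L * (g L - s0 - s1 / V * (L%:R - alpha)) ^+ 2) = fun n =>
  series (fun L => g L ^+ 2 * pl L) n - 2 * s0 * series (fun L => g L * pl L) n
  - 2 * (s1 / V) * series (fun L => g L * pl L * (L%:R - alpha)) n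
  + s0 ^+ 2 * series pl n + 2 * s0 * (s1 / V) * series (fun L => pl L * (L%:R - alpha)) n
  + (s1 / V) ^+ 2 * series (fun L => pl L * (L%:R - alpha) ^+ 2) n.
  apply/funext; elim=> [|n IH]; first by rewrite /series/= !big_geq// !mulr0; ring.
  by rewrite 7!seriesSr IH; ring.
have -> : Qlim = ser (fun L => g L ^+ 2 * pl L) - 2 * s0 * s0 - 2 * (s1 / V) * s1 + s0 ^+ 2 * 1
  + 2 * s0 * (s1 / V) * 0 + (s1 / V) ^+ 2 * V.
  rewrite /Qlim -/s0 -/s1; field; exact: V0.
have cZ (a : R) (u : nat -> R) (l : R) : u @ \oo --> l -> (fun n => a * u n) @ \oo --> a * l.
  by move=> h; apply: cvgM => //; exact: cvg_cst.
apply: cvgD; last exact: cZ (pil_sum2 alpha_ge0).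
apply: cvgD; last exact: cZ (pil_sum1 alpha_ge0).
apply: cvgD; last exact: cZ (pil_sum0 alpha_ge0).
apply: cvgB; last exact: cZ c1.
by apply: cvgB; [exact: c2 | exact: cZ c0].
Qed.

Let res_ge0 L : 0 <= pl L * (g L - s0 - s1 / V * (L%:R - alpha)) ^+ 2.
Proof. by apply: mulr_ge0; [exact: pil_ge0 | exact: sqr_ge0]. Qed.

Let res_le n : series (fun L => pl L * (g L - s0 - s1 / V * (L%:R - alpha)) ^+ 2) n <= Qlim.
Proof.
rewrite -(cvg_lim _ Qlim_residual)//; apply: nondecreasing_cvgn_le.
  by apply: nondecreasing_series => i _ _; exact: res_ge0.
by apply/cvg_ex; exists Qlim; exact: Qlim_residual.
Qed.

Lemma Qlim_ge0 : 0 <= Qlim.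
Proof. by have := res_le 0; rewrite /series/= big_geq. Qed.

Lemma Qlim_gt0 : (forall a b : R, ~ forall L, g L = a + b * L.+1%:R) -> 0 < Qlim.
Proof.
move=> na; rewrite lt_neqAle Qlim_ge0 andbT eq_sym; apply/eqP => Q0.
apply: (na (s0 - s1 / V * (1 + alpha)) (s1 / V)) => L.
have h : series (fun L => pl L * (g L - s0 - s1 / V * (L%:R - alpha)) ^+ 2) L.+1 <= 0.
  by rewrite -Q0 res_le.
have : pl L * (g L - s0 - s1 / V * (L%:R - alpha)) ^+ 2 <= 0.
  apply: le_trans h; rewrite seriesSr lerDr /series/=.
  by apply: sumr_ge0 => i _; exact: res_ge0.
have p0 : 0 < pl L by exact: pil_gt0.
rewrite pmulr_rle0// => hs; have /eqP : (g L - s0 - s1 / V * (L%:R - alpha)) ^+ 2 = 0.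
  by apply/eqP; rewrite eq_le hs sqr_ge0.
rewrite sqrf_eq0 => /eqP e; rewrite -natr1; move: e; set z := s1 / V; lra.
Qed.

Lemma diagonal_series :
  series (fun L => g L ^+ 2 * Hker L.+2 L.+2 alpha) @ \oo -->
   ser (fun L => g L ^+ 2 * pl L) - ser (fun L => (g L * pl L) ^+ 2 * W L).
Proof.
have -> : series (fun L => g L ^+ 2 * Hker L.+2 L.+2 alpha) = fun n =>
  series (fun L => g L ^+ 2 * pl L) n - series (fun L => (g L * pl L) ^+ 2 * W L) n.
  apply/funext => n; rewrite /series/= -sumrB; apply: eq_bigr => L _.
  by rewrite (HkerE alpha_gt0) eqxx /= /W /V; ring.
by apply: cvgB; [exact: c2 | exact: c3].
Qed.

Let inner L : series (fun J => if J.+2 == L.+2 then 0 else g L * g J * Hker L.+2 J.+2 alpha) @ \oo -->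
  - (g L * pl L * s0) - g L * pl L * (L%:R - alpha) * (s1 / V) + (g L * pl L) ^+ 2 * W L.
Proof.
pose u n := - (g L * pl L) * series (fun J => g J * pl J) n
  - g L * pl L * (L%:R - alpha) / V * series (fun J => g J * pl J * (J%:R - alpha)) n + (g L * pl L) ^+ 2 * W L.
have cu : u @ \oo --> - (g L * pl L * s0) - g L * pl L * (L%:R - alpha) * (s1 / V) + (g L * pl L) ^+ 2 * W L.
  apply: cvgD; last exact: cvg_cst.
  have -> : - (g L * pl L * s0) - g L * pl L * (L%:R - alpha) * (s1 / V) =
    - (g L * pl L) * s0 - g L * pl L * (L%:R - alpha) / V * s1 by ring.
  by apply: cvgB; apply: cvgM; [exact: cvg_cst | exact: c0 | exact: cvg_cst | exact: c1].
apply: cvg_near_eq cu; near=> n; have Ln : (L < n)%N by near: n; exact: nbhs_infty_gt.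
rewrite /u /series /= !big_mkord !mulr_sumr -sumrB.
rewrite (bigD1 (Ordinal Ln))//= [RHS](bigD1 (Ordinal Ln))//= eqxx add0r.
rewrite addrAC -[RHS]add0r; congr (_ + _).
  by rewrite /W; ring.
apply: eq_bigr => J JL; have JL' : (J : nat) != L by rewrite -(inj_eq val_inj) in JL.
rewrite !eqSS (negPf JL') (HkerE alpha_gt0) eq_sym (negPf JL') -/V /=; ring.
Unshelve. all: by end_near. Qed.

(** The inner sums converge to a combination of the full sums, corrected by the excluded
    diagonal term; the correction cancels with that of [diagonal_series]. *)
Lemma offdiagonal_series :
  series (fun L => sum_from2 (fun j => if j == L.+2 then 0 else g L * g (j - 2) * Hker L.+2 j alpha)) @ \oo -->
  - s0 ^+ 2 - s1 ^+ 2 / V + ser (fun L => (g L * pl L) ^+ 2 * W L).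
Proof.
have -> : (fun L => sum_from2 (fun j => if j == L.+2 then 0 else g L * g (j - 2) * Hker L.+2 j alpha)) =
  fun L => - s0 * (g L * pl L) - s1 / V * (g L * pl L * (L%:R - alpha)) + (g L * pl L) ^+ 2 * W L.
  apply/funext => L.
  have -> : - s0 * (g L * pl L) - s1 / V * (g L * pl L * (L%:R - alpha)) = 
    - (g L * pl L * s0) - g L * pl L * (L%:R - alpha) * (s1 / V) by ring.
  apply: sum_from2_cvg; rewrite [X in series X](_ : _ = fun J => if J.+2 == L.+2 then 0 else g L * g J * Hker L.+2 J.+2 alpha).
    exact: inner.
  by apply/funext => J; rewrite !subSS subn0.
have -> : series (fun L => - s0 * (g L * pl L) - s1 / V * (g L * pl L * (L%:R - alpha)) + (g L * pl L) ^+ 2 * W L)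
  = fun n => - s0 * series (fun L => g L * pl L) n - s1 / V * series (fun L => g L * pl L * (L%:R - alpha)) n
    + series (fun L => (g L * pl L) ^+ 2 * W L) n.
  by apply/funext => n; rewrite /series/= !mulr_sumr -sumrB -big_split.
have -> : - s0 ^+ 2 - s1 ^+ 2 / V = - s0 * s0 - s1 / V * s1 by ring.
apply: cvgD; last exact: c3.
by apply: cvgB; apply: cvgM; [exact: cvg_cst | exact: c0 | exact: cvg_cst | exact: c1].
Qed.

Lemma double_series : (sum_from2 (fun l => g (l - 2) ^+ 2 * Hker l l alpha)
  + sum_from2 (fun l => sum_from2 (fun j => if j == l then 0 else g (l - 2) * g (j - 2) * Hker l j alpha)))
  = Qlim.
Proof.
have -> : sum_from2 (fun l => g (l - 2) ^+ 2 * Hker l l alpha) =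
    ser (fun L => g L ^+ 2 * pl L) - ser (fun L => (g L * pl L) ^+ 2 * W L).
  apply: sum_from2_cvg.
  rewrite [X in series X](_ : _ = fun L => g L ^+ 2 * Hker L.+2 L.+2 alpha); first exact: diagonal_series.
  by apply/funext => L; rewrite !subSS subn0.
have -> : sum_from2 (fun l => sum_from2 (fun j => if j == l then 0 else g (l - 2) * g (j - 2) * Hker l j alpha))
    = - s0 ^+ 2 - s1 ^+ 2 / V + ser (fun L => (g L * pl L) ^+ 2 * W L).
  apply: sum_from2_cvg.
  rewrite [X in series X](_ : _ = fun L => sum_from2 (fun j => if j == L.+2 then 0 else g L * g (j - 2) * Hker L.+2 j alpha)).
    exact: offdiagonal_series.
  by apply/funext => L; rewrite !subSS subn0.
rewrite /Qlim -/s0 -/s1; ring.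
Qed.

End positive.

(** The off-diagonal part is at most a product of two geometric sequences; on the diagonal
    [y^L] is written as a product of two powers of [sqrt y]. *)
Lemma form_summable : summable [set lj : nat * nat | (2 <= lj.1)%N /\ (2 <= lj.2)%N]
  (fun lj => (g (lj.1 - 2) * g (lj.2 - 2) * Hker lj.1 lj.2 alpha)%:E).
Proof.
have [K [y [K0 /andP[y0 y1] HK]]] := pil_poly alpha_ge0 2.
pose z := Num.sqrt y; have z0 : 0 < z by rewrite sqrtr_gt0.
have zz : z * z = y by rewrite -expr2 sqr_sqrtr// ltW.
have z1 : z < 1 by rewrite -sqrtr1 ltr_sqrt.
have yz : y <= z by rewrite -zz ler_piMl// ltW.
pose K1 := 1 + (1 + alpha) ^+ 2 / V.
have K10 : 0 <= K1 by apply: addr_ge0 => //; apply: divr_ge0 => //; exact: sqr_ge0.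
have C2 : 0 <= C ^+ 2 by exact: sqr_ge0.
pose K2 := C ^+ 2 * K1 * K ^+ 2 + C ^+ 2 * K.
have K20 : 0 <= K2.
  by apply: addr_ge0; apply: mulr_ge0 => //; [exact: mulr_ge0 | exact: sqr_ge0].
apply: (@summable_geo2 _ (fun l j => g (l - 2) * g (j - 2) * Hker l j alpha) (K2 / z ^+ 4) z).
- by rewrite (ltW z0).
- by apply: divr_ge0 => //; rewrite exprn_ge0// ltW.
move=> [|[|L]] [|[|J]]// _ _.
have -> : (L.+2 - 2 = L)%N by rewrite !subSS subn0.
have -> : (J.+2 - 2 = J)%N by rewrite !subSS subn0.
have -> : K2 / z ^+ 4 * z ^+ L.+2 * z ^+ J.+2 = K2 * (z ^+ L * z ^+ J).
  by rewrite -[L.+2]addn2 -[J.+2]addn2 !exprD; field; rewrite gt_eqF.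
have zL n : 0 <= z ^+ n by rewrite exprn_ge0// ltW.
have [a0|a0] := eqVneq alpha 0.
  rewrite a0 Hker0 mulr0 normr0; apply: mulr_ge0 => //; exact: mulr_ge0.
have ap : 0 < alpha by rewrite lt_neqAle eq_sym a0.
have pL := pil_ge0 alpha_ge0 L; have pJ := pil_ge0 alpha_ge0 J.
have Vp : 0 < V by rewrite /V mulr_gt0.
have hH : `|Hker L.+2 J.+2 alpha| <= K1 * (L.+1%:R * J.+1%:R) * (pl L * pl J) + (L == J)%:R * pl L.
  rewrite (HkerE ap) -/V; apply: le_trans (ler_normD _ _) _; apply: lerD; last first.
    by rewrite ger0_norm// mulr_ge0.
  rewrite mulNr normrN normrM (ger0_norm (mulr_ge0 pL pJ)) mulrC ler_wpM2r//; first exact: mulr_ge0.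
  apply: le_trans (ler_normD _ _) _; rewrite normr1 /K1 [leRHS]mulrDl; apply: lerD.
    rewrite mul1r; have := ler_pM ler01 ler01 (S1 L) (S1 J); rewrite mulr1; exact.
  rewrite 2!normrM (gtr0_norm (_ : 0 < V^-1)) ?invr_gt0// [leRHS]mulrAC ler_wpM2r ?invr_ge0//.
  have -> : (1 + alpha) ^+ 2 * (L.+1%:R * J.+1%:R) = ((1 + alpha) * L.+1%:R) * ((1 + alpha) * J.+1%:R) by ring.
  exact: ler_pM.
have gg : `|g L * g J| <= (C * L.+1%:R) * (C * J.+1%:R) by rewrite normrM; apply: ler_pM.
rewrite normrM; apply: le_trans (ler_pM _ _ gg hH) _ => //.
rewrite mulrDr /K2 [leRHS]mulrDl; apply: lerD.
  have -> : C * L.+1%:R * (C * J.+1%:R) * (K1 * (L.+1%:R * J.+1%:R) * (pl L * pl J)) =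
    C ^+ 2 * K1 * ((L.+1%:R ^+ 2 * pl L) * (J.+1%:R ^+ 2 * pl J)) by ring.
  rewrite -[leRHS]mulrA; apply: ler_wpM2l; first exact: mulr_ge0.
  have -> : K ^+ 2 * (z ^+ L * z ^+ J) = (K * z ^+ L) * (K * z ^+ J) by ring.
  have h n : n.+1%:R ^+ 2 * pl n <= K * z ^+ n.
    apply: le_trans (HK n) _; rewrite ler_wpM2l//.
    by apply: lerXn2r => //; rewrite nnegrE ltW.
  apply: ler_pM => //; apply: mulr_ge0 => //; exact: sqr_ge0.
have [<-|_] := eqVneq L J; last by rewrite mul0r mulr0; apply: mulr_ge0; apply: mulr_ge0.
have -> : C * L.+1%:R * (C * L.+1%:R) * (1%:R * pl L) = C ^+ 2 * (L.+1%:R ^+ 2 * pl L) by ring.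
rewrite -[leRHS]mulrA; apply: ler_wpM2l => //; apply: le_trans (HK L) _.
by rewrite -exprMn zz.
Qed.

End quadratic_form.

(** * The constants chi and sigma2_G *)

Section instances.
Variables (R : realType) (p beta B : R).
Hypotheses (p01 : 0 <= p <= 1) (beta_ge0 : 0 <= beta).
Notation alpha := (alpha12 p).

Lemma alpha12_ge0 : 0 <= alpha.
Proof. by case/andP: p01 => p0 p1; rewrite /alpha12 divr_ge0 ?mulr_ge0 ?subr_ge0. Qed.

Lemma gammaE e : (0 < e)%N -> gamma beta e.+1 B = phi1 beta e B.
Proof.
move=> e0; rewrite /gamma /phi1; congr (derive1 _ B); apply/funext => b.
by rewrite gamma_arg.
Qed.

Lemma La2E : derive1n 2 (fun b => ln (lambda_plus beta b)) B = La2 beta B.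
Proof. by []. Qed.

Lemma chi_termE L : chi_term p beta B L.+2 = pstar p L.+2 * (Pf2 beta B + phi2 beta L.+1 B).
Proof.
rewrite /chi_term; congr (_ * _).
have -> : (fun b => ln (A_plus beta b + A_minus beta b * Defs.ratio beta b ^+ L.+2)) = fun b => Pf beta b + phi beta L.+1 b.
  by apply/funext => b; rewrite (chi_arg beta_ge0).
have [P_1 P_2] := D1_Pf beta; have [f_1 f_2] := D1_phi beta_ge0 L.+1.
rewrite /derive1n /= (D1_derive1 (D1D P_1 f_1)).
by rewrite (D1_derive1 (D1D P_2 f_2)).
Qed.

#[local] Opaque phi1 phi2 Pf2 La2 gamma Hker.

Lemma phi_bounds : exists2 C, 0 <= C &
  forall L, `|phi1 beta L.+1 B| <= C * L.+1%:R /\ `|phi2 beta L.+1 B| <= C * L.+1%:R ^+ 2.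
Proof. by have [[C C0 H] _] := phi_taylor beta_ge0 B; exists C => // L; exact: H. Qed.

Lemma pstarE L : p < 1 -> pstar p L.+2 = (1 - p) / 2 * pil alpha L.
Proof.
move=> p1; have /andP[p0 _] := p01.
have n1 : 1 - p != 0 by rewrite subr_eq0 gt_eqF.
have n2 : p + 1 != 0 by rewrite gt_eqF// ltr_wpDl.
have n3 : 1 + alpha != 0 by rewrite gt_eqF// ltr_wpDr ?alpha12_ge0.
rewrite /pstar pilE !subSS subn0.
have e1 : 1 + alpha = (p + 1) / (1 - p) by rewrite /alpha12; field; exact: n1.
have -> : alpha / (1 + alpha) = 2 * p / (p + 1).
  by rewrite e1 /alpha12; field; rewrite ?n1 ?n2.
by rewrite e1 invf_div; ring.
Qed.

Lemma phi2_series : exists S : R,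
  (fun M => \sum_(L < M) phi2 beta L.+1 B * pil alpha L) @ \oo --> S.
Proof.
have [C C0 H] := phi_bounds.
have h : cvgn (series (fun L => phi2 beta L.+1 B * pil alpha L)).
  apply: (@pil_cvg _ alpha alpha12_ge0 _ 2 C C0) => L.
  have p0 := pil_ge0 alpha12_ge0 L; have [_ h2] := H L.
  by rewrite normrM (ger0_norm p0) [C * _]mulrA ler_wpM2r.
exists (limn (series (fun L => phi2 beta L.+1 B * pil alpha L))).
rewrite (_ : (fun M => _) = series (fun L => phi2 beta L.+1 B * pil alpha L)); first exact: h.
by apply/funext => M; rewrite /series/= big_mkord.
Qed.

Lemma chi_proper S : p < 1 ->
  (fun M => \sum_(L < M) phi2 beta L.+1 B * pil alpha L) @ \oo --> S ->
  chi p beta B = La2 beta B + (1 - p) / 2 * (Pf2 beta B + S).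
Proof.
move=> p1 hS; rewrite /chi La2E; congr (_ + _); apply: sum_from2_cvg.
have -> : series (fun L => chi_term p beta B L.+2) = fun n =>
   (1 - p) / 2 * (Pf2 beta B * series (pil alpha) n + \sum_(L < n) phi2 beta L.+1 B * pil alpha L).
  apply/funext; elim=> [|n IH].
    by rewrite /series/= !big_geq// big_ord0 mulr0 addr0 mulr0.
  rewrite seriesSr IH big_ord_recr/= [series (pil alpha) n.+1]seriesSr chi_termE (pstarE _ p1); ring.
apply: cvgM; first exact: cvg_cst.
apply: cvgD => //; rewrite -[X in _ --> X]mulr1; apply: cvgM; first exact: cvg_cst.
exact: pil_sum0 alpha12_ge0.
Qed.

Lemma pstar1 L : p = 1 -> pstar p L = 0.
Proof. by move=> ->; rewrite /pstar subrr mul0r !mulr0. Qed.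

Lemma chi_degenerate : p = 1 -> chi p beta B = La2 beta B.
Proof.
move=> p1; rewrite /chi La2E -[RHS]addr0; congr (_ + _); apply: sum_from2_cvg.
rewrite (_ : series _ = fun=> 0); first exact: cvg_cst.
by apply/funext => n; rewrite /series/= big1// => L _; rewrite chi_termE pstar1// mul0r.
Qed.

Lemma chi_summable : summable [set l : nat | (2 <= l)%N] (fun l => (chi_term p beta B l)%:E).
Proof.
have /andP[p0 p1] := p01.
have [C C0 H] := phi_bounds.
have [K [y [K0 /andP[y0 y1] HK]]] := pil_poly alpha12_ge0 2.
apply: (@summable_geo _ _ _ ((`|Pf2 beta B| + C) * K / y ^+ 2) y); first by rewrite (ltW y0).
  by rewrite divr_ge0 ?exprn_ge0 ?(ltW y0)// mulr_ge0// addr_ge0.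
move=> [|[|L]]// _; rewrite chi_termE.
have -> : (`|Pf2 beta B| + C) * K / y ^+ 2 * y ^+ L.+2 = (`|Pf2 beta B| + C) * (K * y ^+ L).
  by rewrite -[L.+2]addn2 exprD; field; rewrite gt_eqF.
have [e|ne] := eqVneq p 1.
  by rewrite pstar1// mul0r normr0; apply: mulr_ge0; [exact: addr_ge0 | apply: mulr_ge0 => //; rewrite exprn_ge0 ?ltW].
have p1' : p < 1 by rewrite lt_neqAle ne.
have q0 : 0 <= (1 - p) / 2 by rewrite divr_ge0 ?subr_ge0.
have q1 : (1 - p) / 2 <= 1 by rewrite ler_pdivrMr//; lra.
have l0 := pil_ge0 alpha12_ge0 L; have [_ h2] := H L.
rewrite pstarE// normrM normrM (ger0_norm q0) (ger0_norm l0).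
apply: (@le_trans _ _ (pil alpha L * ((`|Pf2 beta B| + C) * L.+1%:R ^+ 2))).
  apply: ler_pM => //; first exact: mulr_ge0.
    by rewrite ler_piMl.
  apply: le_trans (ler_normD _ _) _; rewrite mulrDl lerD// ler_peMr//.
  by rewrite exprn_ege1// ler1n.
rewrite mulrCA ler_wpM2l ?addr_ge0// mulrC; exact: HK.
Qed.

Let g L := phi1 beta L.+1 B.

Lemma sigma_termE L J :
  sigma2_G_term p beta B L.+2 J.+2 = g (L.+2 - 2) * g (J.+2 - 2) * Hker L.+2 J.+2 alpha.
Proof. by rewrite /sigma2_G_term 2?gammaE ?(subSS, subn0). Qed.

Lemma sigma_summable : summable [set lj : nat * nat | (2 <= lj.1)%N /\ (2 <= lj.2)%N]
  (fun lj => (sigma2_G_term p beta B lj.1 lj.2)%:E).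
Proof.
have [C C0 H] := phi_bounds.
have := @form_summable _ alpha g C alpha12_ge0 (fun L => (H L).1).
apply: le_lt_trans; apply: le_esum => -[l j] /= [l2 j2].
by rewrite -(subnK l2) -(subnK j2) !addn2 sigma_termE.
Qed.

Lemma sum_from2_ext (u v : nat -> R) : (forall L, u L.+2 = v L.+2) -> sum_from2 u = sum_from2 v.
Proof.
move=> h; rewrite /sum_from2; congr (limn _); apply/funext => n.
apply: eq_big_nat => l /andP[l2 _]; rewrite -(subnK l2) addn2; exact: h.
Qed.

Lemma sigma2_GE : sigma2_G p beta B = (1 - p) / 2 *
 (sum_from2 (fun l => g (l - 2) ^+ 2 * Hker l l alpha)
  + sum_from2 (fun l => sum_from2 (fun j => if j == l then 0 else g (l - 2) * g (j - 2) * Hker l j alpha))).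
Proof.
rewrite /sigma2_G; apply: congr1; apply: congr2; apply: sum_from2_ext => L.
  by rewrite gammaE ?(subSS, subn0).
by apply: sum_from2_ext => J; rewrite sigma_termE.
Qed.

Lemma alpha12_gt0 : 0 < p < 1 -> 0 < alpha.
Proof. by case/andP=> p0 p1; rewrite /alpha12 divr_gt0 ?mulr_gt0 ?subr_gt0. Qed.

Lemma alpha12_zero : p = 0 \/ p = 1 -> alpha = 0.
Proof. by rewrite /alpha12; case=> ->; rewrite ?mulr0 ?mul0r// subrr invr0 mulr0. Qed.

Lemma sum_from2_0 : sum_from2 (fun=> 0 : R) = 0.
Proof.
apply: sum_from2_cvg; rewrite (_ : series _ = fun=> 0); first exact: cvg_cst.
by apply/funext => n; rewrite /series/= big1.
Qed.

Lemma sigma2_G_degenerate : p = 0 \/ p = 1 -> sigma2_G p beta B = 0.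
Proof.
move=> h; rewrite sigma2_GE (alpha12_zero h).
have -> : sum_from2 (fun l => g (l - 2) ^+ 2 * Hker l l 0) = 0.
  by rewrite -[RHS]sum_from2_0; apply: sum_from2_ext => L; rewrite Hker0 mulr0.
have -> : sum_from2 (fun l => sum_from2 (fun j => if j == l then 0 else g (l - 2) * g (j - 2) * Hker l j 0)) = 0.
  rewrite -[RHS]sum_from2_0; apply: sum_from2_ext => L.
  rewrite -[RHS]sum_from2_0; apply: sum_from2_ext => J.
  by rewrite Hker0 mulr0 if_same.
by rewrite addr0 mulr0.
Qed.

Lemma p_cases : (p = 0 \/ p = 1) \/ 0 < p < 1.
Proof.
have /andP[p0 p1] := p01.
have [->|n0] := eqVneq p 0; first by left; left.
have [->|n1] := eqVneq p 1; first by left; right.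
by right; rewrite lt_neqAle eq_sym n0 p0 lt_neqAle n1.
Qed.

Lemma sigma2_G_ge0 : 0 <= sigma2_G p beta B.
Proof.
have [h|h] := p_cases; first by rewrite sigma2_G_degenerate.
have [C C0 H] := phi_bounds; have /andP[_ p1] := h.
rewrite sigma2_GE (double_series alpha12_ge0 C0 (fun L => (H L).1) (alpha12_gt0 h)).
apply: mulr_ge0; first by rewrite divr_ge0// subr_ge0 ltW.
exact: Qlim_ge0 alpha12_ge0 C0 (fun L => (H L).1) (alpha12_gt0 h).
Qed.

Lemma sigma2_G_gt0 : 0 < p < 1 -> 0 < beta -> B != 0 -> 0 < sigma2_G p beta B.
Proof.
move=> h bp Bn; have [C C0 H] := phi_bounds; have /andP[_ p1] := h.
rewrite sigma2_GE (double_series alpha12_ge0 C0 (fun L => (H L).1) (alpha12_gt0 h)).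
apply: mulr_gt0; first by rewrite divr_gt0// subr_gt0.
apply: (Qlim_gt0 alpha12_ge0 C0 (fun L => (H L).1) (alpha12_gt0 h)) => a b aff.
by apply: (phi1_not_affine beta_ge0 (a0 := a) (b0 := b) bp Bn) => -[|e]// _; exact: aff.
Qed.

Lemma sigma_proper : p < 1 -> exists2 Q,
  (fun M => \sum_(L < M) \sum_(J < M) phi1 beta L.+1 B * phi1 beta J.+1 B * Hker L.+2 J.+2 alpha) @ \oo --> Q &
  sigma2_G p beta B = (1 - p) / 2 * Q.
Proof.
move=> p1; have [h|h] := p_cases.
  exists 0; last by rewrite sigma2_G_degenerate// mulr0.
  rewrite (_ : (fun M => _) = fun=> 0); first exact: cvg_cst.
  apply/funext => M; rewrite big1// => L _; rewrite big1// => J _.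
  by rewrite (alpha12_zero h) Hker0 mulr0.
have [C C0 H] := phi_bounds.
exists (Qlim alpha g); first exact: truncated_form_cvg alpha12_ge0 C0 (fun L => (H L).1) (alpha12_gt0 h).
by rewrite sigma2_GE (double_series alpha12_ge0 C0 (fun L => (H L).1) (alpha12_gt0 h)).
Qed.

End instances.

(** * Quenched moments as derivatives in the field *)

Lemma D1_sum (R : realType) (I : Type) (r : seq I) (f f' : I -> R -> R) : (forall i, D1 (f i) (f' i)) ->
  D1 (fun b => \sum_(i <- r) f i b) (fun b => \sum_(i <- r) f' i b).
Proof.
move=> h; elim: r => [|i r IH].
  rewrite (_ : (fun b => _) = fun=> 0); last by apply/funext => b; rewrite big_nil.
  by apply: D1_eq (D1_cst 0) _ => b; rewrite big_nil.
rewrite (_ : (fun b => _) = fun b => f i b + \sum_(j <- r) f j b); last first.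
  by apply/funext => b; rewrite big_cons.
by apply: D1_eq (D1D (h i) IH) _ => b; rewrite big_cons.
Qed.

Section quenched_moments.
Variables (R : realType) (N : nat) (d : 'I_N -> nat) (beta : R).
Variable M : {set {set half_edge d}}.
Local Notation S := (@total_spin R N).
Local Notation Z := (fun b => partition_function beta b M).

Let wgt b (j : nat) := \sum_(s : config N) S s ^+ j * boltzmann beta b M s.

Let ZE b : Z b = wgt b 0.
Proof. by apply: eq_bigr => s _; rewrite expr0 mul1r. Qed.

Lemma partition_function_gt0 b : 0 < Z b.
Proof.
rewrite /partition_function (bigD1 [ffun=> true])//= ltr_pwDl ?expR_gt0//.
by apply: sumr_ge0 => s _; exact: expR_ge0.
Qed.

Let Zn0 b : Z b != 0. Proof. by rewrite gt_eqF ?partition_function_gt0. Qed.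

Let D1_wgt j : D1 (fun b => wgt b j) (fun b => wgt b j.+1).
Proof.
apply: D1_sum => s; rewrite /boltzmann; set c := beta * _.
apply: D1_eq (D1M (D1_cst (S s ^+ j)) (D1_exp (D1D (D1_cst c) (D1M (@D1_id R) (D1_cst (S s)))))) _ => b.
by rewrite exprSr; ring.
Qed.

(** Tilting by [h] the total spin is a shift of the field. *)
Lemma quenched_exp B h :
  quenched_expect beta B M (fun s => expR (h * S s)) = Z (B + h) / Z B.
Proof.
rewrite /quenched_expect /partition_function mulr_suml; apply: eq_bigr => s _.
by rewrite /quenched /boltzmann mulrAC -expRD; congr (expR _ / _); ring.
Qed.

Let qE B (f : config N -> R) : quenched_expect beta B M f = (\sum_s f s * boltzmann beta B M s) / Z B.
Proof.
by rewrite /quenched_expect mulr_suml; apply: eq_bigr => s _; rewrite /quenched mulrAC [_ * f s]mulrC.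
Qed.

Let D1_lnZ : D1 (fun b => ln (Z b)) (fun b => wgt b 1 / wgt b 0).
Proof.
have h : D1 Z (fun b => wgt b 1) by rewrite (_ : Z = wgt^~ 0); [exact: D1_wgt | apply/funext => b; exact: ZE].
by apply: D1_eq (D1_ln partition_function_gt0 h) _ => b; rewrite -ZE.
Qed.

Lemma quenched_mean B : quenched_expect beta B M S = derive1 (fun b => ln (Z b)) B.
Proof.
by rewrite (D1_derive1 D1_lnZ) qE ZE; congr (_ / _).
Qed.

Lemma susceptibilityE B :
  susceptibility beta B M = derive1 (derive1 (fun b => ln (Z b))) B / N%:R.
Proof.
have w0 b : wgt b 0 != 0 by rewrite -ZE.
rewrite (D1_derive1 D1_lnZ) (D1_derive1 (D1M (D1_wgt 1) (D1V w0 (D1_wgt 0)))).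
set c := (Num.sqrt N%:R : R)^-1; have c2 : c ^+ 2 = N%:R^-1 :> R by rewrite exprVn sqr_sqrtr.
rewrite /susceptibility /quenched_var !qE.
pose m := wgt B 1 / wgt B 0 * c.
have -> : (\sum_s total_spin R s / Num.sqrt N%:R * boltzmann beta B M s) / Z B = m.
  rewrite /m ZE mulrAC; congr (_ / _); rewrite mulr_suml; apply: eq_bigr => s _.
  by rewrite expr1 /c; ring.
have -> : \sum_s (total_spin R s / Num.sqrt N%:R - m) ^+ 2 * boltzmann beta B M s =
  c ^+ 2 * wgt B 2 - 2 * c * m * wgt B 1 + m ^+ 2 * wgt B 0.
  rewrite !mulr_sumr -sumrB -big_split/=; apply: eq_bigr => s _.
  by rewrite -/c expr0 expr1; ring.
rewrite ZE -c2 /m; field; exact: w0.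
Qed.

End quenched_moments.

Section averaged.
Variables (R : realType) (N : nat) (d : 'I_N -> nat) (beta B : R).
Implicit Types F G : {set {set half_edge d}} -> R.

Lemma CM_expectZ a F : CM_expect (fun M => a * F M) = a * CM_expect F.
Proof. by rewrite /CM_expect -mulr_sumr mulrA. Qed.

Lemma avg_quenched_sum (f : config N -> R) :
  \sum_s avg_quenched d beta B s * f s = CM_expect (fun M => quenched_expect (d := d) beta B M f).
Proof.
rewrite /avg_quenched /CM_expect /quenched_expect exchange_big/= mulr_suml.
apply: eq_bigr => s _; rewrite mulrAC mulr_suml; congr (_ / _).
Qed.

Lemma avg_quenched_ge0 s : 0 <= avg_quenched d beta B s.
Proof.
rewrite /avg_quenched /CM_expect divr_ge0//; apply: sumr_ge0 => M _.
by rewrite /quenched divr_ge0 ?expR_ge0// ltW ?partition_function_gt0.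
Qed.

Lemma normalized_mgf t : let h := t / Num.sqrt N%:R in
  \sum_s avg_quenched d beta B s * expR (t * normalized_spin d beta B s) =
  CM_expect (fun M : {set {set half_edge d}} =>
    expR (- h * CM_expect (fun M : {set {set half_edge d}} => derive1 (fun b => ln (partition_function beta b M)) B))
     * (partition_function beta (B + h) M / partition_function beta B M)).
Proof.
move=> h; rewrite avg_quenched_sum CM_expectZ -CM_expectZ; apply: (congr1 (@CM_expect _ _ _)); apply/funext => M.
have -> : CM_expect (fun M : {set {set half_edge d}} => derive1 (fun b => ln (partition_function beta b M)) B)
   = avg_quenched_expect d beta B (@total_spin R N).
  rewrite /avg_quenched_expect avg_quenched_sum; congr (CM_expect _); apply/funext => M'.
  by rewrite quenched_mean.
rewrite -quenched_exp /quenched_expect mulr_sumr; apply: eq_bigr => s _.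
rewrite [RHS]mulrCA; congr (_ * _); rewrite -expRD; congr expR.
by rewrite /normalized_spin /h; ring.
Qed.

End averaged.

(** * Averages over the configuration model as averages over shapes *)

Section free_energy.
Variables (R : realType) (beta : R).
Hypothesis beta_ge0 : 0 <= beta.

(** A path with [e] edges has [e + 1] vertices and a cycle [e], so the coefficient of the bulk
    free energy is the number [2 k + n] of vertices. *)
Lemma ln_zshape k n sh : reach k n sh -> forall b,
  0 < zshape beta b sh /\ ln (zshape beta b sh) =
   (2 * k + n)%:R * La beta b + k%:R * Pf beta b + psum (fun e => phi beta e b) sh + csum (fun e => psi beta e b) sh.
Proof.
case/and3P=> pos /eqP ed /eqP ct b.
have -> : (2 * k + n = edges sh + count fst sh)%N by rewrite ed ct; lia.
rewrite -ct {k n ed ct}; rewrite /zshape /edges.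
elim: sh pos => [|[[] e] sh IH] /=.
- by rewrite !big_nil /psum /csum !big_nil ln1 => _; split; rewrite ?ltr01//; ring.
- case/andP=> e0 /IH[z0 lz]; rewrite !big_cons /= {1}/zc /=.
  have zp : 0 < zpath beta b e by have [h _] := expsum_cumulant (expsum_zpath beta e); exact: h.
  split; first exact: mulr_gt0.
  rewrite lnM ?posrE// lz ln_zpath// psum_cons /csum big_cons/= !natrD -natr1; ring.
- case/andP=> e0 /IH[z0 lz]; rewrite !big_cons /= {1}/zc /=.
  have zp : 0 < zcyc beta b e.
    rewrite zcyc_prod//; exact: mulr_gt0 (exprn_gt0 _ (lp_gt0 _ _)) (psi_arg_gt0 beta_ge0 _ _).
  split; first exact: mulr_gt0.
  rewrite lnM ?posrE// lz ln_zcyc// psum_cons /csum big_cons/= !natrD; ring.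
Qed.

Lemma D1_psum (f f' : nat -> R -> R) sh : (forall e, D1 (f e) (f' e)) ->
  D1 (fun b => psum (fun e => f e b) sh) (fun b => psum (fun e => f' e b) sh).
Proof.
move=> h; rewrite (_ : (fun b => psum (fun e => f e b) sh) = fun b => \sum_(c <- sh) if c.1 then f c.2 b else 0); last first.
  by apply/funext => b; rewrite /psum big_mkcond.
have := @D1_sum R (bool * nat) sh (fun c b => if c.1 then f c.2 b else 0) (fun c b => if c.1 then f' c.2 b else 0).
move=> H; apply: D1_eq (H _) _ => [[[] e]|b] /=; [exact: h | exact: D1_cst |].
by rewrite /psum [RHS]big_mkcond.
Qed.

Lemma D1_csum (f f' : nat -> R -> R) sh : (forall e, D1 (f e) (f' e)) ->
  D1 (fun b => csum (fun e => f e b) sh) (fun b => csum (fun e => f' e b) sh).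
Proof.
move=> h; rewrite (_ : (fun b => csum (fun e => f e b) sh) = fun b => \sum_(c <- sh) if ~~ c.1 then f c.2 b else 0); last first.
  by apply/funext => b; rewrite /csum big_mkcond.
have := @D1_sum R (bool * nat) sh (fun c b => if ~~ c.1 then f c.2 b else 0) (fun c b => if ~~ c.1 then f' c.2 b else 0).
move=> H; apply: D1_eq (H _) _ => [[[] e]|b] /=; [exact: D1_cst | exact: h |].
by rewrite /csum [RHS]big_mkcond.
Qed.

Section derivatives.
Variables (k n : nat) (sh : shape).
Hypothesis rs : reach k n sh.

Lemma derive1_ln_zshape : derive1 (fun b => ln (zshape beta b sh)) = fun b =>
   (2 * k + n)%:R * La1 beta b + k%:R * Pf1 beta b + psum (fun e => phi1 beta e b) sh + csum (fun e => psi1 beta e b) sh.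
Proof.
rewrite (_ : (fun b => ln _) = fun b => (2 * k + n)%:R * La beta b + k%:R * Pf beta b
    + psum (fun e => phi beta e b) sh + csum (fun e => psi beta e b) sh); last first.
  by apply/funext => b; have [_] := ln_zshape rs b.
have [l1 _] := D1_La beta; have [p1 _] := D1_Pf beta.
have dp : D1 (fun b => psum (fun e => phi beta e b) sh) (fun b => psum (fun e => phi1 beta e b) sh).
  by apply: D1_psum => e; have [h _] := D1_phi beta_ge0 e; exact: h.
have dc : D1 (fun b => csum (fun e => psi beta e b) sh) (fun b => csum (fun e => psi1 beta e b) sh).
  by apply: D1_csum => e; exact: D1_psi.
apply: D1_derive1.
apply: D1_eq (D1D (D1D (D1D (D1M (D1_cst (2 * k + n)%:R) l1) (D1M (D1_cst k%:R) p1)) dp) dc) _ => b.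
by rewrite !mul0r !add0r.
Qed.

Lemma derive2_ln_zshape psi2 : (forall e, D1 (psi1 beta e) (psi2 e)) ->
  derive1 (derive1 (fun b => ln (zshape beta b sh))) = fun b =>
   (2 * k + n)%:R * La2 beta b + k%:R * Pf2 beta b + psum (fun e => phi2 beta e b) sh + csum (fun e => psi2 e b) sh.
Proof.
move=> hpsi; rewrite derive1_ln_zshape.
have [_ l2] := D1_La beta; have [_ p2] := D1_Pf beta.
have dp : D1 (fun b => psum (fun e => phi1 beta e b) sh) (fun b => psum (fun e => phi2 beta e b) sh).
  by apply: D1_psum => e; have [_ h] := D1_phi beta_ge0 e; exact: h.
apply: D1_derive1.
apply: D1_eq (D1D (D1D (D1D (D1M (D1_cst (2 * k + n)%:R) l2) (D1M (D1_cst k%:R) p2)) dp) (D1_csum sh hpsi)) _ => b.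
move: (La1 beta b) (Pf1 beta b) (La2 beta b) (Pf2 beta b) (psum _ _) (csum _ _) => *.
by rewrite !mul0r !add0r.
Qed.

End derivatives.

Section laplace.
Variables (B : R) (k n : nat) (h : R).

Definition dphi e : R := phi beta e (B + h) - phi beta e B.
Definition dpsi e : R := psi beta e (B + h) - psi beta e B.

(** The deterministic part of the increment of the free energy when the field moves from [B]
    to [B + h], once the first-order mean has been subtracted. *)
Definition drift : R := (2 * k + n)%:R * (La beta (B + h) - La beta B - h * La1 beta B)
  + k%:R * (Pf beta (B + h) - Pf beta B - h * Pf1 beta B)
  + (mean k n dphi - h * mean k n (fun e => phi1 beta e B)).

Lemma Ex_laplace :
  Ex k n (fun sh => expR (- h * Ex k n (fun sh => derive1 (fun b => ln (zshape beta b sh)) B))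
     * (zshape beta (B + h) sh / zshape beta B sh)) =
  expR drift * Ex k n (fun sh => expR (psum dphi sh - mean k n dphi +
     (csum dpsi sh - h * Ex k n (csum (fun e => psi1 beta e B))))).
Proof.
have -> : Ex k n (fun sh => derive1 (fun b => ln (zshape beta b sh)) B) =
   (2 * k + n)%:R * La1 beta B + k%:R * Pf1 beta B + mean k n (fun e => phi1 beta e B)
   + Ex k n (csum (fun e => psi1 beta e B)).
  rewrite /mean -[X in X + _ + _](Ex_cst k n) -!ExD; apply: Ex_eq => s rs.
  by rewrite (derive1_ln_zshape rs).
rewrite -ExZ; apply: Ex_eq => s rs.
have [z1 l1] := ln_zshape rs B; have [z2 l2] := ln_zshape rs (B + h).
rewrite -{1}(lnK z2) -{1}(lnK z1) -expRN -!expRD; congr expR.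
rewrite l1 l2 /drift.
have -> : psum dphi s = psum (fun e => phi beta e (B + h)) s - psum (fun e => phi beta e B) s.
  by rewrite /psum -sumrB.
have -> : csum dpsi s = csum (fun e => psi beta e (B + h)) s - csum (fun e => psi beta e B) s.
  by rewrite /csum -sumrB.
ring.
Qed.

End laplace.
End free_energy.

Section configuration.
Variables (R : realType) (p beta B : R) (N : nat).
Hypotheses (beta_ge0 : 0 <= beta) (ev : ~~ odd (n1 p N)) (n2N : (n2 p N <= N)%N).
Local Notation k := (n1 p N)./2.
Local Notation n := (n2 p N).
Local Notation d := (@CM12_deg R p N).

Lemma vertex_count : N = (2 * k + n)%N.
Proof. by rewrite mul2n halfK (negbTE ev) subn0 /n1 subnK. Qed.

Lemma law_mgf t : let h := t / Num.sqrt N%:R in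
  \sum_s avg_quenched d beta B s * expR (t * normalized_spin d beta B s) =
  expR (drift beta B k n h) * Ex k n (fun sh => expR (psum (dphi beta B h) sh - mean k n (dphi beta B h) +
     (csum (dpsi beta B h) sh - h * Ex k n (csum (fun e => psi1 beta e B))))).
Proof.
move=> h; rewrite normalized_mgf -(Ex_laplace beta_ge0 B k n h).
have -> : CM_expect (fun M : {set {set half_edge d}} => derive1 (fun b => ln (partition_function beta b M)) B)
  = Ex k n (fun sh => derive1 (fun b => ln (zshape beta b sh)) B).
  apply: CM12_law => // M sh hM; congr (derive1 _ B); apply/funext => b; by rewrite hM.
by apply: CM12_law => // M sh hM; rewrite !hM.
Qed.

Lemma law_susceptibility (A : pred R) :
  CM_prob R (fun M : {set {set half_edge d}} => A (susceptibility beta B M)) =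
  Ex k n (fun sh => (A (derive1 (derive1 (fun b => ln (zshape beta b sh))) B / N%:R))%:R).
Proof.
apply: CM12_law => // M sh hM; rewrite susceptibilityE.
rewrite (_ : (fun b => ln (partition_function beta b M)) = fun b => ln (zshape beta b sh))//.
by apply/funext => b; rewrite hM.
Qed.

End configuration.

(** * Limit of the Laplace transform and of the susceptibility *)

Section scaling.
Variable R : realType.

Lemma var_scale k n a (f : nat -> R) : var k n (fun e => a * f e) = a ^+ 2 * var k n f.
Proof. by rewrite /var meanZ -ExZ; apply: Ex_eq => s _; rewrite psumZ -mulrBr exprMn. Qed.

Lemma mgf_scale k n a (f : nat -> R) c : mgf k n (fun e => a * f e) c = mgf k n f (c * a).
Proof. by rewrite /mgf meanZ; apply: Ex_eq => s _; rewrite psumZ -mulrBr mulrA. Qed.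

Lemma mean_lin3 k n (f g g' : nat -> R) a b :
  mean k n (fun e => f e - a * g e - b * g' e) = mean k n f - a * mean k n g - b * mean k n g'.
Proof.
have E : (fun e => f e - a * g e - b * g' e) = fun e => (f e + (- a) * g e) + (- b) * g' e.
  by apply/funext => e; rewrite !mulNr.
by rewrite E (meanD _ _ (fun e => f e + - a * g e)) (meanD _ _ f) !meanZ !mulNr.
Qed.

Lemma cvg_eps (T : Type) (F : set_system T) {FF : Filter F} (a : T -> R) l K : 0 <= K ->
  (forall e, 0 < e -> \forall x \near F, `|a x - l| <= e * K) -> a x @[x --> F] --> l.
Proof.
move=> K0 H; apply/cvgrPdist_le => e e0.
have p : 0 < e / (K + 1) by rewrite divr_gt0// ltr_wpDl.
apply: filterS (H _ p) => x h; rewrite distrC; apply: le_trans h _.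
by rewrite mulrAC ler_pdivrMr ?ltr_wpDl// ler_wpM2l ?(ltW e0)// lerDl.
Qed.

Lemma cvg_diff0 (T : Type) (F : set_system T) {FF : Filter F} (a b : T -> R) (l : R) :
  a x - b x @[x --> F] --> (0 : R) -> b x @[x --> F] --> l -> a x @[x --> F] --> l.
Proof.
move=> h1 h2; have h3 : (a x - b x) + b x @[x --> F] --> 0 + l by apply: cvgD.
by move: h3; rewrite add0r; under eq_fun do rewrite subrK.
Qed.

End scaling.

Section asymptotics.
Variables (R : realType) (beta B : R).
Hypothesis beta_ge0 : 0 <= beta.
Variables (T : Type) (F : set_system T).
Context {FF : Filter F}.
Variables (k_ n_ : T -> nat) (kappa M2 v K3 Kv : R).
Notation N x := ((2 * k_ x + n_ x)%:R : R).
Hypothesis N_gt0 : \forall x \near F, 0 < N x.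
Hypothesis N_inv : (N x)^-1 @[x --> F] --> (0 : R).
Hypothesis k_lim : (k_ x)%:R / N x @[x --> F] --> kappa.
Hypothesis mean2_lim : mean (k_ x) (n_ x) (fun e => phi2 beta e B) / N x @[x --> F] --> M2.
Hypothesis K3_ge0 : 0 <= K3.
Hypothesis mean3_le : \forall x \near F, mean (k_ x) (n_ x) (fun e => e%:R ^+ 3) <= K3 * N x.
Hypothesis var1_lim : var (k_ x) (n_ x) (fun e => phi1 beta e B) / N x @[x --> F] --> v.
Hypothesis Kv_ge0 : 0 <= Kv.
Hypothesis var3_le : \forall x \near F, forall (f : nat -> R) C, 0 <= C ->
  (forall e, (0 < e)%N -> `|f e| <= C * e%:R ^+ 3) -> var (k_ x) (n_ x) f <= N x * C ^+ 2 * Kv.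
Hypothesis path_mgf : forall T0 eps : R, 0 <= T0 -> 0 < eps -> \forall x \near F, forall (f : nat -> R) h,
  (forall e, `|f e| <= 1) -> `|h| <= T0 / Num.sqrt (N x) ->
  `|mgf (k_ x) (n_ x) f h - expR (h ^+ 2 / 2 * var (k_ x) (n_ x) f)| <= eps.

#[local] Opaque phi phi1 phi2 psi psi1 La La1 La2 Pf Pf1 Pf2.

Lemma sqrtN_inv : Num.sqrt (N x)^-1 @[x --> F] --> (0 : R).
Proof.
rewrite -[X in _ --> X](sqrtr0 R).
by apply: (cvg_comp _ Num.sqrt N_inv); exact: sqrt_continuous.
Qed.

Section laplace_limit.
Variable t : R.
Let h x : R := t / Num.sqrt (N x).

Let t20 : 0 <= t ^+ 2. Proof. exact: sqr_ge0. Qed.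

Let h2 x : 0 < N x -> h x ^+ 2 = t ^+ 2 / N x.
Proof. by move=> N0; rewrite /h expr_div_n sqr_sqrtr// ltW. Qed.

Let Nh2 : \forall x \near F, N x * h x ^+ 2 = t ^+ 2.
Proof. by apply: filterS N_gt0 => x N0; rewrite h2// mulrC divfK// gt_eqF. Qed.

Let sqrtVN x : Num.sqrt (N x)^-1 = (Num.sqrt (N x))^-1.
Proof. by rewrite sqrtrV. Qed.

Let h_small d : 0 < d -> \forall x \near F, `|h x| < d.
Proof.
move=> d0; have c : h x @[x --> F] --> (0 : R).
  rewrite -[X in _ --> X](mulr0 t); apply: cvgM; first exact: cvg_cst.
  by under eq_fun do rewrite -sqrtVN; exact: sqrtN_inv.
move/cvgrPdist_lt : c => /(_ d d0); apply: filterS => x; by rewrite sub0r normrN.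
Qed.

(** Second-order terms of the increments: the bulk and boundary parts are smooth functions
    multiplied by [N] and [k], and the path part is a mean, with Taylor remainder at most
    [e h^2] times the mean of the cubes of the lengths, which is of order [N]. *)
Lemma drift_lim : drift beta B (k_ x) (n_ x) (h x) @[x --> F] -->
  (La2 beta B + kappa * Pf2 beta B + M2) * t ^+ 2 / 2.
Proof.
have [La_1 La_2] := D1_La beta; have [P_1 P_2] := D1_Pf beta.
have cLa : N x * (La beta (B + h x) - La beta B - h x * La1 beta B) @[x --> F] --> t ^+ 2 / 2 * La2 beta B.
  apply: (@cvg_eps _ _ _ _ _ _ (t ^+ 2)) => // e e0.
  have [d d0 H] := peano2 B La_1 La_2 e0.
  near=> x; have hd : `|h x| < d by near: x; exact: h_small.
  have N0 : 0 < N x by near: x.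
  have NE : N x * h x ^+ 2 = t ^+ 2 by near: x.
  have := H _ hd; move: (La beta (B + h x) - La beta B - h x * La1 beta B) => z hz.
  have -> : N x * z - t ^+ 2 / 2 * La2 beta B = N x * (z - h x ^+ 2 / 2 * La2 beta B) by rewrite -NE; ring.
  by rewrite normrM (gtr0_norm N0) -NE mulrCA ler_wpM2l// ltW.
have cPf : (k_ x)%:R * (Pf beta (B + h x) - Pf beta B - h x * Pf1 beta B) @[x --> F] --> kappa * (t ^+ 2 / 2 * Pf2 beta B).
  have c1 : N x * (Pf beta (B + h x) - Pf beta B - h x * Pf1 beta B) @[x --> F] --> t ^+ 2 / 2 * Pf2 beta B.
    apply: (@cvg_eps _ _ _ _ _ _ (t ^+ 2)) => // e e0.
    have [d d0 H] := peano2 B P_1 P_2 e0.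
    near=> x; have hd : `|h x| < d by near: x; exact: h_small.
    have N0 : 0 < N x by near: x.
    have NE : N x * h x ^+ 2 = t ^+ 2 by near: x.
    have := H _ hd; move: (Pf beta (B + h x) - Pf beta B - h x * Pf1 beta B) => z hz.
    have -> : N x * z - t ^+ 2 / 2 * Pf2 beta B = N x * (z - h x ^+ 2 / 2 * Pf2 beta B) by rewrite -NE; ring.
    by rewrite normrM (gtr0_norm N0) -NE mulrCA ler_wpM2l// ltW.
  apply: cvg_near_eq (cvgM k_lim c1); near=> x.
  have N0 : N x != 0 by rewrite gt_eqF//; near: x.
  by rewrite mulrA divfK.
have cm : mean (k_ x) (n_ x) (dphi beta B (h x)) - h x * mean (k_ x) (n_ x) (fun e => phi1 beta e B) @[x --> F] --> t ^+ 2 / 2 * M2.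
  have [_ tay] := phi_taylor beta_ge0 B.
  have c1 : mean (k_ x) (n_ x) (dphi beta B (h x)) - h x * mean (k_ x) (n_ x) (fun e => phi1 beta e B)
     - h x ^+ 2 / 2 * mean (k_ x) (n_ x) (fun e => phi2 beta e B) @[x --> F] --> (0 : R).
    apply: (@cvg_eps _ _ _ _ _ _ (K3 * t ^+ 2)); first exact: mulr_ge0.
    move=> e e0; have [d d0 H] := tay e e0.
    near=> x; have hd : `|h x| < d by near: x; exact: h_small.
    have NE : N x * h x ^+ 2 = t ^+ 2 by near: x.
    have m3 : mean (k_ x) (n_ x) (fun e => e%:R ^+ 3) <= K3 * N x by near: x.
    have hx0 : 0 <= h x ^+ 2 by exact: sqr_ge0.
    pose u j := dphi beta B (h x) j - h x * phi1 beta j B - h x ^+ 2 / 2 * phi2 beta j B.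
    have -> : mean (k_ x) (n_ x) (dphi beta B (h x)) - h x * mean (k_ x) (n_ x) (fun e => phi1 beta e B)
       - h x ^+ 2 / 2 * mean (k_ x) (n_ x) (fun e => phi2 beta e B) = mean (k_ x) (n_ x) u.
      exact: esym (mean_lin3 _ _ _ _ _ _ _).
    pose w j := e * h x ^+ 2 * j%:R ^+ 3 : R.
    have uw j : (0 < j)%N -> `|u j| <= w j.
      by move=> j0; apply: le_trans (H j (h x) j0 hd) _; rewrite /w mulrAC.
    have mw : mean (k_ x) (n_ x) w <= e * (K3 * t ^+ 2).
      rewrite meanZ -NE -mulrA ler_wpM2l ?(ltW e0)// [K3 * _]mulrA mulrC ler_wpM2r//.
    rewrite subr0; apply: le_trans mw; rewrite ler_norml; apply/andP; split.
      rewrite lerNl -mulN1r -meanZ; apply: Ex_psum_le => j j0 _; rewrite mulN1r.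
      by apply: le_trans (uw j j0); rewrite -normrN ler_norm.
    by apply: Ex_psum_le => j j0 _; apply: le_trans (ler_norm _) (uw j j0).
  have c2 : t ^+ 2 / 2 * (mean (k_ x) (n_ x) (fun e => phi2 beta e B) / N x) @[x --> F] --> t ^+ 2 / 2 * M2.
    by apply: cvgM => //; exact: cvg_cst.
  apply: cvg_diff0 c1 _; apply: cvg_near_eq c2; near=> x.
  have N0 : 0 < N x by near: x.
  by rewrite h2//; ring.
have -> : (La2 beta B + kappa * Pf2 beta B + M2) * t ^+ 2 / 2 =
  t ^+ 2 / 2 * La2 beta B + kappa * (t ^+ 2 / 2 * Pf2 beta B) + t ^+ 2 / 2 * M2 by field.
by apply: cvgD => //; apply: cvgD.
Unshelve. all: by end_near. Qed.

Let var_dphi_lim : var (k_ x) (n_ x) (dphi beta B (h x)) @[x --> F] --> t ^+ 2 * v.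
Proof.
have [[C C0 bd] tay] := phi_taylor beta_ge0 B.
have [d d0 H] := tay 1 ltr01.
pose C' := C / 2 + 1; have C'0 : 0 <= C' by rewrite addr_ge0// divr_ge0.
pose V1 x := var (k_ x) (n_ x) (fun e => h x * phi1 beta e B).
have cV1 : V1 x @[x --> F] --> t ^+ 2 * v.
  have c : t ^+ 2 * (var (k_ x) (n_ x) (fun e => phi1 beta e B) / N x) @[x --> F] --> t ^+ 2 * v.
    by apply: cvgM => //; exact: cvg_cst.
  apply: cvg_near_eq c; near=> x; have N0 : 0 < N x by near: x.
  by rewrite /V1 var_scale h2//; ring.
pose rho x e := dphi beta B (h x) e - h x * phi1 beta e B.
have vr : \forall x \near F, var (k_ x) (n_ x) (rho x) <= (t ^+ 2) ^+ 2 * C' ^+ 2 * Kv * (N x)^-1.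
  near=> x; have hd : `|h x| < d by near: x; exact: h_small.
  have N0 : 0 < N x by near: x.
  have hx0 : 0 <= h x ^+ 2 by exact: sqr_ge0.
  have vl : forall (f : nat -> R) C, 0 <= C ->
    (forall e, (0 < e)%N -> `|f e| <= C * e%:R ^+ 3) -> var (k_ x) (n_ x) f <= N x * C ^+ 2 * Kv by near: x.
  apply: le_trans (vl _ (h x ^+ 2 * C') (mulr_ge0 hx0 C'0) _) _.
    move=> e e0; have e1 : 1 <= e%:R :> R by rewrite ler1n.
    have -> : rho x e = (dphi beta B (h x) e - h x * phi1 beta e B - h x ^+ 2 / 2 * phi2 beta e B) + h x ^+ 2 / 2 * phi2 beta e B.
      by rewrite /rho; ring.
    apply: le_trans (ler_normD _ _) _.
    rewrite /C' mulrDr mulr1 mulrDl addrC; apply: lerD; last first.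
      by apply: le_trans (H e (h x) e0 hd) _; rewrite mul1r mulrC.
    have [_ b2] := bd e e0; rewrite normrM (ger0_norm (divr_ge0 hx0 (ler0n _ 2))).
    have e23 : e%:R ^+ 2 <= e%:R ^+ 3 :> R by rewrite [leRHS]exprSr ler_peMr ?exprn_ge0.
    have : `|phi2 beta e B| <= C * e%:R ^+ 3 by apply: le_trans b2 _; rewrite ler_wpM2l.
    move=> b3; have -> : h x ^+ 2 * (C / 2) * e%:R ^+ 3 = h x ^+ 2 / 2 * (C * e%:R ^+ 3) by ring.
    by rewrite ler_wpM2l// divr_ge0.
  rewrite le_eqVlt; apply/orP; left; apply/eqP; rewrite exprMn h2//.
  by move: N0; move: (N x) => y y0; field; rewrite gt_eqF.
have cr : (t ^+ 2) ^+ 2 * C' ^+ 2 * Kv * (N x)^-1 @[x --> F] --> (0 : R).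
  by rewrite -[X in _ --> X](mulr0 ((t ^+ 2) ^+ 2 * C' ^+ 2 * Kv)); apply: cvgM => //; exact: cvg_cst.
apply: (@cvg_diff0 _ _ _ _ _ V1 _ _ cV1).
pose W := `|t ^+ 2 * v| + 1; have W0 : 0 < W by rewrite ltr_wpDl.
apply: (@cvg_eps _ _ _ _ _ _ (W + 1)); first by rewrite addr_ge0// ltW.
move=> e e0; have q0 : 0 < 1 + e^-1 by rewrite addr_gt0// invr_gt0.
have e1 : 0 < e / (1 + e^-1) by rewrite divr_gt0.
near=> x; rewrite subr0; apply: le_trans (var_diff _ _ _ _ e0) _.
rewrite mulrDr mulr1; apply: lerD.
  rewrite ler_wpM2l ?(ltW e0)//; apply: le_trans (ler_norm _) _.
  have : `|t ^+ 2 * v - V1 x| <= 1 by near: x; move/cvgrPdist_le : cV1 => /(_ 1 ltr01).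
  rewrite -/(V1 x) /W => hh; rewrite -{1}(subrK (t ^+ 2 * v) (V1 x)); apply: le_trans (ler_normD _ _) _.
  by rewrite distrC addrC lerD2l.
have r1 : var (k_ x) (n_ x) (rho x) <= (t ^+ 2) ^+ 2 * C' ^+ 2 * Kv * (N x)^-1 by near: x.
have r2 : `|0 - (t ^+ 2) ^+ 2 * C' ^+ 2 * Kv * (N x)^-1| <= e / (1 + e^-1).
  by near: x; move/cvgrPdist_le : cr => /(_ _ e1).
rewrite mulrC -ler_pdivlMr//; apply: le_trans r1 _; apply: le_trans r2; rewrite sub0r normrN; exact: ler_norm.
Unshelve. all: by end_near. Qed.

(** The increments [dphi] are uniformly of order [h], so after rescaling the bounded
    case applies, with a variance that is asymptotically that of [h phi1]. *)
Lemma path_laplace_lim c : 0 <= c ->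
  mgf (k_ x) (n_ x) (dphi beta B (h x)) c @[x --> F] --> expR (c ^+ 2 / 2 * (t ^+ 2 * v)).
Proof.
move=> c0; have [C [d [C0 d0 H]]] := phi_lip beta_ge0 B.
pose C' := C + 1; have C'0 : 0 < C' by rewrite ltr_wpDl.
(* tau dominates h and is positive even when t = 0 *)
pose tau x := (`|t| + 1) / Num.sqrt (N x).
have cE : expR (c ^+ 2 / 2 * var (k_ x) (n_ x) (dphi beta B (h x))) @[x --> F] --> expR (c ^+ 2 / 2 * (t ^+ 2 * v)).
  apply: (cvg_comp _ (@expR R)); last exact: continuous_expR.
  by apply: cvgM; [exact: cvg_cst | exact: var_dphi_lim].
apply: cvg_diff0 _ cE.
apply: (@cvg_eps _ _ _ _ _ _ 1) => // e e0; rewrite mulr1.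
pose T0 := c * C' * (`|t| + 1).
have T00 : 0 <= T0 by rewrite !mulr_ge0 ?(ltW C'0)// addr_ge0.
near=> x; rewrite subr0; have hd : `|h x| < d by near: x; exact: h_small.
have N0 : 0 < N x by near: x.
have s0 : 0 < Num.sqrt (N x) by rewrite sqrtr_gt0.
have tau0 : 0 < tau x by rewrite divr_gt0// ltr_wpDl.
have a0 : 0 < C' * tau x by rewrite mulr_gt0.
pose f j := dphi beta B (h x) j / (C' * tau x).
have -> : dphi beta B (h x) = fun j => C' * tau x * f j.
  by apply/funext => j; rewrite /f mulrC divfK// gt_eqF.
have cE' (y z : R) : c ^+ 2 / 2 * (y ^+ 2 * z) = (c * y) ^+ 2 / 2 * z by ring.
rewrite mgf_scale var_scale cE'.
have PM : forall (f : nat -> R) h, (forall e, `|f e| <= 1) -> `|h| <= T0 / Num.sqrt (N x) ->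
  `|mgf (k_ x) (n_ x) f h - expR (h ^+ 2 / 2 * var (k_ x) (n_ x) f)| <= e by near: x; exact: path_mgf.
apply: PM.
  move=> j; rewrite /f normrM normfV (gtr0_norm a0) ler_pdivrMr// mul1r.
  apply: le_trans (H j (h x) hd) _; apply: ler_pM => //; first by rewrite lerDl.
  by rewrite /h /tau normrM normfV (gtr0_norm s0) ler_wpM2r ?invr_ge0 ?(ltW s0)// lerDl.
rewrite ger0_norm; last by apply: mulr_ge0 => //; exact: ltW.
by rewrite /T0 /tau !mulrA.
Unshelve. all: by end_near. Qed.

(** [N^(-1/2)] against the bound [N^(1/4)] on the mean number of cycles. *)
Lemma cycle_small : \forall x \near F, `|h x| * harm R (k_ x) (n_ x) <= 4 * `|t| * Num.sqrt (Num.sqrt (N x)^-1).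
Proof.
apply: filterS N_gt0 => x N0.
have s0 : 0 < Num.sqrt (N x) by rewrite sqrtr_gt0.
have ss0 : 0 < Num.sqrt (Num.sqrt (N x)) by rewrite sqrtr_gt0.
have hl : harm R (k_ x) (n_ x) <= 4 * Num.sqrt (Num.sqrt (N x)).
  apply: le_trans (harm_le _ _ _) _; rewrite ler_wpM2l// !ler_wsqrtr// ler_nat.
  exact: leq_addl.
rewrite /h normrM normfV (gtr0_norm s0) (sqrtrV (ltW N0)) (sqrtrV (ltW s0)).
apply: le_trans (ler_wpM2l _ hl) _; first by rewrite mulr_ge0// invr_ge0 ltW.
have -> : Num.sqrt (N x) = Num.sqrt (Num.sqrt (N x)) * Num.sqrt (Num.sqrt (N x)).
  by rewrite -expr2 sqr_sqrtr// sqrtr_ge0.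
move: ss0; move: (Num.sqrt (Num.sqrt (N x))) => y y0.
rewrite le_eqVlt; apply/orP; left; apply/eqP.
rewrite (_ : Num.sqrt (y * y) = y); last by rewrite -expr2 sqrtr_sqr gtr0_norm.
by field; rewrite gt_eqF.
Qed.

(** The cycle part is a perturbation bounded by a constant times [h] times the number of
    cycles and its mean; it disappears in the limit by [Ex_exp_perturb]. *)
Lemma laplace_lim :
  expR (drift beta B (k_ x) (n_ x) (h x)) * Ex (k_ x) (n_ x) (fun sh =>
     expR (psum (dphi beta B (h x)) sh - mean (k_ x) (n_ x) (dphi beta B (h x)) +
     (csum (dpsi beta B (h x)) sh - h x * Ex (k_ x) (n_ x) (csum (fun e => psi1 beta e B))))) @[x --> F]
  --> expR ((La2 beta B + kappa * Pf2 beta B + M2 + v) * t ^+ 2 / 2).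
Proof.
have -> : (La2 beta B + kappa * Pf2 beta B + M2 + v) * t ^+ 2 / 2 =
  (La2 beta B + kappa * Pf2 beta B + M2) * t ^+ 2 / 2 + 1 ^+ 2 / 2 * (t ^+ 2 * v) by field.
rewrite expRD; apply: cvgM.
  by apply: (cvg_comp _ (@expR R)); [exact: drift_lim | exact: continuous_expR].
have c1 := path_laplace_lim ler01; have c2 := path_laplace_lim (ler0n R 2).
set G := fun x => Ex _ _ _.
apply: cvg_diff0 _ c1.
have [Ca [d [Ca0 d0 Ha]]] := psi_lip beta_ge0 B.
have [Cb Cb0 [psi2 Hb]] := psi_bounds beta_ge0 B.
pose C := Ca + Cb; have C0 : 0 <= C by rewrite addr_ge0.
pose E1 : R := expR 1; pose q : R := 2 * C * (2 + E1) * (4 * `|t|).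
pose g x := expR (q * Num.sqrt (Num.sqrt (N x)^-1)) - 1.
have cg : g x @[x --> F] --> (0 : R).
  have cq : q * Num.sqrt (Num.sqrt (N x)^-1) @[x --> F] --> (0 : R).
    rewrite -[X in _ --> X](mulr0 q); apply: cvgM; first exact: cvg_cst.
    rewrite -[X in _ --> X](sqrtr0 R); apply: (cvg_comp _ Num.sqrt sqrtN_inv); exact: sqrt_continuous.
  have ce : expR (q * Num.sqrt (Num.sqrt (N x)^-1)) @[x --> F] --> expR (0 : R).
    by apply: (cvg_comp _ (@expR R) cq); exact: continuous_expR.
  rewrite expR0 in ce; rewrite -[X in _ --> X](subrr (1 : R)).
  by apply: cvgB => //; exact: cvg_cst.
pose W := expR (2 ^+ 2 / 2 * (t ^+ 2 * v)) + 1; have W0 : 0 < W by rewrite ltr_wpDl.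
apply: (@cvg_eps _ _ _ _ _ _ (W + 1)); first by rewrite addr_ge0// ltW.
move=> e e0; rewrite mulrDr mulr1.
have dC : 0 < Num.min d (2 * C + 1)^-1 by rewrite lt_min d0 invr_gt0 ltr_wpDl// mulr_ge0.
near=> x; rewrite subr0.
have /andP[hd hd'] : (`|h x| < d) && (`|h x| < (2 * C + 1)^-1).
  by rewrite -lt_min; near: x; exact: h_small.
have N0 : 0 < N x by near: x.
have cs : `|h x| * harm R (k_ x) (n_ x) <= 4 * `|t| * Num.sqrt (Num.sqrt (N x)^-1).
  by near: x; exact: cycle_small.
pose A s := psum (dphi beta B (h x)) s - mean (k_ x) (n_ x) (dphi beta B (h x)).
pose E s := csum (dpsi beta B (h x)) s - h x * Ex (k_ x) (n_ x) (csum (fun e => psi1 beta e B)).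
pose K s := C * `|h x| * (ncyc R s + harm R (k_ x) (n_ x)).
have EK s : reach (k_ x) (n_ x) s -> `|E s| <= K s.
  move=> rs; apply: le_trans (ler_normB _ _) _; rewrite /K mulrDr; apply: lerD.
    apply: csum_le rs _ => j _; apply: le_trans (Ha j (h x) hd) _.
    by rewrite ler_wpM2r// lerDl.
  have hE : `|Ex (k_ x) (n_ x) (csum (fun e => psi1 beta e B))| <= Cb * harm R (k_ x) (n_ x).
    rewrite -Ex_ncyc -ExZ; apply: le_trans (Ex_norm _ _ _) _; apply: Ex_le => u ru.
    by apply: csum_le ru _ => j _; have [_ b1 _] := Hb j.
  rewrite normrM; apply: (@le_trans _ _ (`|h x| * (C * harm R (k_ x) (n_ x)))).
    by rewrite ler_wpM2l//; apply: le_trans hE _; rewrite ler_wpM2r ?harm_ge0// lerDr.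
  by rewrite mulrCA mulrA.
have -> : mgf (k_ x) (n_ x) (dphi beta B (h x)) 1 = Ex (k_ x) (n_ x) (fun s => expR (A s)).
  by rewrite /mgf; apply: Ex_eq => s _; rewrite mul1r.
apply: le_trans (Ex_exp_perturb A e0 EK) _.
have A2 : Ex (k_ x) (n_ x) (fun s => expR (2 * A s)) <= W.
  have : `|expR (2 ^+ 2 / 2 * (t ^+ 2 * v)) - mgf (k_ x) (n_ x) (dphi beta B (h x)) 2| <= 1.
    by near: x; move/cvgrPdist_le : c2 => /(_ 1 ltr01).
  rewrite /W /mgf -/A; set y := Ex _ _ _; rewrite ler_norml => /andP[]; move: (expR _) => z; lra.
have gx : g x <= e ^+ 2.
  have : `|0 - g x| <= e ^+ 2 by near: x; move/cvgrPdist_le : cg => /(_ (e ^+ 2)); apply; rewrite exprn_gt0.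
  by rewrite sub0r normrN => hg; apply: le_trans (ler_norm _) hg.
have KG : Ex (k_ x) (n_ x) (fun s => expR (2 * K s)) - 1 <= g x.
  rewrite lerD2r; pose u := 2 * C * `|h x|; pose H := harm R (k_ x) (n_ x).
  have u0 : 0 <= u by rewrite !mulr_ge0.
  have H0 : 0 <= H by exact: harm_ge0.
  have u1 : u <= 1.
    have : (2 * C + 1) * `|h x| <= 1.
      by rewrite mulrC -ler_pdivlMr ?ltr_wpDl ?mulr_ge0// div1r ltW.
    rewrite mulrDl mul1r -/u; have := normr_ge0 (h x); lra.
  have eu : expR u - 1 <= (1 + E1) * u.
    have un : `|u| <= 1 by rewrite ger0_norm.
    have := expR_taylor1 un; rewrite ler_norml (ger0_norm u0) -/E1 => /andP[_ hu].
    have : E1 * u ^+ 2 <= E1 * u by rewrite ler_wpM2l ?expR_ge0// expr2 ler_piMl.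
    by rewrite mulrDl mul1r; move: hu; move: (E1 * u ^+ 2) (E1 * u) (expR u) => ? ? ?; lra.
  have -> : Ex (k_ x) (n_ x) (fun s => expR (2 * K s)) = expR (u * H) * Ex (k_ x) (n_ x) (fun s => expR (u * ncyc R s)).
    by rewrite -ExZ; apply: Ex_eq => s _; rewrite -expRD; congr expR; rewrite /K /u /H; ring.
  apply: (@le_trans _ _ (expR (u * H) * expR ((expR u - 1) * H))).
    by rewrite ler_wpM2l ?expR_ge0//; exact: Ex_exp_ncyc.
  rewrite -expRD ler_expR; apply: (@le_trans _ _ ((2 + E1) * (u * H))).
    have : (expR u - 1) * H <= (1 + E1) * u * H by rewrite ler_wpM2r.
    by move: (expR u - 1) => z; move: (E1) => y; lra.
  have uH : u * H <= 2 * C * (4 * `|t| * Num.sqrt (Num.sqrt (N x)^-1)).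
    have -> : u * H = 2 * C * (`|h x| * H) by rewrite /u; ring.
    by apply: ler_wpM2l; [exact: mulr_ge0 | exact: cs].
  apply: (@le_trans _ _ ((2 + E1) * (2 * C * (4 * `|t| * Num.sqrt (Num.sqrt (N x)^-1))))).
    by rewrite ler_wpM2l// addr_ge0// expR_ge0.
  by rewrite /q le_eqVlt; apply/orP; left; apply/eqP; move: (E1) (Num.sqrt _) => ? ?; ring.
have e2 : e^-1 * (Ex (k_ x) (n_ x) (fun s => expR (2 * K s)) - 1) <= e.
  by rewrite mulrC ler_pdivrMr//; apply: le_trans KG _; rewrite -expr2.
have e3 : e * Ex (k_ x) (n_ x) (fun s => expR (2 * A s)) <= e * W by rewrite ler_wpM2l// ltW.
move: e2 e3; move: (_ * _) (_ * _) => y1 y2 e2 e3.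
have eW : 0 <= e * W by rewrite mulr_ge0 ?ltW.
rewrite ler_pdivrMr//; move: eW e2 e3; move: (e * W) => z; lra.
Unshelve. all: by end_near. Qed.

End laplace_limit.
(** On the event, either the centered path sum or the cycle sum exceeds a fraction of
    [eps N], so the indicator is at most a combination of the square of the former and of the
    latter, whose expectations tend to 0 (Chebyshev and Markov). *)
Lemma susceptibility_lim (eps : R) : 0 < eps ->
  Ex (k_ x) (n_ x) (fun sh => (eps < `|derive1 (derive1 (fun b => ln (zshape beta b sh))) B / N x
     - (La2 beta B + kappa * Pf2 beta B + M2)|)%R%:R) @[x --> F] --> (0 : R).
Proof.
move=> eps0.
have [[C C0 bd] _] := phi_taylor beta_ge0 B.
have [Cb Cb0 [psi2 Hb]] := psi_bounds beta_ge0 B.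
pose r1 x := ((k_ x)%:R / N x - kappa) * Pf2 beta B.
pose r2 x := mean (k_ x) (n_ x) (fun e => phi2 beta e B) / N x - M2.
have c12 : r1 x + r2 x @[x --> F] --> (0 : R).
  rewrite -[X in _ --> X](addr0 0); apply: cvgD.
    rewrite -(mul0r (Pf2 beta B)) -(subrr kappa); apply: cvgM; last exact: cvg_cst.
    by apply: cvgB => //; exact: cvg_cst.
  by rewrite -(subrr M2); apply: cvgB => //; exact: cvg_cst.
pose bnd x := 16 / eps ^+ 2 * (C ^+ 2 * Kv * (N x)^-1)
   + 4 / eps * Cb * (Num.sqrt (N x)^-1 * (4 * `|1| * Num.sqrt (Num.sqrt (N x)^-1))).
have cb : bnd x @[x --> F] --> (0 : R).
  have -> : 0 = 16 / eps ^+ 2 * (C ^+ 2 * Kv * 0) + 4 / eps * Cb * (0 * (4 * `|1| * 0)) :> R by rewrite !mulr0 addr0.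
  have css : Num.sqrt (Num.sqrt (N x)^-1) @[x --> F] --> (0 : R).
    rewrite -[X in _ --> X](sqrtr0 R); apply: (cvg_comp _ Num.sqrt sqrtN_inv); exact: sqrt_continuous.
  have cM (a : R) (u : T -> R) l : u x @[x --> F] --> l -> a * u x @[x --> F] --> a * l.
    by move=> h; apply: cvgM => //; exact: cvg_cst.
  apply: cvgD; apply: (cM _ _ _ _); first exact: (cM _ _ _ _).
  by apply: cvgM; [exact: sqrtN_inv | exact: (cM _ _ _ _)].
apply: (@cvg_eps _ _ _ _ _ _ 1) => // e e0; rewrite mulr1; near=> x; rewrite subr0.
have N0 : 0 < N x by near: x.
have Nn : N x != 0 by rewrite gt_eqF.
have r12 : `|r1 x + r2 x| <= eps / 2.
  have : `|0 - (r1 x + r2 x)| <= eps / 2.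
    by near: x; move/cvgrPdist_le : c12 => /(_ (eps / 2)); apply; rewrite divr_gt0.
  by rewrite sub0r normrN.
have be : bnd x <= e.
  have : `|0 - bnd x| <= e by near: x; move/cvgrPdist_le : cb => /(_ e e0).
  by rewrite sub0r normrN => hg; apply: le_trans (ler_norm _) hg.
have cs : `|1 / Num.sqrt (N x)| * harm R (k_ x) (n_ x) <= 4 * `|1| * Num.sqrt (Num.sqrt (N x)^-1).
  by near: x; exact: (cycle_small 1).
have vl : forall (f : nat -> R) C, 0 <= C ->
    (forall e, (0 < e)%N -> `|f e| <= C * e%:R ^+ 3) -> var (k_ x) (n_ x) f <= N x * C ^+ 2 * Kv by near: x.
have v2 : var (k_ x) (n_ x) (fun e => phi2 beta e B) <= N x * C ^+ 2 * Kv.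
  apply: vl => // j j0; have [_ b2] := bd j j0; apply: le_trans b2 _; rewrite ler_wpM2l//.
  by rewrite [leRHS]exprSr ler_peMr ?exprn_ge0// ler1n.
pose m2 := mean (k_ x) (n_ x) (fun e => phi2 beta e B).
pose Gd s : R := 16 / eps ^+ 2 * ((N x)^-1 ^+ 2 * (psum (fun e => phi2 beta e B) s - m2) ^+ 2)
   + 4 / eps * Cb * (N x)^-1 * ncyc R s.
have ind_le s : reach (k_ x) (n_ x) s -> (eps < `|derive1 (derive1 (fun b => ln (zshape beta b s))) B / N x
     - (La2 beta B + kappa * Pf2 beta B + M2)|)%R%:R <= Gd s.
  move=> rs; rewrite (derive2_ln_zshape beta_ge0 rs (fun e => let: And3 h _ _ := Hb e in h)).
  have cl : `|csum (fun e => psi2 e B) s| <= Cb * ncyc R s.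
    by apply: csum_le rs _ => j _; have [_ _] := Hb j.
  have -> : (N x * La2 beta B + (k_ x)%:R * Pf2 beta B + psum (fun e => phi2 beta e B) s + csum (fun e => psi2 e B) s) / N x
     - (La2 beta B + kappa * Pf2 beta B + M2) =
     (r1 x + r2 x) + ((N x)^-1 * (psum (fun e => phi2 beta e B) s - m2) + (N x)^-1 * csum (fun e => psi2 e B) s).
    rewrite /r1 /r2 -/m2; move: (psum _ _) (csum _ _) (m2) Nn => y1 y2 y3; move: (N x) => y0 Nn; by field.
  set a := (N x)^-1 * (psum _ _ - _); set b := (N x)^-1 * csum _ _.
  have ble : `|b| <= Cb * (N x)^-1 * ncyc R s.
    rewrite /b normrM (gtr0_norm (_ : 0 < (N x)^-1)) ?invr_gt0//.
    by rewrite [Cb * _]mulrC -[leRHS]mulrA; apply: ler_wpM2l => //; rewrite invr_ge0 ltW.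
  have n0 := ncyc_ge0 R s.
  have Gd0 : 0 <= 4 / eps * Cb * (N x)^-1 * ncyc R s.
    by rewrite !mulr_ge0 ?invr_ge0// ltW.
  have a2 : 0 <= 16 / eps ^+ 2 * ((N x)^-1 ^+ 2 * (psum (fun e => phi2 beta e B) s - m2) ^+ 2).
    by apply: mulr_ge0; [rewrite divr_ge0 ?exprn_ge0 ?ltW | apply: mulr_ge0; exact: sqr_ge0].
  case: (ltP eps) => h; last by rewrite addr_ge0.
  have h1 : eps / 2 < `|a| + `|b|.
    have := lt_le_trans h (ler_normD (r1 x + r2 x) (a + b)); have := ler_normD a b.
    move: r12; move: `|_ + _| => y1; move: `|_ + _| => y2; move: `|a| `|b| => y3 y4; lra.
  rewrite /Gd -exprMn -/a.
  have [ha|ha] := leP `|a| (eps / 4).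
    have hb : eps / 4 <= `|b| by move: h1 ha; move: `|a| `|b| => y3 y4; lra.
    apply: (@le_trans _ _ (4 / eps * `|b|)).
      by rewrite mulrC mulrA ler_pdivlMr// mul1r; move: hb; move: `|b| => y; lra.
    apply: (@le_trans _ _ (4 / eps * Cb * (N x)^-1 * ncyc R s)).
      rewrite -[leRHS]mulrA -[leRHS]mulrA [Cb * _]mulrA; apply: ler_wpM2l => //.
      by rewrite divr_ge0// ltW.
    by rewrite lerDr; rewrite exprMn.
  apply: (@le_trans _ _ (16 / eps ^+ 2 * a ^+ 2)); last by rewrite lerDl.
  rewrite mulrAC ler_pdivlMr ?exprn_gt0// mul1r.
  have sq (y : R) : 16 * y ^+ 2 = (4 * `|y|) ^+ 2 by rewrite [RHS]exprMn real_normK ?num_real//; ring.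
  rewrite sq.
  apply: lerXn2r; rewrite ?nnegrE ?(ltW eps0)//.
  by move: ha; move: `|a| => y; lra.
rewrite ger0_norm; last by apply: Ex_ge0.
apply: le_trans (Ex_le ind_le) _; apply: le_trans be.
rewrite /Gd ExD !ExZ Ex_ncyc /bnd; apply: lerD.
  apply: ler_wpM2l; first by rewrite divr_ge0 ?exprn_ge0 ?ltW.
  apply: le_trans (ler_wpM2l (sqr_ge0 _) v2) _.
  by rewrite le_eqVlt; apply/orP; left; apply/eqP; move: (N x) Nn => y Nn; field.
rewrite -[leLHS]mulrA; apply: ler_wpM2l; first by rewrite mulr_ge0// divr_ge0// ltW.
have -> : (N x)^-1 * harm R (k_ x) (n_ x) = Num.sqrt (N x)^-1 * (`|1 / Num.sqrt (N x)| * harm R (k_ x) (n_ x)).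
  rewrite mulrA; congr (_ * _).
  rewrite div1r -(sqrtrV (ltW N0)) ger0_norm ?sqrtr_ge0// -expr2 sqr_sqrtr// invr_ge0 ltW//.
by apply: ler_wpM2l => //; exact: sqrtr_ge0.
Unshelve. all: by end_near. Qed.

End asymptotics.

(** * Proportions of vertices of degree 1 and 2 *)

Section no_paths.
Variable R : realType.
Implicit Type f : nat -> R.

(** When there are no vertices of degree 1 all components are cycles. *)
Lemma psum_no_path n s f : reach 0 n s -> psum f s = 0.
Proof.
case/and3P=> _ _ /eqP h; rewrite /psum; elim: s h => [|[[] e] s IH]//= h; first by rewrite big_nil.
by rewrite big_cons/= IH.
Qed.

Lemma mean_no_path n f : mean 0 n f = 0.
Proof. by rewrite /mean -(Ex_cst 0 n (0 : R)); apply: Ex_eq => s rs; rewrite (psum_no_path _ rs). Qed.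

Lemma var_no_path n f : var 0 n f = 0.
Proof.
rewrite /var -[RHS](Ex_cst 0 n (0 : R)); apply: Ex_eq => s rs.
by rewrite (psum_no_path _ rs) mean_no_path subrr expr0n.
Qed.

Lemma mgf_no_path n f h : mgf 0 n f h = 1.
Proof.
rewrite /mgf -[RHS](Ex_cst 0 n (1 : R)); apply: Ex_eq => s rs.
by rewrite (psum_no_path _ rs) mean_no_path subrr mulr0 expR0.
Qed.

End no_paths.

Section degree_sequence.
Variables (R : realType) (p : R).
Hypothesis p01 : 0 <= p <= 1.
Local Notation F := (CM12_infty p).
Local Notation k_ := (fun N => (n1 p N)./2).
Local Notation n_ := (fun N => n2 p N).

Lemma n2_itv N : (n2 p N)%:R <= p * N%:R < (n2 p N).+1%:R.
Proof. by rewrite /n2; apply: truncn_itv; rewrite mulr_ge0//; case/andP: p01. Qed.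

Lemma n2_le N : (n2 p N <= N)%N.
Proof.
have /andP[h _] := n2_itv N; rewrite -(ler_nat R); apply: le_trans h _.
by rewrite ler_piMl//; case/andP: p01.
Qed.

Lemma F_even : \forall N \near F, ~~ odd (n1 p N).
Proof. exact: withinT. Qed.

Lemma F_large m : \forall N \near F, (m <= N)%N.
Proof. by apply: cvg_within; exists m. Qed.

Lemma F_count : \forall N \near F, (2 * k_ N + n_ N)%N = N.
Proof. by apply: filterS F_even => N ev; rewrite -(vertex_count ev (n2_le N)). Qed.

Lemma N_inv_lim : (N%:R : R)^-1 @[N --> F] --> (0 : R).
Proof.
apply: cvg_trans (_ : (fun N : nat => (N%:R : R)^-1) @ \oo --> (0 : R)).
  exact: cvg_app (@cvg_within _ _ _ _).
by rewrite -(cvg_shiftS (fun N : nat => (N%:R : R)^-1)); exact: cvg_harmonic.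
Qed.

Lemma n2_lim : (n_ N)%:R / N%:R @[N --> F] --> p.
Proof.
apply: (@cvg_eps _ _ _ _ _ _ 1) => // e e0; rewrite mulr1.
near=> N; have N0 : (0 < N)%N by near: N; exact: F_large.
have NR : 0 < N%:R :> R by rewrite ltr0n.
have iN : N%:R^-1 <= e.
  have : `|0 - N%:R^-1| <= e by near: N; move/cvgrPdist_le : N_inv_lim => /(_ e e0).
  by rewrite sub0r normrN ger0_norm// invr_ge0.
apply: le_trans iN; have /andP[a b] := n2_itv N.
have -> : (n_ N)%:R / N%:R - p = ((n_ N)%:R - p * N%:R) / N%:R by field; rewrite gt_eqF.
rewrite normrM (gtr0_norm (_ : 0 < N%:R^-1)) ?invr_gt0// ler_piMl ?invr_ge0//.
by move: b; rewrite -natr1 => b; rewrite ler_norml; apply/andP; split; lra.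
Unshelve. all: by end_near. Qed.

Lemma k_lim : (k_ N)%:R / N%:R @[N --> F] --> (1 - p) / 2.
Proof.
have c : (1 - (n_ N)%:R / N%:R) / 2 @[N --> F] --> (1 - p) / 2.
  apply: cvgM; last exact: cvg_cst; apply: cvgB; [exact: cvg_cst | exact: n2_lim].
apply: cvg_near_eq c; near=> N; have N0 : (0 < N)%N by near: N; exact: F_large.
have NR : N%:R != 0 :> R by rewrite gt_eqF// ltr0n.
have e : (2 * k_ N + n_ N)%N = N by near: N; exact: F_count.
have e' : N%:R = 2 * (k_ N)%:R + (n_ N)%:R :> R by rewrite -natrM -natrD e.
have -> : (n_ N)%:R = N%:R - 2 * (k_ N)%:R :> R by rewrite e'; ring.
by field.
Unshelve. all: by end_near. Qed.

Lemma N_F_gt0 : \forall N \near F, 0 < (2 * k_ N + n_ N)%:R :> R.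
Proof.
near=> N; rewrite (_ : (2 * k_ N + n_ N)%N = N); last by near: N; exact: F_count.
by rewrite ltr0n; near: N; exact: F_large.
Unshelve. all: by end_near. Qed.

Lemma over_N (u : nat -> R) (l : R) : u N / N%:R @[N --> F] --> l -> u N / (2 * k_ N + n_ N)%:R @[N --> F] --> l.
Proof.
apply: cvg_near_eq; near=> N; rewrite (_ : (2 * k_ N + n_ N)%N = N)//.
by near: N; exact: F_count.
Unshelve. all: by end_near. Qed.

Lemma NF_inv_lim : ((2 * k_ N + n_ N)%:R : R)^-1 @[N --> F] --> (0 : R).
Proof.
apply: cvg_near_eq N_inv_lim; near=> N; rewrite (_ : (2 * k_ N + n_ N)%N = N)//.
by near: N; exact: F_count.
Unshelve. all: by end_near. Qed.

Section positive_fraction.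
Hypothesis p1 : p < 1.
Let kap0 : 0 < (1 - p) / 2. Proof. by rewrite divr_gt0// subr_gt0. Qed.

Lemma k_F_gt0 : \forall N \near F, (0 < k_ N)%N.
Proof.
near=> N; have h : `|(1 - p) / 2 - (k_ N)%:R / N%:R| < (1 - p) / 2.
  by near: N; move/cvgrPdist_lt : k_lim => /(_ _ kap0).
by rewrite lt0n; apply/eqP => k0; move: h; rewrite k0 mul0r subr0 gtr0_norm// ltxx.
Unshelve. all: by end_near. Qed.

Lemma k_F_inv : ((k_ N)%:R : R)^-1 @[N --> F] --> (0 : R).
Proof.
have c : N%:R^-1 / ((k_ N)%:R / N%:R) @[N --> F] --> 0 / ((1 - p) / 2).
  by apply: cvgM; [exact: N_inv_lim | apply: cvgV; [rewrite gt_eqF | exact: k_lim]].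
rewrite mul0r in c; apply: cvg_near_eq c; near=> N.
have NR : N%:R != 0 :> R by rewrite gt_eqF// ltr0n; near: N; exact: F_large.
have kR : (k_ N)%:R != 0 :> R by rewrite gt_eqF// ltr0n; near: N; exact: k_F_gt0.
by field; rewrite NR kR.
Unshelve. all: by end_near. Qed.

Lemma ratio_lim : (n_ N)%:R / (k_ N)%:R @[N --> F] --> alpha12 p.
Proof.
have c : ((n_ N)%:R / N%:R) / ((k_ N)%:R / N%:R) @[N --> F] --> p / ((1 - p) / 2).
  by apply: cvgM; [exact: n2_lim | apply: cvgV; [rewrite gt_eqF | exact: k_lim]].
have -> : alpha12 p = p / ((1 - p) / 2) by rewrite /alpha12; field; rewrite subr_eq0 gt_eqF.
apply: cvg_near_eq c; near=> N.
have NR : N%:R != 0 :> R by rewrite gt_eqF// ltr0n; near: N; exact: F_large.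
have kR : (k_ N)%:R != 0 :> R by rewrite gt_eqF// ltr0n; near: N; exact: k_F_gt0.
by field; rewrite NR kR.
Unshelve. all: by end_near. Qed.

Lemma alpha_dichotomy : 0 < alpha12 p \/ (alpha12 p = 0 /\ forall N, n_ N = 0%N).
Proof.
have /andP[p0 _] := p01; have [->|n0] := eqVneq p 0.
  right; split; first by rewrite /alpha12 mulr0 mul0r.
  by move=> N; rewrite /n2 mul0r truncn0.
by left; apply: alpha12_gt0; rewrite lt_neqAle eq_sym n0 p0.
Qed.

Lemma over_k (u : nat -> R) (l : R) : u N / (k_ N)%:R @[N --> F] --> l ->
  u N / (2 * k_ N + n_ N)%:R @[N --> F] --> (1 - p) / 2 * l.
Proof.
move=> c; apply: over_N; apply: cvg_near_eq (cvgM k_lim c); near=> N.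
have NR : N%:R != 0 :> R by rewrite gt_eqF// ltr0n; near: N; exact: F_large.
have kR : (k_ N)%:R != 0 :> R by rewrite gt_eqF// ltr0n; near: N; exact: k_F_gt0.
by rewrite /=; field; rewrite NR kR.
Unshelve. all: by end_near. Qed.

End positive_fraction.
End degree_sequence.

(** * The central limit theorem *)

(** The sign of [v] need not be known in advance: [e^x + e^(-x) >= 2] forces it unless the
    filter contains the empty set, in which case everything converges. *)
Lemma mgf_cvg_in_distribution_any (R : realType) (T : nat -> finType)
    (P X : forall N, T N -> R) (F : set_system nat) (v : R) :
  Filter F -> (forall (N : nat) (w : T N), 0 <= P N w) ->
  (forall t : R, \sum_(w : T N) P N w * expR (t * X N w) @[N --> F] --> expR (v * t ^+ 2 / 2)) ->
  cvg_in_distribution P X F (centered_gaussian v).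
Proof.
move=> FF P0 H; have [F0|nF0] := pselect (F set0).
  by move=> f _ _ U _; apply: (@filterS _ F _ set0 _ _ F0).
apply: mgf_cvg_in_distribution => //.
have PF : ProperFilter F by split.
have c2 : \sum_(w : T N) P N w * expR (1 * X N w) + \sum_(w : T N) P N w * expR (-1 * X N w)
   - 2 * \sum_(w : T N) P N w * expR (0 * X N w) @[N --> F]
   --> expR (v * 1 ^+ 2 / 2) + expR (v * (-1) ^+ 2 / 2) - 2 * expR (v * 0 ^+ 2 / 2).
  apply: cvgB; first by apply: cvgD; exact: H.
  by apply: cvgM; [exact: cvg_cst | exact: H].
have : 0 <= expR (v * 1 ^+ 2 / 2) + expR (v * (-1) ^+ 2 / 2) - 2 * expR (v * 0 ^+ 2 / 2).
  rewrite -(cvg_lim _ c2)//; apply: limr_ge; first exact: (cvgP _ c2).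
  apply: nearW => N; rewrite -big_split/= mulr_sumr -sumrB; apply: sumr_ge0 => w _.
  have -> : P N w * expR (1 * X N w) + P N w * expR (-1 * X N w) - 2 * (P N w * expR (0 * X N w))
    = P N w * (expR (X N w) + expR (- X N w) - 2) by rewrite mul1r mulN1r mul0r expR0; ring.
  rewrite mulr_ge0//; have := expR_ge1Dx (X N w); have := expR_ge1Dx (- X N w); lra.
rewrite sqrrN !expr1n expr0n/= !mulr0 !mul0r expR0 !mulr1 => h.
have : expR 0 <= expR (v / 2) by rewrite expR0; lra.
by rewrite ler_expR; lra.
Qed.

Lemma leq_double_add a b : (a <= 2 * a + b)%N.
Proof. by rewrite mul2n -addnn -addnA leq_addr. Qed.

Section theorem.
Variables (R : realType) (p beta B : R).
Hypotheses (p01 : 0 <= p <= 1) (beta_ge0 : 0 <= beta).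
Local Notation F := (CM12_infty p).
Local Notation k_ := (fun N => (n1 p N)./2).
Local Notation n_ := (fun N => n2 p N).
Local Notation NN N := ((2 * (n1 p N)./2 + n2 p N)%:R : R).

Let path_statistics (kappa M2 v K3 Kv : R) :=
  [/\ (k_ N)%:R / NN N @[N --> F] --> kappa,
      mean (k_ N) (n_ N) (fun e => phi2 beta e B) / NN N @[N --> F] --> M2,
      0 <= K3 /\ \forall N \near F, mean (k_ N) (n_ N) (fun e => e%:R ^+ 3) <= K3 * NN N,
      var (k_ N) (n_ N) (fun e => phi1 beta e B) / NN N @[N --> F] --> v &
      (\forall N \near F, forall (f : nat -> R) (C : R), 0 <= C ->
        (forall e, (0 < e)%N -> `|f e| <= C * e%:R ^+ 3) -> var (k_ N) (n_ N) f <= NN N * C ^+ 2 * Kv) /\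
      forall T0 eps : R, 0 <= T0 -> 0 < eps -> \forall N \near F, forall (f : nat -> R) h,
        (forall e, `|f e| <= 1) -> `|h| <= T0 / Num.sqrt (NN N) ->
        `|mgf (k_ N) (n_ N) f h - expR (h ^+ 2 / 2 * var (k_ N) (n_ N) f)| <= eps].

Let statistics_degenerate : p = 1 -> path_statistics 0 0 0 0 0.
Proof.
move=> p1; have k0 N : k_ N = 0%N.
  suff -> : n1 p N = 0%N by [].
  rewrite /n1; apply/eqP; rewrite subn_eq0 -(ler_nat R).
  by have /andP[_ h] := n2_itv p01 N; move: h; rewrite p1 mul1r ltr_nat ler_nat ltnS.
split.
- by under eq_fun do rewrite k0 mul0r; exact: cvg_cst.
- by under eq_fun do rewrite k0 mean_no_path mul0r; exact: cvg_cst.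
- by split=> //; apply: nearW => N; rewrite k0 mean_no_path mul0r.
- by under eq_fun do rewrite k0 var_no_path mul0r; exact: cvg_cst.
- split; first by apply: nearW => N f C _ _; rewrite k0 var_no_path mulr0.
  move=> T0 eps _ e0; apply: nearW => N f h _ _.
  by rewrite k0 mgf_no_path var_no_path mulr0 expR0 subrr normr0 ltW.
Qed.

Let inv_sqrt_small (u : nat -> nat) (K eps : R) : 0 <= K -> 0 < eps ->
  ((u N)%:R : R)^-1 @[N --> F] --> (0 : R) -> \forall N \near F, K / Num.sqrt (u N)%:R <= eps.
Proof.
move=> K0 e0 hu; have c : K * Num.sqrt ((u N)%:R : R)^-1 @[N --> F] --> (0 : R).
  rewrite -[X in _ --> X](mulr0 K) -[X in _ * X](sqrtr0 R); apply: cvgM; first exact: cvg_cst.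
  by apply: (cvg_comp _ Num.sqrt hu); exact: sqrt_continuous.
move/cvgrPdist_le : c => /(_ _ e0); apply: filterS => N.
by rewrite sub0r normrN sqrtrV// => h; apply: le_trans (ler_norm _) h.
Qed.

Let statistics_proper : p < 1 -> exists S Q K3 Kv : R, [/\
  (fun M => \sum_(L < M) phi2 beta L.+1 B * pil (alpha12 p) L) @ \oo --> S,
  sigma2_G p beta B = (1 - p) / 2 * Q &
  path_statistics ((1 - p) / 2) ((1 - p) / 2 * S) ((1 - p) / 2 * Q) K3 Kv].
Proof.
move=> p1; have [[C C0 bd] _] := phi_taylor beta_ge0 B.
have al := alpha_dichotomy p01 p1; have ki := k_F_inv p01 p1; have kg := k_F_gt0 p01 p1.
have rl := ratio_lim p01 p1; have a0 := alpha12_ge0 p01.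
have [S hS] := phi2_series B p01 beta_ge0.
have [Q hQ sQ] := sigma_proper B p01 beta_ge0 p1.
have [S3 hS3] : exists S3 : R, (fun M => \sum_(L < M) L.+1%:R ^+ 3 * pil (alpha12 p) L) @ \oo --> S3.
  have h : cvgn (series (fun L => L.+1%:R ^+ 3 * pil (alpha12 p) L)).
    apply: (@pil_cvg _ _ a0 _ 3 1) => // L; rewrite mul1r ger0_norm// mulr_ge0 ?exprn_ge0//.
    exact: pil_ge0.
  exists (limn (series (fun L => L.+1%:R ^+ 3 * pil (alpha12 p) L))).
  rewrite (_ : (fun M => _) = series (fun L => L.+1%:R ^+ 3 * pil (alpha12 p) L)); first exact: h.
  by apply/funext => M; rewrite /series/= big_mkord.
have m3 : mean (k_ N) (n_ N) (fun e => e%:R ^+ 3) / (k_ N)%:R @[N --> F] --> S3.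
  have b3 e : (0 < e)%N -> `|e%:R ^+ 3 : R| <= 1 * e%:R ^+ 3 by rewrite mul1r ger0_norm// exprn_ge0.
  have := @mean_cvg R nat F _ k_ n_ (alpha12 p) al ki kg rl (fun e => e%:R ^+ 3) 1 3 ler01 b3 S3 hS3.
  exact.
exists S, Q, (`|S3| + 1), (varK 3 (alpha12 p + 1)); split=> //; split.
- by apply: (over_N p01); exact: k_lim.
- apply: (over_k p01 p1 (u := fun N => mean (k_ N) (n_ N) (fun e => phi2 beta e B))).
  have b2 e : (0 < e)%N -> `|phi2 beta e B| <= C * e%:R ^+ 2 by move=> e0; have [] := bd e e0.
  have := @mean_cvg R nat F _ k_ n_ (alpha12 p) al ki kg rl (fun e => phi2 beta e B) C 2 C0 b2 S hS.
  exact.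
- split; first by rewrite addr_ge0.
  near=> N; have kN : (0 < k_ N)%N by near: N.
  have h : `|S3 - mean (k_ N) (n_ N) (fun e => e%:R ^+ 3) / (k_ N)%:R| <= 1.
    by near: N; move/cvgrPdist_le : m3 => /(_ 1 ltr01).
  have kR : 0 < (k_ N)%:R :> R by rewrite ltr0n.
  have : mean (k_ N) (n_ N) (fun e => e%:R ^+ 3) <= (`|S3| + 1) * (k_ N)%:R.
    rewrite -ler_pdivrMr//; have := ler_norm S3; move: h; move: (mean _ _ _ / _) `|S3| => z y.
    by rewrite ler_norml => /andP[h1 h2] h3; lra.
  move=> hm; apply: le_trans hm _; by rewrite ler_wpM2l ?addr_ge0// ler_nat leq_double_add.
- apply: (over_k p01 p1 (u := fun N => var (k_ N) (n_ N) (fun e => phi1 beta e B))).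
  have b1 e : (0 < e)%N -> `|phi1 beta e B| <= C * e%:R ^+ 1 by move=> e0; rewrite expr1; have [] := bd e e0.
  have := @var_cvg R nat F _ k_ n_ (alpha12 p) al ki kg rl (fun e => phi1 beta e B) C 1 C0 b1 Q hQ.
  exact.
have nb := n_bound kg rl.
split.
  near=> N => f C' C'0 hf; have kN : (0 < k_ N)%N by near: N.
  have nN : (n_ N)%:R <= (alpha12 p + 1) * (k_ N)%:R by near: N; exact: nb.
  apply: le_trans (@var_le R _ _ f C' 3 _ kN C'0 nN (fun e e0 _ => hf e e0)) _.
  apply: ler_wpM2r; first exact: varK_ge0.
  by apply: ler_wpM2r; [exact: sqr_ge0 | rewrite ler_nat leq_addl].
move=> T0 eps T00 e0.
near=> N => f h f1 hh; have kN : (0 < k_ N)%N by near: N.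
have kR : 0 < (k_ N)%:R :> R by rewrite ltr0n.
have nN : (n_ N)%:R <= (alpha12 p + 1) * (k_ N)%:R by near: N; exact: nb.
have h8 : T0 / Num.sqrt (k_ N)%:R <= 1 / 8 by near: N; apply: inv_sqrt_small => //; lra.
have he : mgfK (alpha12 p + 1) T0 / Num.sqrt (k_ N)%:R <= eps.
  near: N; have [K0|K0] := leP 0 (mgfK (alpha12 p + 1) T0); first exact: inv_sqrt_small.
  apply: nearW => N; apply: le_trans (ltW e0); rewrite mulr_le0_ge0 ?(ltW K0)// invr_ge0 sqrtr_ge0//.
have hk : `|h| <= T0 / Num.sqrt (k_ N)%:R.
  apply: le_trans hh _; rewrite ler_wpM2l// lef_pV2 ?posrE ?sqrtr_gt0// ?ltr0n ?addn_gt0 ?muln_gt0 ?kN//.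
  by rewrite ler_wsqrtr// ler_nat leq_double_add.
apply: le_trans he; apply: mgf_approx => //; last exact: le_trans h8.
Unshelve. all: by end_near. Qed.

Let all_statistics : exists kappa M2 K3 Kv : R,
  chi p beta B = La2 beta B + kappa * Pf2 beta B + M2 /\
  path_statistics kappa M2 (sigma2_G p beta B) K3 Kv.
Proof.
have /andP[_ ple] := p01; have [p1|p1] := eqVneq p 1.
  exists 0, 0, 0, 0; rewrite chi_degenerate// sigma2_G_degenerate//; last by right.
  by split; [rewrite mul0r !addr0 | exact: statistics_degenerate].
have p1' : p < 1 by rewrite lt_neqAle p1.
have [S [Q [K3 [Kv [hS sQ st]]]]] := statistics_proper p1'.
exists ((1 - p) / 2), ((1 - p) / 2 * S), K3, Kv; rewrite sQ; split=> //.
by rewrite (chi_proper p01 beta_ge0 p1' hS); ring.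
Qed.

Lemma spin_clt : cvg_in_distribution
    (fun N => avg_quenched (@CM12_deg R p N) beta B)
    (fun N => normalized_spin (@CM12_deg R p N) beta B)
    F (centered_gaussian (sigma2_aq p beta B)).
Proof.
have [kappa [M2 [K3 [Kv [chiE [h1 h2 [h3 h3'] h4 [h5 h6]]]]]]] := all_statistics.
apply: mgf_cvg_in_distribution_any; first by move=> N w; exact: avg_quenched_ge0.
move=> t; rewrite /sigma2_aq chiE.
have FF : Filter F by exact: within_filter.
have := @laplace_lim R beta B beta_ge0 nat F FF k_ n_ kappa M2 (sigma2_G p beta B) K3 Kv
  (N_F_gt0 p01) (NF_inv_lim p01) h1 h2 h3 h3' h4 h5 h6 t.
apply: cvg_trans; apply: near_eq_cvg; near=> N.
have ev : ~~ odd (n1 p N) by near: N; exact: F_even.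
by rewrite (law_mgf B beta_ge0 ev (n2_le p01 N) t) /= -(vertex_count ev (n2_le p01 N)).
Unshelve. all: by end_near. Qed.

Lemma susceptibility_cvg eps : 0 < eps ->
  CM_prob R (fun M : {set {set half_edge (@CM12_deg R p N)}} =>
         eps < `|susceptibility beta B M - chi p beta B|) @[N --> F] --> (0 : R).
Proof.
move=> e0; have [kappa [M2 [K3 [Kv [chiE [h1 h2 _ _ [h5 _]]]]]]] := all_statistics.
have FF : Filter F by exact: within_filter.
have c := @susceptibility_lim R beta B beta_ge0 nat F FF k_ n_ _ _ _ (N_F_gt0 p01) (NF_inv_lim p01) h1 h2 h5 eps e0.
move: c; apply: cvg_trans; apply: near_eq_cvg; near=> N.
have ev : ~~ odd (n1 p N) by near: N; exact: F_even.
rewrite (law_susceptibility beta B ev (n2_le p01 N) (fun y => eps < `|y - chi p beta B|)).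
by rewrite -(vertex_count ev (n2_le p01 N)) chiE.
Unshelve. all: by end_near. Qed.

End theorem.

Theorem theorem1p6 (R : realType) (p beta B : R)
    (p01 : 0 <= p <= 1) (beta_ge0 : 0 <= beta) :
  (* central limit theorem under the averaged quenched measure *)
  cvg_in_distribution
    (fun N => avg_quenched (@CM12_deg R p N) beta B)
    (fun N => normalized_spin (@CM12_deg R p N) beta B)
    (CM12_infty p)
    (centered_gaussian (sigma2_aq p beta B))
  (* chi is the limit, in probability, of the random quenched susceptibility *)
  /\ (forall eps : R, 0 < eps ->
       CM_prob R (fun M : {set {set half_edge (@CM12_deg R p N)}} =>
         eps < `|susceptibility beta B M - chi p beta B|)
         @[N --> CM12_infty p] --> (0 : R))
  (* the series defining chi and sigma2_G converge absolutely *)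
  /\ summable [set l : nat | (2 <= l)%N]
       (fun l => (chi_term p beta B l)%:E)
  /\ summable [set lj : nat * nat | (2 <= lj.1)%N /\ (2 <= lj.2)%N]
       (fun lj => (sigma2_G_term p beta B lj.1 lj.2)%:E)
  (* sigma2_G is positive, strictly so outside the degenerate cases *)
  /\ 0 <= sigma2_G p beta B
  /\ (0 < p < 1 -> 0 < beta -> B != 0 -> 0 < sigma2_G p beta B).
Proof.
split; first exact: spin_clt.
split; first exact: susceptibility_cvg.
split; first exact: chi_summable.
split; first exact: sigma_summable.
by split; [exact: sigma2_G_ge0 | exact: sigma2_G_gt0].
Qed.
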